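(* Let $t\in(0,1)$, $x\in\mathbb R$, let $n$ be a positive even integer and $(a_1,\dots,a_n)\in(0,1)^n$. Let $\lambda$ be a random partition distributed according to the half-space Hall–Littlewood measure with parameters $a_1,\dots,a_n$, and denote the expectation by $\mathbb E^{\rm HL}$. Then $$\mathbb E^{\rm HL}\left[\frac{1}{(-t^{x+n-\ell(\lambda)};t^2)_\infty}\right]=\mathrm{Pf}\left[\mathsf J+\mathsf f_x\cdot\mathsf K^{\complement}\right]_{\ell^2(\mathbb Z_{\ge0})},\qquad\text{where}\quad \mathsf f_x(j)=\frac{(-t^{x+j+1};t^2)_\infty}{(-t^{x+j};t^2)_\infty}-1 .$$
   Context: **Half-space Hall–Littlewood measure.** The probability measure on partitions $$\mathbb P^{\rm HL}(\lambda)=\frac{1}{\Phi(a_1,\dots,a_n)}\,b^{\rm el}_\lambda\,P_\lambda(a_1,\dots,a_n)\,\mathbf 1_{\lambda'\text{ even}}.$$ Here $P_\lambda$ is the Hall–Littlewood $P$-polynomial with parameter $t$, and ''$\lambda'$ even'' means that all parts of the transpose are even, equivalently all multiplicities $m_i(\lambda)$ are even. For such $\lambda$, $b^{\rm el}_\lambda=\prod_{i\ge1}\prod_{k=1}^{m_i(\lambda)/2}(1-t^{2k-1})$. Also $\Phi(a)=\prod_{i<j}\frac{1-ta_ia_j}{1-a_ia_j}$, and $\ell(\lambda)$ is the length of $\lambda$. **Kernel.** $\mathsf K^\complement$ is the $2\times2$ matrix valued kernel on $\mathbb Z_{\ge0}$ given, with $f(z)=\prod_{j=1}^n\frac{z-a_j}{1-a_jz}$,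 by $$\mathsf K^\complement_{11}(u,v)=\frac1{(2\mathrm i\pi)^2}\iint\frac{(w-z)f(z)f(w)}{(z^2-1)(w^2-1)(zw-1)}\frac{dz}{z^u}\frac{dw}{w^v},$$ $$\mathsf K^\complement_{12}(u,v)=\mathbf 1_{u=v}+\frac1{(2\mathrm i\pi)^2}\iint\frac{(w-z)f(z)f(w)}{(z^2-1)w(zw-1)}\frac{dz}{z^u}\frac{dw}{w^v},\qquad\mathsf K^\complement_{21}(u,v)=-\mathsf K^\complement_{12}(v,u),$$ $$\mathsf K^\complement_{22}(u,v)=\frac1{(2\mathrm i\pi)^2}\iint\frac{(w-z)f(z)f(w)}{zw(zw-1)}\frac{dz}{z^u}\frac{dw}{w^v}.$$ All contours are positively oriented circles around $0$. For $\mathsf K^\complement_{11},\mathsf K^\complement_{12}$ they have radius strictly between $1$ and $\min_j a_j^{-1}$; for $\mathsf K^\complement_{22}$ they have radius smaller than $1$. **Fredholm Pfaffian.** With $\mathsf J(x,y)=\delta_{x=y}\begin{pmatrix}0&1\\-1&0\end{pmatrix}$, $$\mathrm{Pf}[\mathsf J+\mathsf f\cdot\mathsf K]_{\ell^2(\mathbb Z_{\ge0})}=1+\sum_{k\ge1}\frac1{k!}\sum_{x_1,\dots,x_k\in\mathbb Z_{\ge0}}\Big(\prod_{i=1}^k\mathsf f(x_i)\Big)\mathrm{Pf}\big(\mathsf K(x_i,x_j)\big)_{i,j=1}^k .$$ Also $(a;q)_\infty=\prod_{i\ge0}(1-aq^i)$. *)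

(* Defs.v *)
From HB Require Import structures.
From mathcomp Require Import all_boot all_order all_fingroup all_algebra.
From mathcomp Require mpoly.

Set Implicit Arguments.
Unset Strict Implicit.
Unset Printing Implicit Defensive.

Import Order.TTheory GRing.Theory Num.Theory.
Local Open Scope ring_scope.

Definition is_partition (s : seq nat) : bool := sorted geq s && (0%N \notin s).

Record intpartition := IntPartition { parts :> seq nat; _ : is_partition parts }.

HB.instance Definition _ := [isSub for parts].
HB.instance Definition _ := [Countable of intpartition by <:].

(* the i-th part (i >= 1) of the transpose is the number of parts >= i *)
Definition ptranspose (lam : intpartition) : seq nat :=
  [seq count (leq i) lam | i <- iota 1 (head 0%N lam)].

Definition ptranspose_even (lam : intpartition) : bool :=
  all (fun m => ~~ odd m) (ptranspose lam).

Definition plength (lam : intpartition) : nat := size lam.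
Definition part (lam : intpartition) (i : nat) : nat := nth 0%N lam i.
Definition mult (lam : intpartition) (i : nat) : nat := count_mem i lam.

Module HallLittlewood.
Import mpoly.

Section Def.
Variables (R : realFieldType) (n : nat).

Notation "p %:F" := (@FracField.tofrac {mpoly R[n]} p).

Section Divisibility.
Implicit Types (i j k : 'I_n) (p q : {mpoly R[n]}).

Let merge i j k := if k == j then i else k.
Let phi i j p := p \mPo [tuple 'X_(merge i j k) : {mpoly R[n]} | k < n].

Let phiX i j k : phi i j 'X_k = 'X_(merge i j k).
Proof. by rewrite /phi comp_mpolyXU (nth_map k) ?size_enum_ord// nth_ord_enum. Qed.

Let phi_dvd i j p : exists q, p - phi i j p = q * ('X_i - 'X_j).
Proof.
rewrite (mpolyE p) /phi (raddf_sum (comp_mpoly _))/= -sumrB; elim/big_ind: _ => [|a b [u ->] [v ->]|m _].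
- by exists 0; rewrite mul0r.
- by exists (u + v); rewrite mulrDl.
rewrite linearZ/= -scalerBr.
suff [q ->] : exists q, 'X_[m] - phi i j 'X_[m] = q * ('X_i - 'X_j).
  by exists (p@_m *: q); rewrite scalerAl.
pose P p := exists q, p - phi i j p = q * ('X_i - 'X_j).
have PM a b : P a -> P b -> P (a * b).
  move=> [u hu] [v hv]; exists (u * b + phi i j a * v).
  rewrite mulrDl -[phi i j a * v * _]mulrA -hv -mulrAC -hu.
  by rewrite [phi i j (a * b)]rmorphM/= mulrBl mulrBr addrA subrK.
have P1 : P 1 by exists 0; rewrite /phi rmorph1 subrr mul0r.
rewrite mpolyXE_id; apply: (big_ind P) => // k _.
elim: (m k) => [|e IH]; first by rewrite expr0.
rewrite exprS; apply: PM => //.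
rewrite /P phiX /merge; case: eqP => [->|_]; last by exists 0; rewrite subrr mul0r.
by exists (- 1); rewrite mulN1r opprB.
Qed.

Let mpolyX_neq i j : i != j -> 'X_i - 'X_j != 0 :> {mpoly R[n]}.
Proof.
move=> ij; apply/eqP => /(congr1 (mcoeff U_(i))); apply/eqP.
by rewrite mcoeff0 mcoeffB !mcoeffXU eqxx [j == i]eq_sym (negbTE ij) subr0 oner_eq0.
Qed.

Let prod_dvd (s : seq ('I_n * 'I_n)) p : uniq s ->
  (forall i j, (i, j) \in s -> (i < j)%N /\ phi i j p = 0) ->
  exists q, p = q * \prod_(ij <- s) ('X_ij.1 - 'X_ij.2).
Proof.
elim: s => [|[i j] s IH]/=; first by exists p; rewrite big_nil mulr1.
move=> /andP[ijs us] H.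
have [q pE] : exists q, p = q * \prod_(ij <- s) ('X_ij.1 - 'X_ij.2).
  by apply: IH => // k l kls; apply: H; rewrite inE kls orbT.
have [lij] := H i j (mem_head _ _).
rewrite pE /phi rmorphM rmorph_prod/= => /eqP; rewrite mulf_eq0 prodf_seq_eq0.
have -> /= : has (fun kl : 'I_n * 'I_n => true && (('X_kl.1 - 'X_kl.2) \mPo
    [tuple 'X_(merge i j k) : {mpoly R[n]} | k < n] == 0)) s = false.
  apply/negbTE/hasPn => -[k l] kls /=.
  rewrite rmorphB/= -!/(phi _ _ _) !phiX; apply: mpolyX_neq.
  have [lkl _] := H k l (mem_behead (s := (i, j) :: s) kls).
  apply: contra ijs; rewrite /merge; case: ifP => [/eqP kj|/negP kj].
    case: ifP => [/eqP lj|_ /eqP il]; first by rewrite kj lj ltnn in lkl.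
    by move: lkl lij; rewrite kj il => /ltn_trans h /h; rewrite ltnn.
  case: ifP => [/eqP lj /eqP ki|_ /eqP kl]; first by rewrite -lj -ki.
  by rewrite kl ltnn in lkl.
rewrite orbF => /eqP q0; have [r] := phi_dvd i j q; rewrite /phi q0 subr0 => ->.
by exists r; rewrite big_cons mulrA.
Qed.

Variable N : (('I_n -> {mpoly R[n]}) -> {mpoly R[n]}).
Hypothesis N_phi : forall i j x, phi i j (N x) = N (phi i j \o x).
Hypothesis N_ext : forall x y, x =1 y -> N x = N y.

Let Delta (w : 'S_n) : {mpoly R[n]} :=
  \prod_(i < n) \prod_(j < n | (i < j)%N) ('X_(w i) - 'X_(w j)).

Let Delta_sign w : Delta w = (-1) ^+ w * Delta 1%g.
Proof.
pose V (w : 'S_n) := Vandermonde n (\row_i 'X_(w i) : 'rV[{mpoly R[n]}]_n).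
have DV s : Delta s = (\prod_(i < n) \prod_(j < n | (i < j)%N) -1) * \det (V s).
  rewrite det_Vandermonde -big_split; apply: eq_bigr => i _ /=.
  by rewrite -big_split; apply: eq_bigr => j _ /=; rewrite !mxE mulN1r opprB.
rewrite !DV mulrCA; congr (_ * _).
have -> : V w = V 1%g *m perm_mx (w^-1)%g.
  by rewrite -col_permE; apply/matrixP => i j; rewrite !mxE perm1 ?invgK.
by rewrite det_mulmx det_perm odd_permV mulrC.
Qed.

Lemma sym_frac_polynomial :
  exists p, p%:F == \sum_(w : 'S_n) (N (fun i => 'X_(w i)))%:F / (Delta w)%:F.
Proof.
pose A := \sum_(w : 'S_n) (-1) ^+ w * N (fun i => 'X_(w i)).
have phiA i j : i != j -> phi i j A = 0.
  move=> ij; rewrite /phi raddf_sum/=.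
  set S := \sum_w _; suff /eqP : S + S = 0 by rewrite -mulr2n -scaler_nat scaler_eq0 pnatr_eq0/= => /eqP.
  rewrite {2}/S (reindex_inj (mulIg (tperm i j)))/= -big_split/= big1// => w _.
  rewrite !rmorphM/= odd_permM odd_tperm ij addbT !rmorph_sign -!/(phi _ _ _) !N_phi.
  rewrite signrN mulNr; apply/eqP; rewrite subr_eq0; apply/eqP; congr (_ * _).
  apply: N_ext => k /=; rewrite permM !phiX /merge.
  by case: tpermP => [->|->|_ _]; rewrite ?eqxx ?(negbTE ij)//.
pose s := [seq ij : 'I_n * 'I_n <- index_enum ('I_n * 'I_n)%type | (ij.1 < ij.2)%N].
have [] := @prod_dvd s A.
- by rewrite filter_uniq// index_enum_uniq.
- move=> i j; rewrite mem_filter/= => /andP[ij _]; split=> //.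
  by apply: phiA; apply: contraTneq ij => ->; rewrite ltnn.
move=> q AE; exists q; apply/eqP.
have sE : \prod_(ij <- s) ('X_ij.1 - 'X_ij.2) = Delta 1%g.
  rewrite big_filter /Delta pair_big_dep/=.
  by apply: eq_bigr => ij _; rewrite !perm1.
have D0 : (Delta 1%g)%:F != 0.
  rewrite tofrac_eq0 -sE prodf_seq_neq0; apply/allP => -[i j].
  rewrite mem_filter/= => /andP[ij _]; apply: mpolyX_neq.
  by apply: contraTneq ij => ->; rewrite ltnn.
apply: (mulIf D0); rewrite -tofracM -sE -AE /A raddf_sum/= mulr_suml.
apply: eq_bigr => w _; rewrite sE Delta_sign !tofracM invfM -!mulrA mulVf// mulr1.
by rewrite rmorph_sign invr_sign mulrC.
Qed.

End Divisibility.

Implicit Types (lam : intpartition) (t : R) (a : 'I_n -> R).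

(* The symmetrization sum_w w(x^lam prod_(i < j) (x_i - t x_j) / (x_i - x_j))
   is taken in the fraction field: it is a polynomial (HL_sym_polynomial), which
   can be evaluated at any a, including at points with coinciding a_i. *)
Definition HL_sym t lam : {fraction {mpoly R[n]}} :=
  \sum_(w : 'S_n)
    (\prod_(i < n) ('X_(w i))%:F ^+ part lam i) *
    \prod_(i < n) \prod_(j < n | (i < j)%N)
      (('X_(w i) - t *: 'X_(w j))%:F / ('X_(w i) - 'X_(w j))%:F).

Lemma HL_sym_polynomial t lam : exists p : {mpoly R[n]}, p%:F == HL_sym t lam.
Proof.
pose N (x : 'I_n -> {mpoly R[n]}) := (\prod_(i < n) x i ^+ part lam i) *
  \prod_(i < n) \prod_(j < n | (i < j)%N) (x i - t *: x j).
have [||p /eqP pE] := @sym_frac_polynomial N.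
- move=> i j x; rewrite rmorphM !rmorph_prod/=; congr (_ * _).
    by apply: eq_bigr => k _; rewrite rmorphXn.
  apply: eq_bigr => k _; rewrite rmorph_prod/=.
  by apply: eq_bigr => l _; rewrite rmorphB/= linearZ.
- move=> x y xy; rewrite /N; congr (_ * _); apply: eq_bigr => i _; rewrite ?xy//.
  by apply: eq_bigr => j _; rewrite !xy.
exists p; apply/eqP; rewrite pE; apply: eq_bigr => w _.
rewrite /N tofracM -mulrA !rmorph_prod/=; congr (_ * _).
  by apply: eq_bigr => i _; rewrite rmorphXn.
rewrite -prodfV -big_split; apply: eq_bigr => i _ /=.
by rewrite !rmorph_prod/= -prodfV -big_split.
Qed.

Definition HL_R t lam : {mpoly R[n]} := xchoose (HL_sym_polynomial t lam).

Definition v_ (t : R) (m : nat) : R :=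
  \prod_(1 <= i < m.+1) ((1 - t ^+ i) / (1 - t)).

(* m_0 = n - l(lam), the number of zero parts among lam_1, ..., lam_n *)
Definition v t lam : R :=
  v_ t (n - plength lam) *
  \prod_(1 <= i < (head 0%N lam).+1) v_ t (mult lam i).

(* P_lam(x_1, ..., x_n; t) vanishes when l(lam) > n *)
Definition HL_P t lam : {mpoly R[n]} :=
  if (plength lam <= n)%N then (v t lam)^-1 *: HL_R t lam else 0.

Definition HL_P_eval t lam a : R := (HL_P t lam).@[a].
End Def.
End HallLittlewood.

From mathcomp Require Import all_classical all_reals all_analysis.
From mathcomp Require Import complex.
Import numFieldNormedType.Exports.
Local Open Scope classical_set_scope.
Local Open Scope ring_scope.
Local Open Scope complex_scope.

Section Sums.
Variables (R : realType) (I : choiceType).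

Definition rsummable (f : I -> R) : Prop := summable [set: I] (EFin \o f).

(* \esum is meant for nonnegative families, hence the splitting *)
Definition rsum (f : I -> R) : R :=
  fine (\esum_(i in [set: I]) ((EFin \o f)^\+ i)%E)
  - fine (\esum_(i in [set: I]) ((EFin \o f)^\- i)%E).

Definition csummable (f : I -> R[i]) : Prop :=
  rsummable (fun i => complex.Re (f i)) /\ rsummable (fun i => complex.Im (f i)).

Definition csum (f : I -> R[i]) : R[i] :=
  rsum (fun i => complex.Re (f i)) +i* rsum (fun i => complex.Im (f i)).

End Sums.

Section HallLittlewoodMeasure.
Variables (R : realType) (n : nat) (t : R) (a : 'I_n -> R).
Implicit Type lam : intpartition.

(* the factors with lam_1 < i are equal to 1 *)
Definition b_el lam : R :=
  \prod_(1 <= i < (head 0%N lam).+1)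
    \prod_(1 <= k < (mult lam i)./2.+1) (1 - t ^+ (k.*2).-1).

Definition HL_Phi : R :=
  \prod_(i < n) \prod_(j < n | (i < j)%N)
    ((1 - t * a i * a j) / (1 - a i * a j)).

Definition HL_prob lam : R :=
  HL_Phi^-1 * b_el lam * HallLittlewood.HL_P_eval t lam a *
  (ptranspose_even lam)%:R.

Definition HL_integrable (F : intpartition -> R) : Prop :=
  rsummable (fun lam => HL_prob lam * F lam).

Definition HL_expectation (F : intpartition -> R) : R :=
  rsum (fun lam => HL_prob lam * F lam).

End HallLittlewoodMeasure.

Definition qpoch_inf (R : realType) (b q : R) : R :=
  limn (fun N => \prod_(0 <= i < N) (1 - b * q ^+ i)).

Section ContourIntegral.
Variable R : realType.

Definition circle_pt (r theta : R) : R[i] :=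
  (r * cos theta) +i* (r * sin theta).

(* integral of g(z) dz over the positively oriented circle |z| = r *)
Definition circle_integral (r : R) (g : R[i] -> R[i]) : R[i] :=
  let h theta := g (circle_pt r theta) * ((0 +i* 1) * circle_pt r theta) in
  (\int[lebesgue_measure]_(theta in `[0, 2 * pi]) complex.Re (h theta)) +i*
  (\int[lebesgue_measure]_(theta in `[0, 2 * pi]) complex.Im (h theta)).

(* (2 i pi)^-2 times the integral of g(z, w) dz dw over |z| = r1, |w| = r2 *)
Definition circle_integral2 (r1 r2 : R) (g : R[i] -> R[i] -> R[i]) : R[i] :=
  (0 +i* (2 * pi)) ^- 2 *
  circle_integral r1 (fun z => circle_integral r2 (fun w => g z w)).

End ContourIntegral.

Section Kernel.
Variables (R : realType) (n : nat) (a : 'I_n -> R).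

Definition f_prod (z : R[i]) : R[i] :=
  \prod_(j < n) ((z - (a j)%:C) / (1 - (a j)%:C * z)).

(* r1, r2 : radii of the z- and w-contours of K11 and K12;
   s1, s2 : radii of the z- and w-contours of K22 *)
Variables (r1 r2 s1 s2 : R).

Definition Kc11 (u v : nat) : R[i] :=
  circle_integral2 r1 r2 (fun z w =>
    (w - z) * f_prod z * f_prod w /
      ((z ^+ 2 - 1) * (w ^+ 2 - 1) * (z * w - 1)) / z ^+ u / w ^+ v).

Definition Kc12 (u v : nat) : R[i] :=
  (u == v)%:R +
  circle_integral2 r1 r2 (fun z w =>
    (w - z) * f_prod z * f_prod w /
      ((z ^+ 2 - 1) * w * (z * w - 1)) / z ^+ u / w ^+ v).

Definition Kc22 (u v : nat) : R[i] :=
  circle_integral2 s1 s2 (fun z w =>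
    (w - z) * f_prod z * f_prod w /
      (z * w * (z * w - 1)) / z ^+ u / w ^+ v).

Definition Kc (u v : nat) : 'M[R[i]]_2 :=
  \matrix_(p < 2, q < 2)
    if p == 0 then (if q == 0 then Kc11 u v else Kc12 u v)
    else (if q == 0 then - Kc12 v u else Kc22 u v).

End Kernel.

Section Pfaffian.

Lemma ord_even_subproof k (i : 'I_k) : (i.*2 < k.*2)%N.
Proof. by rewrite ltn_double. Qed.

Lemma ord_odd_subproof k (i : 'I_k) : (i.*2.+1 < k.*2)%N.
Proof. by rewrite ltn_Sdouble. Qed.

Lemma ord_half_subproof k (p : 'I_k.*2) : (p./2 < k)%N.
Proof. by rewrite ltn_half_double. Qed.

Definition ord_even k (i : 'I_k) : 'I_k.*2 := Ordinal (ord_even_subproof i).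
Definition ord_odd k (i : 'I_k) : 'I_k.*2 := Ordinal (ord_odd_subproof i).
Definition ord_half k (p : 'I_k.*2) : 'I_k := Ordinal (ord_half_subproof p).

Definition pfaffian (F : fieldType) k (A : 'M[F]_(k.*2)) : F :=
  ((2 ^ k * k`!)%N%:R)^-1 *
  \sum_(s : 'S_(k.*2)) (-1) ^+ s * \prod_(i < k) A (s (ord_even i)) (s (ord_odd i)).

(* the 2k x 2k matrix with 2 x 2 blocks K (x i) (x j) *)
Definition kernel_mx (F : fieldType) (K : nat -> nat -> 'M[F]_2) k
    (x : {ffun 'I_k -> nat}) : 'M[F]_(k.*2) :=
  \matrix_(p, q) K (x (ord_half p)) (x (ord_half q))
    (inord (odd p)) (inord (odd q)).

End Pfaffian.

Section FredholmPfaffian.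
Variables (R : realType) (f : nat -> R[i]) (K : nat -> nat -> 'M[R[i]]_2).

Definition fredholm_summand k (x : {ffun 'I_k -> nat}) : R[i] :=
  (\prod_(i < k) f (x i)) * pfaffian (kernel_mx K x).

Definition fredholm_term (k : nat) : R[i] :=
  (k`!%:R)^-1 * csum (@fredholm_summand k).

Definition fredholm_summable : Prop :=
  (forall k, csummable (@fredholm_summand k)) /\
  csummable (fun k => fredholm_term k.+1).

(* Pf[J + f K] on l^2(Z_{>= 0}), through its expansion; J is implicit in it *)
Definition fredholm_pfaffian : R[i] :=
  1 + csum (fun k => fredholm_term k.+1).

End FredholmPfaffian.

Definition f_x (R : realType) (t x : R) (j : nat) : R :=
  qpoch_inf (- t `^ (x + j%:R + 1)) (t ^+ 2) /
  qpoch_inf (- t `^ (x + j%:R)) (t ^+ 2) - 1.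

(* Main.v *)
(** Both sides equal Pf(B_u) / (Pf(B_0) g(x)), where u = - t^x, g(x) is the
    q-Pochhammer symbol (- t^x; t^2)_oo and B_u has the entries
    (a_i - a_j) (1 / (1 - a_i a_j) - u / (1 - t a_i a_j)); the a_i may be taken
    distinct, since both sides are continuous in a.

    For the expectation, summing over lambda one column at a time turns the
    symmetrization formula for P_lambda into a recursion over subsets of the a_i,
    whose fixed point is the normalized Pfaffian of B_u (a refined Littlewood
    identity).

    For the Fredholm Pfaffian, residues at the 1 / a_j give K = D + W^T B_0^-1 W
    with D supported near the diagonal and W built from powers of the a_j. Schur complements then turn the minor of
    K on a finite set T, times Pf(B_0), into the Pfaffian of the matrix with entries
    (a_i - a_j) sum_s (a_i a_j)^s phi_s phi_(s+1), where phi is the indicator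
    function of the complement of T. This is affine in each phi_s, so that summing
    over T with weights f amounts to taking phi_s = 1 / (1 + f_s) = g(x+s) / g(x+s+1),
    and then phi_s phi_(s+1) = 1 + t^(x+s). *)

From HB Require Import structures.
Require Import Defs.
From mathcomp Require Import all_boot all_order all_fingroup all_algebra.
From mathcomp Require Import ring lra zify.
From mathcomp Require mpoly.

Set Implicit Arguments.
Unset Strict Implicit.
Unset Printing Implicit Defensive.

Import Order.TTheory GRing.Theory Num.Theory.
Local Open Scope ring_scope.

(** * Evaluation of Hall-Littlewood polynomials *)

(** The explicit formulas for distinct parameters have poles where two [a_i] coincide, so the
    continuity in [a] needs majorants that do not see these poles. For the Hall-Littlewood measure
    the parameters move along the line [a_i - e * (i + 1)]; the symmetrized sum is then a polynomial
    in [e], bounded in a coefficient norm for which division by the differences of parameters costs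
    a constant independent of lambda. For the kernel, contour estimates and moments of f play this
    role. The crude bound for a Pfaffian of order [2k] grows like [k!], which cancels the [1/k!] of
    the Fredholm expansion. Convergence comes from the weight [t^j] and from the fact that [k]
    distinct points have sum at least k(k-1)/2. In the Littlewood identity the parameter [u] has to
    stay free: removing a column replaces it by [t], and the induction also calls the identity at
    [u * t]. The value [u = - t^x] enters since g(x + m), for even [m], is g(x) divided by the
    finite product of the [1 - u t^(2i)] with [2i < m]. *)

Module HLPolynomial.
Import mpoly HallLittlewood.

Section Clear.
Variables (R : realFieldType) (n : nat) (t : R) (lam : intpartition).

Section Values.
Variables (S : comNzRingType) (c : S) (x : 'I_n -> S).
Definition vdm (w : 'S_n) : S := \prod_(i < n) \prod_(j < n | (i < j)%N) (x (w i) - x (w j)).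
Definition mon (w : 'S_n) : S := \prod_(i < n) x (w i) ^+ part lam i.
Definition tvdm (w : 'S_n) : S := \prod_(i < n) \prod_(j < n | (i < j)%N) (x (w i) - c * x (w j)).
End Values.

Lemma tofrac_neq0_X (i j : 'I_n) : i != j -> ('X_i - 'X_j : {mpoly R[n]}) != 0.
Proof.
move=> ij; apply/eqP => /(congr1 (mcoeff U_(i))); apply/eqP.
by rewrite mcoeff0 mcoeffB !mcoeffXU eqxx [j == i]eq_sym (negbTE ij) subr0 oner_eq0.
Qed.

(** The product of [vdm w] over all permutations serves as common denominator, so that no signs
    relating the [vdm w] have to be tracked. The outcome is an identity of polynomials, which
    survives every specialization, coinciding parameters included. *)
Lemma HL_R_clear : HL_R n t lam * \prod_w vdm (fun i => 'X_i) w =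
  \sum_w mon (fun i => 'X_i) w * tvdm (t%:MP) (fun i => 'X_i) w * \prod_(w' | w' != w) vdm (fun i => 'X_i) w'.
Proof.
have v0 w : vdm (fun i => 'X_i : {mpoly R[n]}) w != 0.
  apply/prodf_neq0 => i _; apply/prodf_neq0 => j ij; apply: tofrac_neq0_X.
  by rewrite (inj_eq perm_inj) neq_ltn ij.
apply/eqP; rewrite -tofrac_eq tofracM (eqP (xchooseP (HL_sym_polynomial n t lam))).
rewrite raddf_sum mulr_suml; apply/eqP; apply: eq_bigr => w _ /=.
rewrite (bigD1 w)//= !tofracM mulrA; congr (_ * _); rewrite /HL_sym -mulrA; congr (_ * _).
  by rewrite /mon rmorph_prod; apply: eq_bigr => i _; rewrite rmorphXn.
have tv0 : tofrac (vdm (fun i => 'X_i : {mpoly R[n]}) w) != 0 by rewrite tofrac_eq0.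
apply: (mulIf (invr_neq0 tv0)); rewrite mulfK// /tvdm /vdm !rmorph_prod -prodfV -big_split.
apply: eq_bigr => i _ /=; rewrite !rmorph_prod -prodfV -big_split; apply: eq_bigr => j _ /=.
by rewrite mul_mpolyC.
Qed.

(** Used with values in [R] at distinct points, and with values in [{poly R}], where the points are
    affine functions of the perturbation parameter. *)
Lemma HL_R_map (S : comNzRingType) (f : {rmorphism R -> S}) (x : 'I_n -> S) :
  mmap f x (HL_R n t lam) * \prod_w vdm x w =
  \sum_w mon x w * tvdm (f t) x w * \prod_(w' | w' != w) vdm x w'.
Proof.
have mX i : mmap f x 'X_i = x i by rewrite mmapX mmap1U.
have hv w : mmap f x (vdm (fun i => 'X_i) w) = vdm x w.
  rewrite rmorph_prod; apply: eq_bigr => i _; rewrite rmorph_prod; apply: eq_bigr => j _ /=.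
  by rewrite rmorphB /= !mX.
have := congr1 (mmap f x) HL_R_clear; rewrite rmorphM rmorph_prod /=.
under [in LHS]eq_bigr => w _ do rewrite hv.
move=> ->; rewrite rmorph_sum; apply: eq_bigr => w _ /=; rewrite !rmorphM /=; congr (_ * _ * _).
- by rewrite rmorph_prod; apply: eq_bigr => i _; rewrite rmorphXn /= mX.
- rewrite rmorph_prod; apply: eq_bigr => i _; rewrite rmorph_prod; apply: eq_bigr => j _ /=.
  by rewrite rmorphB rmorphM /= !mX mmapC.
- by rewrite rmorph_prod; apply: eq_bigr => w' _; rewrite -hv.
Qed.

End Clear.

Section Evaluation.
Variables (R : realFieldType) (n : nat) (t : R).
Implicit Types (lam : intpartition) (a : 'I_n -> R).

Lemma HL_R_eval lam a : injective a ->
  (HL_R n t lam).@[a] = \sum_(w : 'S_n) (\prod_(i < n) a (w i) ^+ part lam i) *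
    \prod_(i < n) \prod_(j < n | (i < j)%N) ((a (w i) - t * a (w j)) / (a (w i) - a (w j))).
Proof.
move=> ainj; have v0 w : vdm a w != 0.
  apply/prodf_neq0 => i _; apply/prodf_neq0 => j ij; rewrite subr_eq0 !(inj_eq ainj, inj_eq perm_inj).
  by rewrite neq_ltn ij.
have P0 : \prod_w vdm a w != 0 by apply/prodf_neq0.
apply: (mulIf P0); rewrite [LHS](HL_R_map t lam idfun a) mulr_suml; apply: eq_bigr => w _ /=.
rewrite [in RHS](bigD1 w)//= mulrA; congr (_ * _); rewrite -mulrA; congr (_ * _).
apply: (mulIf (invr_neq0 (v0 w))); rewrite mulfK// /tvdm /vdm -prodfV -big_split.
by apply: eq_bigr => i _ /=; rewrite -prodfV -big_split.
Qed.

Lemma horner_mmap (p : {mpoly R[n]}) (h : 'I_n -> {poly R}) e :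
  (mmap polyC h p).[e] = p.@[fun i => (h i).[e]].
Proof.
rewrite /meval /mmap horner_sum; apply: eq_bigr => m _.
rewrite hornerM hornerC; congr (_ * _); rewrite /mmap1 horner_prod; apply: eq_bigr => i _.
by rewrite horner_exp.
Qed.

End Evaluation.

(** * A weighted coefficient norm on polynomials in one variable *)

Section WeightedNorm.
Variables (R : realFieldType) (eta : R).
Hypothesis eta0 : 0 < eta.
Implicit Types p q : {poly R}.

(** The norm of power series that converge absolutely at radius [eta]. It dominates the values for
    [|e| <= eta] and, contrary to a supremum over an interval, is bounded below under multiplication
    by an affine factor uniformly in the degree, even if the factor has its root inside. *)
Definition wnorm p : R := \sum_(k < size p) `|p`_k| * eta ^+ k.

Lemma wnorm_wide N p : (size p <= N)%N -> wnorm p = \sum_(k < N) `|p`_k| * eta ^+ k.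
Proof.
move=> h; rewrite /wnorm (big_ord_widen N (fun k => `|p`_k| * eta ^+ k)) // big_mkcond; apply: eq_bigr => k _.
by case: ltnP => // hk; rewrite nth_default// normr0 mul0r.
Qed.

Lemma wnorm_ge0 p : 0 <= wnorm p.
Proof. by apply: sumr_ge0 => k _; rewrite mulr_ge0// exprn_ge0// ltW. Qed.

Lemma wnormD p q : wnorm (p + q) <= wnorm p + wnorm q.
Proof.
set N := maxn (size p) (size q); rewrite !(@wnorm_wide N) ?leq_maxl ?leq_maxr ?size_polyD//.
rewrite -big_split; apply: ler_sum => k _ /=; rewrite coefD -mulrDl ler_wpM2r ?ler_normD//.
by rewrite exprn_ge0// ltW.
Qed.

Lemma wnormN p : wnorm (- p) = wnorm p.
Proof. by rewrite /wnorm size_polyN; apply: eq_bigr => k _; rewrite coefN normrN. Qed.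

Lemma wnormZ c p : wnorm (c *: p) = `|c| * wnorm p.
Proof.
rewrite (@wnorm_wide (size p)) ?size_scale_leq// mulr_sumr; apply: eq_bigr => k _.
by rewrite coefZ normrM mulrA.
Qed.

Lemma wnormMX p : wnorm (p * 'X) = eta * wnorm p.
Proof.
rewrite (@wnorm_wide (size p).+1); last first.
  by rewrite (leq_trans (size_polyMleq _ _))// size_polyX addn2.
rewrite big_ord_recl coefMX /= normr0 mul0r add0r mulr_sumr; apply: eq_bigr => k _.
by rewrite coefMX /= exprS; ring.
Qed.

(** Triangle inequality for [c *: p] and [d *: (p * 'X)], whose norms are exactly [|c|] and
    [|d| * eta] times that of [p]. For a nonzero factor the constant vanishes only if the root has
    modulus [eta]; this is how a denominator that vanishes at [e = 0] is divided out. *)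
Lemma wnorm_affine c d p : `|wnorm ((c%:P + d *: 'X) * p)| >= `| `|c| - `|d| * eta| * wnorm p.
Proof.
have -> : (c%:P + d *: 'X) * p = c *: p + d *: (p * 'X).
  by rewrite mulrDl mul_polyC -scalerAl [p * _]mulrC.
rewrite (ger0_norm (wnorm_ge0 _)).
have h1 := wnormD (c *: p + d *: (p * 'X)) (- (d *: (p * 'X))).
have h2 := wnormD (c *: p + d *: (p * 'X)) (- (c *: p)).
rewrite addrK wnormN !wnormZ wnormMX in h1.
rewrite addrAC subrr add0r wnormN !wnormZ wnormMX in h2.
case: (ger0P (`|c| - `|d| * eta)) => _; [move: h1|move: h2];
  rewrite -lerBlDr; apply: le_trans; rewrite le_eqVlt; apply/orP; left; apply/eqP; ring.
Qed.

Lemma wnorm_mul_affine c d p : wnorm ((c%:P + d *: 'X) * p) <= (`|c| + `|d| * eta) * wnorm p.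
Proof.
have -> : (c%:P + d *: 'X) * p = c *: p + d *: (p * 'X).
  by rewrite mulrDl mul_polyC -scalerAl [p * _]mulrC.
apply: le_trans (wnormD _ _) _; rewrite !wnormZ wnormMX le_eqVlt; apply/orP; left; apply/eqP; ring.
Qed.

Lemma wnorm_horner p e : `|e| <= eta -> `|p.[e]| <= wnorm p.
Proof.
move=> he; rewrite horner_coef (le_trans (ler_norm_sum _ _ _))//; apply: ler_sum => k _.
by rewrite normrM normrX ler_wpM2l// lerXn2r// nnegrE// ltW.
Qed.

End WeightedNorm.

(** * A geometric bound for P_lambda along a line of parameters *)

Section UniformBound.
Variables (R : realFieldType) (n : nat) (t : R) (a : 'I_n -> R).
Hypotheses (t01 : 0 < t < 1) (a01 : forall i, 0 < a i < 1).

(** [P e] for all sufficiently small positive [e]. Finitely many such conditions can be met at once,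
    which is how radii and perturbation sizes are chosen. *)
Definition small (P : R -> Prop) := exists2 d, 0 < d & forall e, 0 < e <= d -> P e.

Lemma small_and P Q : small P -> small Q -> small (fun e => P e /\ Q e).
Proof.
move=> [d1 h1 H1] [d2 h2 H2]; exists (Num.min d1 d2); first by rewrite lt_min h1.
by move=> e /andP[e0]; rewrite le_min => /andP[a1 a2]; split; [apply: H1|apply: H2]; rewrite e0.
Qed.

Lemma small_forall (I : finType) (P : I -> R -> Prop) :
  (forall i, small (P i)) -> small (fun e => forall i, P i e).
Proof.
move=> h; suff [d d0 H] : small (fun e => {in enum I, forall i, P i e}).
  by exists d => // e he i; apply: H => //; rewrite mem_enum.
elim: (enum I) => [|i s [d d0 H]]; first by exists 1.
have [d' d'0 H'] := small_and (h i) (ex_intro2 _ _ d d0 H).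
exists d' => // e he j; rewrite inE => /orP[/eqP ->|]; have [] := H' e he => // _; exact.
Qed.

Lemma small_affine (c d : R) : d != 0 -> small (fun e => `|c| - `|d| * e != 0).
Proof.
move=> d0; have dp : 0 < `|d| by rewrite normr_gt0.
have [->|c0] := eqVneq c 0.
  exists 1 => // e /andP[e0 _]; rewrite normr0 sub0r oppr_eq0 mulf_neq0//; first by rewrite gt_eqF.
  by rewrite gt_eqF.
have cp : 0 < `|c| by rewrite normr_gt0.
exists (`|c| / (2 * `|d|)); first by rewrite divr_gt0// mulr_gt0.
move=> e /andP[e0]; rewrite ler_pdivlMr ?mulr_gt0// => he; rewrite gt_eqF// subr_gt0.
by have := mulr_gt0 e0 dp; lra.
Qed.

Lemma small_le1 (c d : R) : c < 1 -> 0 < d -> small (fun e => c + d * e < 1).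
Proof.
move=> c1 d0; exists ((1 - c) / (2 * d)); first by rewrite divr_gt0 ?mulr_gt0// subr_gt0.
move=> e /andP[e0]; rewrite ler_pdivlMr ?mulr_gt0// => he.
by have := mulr_gt0 e0 d0; lra.
Qed.

(** The slopes are distinct, so that the perturbed parameters separate for small nonzero [e], and
    negative, so that they move below [a i] for positive [e]. *)
Let dd (i : 'I_n) : R := - (i.+1)%:R.
Let x (i : 'I_n) : {poly R} := (a i)%:P + dd i *: 'X.

Lemma v_ge1 (lam : intpartition) : 1 <= v n t lam.
Proof.
have /andP[t0 t1] := t01.
have h m : 1 <= v_ t m.
  rewrite /v_ big_seq; apply: (big_ind (fun z => 1 <= z)) => // [p q hp hq|i].
    by apply: mulr_ege1.
  rewrite mem_index_iota => /andP[i1 _]; rewrite ler_pdivlMr ?subr_gt0// mul1r lerD2l lerN2.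
  by rewrite -[leRHS]expr1; apply: ler_wiXn2l => //; exact: ltW.
by apply: mulr_ege1 => //; apply: (big_ind (fun z => 1 <= z)) => // p q; exact: mulr_ege1.
Qed.

(** Coinciding parameters make the denominators vanish at [e = 0], so the estimate is made for the
    whole polynomial in [e]: in norm, each term of the cleared numerator carries a factor
    [rho ^+ sumn lam], and dividing by the product of the [vdm] costs the constant [K], which does
    not depend on [lam]. *)
Lemma HL_P_bound : exists eta C rho : R, [/\ 0 < eta, 0 <= C, 0 < rho < 1 &
  forall lam e, `|e| <= eta ->
    `|HL_P_eval t lam (fun i : 'I_n => a i - e * (i.+1)%:R)| <= C * rho ^+ sumn lam].
Proof.
have hdd (i j : 'I_n) : i != j -> dd i - dd j != 0.
  move=> ij; rewrite /dd opprK addrC subr_eq0 eqr_nat eqSS eq_sym; exact: ij.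
(* [eta0] avoids the moduli of the roots of all differences [x i - x j], and keeps
   [a i + (i + 1) * eta0], the norm of [x i], below 1. *)
have [eta0 e0 He] : small (fun e => (forall i j : 'I_n, i != j -> `|a i - a j| - `|dd i - dd j| * e != 0)
     /\ forall i : 'I_n, a i + (i.+1)%:R * e < 1).
  apply: small_and.
    apply: small_forall => i; apply: small_forall => j; have [->|ij] := eqVneq i j.
      by exists 1.
    by have [d d0 H] := small_affine (a i - a j) (hdd i j ij); exists d => // e /H.
  by apply: small_forall => i; apply: small_le1; [case/andP: (a01 i)|rewrite ltr0n].
have [hne hlt] := He eta0 (introT andP (conj e0 (lexx _))).
(* The default [1/2] keeps [rho] positive even for an empty family of parameters. *)
pose rho := \big[Num.max/(2%:R^-1 : R)]_(i < n) (a i + (i.+1)%:R * eta0).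
have rho1 : rho < 1.
  apply: (big_ind (fun z => z < 1)) => [|p q hp hq|i _]; last exact: hlt.
    by rewrite invf_lt1 ?ltr1n.
  by rewrite gt_max hp.
have rho_ge i : a i + (i.+1)%:R * eta0 <= rho by exact: le_bigmax.
have rho0 : 0 < rho.
  by apply: lt_le_trans (_ : 2%:R^-1 <= rho); [rewrite invr_gt0 ltr0n|exact: bigmax_ge_id].
(* [low G] says that multiplication by [G] is bounded below in norm. It is stable under products,
   hence passes from the differences [x i - x j] to the product of all the [vdm]. *)
pose low (G : {poly R}) := exists2 K, 0 < K & forall p, K * wnorm eta0 p <= wnorm eta0 (G * p).
have low1 : low 1 by exists 1 => // p; rewrite !mul1r.
have lowM G H : low G -> low H -> low (G * H).
  move=> [K1 k1 h1] [K2 k2 h2]; exists (K1 * K2); first exact: mulr_gt0.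
  by move=> p; rewrite -!mulrA (le_trans _ (h1 _))// ler_wpM2l ?h2// ltW.
have lowx i j : i != j -> low (x i - x j).
  move=> ij; exists `| `|a i - a j| - `|dd i - dd j| * eta0|; first by rewrite normr_gt0 hne.
  move=> p; have -> : x i - x j = (a i - a j)%:P + (dd i - dd j) *: 'X.
    by rewrite /x polyCB scalerBl; ring.
  by have := wnorm_affine e0 (a i - a j) (dd i - dd j) p; rewrite (ger0_norm (wnorm_ge0 e0 _)).
have [K K0 hK] : low (\prod_w vdm x w).
  apply: (big_ind low) => // w _; apply: (big_ind low) => // i _; apply: (big_ind low) => // j ij.
  by apply: lowx; rewrite (inj_eq perm_inj) neq_ltn ij.
pose B w := tvdm t%:P x w * \prod_(w' | w' != w) vdm x w'.
have wx i p : wnorm eta0 (x i * p) <= rho * wnorm eta0 p.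
  apply: le_trans (wnorm_mul_affine e0 _ _ _) _; rewrite ler_wpM2r ?wnorm_ge0//.
  have /andP[a0 _] := a01 i; rewrite (gtr0_norm a0) /dd normrN gtr0_norm ?ltr0n//.
exists eta0, ((\sum_w wnorm eta0 (B w)) / K), rho; split => //.
- by rewrite divr_ge0 ?(ltW K0)// sumr_ge0// => w _; rewrite wnorm_ge0.
- by rewrite rho0.
move=> lam e he; rewrite /HL_P_eval /HL_P; case: ifP => hl; last first.
  rewrite meval0 normr0 mulr_ge0 ?exprn_ge0 ?(ltW rho0)//.
  by rewrite divr_ge0 ?(ltW K0)// sumr_ge0// => w _; rewrite wnorm_ge0.
rewrite mevalZ normrM.
have v1 := v_ge1 lam; have v0 : 0 < v n t lam by exact: lt_le_trans v1.
apply: le_trans (_ : `|(HL_R n t lam).@[fun i => a i - e * (i.+1)%:R]| <= _).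
  by rewrite ler_piMl// gtr0_norm ?invr_gt0// invf_le1.
pose P := mmap polyC x (HL_R n t lam).
have -> : (HL_R n t lam).@[fun i => a i - e * (i.+1)%:R] = P.[e].
  rewrite horner_mmap; apply: meval_eq => i.
  by rewrite /x /dd hornerD hornerC hornerZ hornerX; ring.
apply: le_trans (wnorm_horner e0 P he) _.
rewrite mulrAC ler_pdivlMr// mulrC (le_trans (hK P))//.
rewrite mulrC HL_R_map -/P mulr_suml.
elim/big_ind2: _ => [|p1 q1 p2 q2 h1 h2|w _].
- by rewrite /wnorm size_poly0 big_ord0.
- by apply: le_trans (wnormD e0 _ _) _; exact: lerD.
rewrite -mulrA -/(B w) mulrC.
have up (s : seq 'I_n) p : wnorm eta0 (\prod_(i <- s) x (w i) ^+ part lam i * p) <=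
    rho ^+ (\sum_(i <- s) part lam i) * wnorm eta0 p.
  have upn i k q : wnorm eta0 (x i ^+ k * q) <= rho ^+ k * wnorm eta0 q.
    elim: k => [|k IH]; first by rewrite !expr0 !mul1r.
    by rewrite !exprS -!mulrA (le_trans (wx _ _))// ler_wpM2l// ltW.
  elim: s => [|i s IH]; first by rewrite !big_nil expr0 !mul1r.
  rewrite !big_cons -!mulrA (le_trans (upn _ _ _))// exprD -mulrA ler_wpM2l ?exprn_ge0 ?(ltW rho0)//.
have := up (index_enum 'I_n) (B w); rewrite -/(mon lam x w) [_ * wnorm _ _]mulrC.
suff -> : (\sum_(i < n) part lam i = sumn lam)%N by rewrite [B w * _]mulrC.
rewrite sumnE (big_nth 0%N) big_mkord (big_ord_widen n (fun i => nth 0%N lam i) hl) [RHS]big_mkcond.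
by apply: eq_bigr => i _; rewrite /part; case: ltnP => // h; rewrite nth_default.
Qed.

Lemma HL_P_poly lam : exists p : {poly R}, forall e,
  HL_P_eval t lam (fun i : 'I_n => a i - e * (i.+1)%:R) = p.[e].
Proof.
exists (mmap polyC x (HL_P n t lam)) => e; rewrite horner_mmap; apply: meval_eq => i.
by rewrite /x /dd hornerD hornerC hornerZ hornerX; ring.
Qed.

End UniformBound.
End HLPolynomial.
From mathcomp Require Import all_classical all_reals all_analysis.
From mathcomp Require Import measurable_realfun complex.
Import Order.TTheory GRing.Theory Num.Theory.
Import numFieldNormedType.Exports.
Local Open Scope ring_scope.
Local Open Scope complex_scope.

(** * Pfaffians *)

Section PfaffianTheory.
Variable F : numFieldType.
Implicit Types (A : nat -> nat -> F) (k : nat).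

(** Matrices are functions on [nat] of which only the leading block of size [2k] is read; deleting,
    shifting and gluing indices then needs no casts between ordinal types. *)
Definition pfn k A : F := pfaffian (\matrix_(i < k.*2, j < k.*2) A i j).

Definition antisym A : Prop := forall i j, A i j = - A j i.

Let term k A (s : 'S_(k.*2)) : F :=
  (-1) ^+ s * \prod_(i < k) A (s (ord_even i)) (s (ord_odd i)).

Lemma pfnE k A : pfn k A = ((2 ^ k * k`!)%N%:R)^-1 * \sum_(s : 'S_(k.*2)) term A s.
Proof.
congr (_ * _); apply: eq_bigr => s _; congr (_ * _).
by apply: eq_bigr => i _; rewrite mxE.
Qed.

Lemma eq_pfn k A B :
  (forall i j, (i < k.*2)%N -> (j < k.*2)%N -> A i j = B i j) -> pfn k A = pfn k B.
Proof. by move=> h; congr pfaffian; apply/matrixP => i j; rewrite !mxE h. Qed.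

Lemma pfn0 A : pfn 0 A = 1.
Proof.
rewrite pfnE expn0 fact0 invr1 mul1r (big_pred1 1%g); last first.
  by move=> s; apply/esym/eqP/permP => -[].
by rewrite /term odd_perm1 big_ord0 mulr1.
Qed.

Lemma ord_even_inj k : injective (@ord_even k).
Proof. by move=> i j /(congr1 val)/= /double_inj ?; apply: val_inj. Qed.

Lemma ord_odd_inj k : injective (@ord_odd k).
Proof. by move=> i j /(congr1 val)/= [] /double_inj ?; apply: val_inj. Qed.

Lemma ord_even_odd k (i j : 'I_k) : (ord_even i == ord_odd j) = false.
Proof. by apply/negP => /eqP/(congr1 (odd \o val))/=; rewrite !odd_double. Qed.

Lemma ord_odd_even k (i j : 'I_k) : (ord_odd i == ord_even j) = false.
Proof. by rewrite eq_sym ord_even_odd. Qed.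

Lemma ord_evenP k (p : 'I_(k.*2)) :
  (exists i : 'I_k, p = ord_even i) \/ (exists i : 'I_k, p = ord_odd i).
Proof.
case ho : (odd p); [right|left]; exists (ord_half p); apply: val_inj => /=;
  by rewrite -[LHS]odd_double_half ho.
Qed.

Lemma term_flip k A (i : 'I_k) (s : 'S_(k.*2)) : antisym A ->
  term A (tperm (ord_even i) (ord_odd i) * s)%g = term A s.
Proof.
move=> hA; rewrite /term odd_permM odd_tperm ord_even_odd /= signrN mulNr -mulrN.
congr (_ * _); rewrite (bigD1 i)//= [RHS](bigD1 i)//= !permM tpermL tpermR hA mulNr opprK.
congr (_ * _); apply: eq_bigr => j ji; rewrite !permM !tpermD ?ord_odd_even ?ord_even_odd//.
  by apply: contra ji => /eqP/ord_odd_inj ->.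
by apply: contra ji => /eqP/ord_even_inj ->.
Qed.

Lemma term_swap k A (i0 i : 'I_k) (s : 'S_(k.*2)) : i0 != i ->
  term A (tperm (ord_even i0) (ord_even i) * tperm (ord_odd i0) (ord_odd i) * s)%g = term A s.
Proof.
move=> hi; rewrite /term !odd_permM !odd_tperm (inj_eq (@ord_even_inj k)) (inj_eq (@ord_odd_inj k)) hi /=.
congr (_ * _); rewrite [RHS](reindex_inj (@perm_inj _ (tperm i0 i))); apply: eq_bigr => j _; rewrite !permM.
have hE : (tperm (ord_odd i0) (ord_odd i)) (tperm (ord_even i0) (ord_even i) (ord_even j))
   = ord_even (tperm i0 i j).
  by rewrite -(inj_tperm _ _ _ (@ord_even_inj k)) tpermD ?ord_odd_even.
have hO : (tperm (ord_odd i0) (ord_odd i)) (tperm (ord_even i0) (ord_even i) (ord_odd j))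
   = ord_odd (tperm i0 i j).
  by rewrite (tpermD (x:=ord_even i0)) ?ord_even_odd// -(inj_tperm _ _ _ (@ord_odd_inj k)).
by rewrite hE hO.
Qed.

Let pos0 k : 'I_(k.+1.*2) := ord_even ord0.

(** Flipping the two positions of a pair and exchanging two pairs leave each term unchanged, and
    together these moves bring any position to position 0. *)
Lemma sum_term_position k A (p v : 'I_(k.+1.*2)) : antisym A ->
  \sum_(s : 'S_(k.+1.*2) | s p == v) term A s = \sum_(s : 'S_(k.+1.*2) | s (pos0 k) == v) term A s.
Proof.
move=> hA.
have hodd (i : 'I_k.+1) : \sum_(s : 'S_(k.+1.*2) | s (ord_odd i) == v) term A s =
    \sum_(s : 'S_(k.+1.*2) | s (ord_even i) == v) term A s.
  rewrite (reindex_inj (mulgI (tperm (ord_even i) (ord_odd i)))).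
  apply: eq_big => [s|s _]; first by rewrite permM tpermR.
  exact: term_flip.
have heven (i : 'I_k.+1) : \sum_(s : 'S_(k.+1.*2) | s (ord_even i) == v) term A s =
    \sum_(s : 'S_(k.+1.*2) | s (pos0 k) == v) term A s.
  have [<-//|hi] := eqVneq ord0 i.
  rewrite (reindex_inj (mulgI (tperm (ord_even ord0) (ord_even i) * tperm (ord_odd ord0) (ord_odd i))%g)).
  apply: eq_big => [s|s _]; last exact: term_swap.
  by rewrite !permM tpermR tpermD// ord_odd_even.
by case: (ord_evenP p) => -[i ->]; rewrite ?hodd heven.
Qed.

(** [lift_perm] identifies the permutations of [n] points with those of [n.+1] points sending [i0]
    to [j0]; the inverse is restriction, expressed through [unlift]. *)
Lemma sum_lift_perm n (i0 j0 : 'I_n.+1) (G : 'S_n.+1 -> F) :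
  \sum_(s : 'S_n.+1 | s i0 == j0) G s = \sum_(s : 'S_n) G (lift_perm i0 j0 s).
Proof.
pose low (s : 'S_n.+1) (m : 'I_n) : 'I_n := odflt m (unlift (s i0) (s (lift i0 m))).
have lowK (s : 'S_n.+1) m : lift (s i0) (low s m) = s (lift i0 m).
  rewrite /low; have : s i0 != s (lift i0 m) by rewrite (inj_eq perm_inj) neq_lift.
  by case/unlift_some => q -> ->.
have low_inj (s : 'S_n.+1) : injective (low s).
  by move=> m m' /(congr1 (lift (s i0))); rewrite !lowK => /perm_inj/lift_inj.
rewrite (reindex (lift_perm i0 j0)).
  by apply: eq_bigl => s; rewrite lift_perm_id eqxx.
exists (fun s => perm (low_inj s)) => [s _|s /eqP h]; apply/permP => m.
  by rewrite permE /low lift_perm_id lift_perm_lift liftK.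
case: (unliftP i0 m) => [m'|] ->; last by rewrite lift_perm_id h.
by rewrite lift_perm_lift permE -h lowK.
Qed.

(** Removes the indices [0] and [j.+1]: here [j] counts the possible partners of index 0, hence the
    shift. *)
Definition pfminor j A := fun p q => A (bump j p).+1 (bump j q).+1.

Lemma term_lift k A (j : 'I_(k.*2.+1)) (s : 'S_(k.*2)) :
  @term k.+1 A (lift_perm ord0 ord0 (lift_perm ord0 j s)) =
  (-1) ^+ j * A 0%N j.+1 * term (pfminor j A) s.
Proof.
have sg : odd_perm (lift_perm ord0 ord0 (lift_perm ord0 j s)) = odd j (+) odd_perm s.
  by rewrite !odd_lift_perm addbb addFb.
rewrite /term sg signr_addb signr_odd.
rewrite big_ord_recl -!mulrA; congr (_ * _); rewrite mulrCA; congr (_ * _).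
  have e0 : ord_even (ord0 : 'I_k.+1) = ord0 by apply: val_inj.
  have e1 : ord_odd (ord0 : 'I_k.+1) = lift ord0 ord0 by apply: val_inj.
  by rewrite e0 e1 lift_perm_id lift_perm_lift lift_perm_id.
congr (_ * _); apply: eq_bigr => i _.
have -> : ord_even (lift ord0 i) = lift ord0 (lift ord0 (ord_even i)) by apply: val_inj.
have -> : ord_odd (lift ord0 i) = lift ord0 (lift ord0 (ord_odd i)) by apply: val_inj.
by rewrite !lift_perm_lift.
Qed.

(** The value 0 is taken at one of [2k + 2] positions, all contributing equally, so that it may be
    placed at position 0 at the cost of this factor. Splitting by the partner of 0 leaves
    permutations of the other [2k] indices. *)
Lemma pfn_expand k A : antisym A ->
  pfn k.+1 A = \sum_(j < k.*2.+1) (-1) ^+ j * A 0%N j.+1 * pfn k (pfminor j A).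
Proof.
move=> hA; rewrite pfnE.
have -> : \sum_(s : 'S_(k.+1.*2)) term A s =
    (k.+1.*2)%:R * \sum_(s : 'S_(k.+1.*2) | s (pos0 k) == pos0 k) term A s.
  rewrite (partition_big (fun s : 'S_(k.+1.*2) => s^-1%g (pos0 k)) xpredT)//=.
  set c := (X in _ = _ * X).
  rewrite (eq_bigr (fun _ => c)) ?sumr_const ?card_ord ?mulr_natl// => p _.
  rewrite /c -(sum_term_position p) //; apply: eq_bigl => s.
  by rewrite -(inj_eq (@perm_inj _ s)) permKV eq_sym.
have -> : \sum_(s : 'S_(k.+1.*2) | s (pos0 k) == pos0 k) term A s =
    \sum_(s : 'S_(k.*2.+1)) @term k.+1 A (lift_perm ord0 ord0 s).
  have -> : pos0 k = ord0 :> 'I_(k.*2.+2) by apply: val_inj.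
  exact: (@sum_lift_perm k.*2.+1 ord0 ord0).
rewrite (partition_big (fun s : 'S_k.*2.+1 => s ord0) xpredT)//=.
rewrite !mulr_sumr; apply: eq_bigr => j _; rewrite sum_lift_perm pfnE.
rewrite (eq_bigr _ (fun s _ => term_lift A j s)) -mulr_sumr [RHS]mulrCA !mulrA; congr (_ * _ * _).
congr (_ * _).
have -> : (2 ^ k.+1 * k.+1`! = 2 ^ k * k`! * k.+1.*2)%N by rewrite expnS factS -muln2; ring.
by rewrite natrM invfM mulfVK// pnatr_eq0 doubleS.
Qed.

End PfaffianTheory.

#[global] Opaque pfn.

(** * Pfaffians under congruence and of block-diagonal matrices *)

Section PfaffianCongruence.
Variable F : numFieldType.
Implicit Types (A B M V : nat -> nat -> F) (k m : nat).

Lemma prod_even_odd k (G : 'I_(k.*2) -> F) :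
  \prod_(p < k.*2) G p = \prod_(i < k) (G (ord_even i) * G (ord_odd i)).
Proof.
rewrite (bigID (fun p : 'I_(k.*2) => odd p))/= mulrC big_split/=; congr (_ * _).
  rewrite (reindex_onto (@ord_even k) (@ord_half k)) => [|p /negbTE hp].
    apply: eq_bigl => i; rewrite odd_double/=; apply/eqP/val_inj => /=; by rewrite doubleK.
  by apply: val_inj; rewrite /= -[RHS]odd_double_half hp.
rewrite (reindex_onto (@ord_odd k) (@ord_half k)) => [|p hp].
  apply: eq_bigl => i; rewrite /= odd_double/=; apply/eqP/val_inj => /=; by rewrite uphalf_double.
by apply: val_inj; rewrite /= -[RHS]odd_double_half hp.
Qed.

(** Expanding the products over all choice functions [phi] produces, for each [phi], the determinant
    of the columns of [M] selected by it. This is zero unless [phi] is a permutation, and then it is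
    a sign times the determinant of [M]; the signs rebuild the Pfaffian of [A]. *)
Lemma pfn_congr k M A :
  pfn k (fun i j => \sum_(a < k.*2) \sum_(b < k.*2) M i a * A a b * M j b) =
  \det (\matrix_(i < k.*2, j < k.*2) M i j) * pfn k A.
Proof.
rewrite !pfnE mulrCA; congr (_ * _).
set n := k.*2; pose FF := {ffun 'I_n -> 'I_n}.
pose N (phi : FF) : 'M[F]_n := \matrix_(p, q) M q (phi p).
pose W (phi : FF) : F := \prod_(i < k) A (phi (ord_even i)) (phi (ord_odd i)).
transitivity (\sum_(phi : FF) \det (N phi) * W phi).
  pose tof (phi : FF) : {ffun 'I_k -> 'I_n * 'I_n} := [ffun i => (phi (ord_even i), phi (ord_odd i))].
  pose ofo (f : {ffun 'I_k -> 'I_n * 'I_n}) : FF :=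
    [ffun p : 'I_n => if odd p then (f (ord_half p)).2 else (f (ord_half p)).1].
  have tofK : cancel tof ofo.
    move=> phi; apply/ffunP => p; rewrite !ffunE /=.
    case: (ord_evenP p) => -[i ->] /=; rewrite !odd_double /=; congr (phi _); apply: val_inj => /=.
      by rewrite doubleK.
    by rewrite uphalf_double.
  have ofoK : cancel ofo tof.
    move=> f; apply/ffunP => i; rewrite !ffunE /= odd_double /=.
    have -> : ord_half (ord_even i) = i by apply: val_inj; rewrite /= doubleK.
    have -> : ord_half (ord_odd i) = i by apply: val_inj; rewrite /= uphalf_double.
    by case: (f i).
  transitivity (\sum_(phi : FF) \sum_(s : 'S_n) (-1) ^+ s *
     \prod_(i < k) (M (s (ord_even i)) (phi (ord_even i)) * M (s (ord_odd i)) (phi (ord_odd i))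
       * A (phi (ord_even i)) (phi (ord_odd i)))); last first.
    apply: eq_bigr => phi _; rewrite /determinant mulr_suml; apply: eq_bigr => s _.
    rewrite prod_even_odd -mulrA /W -big_split/=; congr (_ * _).
    by apply: eq_bigr => i _; rewrite !mxE.
  rewrite exchange_big /=; apply: eq_bigr => s _; rewrite -mulr_sumr; congr (_ * _).
  under eq_bigr => i _ do rewrite pair_bigA.
  rewrite bigA_distr_bigA (reindex tof) /=; last by apply: onW_bij; exists ofo.
  by apply: eq_bigr => phi _; apply: eq_bigr => i _; rewrite ffunE /= mulrAC.
rewrite (bigID (fun phi : FF => injectiveb phi)) /= [X in _ + X]big1 ?addr0; last first.
  move=> phi /injectivePn [i1 [i2 hi e]].
  by rewrite (determinant_alternate hi) ?mul0r// => j; rewrite !mxE e.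
rewrite (reindex (@pval _)) /=; last first.
  exists (insubd (1%g : 'S_n)) => /= phi h; first by apply: val_inj; apply: insubdK.
  by apply: insubdK.
rewrite mulr_sumr; apply: eq_big => [s|s _]; first exact: (valP s).
have -> : N (pval s) = row_perm s (\matrix_(i < n, j < n) M i j)^T.
  by apply/matrixP => p q; rewrite !mxE pvalE.
rewrite row_permE det_mulmx det_perm det_tr mulrCA mulrA; congr (_ * _).
by apply: eq_bigr => i _; rewrite pvalE.
Qed.

Lemma sum_double_add k m (G : nat -> F) :
  \sum_(a < (k + m).*2) G a = \sum_(a < k.*2) G a + \sum_(b < m.*2) G (k.*2 + b)%N.
Proof. by rewrite doubleD big_split_ord. Qed.

Lemma sum_double_add2 k m (G : nat -> nat -> F) :
  \sum_(a < (k + m).*2) \sum_(b < (k + m).*2) G a b =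
  \sum_(a < k.*2) \sum_(b < k.*2) G a b + \sum_(a < k.*2) \sum_(b < m.*2) G a (k.*2 + b)%N
  + \sum_(a < m.*2) \sum_(b < k.*2) G (k.*2 + a)%N b
  + \sum_(a < m.*2) \sum_(b < m.*2) G (k.*2 + a)%N (k.*2 + b)%N.
Proof.
rewrite (sum_double_add _ _ (fun a => \sum_(b < (k + m).*2) G a b)) -addrA; congr (_ + _);
  by rewrite -big_split; apply: eq_bigr => a _; rewrite (sum_double_add _ _ (G _)).
Qed.

Definition blockf k A V B := fun i j =>
  if (i < k.*2)%N then (if (j < k.*2)%N then A i j else V i (j - k.*2)%N)
  else (if (j < k.*2)%N then - V j (i - k.*2)%N else B (i - k.*2)%N (j - k.*2)%N).

Lemma antisym_blockf k A V B : antisym A -> antisym B -> antisym (blockf k A V B).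
Proof. by move=> hA hB i j; rewrite /blockf; do 2 case: ifP => _; rewrite ?opprK. Qed.

(** Expansion along row 0: partners in the second block have entry 0, and the surviving minors keep
    the block shape. *)
Lemma pfn_block k m A B : antisym A -> antisym B ->
  pfn (k + m) (blockf k A (fun _ _ => 0) B) = pfn k A * pfn m B.
Proof.
elim: k A => [|k IH] A hA hB.
  by rewrite pfn0 mul1r add0n; apply: eq_pfn => i j hi hj; rewrite /blockf !subn0.
rewrite addSn !pfn_expand//; last exact: antisym_blockf.
rewrite mulr_suml doubleD -addSn big_split_ord/= [X in _ + X]big1 ?addr0 => [|j _]; last first.
  by rewrite /blockf /= ltnS ltnNge -addSn leq_addr/= mulr0 mul0r.
apply: eq_bigr => j _; rewrite {1}/blockf /= ltnS ltn_ord -[RHS]mulrA; congr (_ * _).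
have hA' : antisym (pfminor j A) by move=> a b; exact: hA.
rewrite -IH//; apply: eq_pfn => a b _ _; rewrite /blockf /pfminor.
have hb c : ((bump j c).+1 < k.+1.*2)%N = (c < k.*2)%N.
  by have := ltn_ord j; rewrite /bump doubleS; case: leqP; lia.
have hs c : (k.*2 <= c)%N -> ((bump j c).+1 - k.+1.*2 = c - k.*2)%N.
  by have := ltn_ord j; rewrite /bump doubleS; case: leqP; lia.
by rewrite !hb; case: ltnP => ha; case: ltnP => hbb //; rewrite !hs.
Qed.

End PfaffianCongruence.

(** * Schur complements for Pfaffians *)

Section PfaffianSchurComplement.
Variable F : numFieldType.
Implicit Types (A B M V : nat -> nat -> F) (k m : nat).

Definition deltaf (i j : nat) : F := (i == j)%:R.

Lemma sum_delta n (i : nat) (G : nat -> F) : (i < n)%N ->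
  \sum_(a < n) deltaf i a * G a = G i.
Proof.
move=> hi; rewrite (bigD1 (Ordinal hi))//= /deltaf eqxx mul1r big1 ?addr0// => a ha.
have -> : (i == a) = false by apply: contraNF ha => /eqP e; apply/eqP/val_inj.
by rewrite mul0r.
Qed.

(* entries of U diag(A, B) U^T for U = [[1, X], [Y, 1]] *)
Let U k (X Y : nat -> nat -> F) : nat -> nat -> F := fun i a =>
  if (i < k.*2)%N then (if (a < k.*2)%N then deltaf i a else X i (a - k.*2)%N)
  else (if (a < k.*2)%N then Y (i - k.*2)%N a else deltaf i a).

Lemma det_unitriangular n (T : nat -> nat -> F) :
  (forall i j, (i < j)%N -> (j < n)%N -> T i j = 0) -> (forall i, (i < n)%N -> T i i = 1) ->
  \det (\matrix_(i < n, j < n) T i j) = 1.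
Proof.
move=> h0 h1; rewrite det_trig; last first.
  by apply/is_trig_mxP => i j ij; rewrite mxE h0.
by apply: big1 => i _; rewrite mxE h1.
Qed.

(** Here [M] is the inverse of [A]. Congruence by the unitriangular matrix [[1, 0], [Y, 1]] with Y =
    - V^T M carries the block-diagonal matrix of [A] and the Schur complement [S] to the given one,
    and has determinant 1. *)
Lemma pfn_schur_l k m A B M V : antisym A -> antisym B -> antisym M ->
  (forall i j, (i < k.*2)%N -> (j < k.*2)%N -> \sum_(c < k.*2) M i c * A c j = deltaf i j) ->
  pfn (k + m) (blockf k A V B) =
  pfn k A * pfn m (fun i j => B i j + \sum_(a < k.*2) \sum_(b < k.*2) V a i * M a b * V b j).
Proof.
move=> hA hB hM hMA; set S := fun i j : nat => _ + _.
have hS : antisym S.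
  move=> i j; rewrite /S opprD hB; congr (_ + _); rewrite exchange_big -sumrN.
  apply: eq_bigr => a _; rewrite -sumrN; apply: eq_bigr => b _; rewrite (hM b); ring.
rewrite -pfn_block//.
pose Y i a := - \sum_(c < k.*2) V c i * M c a.
have hAM i j : (i < k.*2)%N -> (j < k.*2)%N -> \sum_(c < k.*2) A i c * M c j = deltaf i j.
  move=> hi hj; rewrite /deltaf eq_sym -[RHS](hMA j i)//; apply: eq_bigr => c _.
  by rewrite hA hM; ring.
have hYA i j : (j < k.*2)%N -> \sum_(a < k.*2) Y i a * A a j = - V j i.
  move=> hj; rewrite -(sum_delta (fun c => V c i) hj).
  under eq_bigr => a _ do rewrite /Y mulNr mulr_suml.
  rewrite sumrN exchange_big; congr (- _); apply: eq_bigr => c _.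
  rewrite /deltaf eq_sym -[(_ == _)%:R](hMA c j)// mulr_suml.
  by apply: eq_bigr => a _; ring.
have -> : pfn (k + m) (blockf k A V B) = pfn (k + m) (fun i j =>
    \sum_(a < (k + m).*2) \sum_(b < (k + m).*2)
      U k (fun _ _ => 0) Y i a * blockf k A (fun _ _ => 0) S a b * U k (fun _ _ => 0) Y j b).
  apply: eq_pfn => i j hi hj.
  rewrite (sum_double_add2 k m (fun a b => U k (fun _ _ => 0) Y i a * blockf k A (fun _ _ => 0) S a b * U k (fun _ _ => 0) Y j b)).
  have hlt (c : 'I_m.*2) : (k.*2 + c < k.*2)%N = false by rewrite ltnNge leq_addr.
  rewrite [X in _ = _ + X + _](_ : _ = 0) ?addr0; last first.
    by apply: big1 => a _; apply: big1 => b _; rewrite /blockf ltn_ord hlt oppr0 mulr0 mul0r.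
  rewrite [X in _ = _ + X + _](_ : _ = 0) ?addr0; last first.
    by apply: big1 => a _; apply: big1 => b _; rewrite /blockf ltn_ord hlt mulr0 mul0r.
  rewrite [X in _ = X + _](_ : _ = \sum_(a < k.*2) \sum_(b < k.*2) U k (fun _ _ => 0) Y i a * A a b * U k (fun _ _ => 0) Y j b); last first.
    by apply: eq_bigr => a _; apply: eq_bigr => b _; rewrite /blockf !ltn_ord.
  rewrite [X in _ = _ + X](_ : _ = \sum_(a < m.*2) \sum_(b < m.*2) U k (fun _ _ => 0) Y i (k.*2 + a)%N * S a b * U k (fun _ _ => 0) Y j (k.*2 + b)%N); last first.
    by apply: eq_bigr => a _; apply: eq_bigr => b _; rewrite /blockf !hlt !addKn.
  have hU0 (a : 'I_m.*2) l : (l < k.*2)%N -> U k (fun _ _ => 0) Y l (k.*2 + a)%N = 0.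
    by move=> hl; rewrite /U hl hlt.
  have hU1 (a : 'I_m.*2) l : (l < k.*2)%N = false -> U k (fun _ _ => 0) Y l (k.*2 + a)%N = deltaf (l - k.*2)%N a.
    move=> hl; rewrite /U hl hlt /deltaf; congr (_%:R); move/negbT: hl; rewrite -leqNgt => hl.
    by rewrite -{1}(subnKC hl) eqn_add2l.
  rewrite {1}/blockf; case: ifP => hik; case: ifP => hjk.
  - rewrite [X in _ = _ + X]big1 ?addr0 => [|a _]; last first.
      by apply: big1 => b _; rewrite hU0// !mul0r.
    under eq_bigr => a _ do under eq_bigr => b _ do rewrite /U hik hjk !ltn_ord -mulrA.
    under eq_bigr => a _ do rewrite -mulr_sumr.
    rewrite (sum_delta (fun a => \sum_(b < k.*2) A a b * deltaf j b))//.
    by rewrite (eq_bigr (fun b : 'I_ _ => deltaf j b * A i b)) ?sum_delta// => b _; rewrite mulrC.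
  - rewrite [X in _ = _ + X]big1 ?addr0 => [|a _]; last first.
      by apply: big1 => b _; rewrite hU0// !mul0r.
    under eq_bigr => a _ do under eq_bigr => b _ do rewrite /U hik hjk !ltn_ord -mulrA.
    under eq_bigr => a _ do rewrite -mulr_sumr.
    rewrite (sum_delta (fun a => \sum_(b < k.*2) A a b * Y (j - k.*2)%N b))//.
    rewrite -[LHS]opprK -(hYA (j - k.*2)%N i)// -sumrN; apply: eq_bigr => b _.
    by rewrite hA; ring.
  - rewrite [X in _ = _ + X]big1 ?addr0 => [|a _]; last first.
      by apply: big1 => b _; rewrite (hU0 b j)// !mulr0.
    under eq_bigr => a _ do under eq_bigr => b _ do rewrite /U hik hjk !ltn_ord mulrC.
    under eq_bigr => a _ do rewrite (sum_delta (fun b => Y (i - k.*2)%N a * A a b))//.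
    by rewrite hYA.
  - have him : (i - k.*2 < m.*2)%N by rewrite ltn_subLR -?doubleD// leqNgt hik.
    have hjm : (j - k.*2 < m.*2)%N by rewrite ltn_subLR -?doubleD// leqNgt hjk.
    under [X in _ = _ + X]eq_bigr => a _ do under eq_bigr => b _ do rewrite (hU1 b j)// (hU1 a i)// -mulrA.
    under [X in _ = _ + X]eq_bigr => a _ do rewrite -mulr_sumr.
    rewrite (sum_delta (fun a => \sum_(b < m.*2) S a b * deltaf (j - k.*2)%N b))//.
    rewrite [X in _ = _ + X](eq_bigr (fun b : 'I_ _ => deltaf (j - k.*2)%N b * S (i - k.*2)%N b)); last by move=> b _; rewrite mulrC.
    rewrite sum_delta//.
    under eq_bigr => a _ do under eq_bigr => b _ do rewrite /U hik hjk !ltn_ord.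
    rewrite exchange_big /=.
    under eq_bigr => b _ do rewrite -mulr_suml hYA//.
    rewrite /S addrCA -[LHS]addr0; congr (_ + _); rewrite -big_split big1//= => b _.
    rewrite /Y mulrNN mulr_sumr -big_split big1//= => c _; rewrite (hM c b); ring.
rewrite pfn_congr det_unitriangular ?mul1r//.
  move=> i j ij hj; rewrite /U; case: ltnP => hi; case: ltnP => hj' //.
  - by rewrite /deltaf (ltn_eqF ij).
  - by have := leq_ltn_trans hi (ltn_trans ij hj'); rewrite ltnn.
  - by rewrite /deltaf (ltn_eqF ij).
by move=> i hi; rewrite /U; case: ltnP => _; rewrite /deltaf eqxx.
Qed.

End PfaffianSchurComplement.

(** * Permutation, scaling, elimination of a pair, rank-two perturbations *)

Section PfaffianConsequences.
Variable F : numFieldType.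
Implicit Types (A B M V : nat -> nat -> F) (k m : nat).

Lemma pfn_perm k A (s : 'S_(k.*2)) (sg : nat -> nat) : (forall i : 'I_(k.*2), sg i = s i) ->
  pfn k (fun i j => A (sg i) (sg j)) = (-1) ^+ s * pfn k A.
Proof.
move=> hs; have := pfn_congr k (fun i a => deltaf F (sg i) a) A.
have -> : (\matrix_(i < k.*2, j < k.*2) deltaf F (sg i) j) = perm_mx s.
  by apply/matrixP => i j; rewrite !mxE /deltaf hs.
rewrite det_perm => <-; apply: eq_pfn => i j hi hj.
under eq_bigr => a _ do under eq_bigr => b _ do rewrite mulrC.
have hsg l : (l < k.*2)%N -> (sg l < k.*2)%N by move=> hl; rewrite (hs (Ordinal hl)) ltn_ord.
under eq_bigr => a _ do rewrite (sum_delta (fun b => deltaf F (sg i) a * A a b)) ?hsg//.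
by rewrite (sum_delta (fun a => A a (sg j))) ?hsg.
Qed.

Lemma pfn_scale k A (c : nat -> F) :
  pfn k (fun i j => c i * A i j * c j) = (\prod_(i < k.*2) c i) * pfn k A.
Proof.
have := pfn_congr k (fun i a => c i * deltaf F i a) A.
have -> : (\matrix_(i < k.*2, j < k.*2) (c i * deltaf F i j)) = diag_mx (\row_j c j).
  apply/matrixP => i j; rewrite !mxE /deltaf; case: (eqVneq i j) => [->|h]; first by rewrite eqxx mulr1.
  by rewrite mulr0n -val_eqE /= in h *; rewrite (negbTE h) mulr0.
rewrite det_diag; under eq_bigr => i _ do rewrite mxE.
move=> <-; apply: eq_pfn => i j hi hj.
under eq_bigr => a _ do under eq_bigr => b _ do
  rewrite -[_ * (c j * _)]mulrA [A _ _ * _]mulrCA [A _ _ * _]mulrC (mulrCA _ (c j)) -mulrA.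
under eq_bigr => a _ do rewrite -!mulr_sumr (sum_delta (A a))//.
by rewrite -!mulr_sumr (sum_delta (fun a => A a j))// mulrC mulrA.
Qed.

(** Rotation by [2k] is the square of rotation by [k], hence an even permutation. *)
Lemma pfn_rot2 k m A : pfn (k + m) (fun i j => A ((i + k.*2) %% (k + m).*2)%N ((j + k.*2) %% (k + m).*2)%N) = pfn (k + m) A.
Proof.
set n := (k + m).*2.
have [n0|n0] := posnP n; first by apply: eq_pfn => i j; rewrite -/n n0.
pose rf (i : 'I_n) : 'I_n := Ordinal (ltn_pmod (i + k) n0).
have rf_inj : injective rf.
  move=> i j /(congr1 val)/= /eqP; rewrite eqn_modDr !modn_small// => /eqP h; exact: val_inj.
rewrite (@pfn_perm _ A (perm rf_inj * perm rf_inj)%g (fun i => ((i + k.*2) %% n)%N)).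
  by rewrite odd_permM addbb mul1r.
by move=> i; rewrite permM !permE /= modnDml -addnA addnn.
Qed.

Lemma pfn_block_swap k m A V B :
  pfn (k + m) (blockf k A V B) = pfn (m + k) (blockf m B (fun i j => - V j i) A).
Proof.
rewrite -pfn_rot2 [(m + k)%N]addnC; apply: eq_pfn => i j; rewrite doubleD => hi hj.
have hlo l : (l < m.*2)%N -> ((l + k.*2) %% (k.*2 + m.*2) = k.*2 + l)%N.
  by move=> hl; rewrite addnC modn_small// ltn_add2l.
have hhi l : (m.*2 <= l)%N -> (l < k.*2 + m.*2)%N -> ((l + k.*2) %% (k.*2 + m.*2) = l - m.*2)%N.
  move=> h1 h2; rewrite -{1}(subnK h1) -addnA [(m.*2 + _)%N]addnC modnDr modn_small//; lia.
have hb l : (k.*2 + l < k.*2)%N = false by rewrite ltnNge leq_addr.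
have hc l : (m.*2 <= l)%N -> (l < k.*2 + m.*2)%N -> (l - m.*2 < k.*2)%N by lia.
rewrite /blockf; case: (ltnP i m.*2) => h1; case: (ltnP j m.*2) => h2.
- by rewrite !hlo// !hb !addKn.
- by rewrite (hlo i)// (hhi j)// hb hc// addKn.
- by rewrite (hlo j)// (hhi i)// hb hc// addKn opprK.
- by rewrite !hhi// !hc.
Qed.

Lemma pfn_schur_r k m A B M V : antisym A -> antisym B -> antisym M ->
  (forall i j, (i < m.*2)%N -> (j < m.*2)%N -> \sum_(c < m.*2) M i c * B c j = deltaf F i j) ->
  pfn (k + m) (blockf k A V B) =
  pfn m B * pfn k (fun i j => A i j + \sum_(a < m.*2) \sum_(b < m.*2) V i a * M a b * V j b).
Proof.
move=> hA hB hM hMB; rewrite pfn_block_swap (pfn_schur_l _ _ hB hA hM hMB)//; congr (_ * _).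
apply: eq_pfn => i j _ _; congr (_ + _); apply: eq_bigr => a _; apply: eq_bigr => b _; ring.
Qed.

Lemma pfn1 A : antisym A -> pfn 1 A = A 0%N 1%N.
Proof. by move=> hA; rewrite pfn_expand// big_ord1 expr0 pfn0; ring. Qed.

Definition shift2 A := fun i j : nat => A i.+2 j.+2.

(** Schur complement of the leading 2 x 2 block, that is, Gaussian elimination of the indices 0 and
    1; [M] is the explicit inverse of this block. *)
Lemma pfn_reduce m A : antisym A -> A 0%N 1%N != 0 ->
  pfn m.+1 A = A 0%N 1%N *
   pfn m (fun i j => A i.+2 j.+2 - (A 0%N i.+2 * A 1%N j.+2 - A 0%N j.+2 * A 1%N i.+2) / A 0%N 1%N).
Proof.
move=> hA h0; have A00 i : A i i = 0.
  by apply/eqP; have := hA i i => /eqP; rewrite -subr_eq0 opprK -mulr2n mulrn_eq0.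
have e10 : A 1%N 0%N = - A 0%N 1%N by rewrite hA.
pose M (i j : nat) : F := if i == 0%N then (if j == 1%N then - (A 0%N 1%N)^-1 else 0)
  else if (i == 1%N) && (j == 0%N) then (A 0%N 1%N)^-1 else 0.
have hM : antisym M by move=> [|[|i]] [|[|j]]; rewrite /M /= ?oppr0 ?opprK.
have -> : pfn m.+1 A = pfn (1 + m) (blockf 1 A (fun i j => A i j.+2) (shift2 A)).
  rewrite add1n; apply: eq_pfn => i j _ _; rewrite /blockf /shift2.
  case: i => [|[|i]]; case: j => [|[|j]] //=; rewrite ?subn2 /= -?hA//.
rewrite (@pfn_schur_l _ _ _ _ _ M)//; last 2 first.
- by move=> i j; exact: hA.
- move=> [|[|i]] [|[|j]] //= _ _; rewrite !big_ord_recl big_ord0 /M /deltaf /= ?A00 ?e10; field => //.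
rewrite pfn1//; congr (_ * _); apply: eq_pfn => i j _ _.
rewrite /shift2; congr (_ + _); rewrite !big_ord_recl !big_ord0 /M /=; field => //.
Qed.

(** The perturbed matrix is the Schur complement of a 2 x 2 block bordering [B] by the rows [al * p]
    and [q]. Only row and column 0 of the bordered matrix contain [al], so that expansion along row
    0 is affine in [al]. *)
Lemma pfn_rank2_affine m B (p q : nat -> F) : antisym B ->
  exists c0 c1, forall al, pfn m (fun i j => B i j + al * (p i * q j - q i * p j)) = c0 + al * c1.
Proof.
move=> hB; pose J (i j : nat) : F := if i == 0%N then (if j == 1%N then - 1 else 0)
  else if (i == 1%N) && (j == 0%N) then 1 else 0.
pose M i j := - J i j.
have hJ : antisym J by move=> [|[|i]] [|[|j]]; rewrite /J /= ?oppr0 ?opprK.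
have hM : antisym M by move=> i j; rewrite /M hJ.
pose V al (i j : nat) := if i == 0%N then al * p j else q j.
pose X al := blockf 1 J (V al) B.
exists (pfn m (pfminor 0 (X 0))).
exists (- \sum_(j < m.*2) (-1) ^+ j.+1 * p j * pfn m (pfminor j.+1 (X 0))) => al.
have := @pfn_schur_l _ 1 m J B M (V al) hJ hB hM.
rewrite (pfn1 hJ) => H.
transitivity (- pfn (1 + m) (X al)).
  rewrite H; last first.
    move=> [|[|i]] [|[|j]] //= _ _; rewrite !big_ord_recl big_ord0 /M /J /deltaf /=; ring.
  rewrite /J /= mulN1r opprK; apply: eq_pfn => i j _ _; congr (_ + _).
  rewrite !big_ord_recl !big_ord0 /M /J /V /=; ring.
have hX : antisym (X al) by apply: antisym_blockf.
rewrite add1n pfn_expand// big_ord_recl /X {1}/blockf {1}/J /= expr0 mul1r mulN1r opprD opprK.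
have hm l : pfn m (pfminor l (blockf 1 J (V al) B)) = pfn m (pfminor l (blockf 1 J (V 0) B)).
  apply: eq_pfn => i j _ _; rewrite /pfminor /blockf; do 2 case: ifP => //; by rewrite /V.
rewrite hm mulrN; congr (_ - _); rewrite mulr_sumr; apply: eq_bigr => j _.
by rewrite hm /blockf /V /= subn2 /=; ring.
Qed.

(** Congruence by the unitriangular matrix that adds multiples of row and column 0 to the others;
    [g] is indexed from the first row after 0, hence the [i.-1]. *)
Lemma pfn_add_row0 k A (g : nat -> F) : A 0%N 0%N = 0 ->
  pfn k.+1 (fun i j => A i j + g i.-1 * (0 < i)%N%:R * A 0%N j + A i 0%N * (g j.-1 * (0 < j)%N%:R)) = pfn k.+1 A.
Proof.
move=> A00; pose h i := g i.-1 * (0 < i)%N%:R.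
have := pfn_congr k.+1 (fun i a => deltaf F i a + h i * deltaf F 0 a) A.
rewrite (@det_unitriangular F _ (fun i a => deltaf F i a + h i * deltaf F 0 a)) ?mul1r => [<-|i j ij _|i _]; last 2 first.
- by rewrite /deltaf (ltn_eqF ij) [0%N == _]ltn_eqF ?mulr0 ?addr0// (leq_ltn_trans _ ij).
- by rewrite /deltaf eqxx /h; case: i => [|i]; rewrite ?mulr0 ?mul0r ?mulr0 addr0.
apply: eq_pfn => i j hi hj; rewrite -!/(h _).
have hs l (G : nat -> F) : (l < k.+1.*2)%N ->
    \sum_(a < k.+1.*2) (deltaf F l a + h l * deltaf F 0 a) * G a = G l + h l * G 0%N.
  move=> hl; under eq_bigr => a _ do rewrite mulrDl -mulrA.
  by rewrite big_split/= -mulr_sumr (sum_delta G hl) (sum_delta G).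
under eq_bigr => a _ do under eq_bigr => b _ do rewrite mulrC.
under eq_bigr => a _ do rewrite (hs j (fun b => (deltaf F i a + h i * deltaf F 0 a) * A a b))// mulrCA -mulrDr.
rewrite (hs i (fun a => A a j + h j * A a 0%N))// A00; ring.
Qed.

End PfaffianConsequences.

(** * Pfaffians indexed by lists of points *)

Section ListPfaffian.
Variables (F : numFieldType) (T : Type) (x0 : T) (K : T -> T -> F).
Hypothesis Kanti : forall x y, K x y = - K y x.
Implicit Types (s : seq T).

Definition pfl s : F := pfn (size s)./2 (fun i j => K (nth x0 s i) (nth x0 s j)).

Lemma pfl_antisym s : antisym (fun i j => K (nth x0 s i) (nth x0 s j)).
Proof. by move=> i j. Qed.

Definition del j s := take j s ++ drop j.+1 s.

Lemma nth_del j s i : (j < size s)%N -> nth x0 (del j s) i = nth x0 s (bump j i).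
Proof.
move=> hj; rewrite /del nth_cat size_take hj /bump; case: ltnP => hi.
  by rewrite nth_take.
by rewrite nth_drop addSn subnKC.
Qed.

Lemma size_del j s : (j < size s)%N -> size (del j s) = (size s).-1.
Proof. by move=> hj; rewrite size_cat size_take size_drop hj; lia. Qed.

Lemma pfl_expand x s : odd (size s) ->
  pfl (x :: s) = \sum_(j < size s) (-1) ^+ j * K x (nth x0 s j) * pfl (del j s).
Proof.
move=> ho; have hs : size s = ((size s)./2).*2.+1 by rewrite -[LHS]odd_double_half ho.
rewrite /pfl /= uphalfE; have -> : ((size s).+1./2 = (size s)./2.+1)%N by rewrite hs; lia.
rewrite pfn_expand; last exact: (pfl_antisym (x :: s)).
suff key n : n = size s -> \sum_(j < n) (-1) ^+ j * K x (nth x0 s j) *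
    pfn (size s)./2 (pfminor j (fun i j0 => K (nth x0 (x :: s) i) (nth x0 (x :: s) j0))) =
    \sum_(j < size s) (-1) ^+ j * K x (nth x0 s j) * pfl (del j s) by exact: key (esym hs).
move=> ->; apply: eq_bigr => j _; congr (_ * _).
rewrite /pfl size_del//; have -> : ((size s).-1./2 = (size s)./2)%N by rewrite hs; lia.
by apply: eq_pfn => p q _ _; rewrite /pfminor /= !nth_del.
Qed.

Lemma pfl_swap s1 s2 x y : ~~ odd (size (s1 ++ x :: y :: s2)) ->
  pfl (s1 ++ x :: y :: s2) = - pfl (s1 ++ y :: x :: s2).
Proof.
set s := _ ++ _ => ho; rewrite /pfl.
have hs : size (s1 ++ y :: x :: s2) = size s by rewrite !size_cat.
rewrite hs; set k := (size s)./2.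
have hk : (k.*2 = size s)%N by rewrite -[RHS]odd_double_half (negbTE ho).
have h1 : (size s1 < k.*2)%N by rewrite hk size_cat /=; lia.
have h2 : ((size s1).+1 < k.*2)%N by rewrite hk size_cat /=; lia.
pose sg i := if i == size s1 then (size s1).+1 else if i == (size s1).+1 then size s1 else i.
rewrite -[RHS]mulN1r; pose tp := tperm (Ordinal h1) (Ordinal h2).
have -> : (-1 : F) = (-1) ^+ tp by rewrite odd_tperm -val_eqE /= neq_ltn ltnSn expr1.
rewrite -(@pfn_perm _ k (fun i j => K (nth x0 (s1 ++ y :: x :: s2) i) (nth x0 (s1 ++ y :: x :: s2) j)) tp sg); last first.
  move=> i; rewrite /sg /tp; case: tpermP => [->|->|/eqP n1 /eqP n2] /=; rewrite ?eqxx//.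
    by rewrite (gtn_eqF (ltnSn _)).
  by rewrite -!val_eqE /= in n1 n2; rewrite (negbTE n1) (negbTE n2).
apply: eq_pfn => i j hi hj.
have hn l : nth x0 s l = nth x0 (s1 ++ y :: x :: s2) (sg l).
  rewrite /s !nth_cat /sg; case: (ltngtP l (size s1)) => hl.
  - by rewrite (ltn_eqF (ltn_trans hl (ltnSn _))) hl.
  - case: eqP => [->|/eqP hne]; first by rewrite ltnn subnn subSnn.
    rewrite ltnNge (ltnW hl) /=; have : (1 < l - size s1)%N by lia.
    by case: (l - size s1)%N => [|[|d]].
  - by rewrite hl ltnNge leqnSn /= subnn subSnn.
by rewrite !hn.
Qed.

Lemma pfl_to_front s1 x s2 : ~~ odd (size (s1 ++ x :: s2)) ->
  pfl (s1 ++ x :: s2) = (-1) ^+ size s1 * pfl (x :: s1 ++ s2).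
Proof.
elim/last_ind: s1 s2 => [|s1 y IH] s2; first by rewrite mul1r.
rewrite !cat_rcons => ho; rewrite pfl_swap// IH; last first.
  by move: ho; rewrite !size_cat /= !addnS.
by rewrite size_rcons exprS mulN1r mulNr.
Qed.

Lemma pfl_adjacent_eq s1 s2 x : ~~ odd (size s2) -> ~~ odd (size s1) -> pfl (s1 ++ x :: x :: s2) = 0.
Proof.
move=> h2 h1; have ho : ~~ odd (size (s1 ++ [:: x, x & s2])).
  by rewrite size_cat /= oddD /= negbK (negbTE h1) (negbTE h2).
apply/eqP; move/eqP: (pfl_swap ho).
by rewrite -subr_eq0 opprK -mulr2n mulrn_eq0.
Qed.

End ListPfaffian.

(** Reduces a symmetry in a list of variables to adjacent transpositions, for which [pfl_swap] and
    its analogues apply. *)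
Lemma perm_invariant (T : eqType) (U : Type) (f : seq T -> U) :
  (forall s1 s2 x y, f (s1 ++ x :: y :: s2) = f (s1 ++ y :: x :: s2)) ->
  forall s s', perm_eq s s' -> f s = f s'.
Proof.
move=> hsw; have mv x p s1 s2 : f (p ++ s1 ++ x :: s2) = f (p ++ x :: s1 ++ s2).
  elim: s1 p => [//|y s1 IH] p /=.
  by have := IH (rcons p y); rewrite !cat_rcons => ->; rewrite hsw.
suff H s : forall p s', perm_eq s s' -> f (p ++ s) = f (p ++ s') by move=> s s' /(H s [::]).
elim: s => [|x s IH] p s' hp.
  by move: hp; rewrite perm_sym => /perm_nilP ->.
have hx : x \in s' by rewrite -(perm_mem hp) mem_head.
case/splitPr: hx hp => a b; rewrite perm_sym perm_catC /= perm_cons perm_catC perm_sym => hp.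
by rewrite mv -!(cat_rcons x p); apply: IH.
Qed.
(** * The refined Littlewood identity *)

Section PolyFunctions.
Variable R : fieldType.
Implicit Types (f g : R -> R) (d e : nat).

(** The expressions in [z] met below are built from Pfaffians and products over lists; it is enough
    to know that they agree pointwise with some polynomial and to keep track of a degree bound. *)
Definition polyfun d f := exists2 p : {poly R}, (size p <= d.+1)%N & forall z, f z = p.[z].

Lemma polyfun_ext d f g : f =1 g -> polyfun d g -> polyfun d f.
Proof. by move=> h [p hp e]; exists p => // z; rewrite h e. Qed.

Lemma polyfun_le d e f : (d <= e)%N -> polyfun d f -> polyfun e f.
Proof. by move=> h [p hp ef]; exists p => //; apply: leq_trans hp _. Qed.

Lemma polyfun_const c : polyfun 0 (fun=> c).
Proof. by exists c%:P => [|z]; rewrite ?hornerC ?size_polyC_leq1. Qed.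

Lemma polyfun_affine a b : polyfun 1 (fun z => a * z + b).
Proof.
exists (a *: 'X + b%:P) => [|z]; last by rewrite hornerD hornerZ hornerX hornerC.
rewrite (leq_trans (size_polyD _ _))// geq_max (leq_trans (size_scale_leq _ _)) ?size_polyX//=.
by rewrite (leq_trans (size_polyC_leq1 _)).
Qed.

Lemma polyfunD d f g : polyfun d f -> polyfun d g -> polyfun d (fun z => f z + g z).
Proof.
move=> [p hp ef] [q hq eg]; exists (p + q) => [|z]; last by rewrite ef eg hornerD.
by rewrite (leq_trans (size_polyD _ _))// geq_max hp.
Qed.

Lemma polyfunM d e f g : polyfun d f -> polyfun e g -> polyfun (d + e) (fun z => f z * g z).
Proof.
move=> [p hp ef] [q hq eg]; exists (p * q) => [|z]; last by rewrite ef eg hornerM.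
by rewrite (leq_trans (size_polyMleq _ _))//; lia.
Qed.

Lemma polyfunZ d c f : polyfun d f -> polyfun d (fun z => c * f z).
Proof. by move=> h; have := polyfunM (polyfun_const c) h. Qed.

Lemma polyfun_sum (I : Type) (r : seq I) d (f : I -> R -> R) :
  (forall i, polyfun d (f i)) -> polyfun d (fun z => \sum_(i <- r) f i z).
Proof.
move=> h; elim: r => [|i r IH].
  by apply: (polyfun_le (leq0n d)); apply: polyfun_ext (polyfun_const 0) => z; rewrite big_nil.
by apply: polyfun_ext (polyfunD (h i) IH) => z; rewrite big_cons.
Qed.

Lemma polyfun_sum_seq (I : eqType) (r : seq I) d (f : I -> R -> R) :
  (forall i, i \in r -> polyfun d (f i)) -> polyfun d (fun z => \sum_(i <- r) f i z).
Proof.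
elim: r => [|i r IH] h.
  by apply: (polyfun_le (leq0n d)); apply: polyfun_ext (polyfun_const 0) => z; rewrite big_nil.
have h1 := h i (mem_head _ _); have h2 := IH (fun j hj => h j (mem_behead (s := i :: r) hj)).
by apply: polyfun_ext (polyfunD h1 h2) => z; rewrite big_cons.
Qed.

Lemma polyfun_prod (I : Type) (r : seq I) d (f : I -> R -> R) :
  (forall i, polyfun d (f i)) -> polyfun (d * size r) (fun z => \prod_(i <- r) f i z).
Proof.
move=> h; elim: r => [|i r IH].
  by rewrite muln0; apply: polyfun_ext (polyfun_const 1) => z; rewrite big_nil.
by rewrite mulnS; apply: polyfun_ext (polyfunM (h i) IH) => z; rewrite big_cons.
Qed.

Lemma polyfun_eq0 d f (rs : seq R) : polyfun d f -> uniq rs -> (d < size rs)%N ->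
  {in rs, forall z, f z = 0} -> f =1 fun=> 0.
Proof.
move=> [p hp ef] u hs h0 z; rewrite ef.
have [->|p0] := eqVneq p 0; first by rewrite horner0.
have ar : all (root p) rs by apply/allP => y hy; rewrite rootE -ef h0.
by have := leq_trans (max_poly_roots p0 ar u) hp; rewrite ltnS leqNgt hs.
Qed.

End PolyFunctions.

(** With parameters in (0, 1), negative [z] avoids every zero of [z - y], [1 - z * y] and
    [1 - t * z * y], so that rational identities can be used there and then extended. *)
Lemma polyfun_eq_neg (R : realFieldType) d (f g : R -> R) : polyfun d f -> polyfun d g ->
  (forall z, z < 0 -> f z = g z) -> f =1 g.
Proof.
move=> hf hg h z; apply/eqP; rewrite -subr_eq0; apply/eqP.
pose rs := [seq - (i.+1%:R) : R | i <- iota 0 d.+1].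
apply: (@polyfun_eq0 R d (fun z => f z - g z) rs).
- by apply: polyfun_ext (polyfunD hf (polyfunZ (-1) hg)) => y; rewrite mulN1r.
- rewrite map_inj_uniq ?iota_uniq// => i j /oppr_inj/eqP; rewrite eqr_nat => /eqP [] //.
- by rewrite size_map size_iota.
- by move=> _ /mapP[i _ ->]; rewrite h ?subrr// oppr_lt0 ltr0n.
Qed.

(** * Splittings of a list into two complementary sublists *)

Section Splits.
Variable T : Type.
Implicit Types s : seq T.

(** Both components keep the order of [s], and each choice of positions occurs once: sums over
    splittings stand for sums over subsets of the parameters. *)
Fixpoint splits s : seq (seq T * seq T) :=
  if s is x :: s' then
    [seq (x :: p.1, p.2) | p <- splits s'] ++ [seq (p.1, x :: p.2) | p <- splits s']
  else [:: ([::], [::])].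

Lemma sum_splits_cons (R : nmodType) (G : seq T -> seq T -> R) x s :
  \sum_(p <- splits (x :: s)) G p.1 p.2 =
  \sum_(p <- splits s) (G (x :: p.1) p.2 + G p.1 (x :: p.2)).
Proof. by rewrite big_cat !big_map big_split. Qed.

Lemma sum_splits_nil (R : nmodType) (G : seq T -> seq T -> R) :
  \sum_(p <- splits [::]) G p.1 p.2 = G [::] [::].
Proof. by rewrite big_seq1. Qed.

Lemma sum_splits_swap (R : nmodType) (G : seq T -> seq T -> R) :
  (forall s1 s2 x y K, G (s1 ++ x :: y :: s2) K = G (s1 ++ y :: x :: s2) K) ->
  (forall s1 s2 x y I, G I (s1 ++ x :: y :: s2) = G I (s1 ++ y :: x :: s2)) ->
  forall s1 s2 x y, \sum_(p <- splits (s1 ++ x :: y :: s2)) G p.1 p.2 =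
    \sum_(p <- splits (s1 ++ y :: x :: s2)) G p.1 p.2.
Proof.
move=> h1 h2 s1 s2 x y; elim: s1 G h1 h2 => [|z s1 IH] G h1 h2.
  rewrite !cat0s !(sum_splits_cons G) (sum_splits_cons (fun I K => G (x :: I) K + G I (x :: K)))
    (sum_splits_cons (fun I K => G (y :: I) K + G I (y :: K))).
  apply: eq_bigr => p _; rewrite (h1 [::]) (h2 [::]) -!addrA; congr (_ + _).
  by rewrite !addrA; congr (_ + _); rewrite addrC.
rewrite !cat_cons !(sum_splits_cons G); apply: (IH (fun I K => G (z :: I) K + G I (z :: K))) => *.
  by rewrite h1 (h1 (z :: _)).
by rewrite h2 (h2 (z :: _)).
Qed.

End Splits.

Lemma splits_perm (T : eqType) (s : seq T) p : p \in splits s -> perm_eq (p.1 ++ p.2) s.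
Proof.
elim: s p => [|x s IH] p /=; first by rewrite inE => /eqP ->.
rewrite mem_cat => /orP[] /mapP[q /IH hq ->] /=; first by rewrite perm_cons.
by rewrite perm_catC /= perm_cons perm_catC.
Qed.

Lemma perm_swap (T : eqType) (s1 s2 : seq T) x y :
  perm_eq (s1 ++ x :: y :: s2) (s1 ++ y :: x :: s2).
Proof. by rewrite perm_cat2l; apply/permPl/(perm_catCA [:: x] [:: y] s2). Qed.

(** * The column recursion satisfied by the normalized Pfaffian *)

Section RefinedLittlewood.
Variables (R : realFieldType) (t : R).
Hypothesis t01 : 0 < t < 1.
Implicit Types (u x y z : R) (s I K Y : seq R).

(** The point [None] is the usual border that gives a meaning to the Pfaffian of an odd number of
    points. The induction on the number of parameters passes through odd numbers. *)
Definition Bk u (o o' : option R) : R :=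
  match o, o' with
  | Some x, Some y => (x - y) * ((1 - x * y)^-1 - u * (1 - t * x * y)^-1)
  | Some _, None => 1 | None, Some _ => -1 | None, None => 0
  end.

Lemma Bk_anti u o o' : Bk u o o' = - Bk u o' o.
Proof.
case: o => [x|]; case: o' => [y|]; rewrite /= ?opprK ?oppr0//.
by rewrite -[t * y * x]mulrA [y * x]mulrC mulrA -[RHS]mulNr opprB.
Qed.

(* an unpaired point is paired with the extra point None *)
Definition pad s : seq (option R) := map Some s ++ (if odd (size s) then [:: None] else [::]).
Definition opad s : seq (option R) := map Some s ++ (if odd (size s) then [::] else [:: None]).

Lemma pad_cons x s : pad (x :: s) = Some x :: opad s.
Proof. by rewrite /pad /opad /=; case: odd. Qed.

Lemma odd_size_opad s : odd (size (opad s)).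
Proof. by rewrite size_cat size_map oddD; case: (odd (size s)). Qed.

Definition pfB u (l : seq (option R)) := pfl None (Bk u) l.

Fixpoint cprod s : R :=
  if s is x :: s' then (\prod_(y <- s') ((1 - t * x * y) / (x - y))) * cprod s' else 1.

(** The prefactor and the Pfaffian are both antisymmetric in the parameters, so [V] is symmetric. At
    [u = 0], for an even number of parameters, it is the Littlewood product that normalizes the
    measure. *)
Definition V u s := cprod s * pfB u (pad s).

Lemma cprod_swap s1 s2 x y : cprod (s1 ++ x :: y :: s2) = - cprod (s1 ++ y :: x :: s2).
Proof.
elim: s1 => [|z s1 IH] /=.
  rewrite !big_cons -[t * y * x]mulrA [y * x]mulrC mulrA -[y - x]opprB invrN; ring.
rewrite IH mulrN; congr (- (_ * _)); apply: perm_big.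
exact: perm_swap.
Qed.

Lemma V_swap u s1 s2 x y : V u (s1 ++ x :: y :: s2) = V u (s1 ++ y :: x :: s2).
Proof.
rewrite /V cprod_swap /pad !map_cat !size_cat /= -!catA /=.
rewrite [pfB _ _]pfl_swap ?mulrNN//.
rewrite !size_cat /= !size_cat !size_map !addnS /= negbK.
by rewrite addnA oddD; case: ifP => /=; rewrite negbK => ->.
Qed.

(** The product of the [1 - u t^j] over [j <= m - 2] with [j] of the parity of [m]; for even [m]
    this is the finite q-Pochhammer symbol (u; t^2) of length [m / 2]. It weighs the number [m] of
    zero parts. *)
Fixpoint hpoch (m : nat) u : R :=
  if m is m'.+1 then (if odd m' then 1 - u else 1) * hpoch m' (u * t) else 1.

Definition acr K I : R := \prod_(k <- K) \prod_(i <- I) ((k - t * i) / (k - i)).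

(** [I] holds the variables with exponent 0 and [K] those with positive exponent. Removing the first
    column of lambda takes one factor out of each [k] in [K]; the length of this column must be
    even. The variables whose exponent becomes 0 correspond to parts equal to 1, whose multiplicity
    is weighted at [t], hence [V t K]. *)
Definition stripterm u I K : R :=
  if odd (size K) then 0 else hpoch (size I) u * acr K I * (\prod_(k <- K) k) * V t K.

Definition strips u s : R := \sum_(p <- splits s) stripterm u p.1 p.2.

Lemma strips_swap u s1 s2 x y : strips u (s1 ++ x :: y :: s2) = strips u (s1 ++ y :: x :: s2).
Proof.
apply: sum_splits_swap => l1 l2 a b L; rewrite /stripterm.
  rewrite !size_cat /=; case: ifP => // _; congr (_ * _ * _ * _).
  by apply: eq_bigr => k _; apply: perm_big; exact: perm_swap.
rewrite !size_cat /=; case: ifP => // _; rewrite V_swap; congr (_ * _ * _ * _); rewrite /acr.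
  by apply: perm_big; exact: perm_swap.
by apply: perm_big; exact: perm_swap.
Qed.

Let q z y : R := (1 - z * y) * (1 - t * z * y).

(* prod_(y <- Y) q z y times the kernel entry (z, o), as a polynomial in z *)
Let kn u z (o : option R) Y : R :=
  if o is Some y then (z - y) * ((1 - u) - (t - u) * z * y) * \prod_(y' <- rem y Y) q z y'
  else \prod_(y <- Y) q z y.

(** Expansion of the Pfaffian along the row of [z] with its denominators cleared, so that [z] may
    also be a pole of the kernel. *)
Let FV u z Y : R :=
  \sum_(j < size (opad Y)) (-1) ^+ j * kn u z (nth None (opad Y) j) Y * pfB u (del j (opad Y)).

Lemma mem_opad Y y : (Some y \in opad Y) = (y \in Y).
Proof.
rewrite mem_cat mem_map; last by move=> ? ? [].
by case: ifP => _; rewrite ?in_nil ?inE ?orbF.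
Qed.

Lemma mem_pad Y y : (Some y \in pad Y) = (y \in Y).
Proof.
rewrite mem_cat mem_map; last by move=> ? ? [].
by case: ifP => _; rewrite ?in_nil ?inE ?orbF.
Qed.

Lemma opad_cons x s : opad (x :: s) = Some x :: pad s.
Proof. by rewrite /pad /opad /=; case: odd. Qed.

Lemma FV_pf u z Y : {in Y, forall y, q z y != 0} ->
  FV u z Y = (\prod_(y <- Y) q z y) * pfB u (Some z :: opad Y).
Proof.
move=> hq; rewrite /pfB (pfl_expand _ (@Bk_anti u)) ?odd_size_opad// mulr_sumr.
apply: eq_bigr => j _; rewrite [RHS]mulrA; congr (_ * _); rewrite [RHS]mulrCA; congr (_ * _).
case hj : (nth None (opad Y) j) => [y|] /=; last by rewrite mulr1.
have hy : y \in Y by rewrite -mem_opad -hj mem_nth.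
rewrite (perm_big _ (perm_to_rem hy)) big_cons /=.
have := hq y hy; rewrite mulf_eq0 negb_or => /andP[h1 h2].
by rewrite /q; field; rewrite h1 h2.
Qed.

Lemma polyfun_q y : polyfun 2 (fun z => q z y).
Proof.
have := polyfunM (polyfun_affine (- y) 1) (polyfun_affine (- (t * y)) 1).
by apply: polyfun_ext => z; rewrite /q; ring.
Qed.

Lemma polyfun_prodq Y : polyfun (2 * size Y) (fun z => \prod_(y <- Y) q z y).
Proof. by apply: polyfun_prod => y; exact: polyfun_q. Qed.

Lemma polyfun_FV u Y : polyfun (2 * size Y) (fun z => FV u z Y).
Proof.
apply: polyfun_sum => j.
suff h : polyfun (2 * size Y) (fun z => kn u z (nth None (opad Y) j) Y).
  have := polyfunZ ((-1) ^+ j * pfB u (del j (opad Y))) h.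
  by apply: polyfun_ext => z; ring.
case hj : (nth None (opad Y) j) => [y|] /=; last exact: polyfun_prodq.
have hy : y \in Y by rewrite -mem_opad -hj mem_nth.
have hs : (2 * size Y = 1 + 1 + 2 * size (rem y Y))%N.
  by rewrite (perm_size (perm_to_rem hy)) /= mulnS.
rewrite hs; apply: polyfunM (polyfun_prodq _).
apply: polyfunM.
  by apply: polyfun_ext (polyfun_affine 1 (- y)) => z; rewrite mul1r.
by apply: polyfun_ext (polyfun_affine (- ((t - u) * y)) (1 - u)) => z; ring.
Qed.

(** At [u = t] the factor [(1 - u) - (t - u) * z * y] loses its term in [z], and for odd [Y] there
    is no [None] entry, so the degree drops by one. This leaves room for the extra factor [z] in the
    odd terms of [FR]. *)
Lemma polyfun_FVt Y : odd (size Y) -> polyfun (2 * size Y).-1 (fun z => FV t z Y).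
Proof.
move=> ho; apply: polyfun_sum => j.
suff h : polyfun (2 * size Y).-1 (fun z => kn t z (nth None (opad Y) j) Y).
  have := polyfunZ ((-1) ^+ j * pfB t (del j (opad Y))) h.
  by apply: polyfun_ext => z; ring.
have hsz : size (opad Y) = size Y by rewrite size_cat size_map ho addn0.
have hnth : nth None (opad Y) j \in opad Y by rewrite mem_nth.
case hj : (nth None (opad Y) j) hnth => [y|] /=; last first.
  by rewrite /opad ho cats0 => /mapP[].
rewrite mem_opad => hy.
have hs : ((2 * size Y).-1 = 1 + 2 * size (rem y Y))%N.
  by rewrite (perm_size (perm_to_rem hy)) [size (_ :: _)]/=; move: (size _) => m; lia.
rewrite hs; apply: polyfunM (polyfun_prodq _).
by apply: polyfun_ext (polyfun_affine (1 - t) (- y * (1 - t))) => z; rewrite subrr; ring.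
Qed.

Let between0 y := 0 < y < 1.

Lemma one_sub_neq0 x y : between0 x -> between0 y -> 1 - x * y != 0.
Proof.
move=> /andP[x0 x1] /andP[y0 y1]; rewrite gt_eqF// subr_gt0 mulr_ilt1 ?ltW//.
Qed.

Lemma one_subt_neq0 x y : between0 x -> between0 y -> 1 - t * x * y != 0.
Proof.
move=> hx hy; have /andP[x0 x1] := hx; have /andP[t0 t1] := t01.
by apply: one_sub_neq0 hy; rewrite /between0 mulr_gt0//= mulr_ilt1 ?ltW.
Qed.

Lemma q_neq0 x y : between0 x -> between0 y -> q x y != 0.
Proof. by move=> hx hy; exact: mulf_neq0 (one_sub_neq0 hx hy) (one_subt_neq0 hx hy). Qed.

(** The kernel satisfies B_u(x, y) = x y B_(ut)(x, y) + (1 - u)(x - y). For odd [Y] the rank-two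
    remainder is removed by adding multiples of the row of the point 0; for even [Y], where [None]
    is present as well, it disappears when the pair formed by 0 and [None] is eliminated. *)
Lemma V0 u Y : {in Y, forall y, between0 y} ->
  cprod Y * pfB u (Some 0 :: opad Y) =
  (\prod_(y <- Y) - y) * ((if odd (size Y) then 1 - u else 1) * V (u * t) Y).
Proof.
move=> hY; rewrite /V [X in _ = _ * X]mulrCA [RHS]mulrCA; congr (_ * _).
have hin i : (i < size Y)%N -> between0 (nth 0 Y i) by move=> hi; apply: hY; rewrite mem_nth.
have hn0 i : (i < size Y)%N -> nth 0 Y i != 0 by move=> /hin /andP[h _]; rewrite gt_eqF.
have hB y y' : between0 y -> between0 y' ->
    Bk u (Some y) (Some y') = y * y' * Bk (u * t) (Some y) (Some y') + (1 - u) * (y - y').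
  move=> h h' /=; have ht := one_subt_neq0 h h'; have h1 := one_sub_neq0 h h'.
  have ht' : 1 - y * y' * t != 0 by rewrite -mulrA [y' * t]mulrC mulrA [y * t]mulrC.
  by field; rewrite ht h1.
rewrite /opad /pad; case ho : (odd (size Y)).
- rewrite cats0 /pfB [in RHS]pfl_to_front ?size_cat ?size_map /= ?addn1 /= ?ho//.
  rewrite cats0 -signr_odd ho expr1 mulN1r.
  have hs : size Y = ((size Y)./2).*2.+1 by rewrite -[LHS]odd_double_half ho.
  rewrite /pfl /= !size_map; set k := uphalf (size Y).
  have hk : k = (size Y)./2.+1 by rewrite /k uphalfE hs; lia.
  pose C i j := Bk (u * t) (nth None (None :: map Some Y) i) (nth None (None :: map Some Y) j).
  (* Up to the scaling [c], the row of the point 0 for [u] is the row of [None] for [u * t]. *)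
  pose c i := if i is i'.+1 then nth 0 Y i' else 1 - u.
  have hA : pfn k (fun i j => Bk u (nth None (Some 0 :: map Some Y) i) (nth None (Some 0 :: map Some Y) j)) =
     pfn k (fun i j => c i * (C i j + (1 - u) / nth 0 Y i.-1 * (0 < i)%N%:R * C 0%N j
         + C i 0%N * ((1 - u) / nth 0 Y j.-1 * (0 < j)%N%:R)) * c j).
    apply: eq_pfn => i j; rewrite hk doubleS -hs ltnS => hi; rewrite ltnS => hj.
    case: i hi => [|i] hi; case: j hj => [|j] hj.
    - by rewrite /C /= !subrr; ring.
    - rewrite /C /= (nth_map 0)//= !(mul0r, mulr0, subr0, invr1); ring.
    - rewrite /C /= (nth_map 0)//= !(mul0r, mulr0, subr0, invr1); ring.
    - rewrite /C /= !(nth_map 0)// hB ?hin// /=; field.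
      have ht := one_subt_neq0 (hin _ hi) (hin _ hj); have h1 := one_sub_neq0 (hin _ hi) (hin _ hj).
      by rewrite ht h1 !hn0.
  rewrite hA pfn_scale hk (pfn_add_row0 _ (fun i => (1 - u) / nth 0 Y i)) // -hk.
  have -> : \prod_(i < k.*2) c i = (1 - u) * \prod_(y <- Y) y.
    by rewrite hk doubleS -hs big_ord_recl /= (big_nth 0) big_mkord.
  rewrite [\prod_(y <- Y) - y](_ : _ = - \prod_(y <- Y) y); last first.
    under eq_bigr => y _ do rewrite -mulN1r.
    by rewrite big_split /= big_const_seq count_predT iter_mulr_1 -signr_odd ho expr1 mulN1r.
  rewrite /C; ring.
- rewrite cats0 mul1r /pfB -cat_cons [LHS]pfl_to_front /=; last by rewrite size_cat size_map addn1 /= ho.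
  rewrite cats0 (@pfl_swap _ _ _ _ [::]) /= ?size_map ?ho //.
  rewrite exprS -signr_odd ho expr0 mulr1 mulN1r opprK.
  have hs : size Y = ((size Y)./2).*2 by rewrite -[LHS]odd_double_half ho.
  rewrite /pfl /= !size_map pfn_reduce /=; last 2 first.
  - by move=> i j; rewrite Bk_anti.
  - exact: oner_neq0.
  rewrite mul1r.
  have -> : \prod_(y <- Y) - y = \prod_(i < (size Y)./2.*2) nth 0 Y i.
    rewrite -hs; transitivity (\prod_(y <- Y) y); last by rewrite (big_nth 0) big_mkord.
    under eq_bigr => y _ do rewrite -mulN1r.
    by rewrite big_split /= big_const_seq count_predT iter_mulr_1 -signr_odd ho expr0 mul1r.
  rewrite -(pfn_scale _ _ (fun i => nth 0 Y i)).
  apply: eq_pfn => i j; rewrite -hs => hi hj.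
  rewrite !(nth_map 0)// hB ?hin// /= !(mul0r, mulr0, subr0, invr1); ring.
Qed.

Lemma odd_size_pad s : ~~ odd (size (pad s)).
Proof. by rewrite size_cat size_map oddD; case: (odd (size s)). Qed.

Lemma FV_first u y Y : {in y :: Y, forall x, between0 x} -> FV u y (y :: Y) = 0.
Proof.
move=> hY; rewrite FV_pf => [|x hx]; last by rewrite q_neq0 ?hY ?mem_head.
rewrite opad_cons [pfB _ _](_ : _ = 0) ?mulr0//.
by apply: (@pfl_adjacent_eq _ _ _ _ [::]); rewrite ?odd_size_pad.
Qed.

(** Since [q y^-1 y = 0], only the term pairing [z] with [y] survives. *)
Lemma FV_inv u y Y : y != 0 -> uniq (y :: Y) ->
  FV u y^-1 (y :: Y) = (y^-1 - y) * (1 - t) * (\prod_(x <- Y) q y^-1 x) * pfB u (pad Y).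
Proof.
move=> y0 /= /andP[yY uY]; have q0 : q y^-1 y = 0 by rewrite /q mulVf// subrr mul0r.
rewrite /FV opad_cons /= big_ord_recl /= eqxx expr0 mul1r [X in _ + X]big1 ?addr0 => [|j _].
  by rewrite /del take0 drop1 /= -[(t - u) * _ * _]mulrA mulVf// mulr1; congr (_ * _ * _ * _); ring.
rewrite add0n; have hm : nth None (pad Y) j \in pad Y by rewrite mem_nth.
case hj : (nth None (pad Y) j) hm => [x|] /=; last by rewrite big_cons q0 !(mul0r, mulr0).
rewrite mem_pad => xY; case: eqP => [e|/eqP hne]; first by move: xY; rewrite -e (negbTE yY).
by rewrite big_cons q0 !(mul0r, mulr0).
Qed.

Lemma FV_zero u Y : FV u 0 Y = pfB u (Some 0 :: opad Y).
Proof.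
have hq y : q 0 y = 1 by rewrite /q; ring.
rewrite FV_pf => [|y _]; last by rewrite hq oner_neq0.
by rewrite big1 ?mul1r// => y _; rewrite hq.
Qed.

Lemma V_FV u z Y : {in Y, forall y, q z y != 0} -> z \notin Y ->
  V u (z :: Y) * \prod_(y <- Y) ((1 - z * y) * (z - y)) = cprod Y * FV u z Y.
Proof.
move=> hq hz; rewrite FV_pf// /V pad_cons /=.
have -> : \prod_(y <- Y) q z y =
   \prod_(y <- Y) ((1 - t * z * y) / (z - y)) * \prod_(y <- Y) ((1 - z * y) * (z - y)).
  rewrite -big_split /=; apply: eq_big_seq => y hy.
  have hne : z - y != 0 by rewrite subr_eq0; apply: contraNneq hz => ->.
  by rewrite /q; field.
ring.
Qed.

(** The terms of [strips] for [z :: Y], cleared of denominators and grouped by the splitting of [Y]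
    alone: the parity of [K] decides whether [z] must join [K] (odd case) or [I] (even case). *)
Let frt u z I K : R :=
  if odd (size K) then
    hpoch (size I) u * acr K I * (\prod_(k <- K) k) * cprod K * z *
    (\prod_(i <- I) ((z - t * i) * (1 - z * i))) * FV t z K
  else hpoch (size I).+1 u * acr K I * (\prod_(k <- K) k) * V t K *
    (\prod_(i <- I) ((1 - z * i) * (z - i))) * (\prod_(k <- K) ((1 - z * k) * (t * z - k))).

Let FR u z Y : R := \sum_(p <- splits Y) frt u z p.1 p.2.

Lemma prod_splits Y p (g : R -> R) : p \in splits Y ->
  \prod_(y <- Y) g y = \prod_(i <- p.1) g i * \prod_(k <- p.2) g k.
Proof. by move=> hp; rewrite -(perm_big _ (splits_perm hp)) big_cat. Qed.

Lemma mem_splits Y p : p \in splits Y -> {subset p.1 <= Y} /\ {subset p.2 <= Y}.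
Proof.
by move=> /splits_perm/perm_mem h; split => x hx; rewrite -h mem_cat hx ?orbT.
Qed.

Lemma size_splits Y p : p \in splits Y -> (size p.1 + size p.2 = size Y)%N.
Proof. by move=> /splits_perm/perm_size; rewrite size_cat. Qed.

Lemma acr_consl k K I : acr (k :: K) I = \prod_(i <- I) ((k - t * i) / (k - i)) * acr K I.
Proof. by rewrite /acr big_cons. Qed.

Lemma acr_consr i K I : acr K (i :: I) = \prod_(k <- K) ((k - t * i) / (k - i)) * acr K I.
Proof. by rewrite /acr -big_split; apply: eq_bigr => k _; rewrite big_cons. Qed.

Lemma strips_FR u z Y : {in Y, forall y, q z y != 0} -> z \notin Y ->
  strips u (z :: Y) * \prod_(y <- Y) ((1 - z * y) * (z - y)) = FR u z Y.
Proof.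
move=> hq hz; rewrite /strips (sum_splits_cons (stripterm u)) mulr_suml; apply: eq_big_seq => -[I K] hp.
rewrite (prod_splits _ hp) /=; have [hI hK] := mem_splits hp; rewrite /= in hI hK.
have hne y : y \in Y -> z - y != 0 by move=> hy; rewrite subr_eq0; apply: contraNneq hz => ->.
rewrite /frt /stripterm [size (z :: K)]/= [odd _.+1]/=; case ho: (odd (size K)) => /=.
- rewrite add0r acr_consl big_cons.
  have := @V_FV t z K (fun y hy => hq y (hK y hy)) (contra (hK z) hz).
  have -> : \prod_(i <- I) ((z - t * i) * (1 - z * i)) =
      \prod_(i <- I) ((z - t * i) / (z - i)) * \prod_(y <- I) ((1 - z * y) * (z - y)).
    by rewrite -big_split /=; apply: eq_big_seq => i hi; field; rewrite hne ?hI.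
  set g1 := \prod_(i <- I) ((z - t * i) / (z - i)); set g2 := \prod_(y <- I) ((1 - z * y) * (z - y)).
  set g3 := \prod_(k <- K) k; set g4 := \prod_(y <- K) _ => h.
  transitivity (hpoch (size I) u * acr K I * g3 * z * (g1 * g2) * (V t (z :: K) * g4)); first ring.
  by rewrite h; ring.
- rewrite addr0 acr_consr.
  have -> : \prod_(k <- K) ((1 - z * k) * (t * z - k)) =
      \prod_(k <- K) ((k - t * z) / (k - z)) * \prod_(y <- K) ((1 - z * y) * (z - y)).
    rewrite -big_split /=; apply: eq_big_seq => k hk; field.
    by rewrite -oppr_eq0 opprB hne ?hK.
  ring.
Qed.

Lemma polyfun_FR u Y : polyfun (2 * size Y) (fun z => FR u z Y).
Proof.
apply: polyfun_sum_seq => -[I K] hp; rewrite /frt /=; have /= hs := size_splits hp.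
case ho: (odd (size K)).
- have hc : (2 * size Y = 1 + 2 * size I + (2 * size K).-1)%N.
    by rewrite -hs; move: (size I) (size K) ho => l [//|m] _; lia.
  rewrite hc; apply: polyfunM (polyfun_FVt ho); apply: polyfunM.
    by apply: polyfun_ext (polyfun_affine (hpoch (size I) u * acr K I * (\prod_(k <- K) k) * cprod K) 0) => z; ring.
  apply: polyfun_prod => i.
  apply: (@polyfunM _ 1 1).
    by apply: polyfun_ext (polyfun_affine 1 (- t * i)) => z; ring.
  by apply: polyfun_ext (polyfun_affine (- i) 1) => z; ring.
- rewrite -hs mulnDr; apply: polyfunM.
    apply: polyfunZ; apply: polyfun_prod => i.
    apply: (@polyfunM _ 1 1).
      by apply: polyfun_ext (polyfun_affine (- i) 1) => z; ring.
    by apply: polyfun_ext (polyfun_affine 1 (- i)) => z; ring.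
  apply: polyfun_prod => k.
  apply: (@polyfunM _ 1 1).
    by apply: polyfun_ext (polyfun_affine (- k) 1) => z; ring.
  by apply: polyfun_ext (polyfun_affine t (- k)) => z; ring.
Qed.

(** The defect of the identity [V = strips], cleared of its denominators in the first variable [z];
    it is a polynomial of degree at most [2|Y|] in [z]. *)
Let DF u z Y := cprod Y * FV u z Y - FR u z Y.

Lemma polyfun_DF u Y : polyfun (2 * size Y) (fun z => DF u z Y).
Proof.
have := polyfunD (polyfunZ (cprod Y) (polyfun_FV u Y)) (polyfunZ (-1) (polyfun_FR u Y)).
by apply: polyfun_ext => z; rewrite mulN1r.
Qed.

Lemma DF_good u z Y : {in Y, forall y, q z y != 0} -> z \notin Y ->
  DF u z Y = (V u (z :: Y) - strips u (z :: Y)) * \prod_(y <- Y) ((1 - z * y) * (z - y)).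
Proof. by move=> hq hz; rewrite /DF -V_FV// -strips_FR// mulrBl. Qed.

(** For negative [z] the defect is expressed through [V] and [strips], which are symmetric;
    polynomiality extends the symmetry to all [z]. It allows any [y] to be moved to the front before
    specializing. *)
Lemma DF_perm u z Y Y' : {in Y, forall y, between0 y} -> perm_eq Y Y' -> DF u z Y = DF u z Y'.
Proof.
move=> hY hp; have /andP[t0 t1] := t01.
apply: (@polyfun_eq_neg _ (2 * size Y) (fun z => DF u z Y) (fun z => DF u z Y')).
- exact: polyfun_DF.
- by rewrite (perm_size hp); exact: polyfun_DF.
move=> w w0; have hq : {in Y, forall y, q w y != 0}.
  move=> y /hY /andP[y0 y1]; rewrite mulf_neq0// gt_eqF// subr_gt0.
    by rewrite (lt_trans _ ltr01)// nmulr_rlt0.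
  by rewrite (lt_trans _ ltr01)// nmulr_rlt0// pmulr_rlt0.
have hw : w \notin Y by apply/negP => /hY /andP[h _]; have := lt_trans w0 h; rewrite ltxx.
rewrite !DF_good// ?(perm_big _ hp)//=; last 2 first.
- by move=> y hy; rewrite hq// (perm_mem hp).
- by rewrite -(perm_mem hp).
congr (_ * _); have hc : perm_eq (w :: Y) (w :: Y') by rewrite perm_cons.
by rewrite (perm_invariant (V_swap u) hc) (perm_invariant (strips_swap u) hc).
Qed.

(** Two equal arguments kill the Pfaffian. In [FR], the two placements of [y] relative to a
    splitting of the other variables cancel each other if the remaining [K] is odd, and vanish
    separately if it is even. *)
Lemma DF_first u y Y : uniq (y :: Y) -> {in y :: Y, forall x, between0 x} -> DF u y (y :: Y) = 0.
Proof.
move=> uY hY; have hy : between0 y by rewrite hY ?mem_head.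
have hYY x : x \in Y -> between0 x by move=> hx; rewrite hY ?inE ?hx ?orbT.
suff hF : FR u y (y :: Y) = 0 by rewrite /DF FV_first// mulr0 hF subr0.

  rewrite /FR (sum_splits_cons (frt u y)) big_seq big1// => -[I K] hp /=.
  have [hI hK] := mem_splits hp; rewrite /= in hI hK.
  have hne x : x \in Y -> y - x != 0.
    by move=> hx; rewrite subr_eq0; apply: contraTneq uY => ->; rewrite /= hx.
  rewrite /frt [size (y :: K)]/= [odd _.+1]/=; case ho: (odd (size K)) => /=; last first.
    rewrite FV_first; last first.
      by move=> x; rewrite inE => /orP[/eqP ->//|/hK]; exact: hYY.
    by rewrite !big_cons subrr; ring.
  rewrite FV_pf => [|x hx]; last by rewrite q_neq0// hYY// hK.
  rewrite /V pad_cons /= acr_consr acr_consl !big_cons.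
  set P := pfB _ _.
  have eK : \prod_(k <- K) ((k - t * y) / (k - y)) * \prod_(k <- K) q y k =
     \prod_(k <- K) ((1 - t * y * k) / (y - k)) * \prod_(k <- K) ((1 - y * k) * (t * y - k)).
    rewrite -!big_split /=; apply: eq_big_seq => k hk; rewrite /q; field.
    by rewrite hne ?hK//= -oppr_eq0 opprB hne ?hK.
  have eI : \prod_(i <- I) ((y - t * i) * (1 - y * i)) =
     \prod_(i <- I) ((y - t * i) / (y - i)) * \prod_(i <- I) ((1 - y * i) * (y - i)).
    by rewrite -!big_split /=; apply: eq_big_seq => i hi; field; rewrite hne ?hI.
  rewrite eI; move: eK.
  move: (\prod_(k <- K) ((k - t * y) / (k - y))) (\prod_(k <- K) q y k)
    (\prod_(k <- K) ((1 - t * y * k) / (y - k))) (\prod_(k <- K) ((1 - y * k) * (t * y - k))) => g1 g2 g3 g4 e.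
  move: (\prod_(i <- I) ((y - t * i) / (y - i))) (\prod_(i <- I) ((1 - y * i) * (y - i))) (\prod_(k <- K) k) => g5 g6 g7.
  set h := (if odd (size I) then _ else _) * hpoch _ _.
  transitivity (h * acr K I * g7 * cprod K * y * (g5 * g6) * P * (1 - y * y) * (y - t * y) * (g1 * g2 - g3 * g4)); first ring.
  by rewrite e subrr mulr0.
Qed.

(** The factors [1 - z * y] vanish, so that [FR] keeps only the splittings in which [y] belongs to a
    [K] of odd size, where [FV_inv] applies. Both sides become the same multiple of [V u Y] and of
    [strips u Y]. *)
Lemma DF_inv u y Y : uniq (y :: Y) -> {in y :: Y, forall x, between0 x} ->
  V u Y = strips u Y -> DF u y^-1 (y :: Y) = 0.
Proof.
move=> uY hY hV; have hy : between0 y by rewrite hY ?mem_head.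
have y0 : y != 0 by case/andP: hy => h _; rewrite gt_eqF.
pose g x := (y - t * x) * (1 - t * y * x) / y ^+ 2.
have hne x : x \in Y -> y - x != 0.
  by move=> hx; rewrite subr_eq0; apply: contraTneq uY => ->; rewrite /= hx.
have hF : FR u y^-1 (y :: Y) = (y^-1 - y) * (1 - t) * (\prod_(x <- Y) g x) * strips u Y.
  rewrite /FR (sum_splits_cons (frt u y^-1)) mulr_sumr; apply: eq_big_seq => -[I K] hp /=.
  have [hI hK] := mem_splits hp; rewrite /= in hI hK.
  rewrite (prod_splits _ hp) /=.
  rewrite /frt /stripterm [size (y :: K)]/= [odd _.+1]/=; case ho: (odd (size K)) => /=.
    by rewrite !big_cons mulVf// subrr; ring.
  rewrite FV_inv//; last first.
    rewrite /= (contra (hK y)) /=; last by case/andP: uY.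
    have : uniq (I ++ K) by rewrite (perm_uniq (splits_perm hp)); case/andP: uY.
    by rewrite cat_uniq => /and3P[].
  rewrite /V acr_consl !big_cons mulVf// subrr.
  have eK : \prod_(x <- K) ((1 - t * y * x) / (y - x)) * \prod_(x <- K) q y^-1 x = \prod_(k <- K) g k.
    by rewrite -!big_split /=; apply: eq_big_seq => k hk; rewrite /q /g; field; rewrite y0 hne ?hK.
  have eI : \prod_(i <- I) ((y - t * i) / (y - i)) * \prod_(i <- I) ((y^-1 - t * i) * (1 - y^-1 * i)) =
     \prod_(i <- I) g i.
    by rewrite -!big_split /=; apply: eq_big_seq => i hi; rewrite /g; field; rewrite y0 hne ?hI.
  rewrite -eK -eI; have yy : y * y^-1 = 1 by rewrite divff.
  set g1 := \prod_(x <- K) ((1 - t * y * x) / (y - x)); set g2 := \prod_(x <- K) q y^-1 x.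
  set g3 := \prod_(i <- I) ((y - t * i) / (y - i)); set g4 := \prod_(i <- I) ((y^-1 - t * i) * (1 - y^-1 * i)).
  set h := hpoch (size I) u; set g5 := \prod_(k <- K) k; set g8 := pfB t (pad K).
  transitivity ((y * y^-1) * (h * acr K I * g5 * cprod K * (g3 * g4) * (y^-1 - y) * (1 - t) * (g1 * g2) * g8)); first ring.
  by rewrite yy; ring.
rewrite /DF hF FV_inv// -hV /V /=.
have e : \prod_(x <- Y) ((1 - t * y * x) / (y - x)) * \prod_(x <- Y) q y^-1 x = \prod_(k <- Y) g k.
  by rewrite -!big_split /=; apply: eq_big_seq => k hk; rewrite /q /g; field; rewrite y0 hne.
rewrite -e; ring.
Qed.

(** The odd terms carry a factor [z]. In the even ones [hpoch] of [(size I).+1] at [u] unfolds to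
    [hpoch] of [size I] at [u * t], which gives the recursion for [Y] at [u * t]; the induction
    therefore has to quantify over [u]. *)
Lemma DF_zero u Y : {in Y, forall x, between0 x} ->
  V (u * t) Y = strips (u * t) Y -> DF u 0 Y = 0.
Proof.
move=> hY hV; rewrite /DF FV_zero V0// hV; apply/eqP; rewrite subr_eq0; apply/eqP.
rewrite mulrA mulr_sumr; apply: eq_big_seq => -[I K] hp; rewrite (prod_splits _ hp) /=.
rewrite /frt /stripterm /=; case ho: (odd (size K)); first by rewrite mulr0; ring.
have -> : odd (size Y) = odd (size I) by rewrite -(size_splits hp) oddD /= ho addbF.
have eI : \prod_(i <- I) ((1 - 0 * i) * (0 - i)) = \prod_(i <- I) - i by apply: eq_bigr => i _; ring.
have eK : \prod_(k <- K) ((1 - 0 * k) * (t * 0 - k)) = \prod_(k <- K) - k by apply: eq_bigr => k _; ring.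
rewrite eI eK; move: (\prod_(i <- I) - i) (\prod_(k <- K) - k) (\prod_(k <- K) k) => g1 g2 g3.
by move: (if _ then _ else _) => c; ring.
Qed.

(** The defect has one zero more than its degree bound. The zeros at the [y] are unconditional;
    those at 0 and at the [1 / y] come from the identity in fewer variables, at [u * t] and at [u]
    respectively. *)
Lemma V_strips u s : uniq s -> {in s, forall x, between0 x} -> V u s = strips u s.
Proof.
have [n] := ubnP (size s); elim: n u s => // n IH u [|z Y] hs us hY.
  rewrite /strips (sum_splits_nil (stripterm u)) /V /stripterm /acr /= !big_nil /V /=.
  by rewrite /pfB /pfl /= !pfn0; ring.
have hYY : {in Y, forall x, between0 x} by move=> x hx; rewrite hY ?inE ?hx ?orbT.
have [zY uY] : z \notin Y /\ uniq Y by case/andP: us.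
have hz : between0 z by rewrite hY ?mem_head.
have hqz : {in Y, forall y, q z y != 0} by move=> y hy; exact: q_neq0 hz (hYY _ hy).
have hY0 y : y \in Y -> 0 < y by move/hYY => /andP[].
have hrem y : y \in Y -> uniq (y :: rem y Y) /\ {in y :: rem y Y, forall x, between0 x}.
  move=> hy; have hp := perm_to_rem hy; split; first by rewrite -(perm_uniq hp).
  by move=> x; rewrite -(perm_mem hp); exact: hYY.
have : DF u z Y = 0.
  (* These [2|Y| + 1] points are distinct because the [y] lie in (0, 1) and the [1 / y] above 1. *)
  pose rs := 0 :: Y ++ map GRing.inv Y.
  apply: (@polyfun_eq0 _ _ (fun w => DF u w Y) rs (polyfun_DF u Y)).
  - rewrite /= mem_cat negb_or cat_uniq uY (map_inj_uniq invr_inj) uY andbT /= -andbA.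
    apply/and3P; split.
    + by apply/negP => /hY0; rewrite ltxx.
    + by apply/mapP => -[y /hY0 h e]; have := invr_gt0 y; rewrite -e h ltxx.
    + apply/hasPn => _ /mapP[y hy ->]; apply/negP => /hYY /andP[_].
      by case/andP: (hYY y hy) => h0 h1; rewrite invf_lt1// ltNge (ltW h1).
  - by rewrite /= size_cat size_map addnn -mul2n.
  move=> w; rewrite inE mem_cat => /or3P[/eqP ->|hw|/mapP[y hy ->]].
  - by apply: DF_zero => //; apply: IH.
  - have [h1 h2] := hrem w hw.
    by rewrite (DF_perm _ _ hYY (perm_to_rem hw)) DF_first.
  - have [h1 h2] := hrem y hy.
    rewrite (DF_perm _ _ hYY (perm_to_rem hy)) DF_inv//; apply: IH.
    + rewrite size_rem//; move: hs => /=; rewrite ltnS => hs; apply: leq_ltn_trans hs.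
      by rewrite leq_pred.
    + by case/andP: h1.
    + by move=> x hx; rewrite h2 ?inE ?hx ?orbT.
rewrite DF_good// => /eqP; rewrite mulf_eq0 subr_eq0 => /orP[/eqP //|].
rewrite prodf_seq_eq0 => /hasP[y hy /=]; have := hqz y hy; rewrite /q mulf_eq0 negb_or => /andP[h1 _].
rewrite mulf_eq0 (negbTE h1) subr_eq0 /= => /eqP e.
by move: zY; rewrite e hy.
Qed.

End RefinedLittlewood.

(** * Hall-Littlewood polynomials at distinct points *)

Section Selections.
Variable T : Type.
Implicit Types s : seq T.

Fixpoint sel s : seq (T * seq T) :=
  if s is x :: s' then (x, s') :: [seq (p.1, x :: p.2) | p <- sel s'] else [::].

Lemma sum_sel_cons (R : nmodType) (G : T -> seq T -> R) x s :
  \sum_(p <- sel (x :: s)) G p.1 p.2 = G x s + \sum_(p <- sel s) G p.1 (x :: p.2).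
Proof. by rewrite big_cons big_map. Qed.

Lemma sum_sel_del (R : nmodType) (G : T -> seq T -> R) x0 s :
  \sum_(p <- sel s) G p.1 p.2 = \sum_(j < size s) G (nth x0 s j) (del j s).
Proof.
elim: s G => [|x s IH] G; first by rewrite big_nil big_ord0.
rewrite sum_sel_cons big_ord_recl (IH (fun y r => G y (x :: r))); congr (_ + _).
by rewrite /del /= drop0.
Qed.

(** Choosing an element and then splitting the rest amounts to splitting and then choosing inside
    the second part. This exchanges the recursion on the exponents with the removal of the variables
    of exponent 0. *)
Lemma sum_sel_splits (R : nmodType) (G : T -> seq T -> seq T -> R) s :
  \sum_(p <- sel s) \sum_(q <- splits p.2) G p.1 q.1 q.2 =
  \sum_(q <- splits s) \sum_(p <- sel q.2) G p.1 q.1 p.2.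
Proof.
elim: s G => [|x s IH] G; first by rewrite big_nil big_seq1 big_nil.
rewrite (sum_sel_cons (fun y r => \sum_(q <- splits r) G y q.1 q.2)).
rewrite (sum_splits_cons (fun I K => \sum_(p <- sel K) G p.1 I p.2)).
under [RHS]eq_bigr => q _ do rewrite (sum_sel_cons (fun y r => G y q.1 r)).
rewrite big_split big_split /= addrCA; congr (_ + _).
rewrite -(IH (fun y I K => G y (x :: I) K)) -(IH (fun y I K => G y I (x :: K))) -big_split.
by apply: eq_bigr => p _; rewrite (sum_splits_cons (G p.1)) big_split.
Qed.

End Selections.

Lemma sel_perm (T : eqType) (s : seq T) p : p \in sel s -> perm_eq (p.1 :: p.2) s.
Proof.
elim: s p => [//|x s IH] p; rewrite inE => /orP[/eqP ->//|/mapP[q /IH hq ->] /=].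
by rewrite (perm_catCA [:: q.1] [:: x]) /= perm_cons.
Qed.

(** * Symmetrized sums by recursion on the exponents *)

Section SymmetrizedSums.
Variables (R : realFieldType) (t : R).
Hypothesis t01 : 0 < t < 1.
Implicit Types (u x y z : R) (J I K Y : seq R) (l : seq nat).

Fixpoint Ssum l J : R :=
  if l is e :: l' then
    \sum_(p <- sel J) p.1 ^+ e * (\prod_(y <- p.2) ((p.1 - t * y) / (p.1 - y))) * Ssum l' p.2
  else 1.

(** Permutations are grouped by the image of 0, the variable that receives the first exponent. *)
Lemma perm_sum_Ssum n (a : 'I_n -> R) l : size l = n ->
  \sum_(w : 'S_n) (\prod_(i < n) a (w i) ^+ nth 0%N l i) *
    \prod_(i < n) \prod_(j < n | (i < j)%N) ((a (w i) - t * a (w j)) / (a (w i) - a (w j))) =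
  Ssum l (codom a).
Proof.
elim: n a l => [|n IH] a l.
  move=> /size0nil ->; rewrite (big_pred1 1%g) => [|s]; last by apply/esym/eqP/permP => -[].
  by rewrite !big_ord0 mulr1.
case: l => [//|e l] /= [hl].
rewrite (partition_big (fun w : 'S_n.+1 => w ord0) xpredT)//=.
rewrite (sum_sel_del (fun x r => x ^+ e * (\prod_(y <- r) ((x - t * y) / (x - y))) * Ssum l r) (a ord0)).
have hs : size (codom a) = n.+1 by rewrite size_codom card_ord.
rewrite -[RHS](big_mkord xpredT (fun j => nth (a ord0) (codom a) j ^+ e *
  (\prod_(y <- del j (codom a)) ((nth (a ord0) (codom a) j - t * y) / (nth (a ord0) (codom a) j - y))) * Ssum l (del j (codom a)))).
rewrite hs big_mkord; apply: eq_bigr => j _.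
rewrite sum_lift_perm.
have hc : codom a = map a (enum 'I_n.+1) by [].
have hn (i : 'I_n.+1) : nth (a ord0) (codom a) i = a i.
  by rewrite hc (nth_map ord0) ?size_enum_ord// nth_ord_enum.
have hd : del j (codom a) = codom (a \o lift j).
  apply: (@eq_from_nth _ (a ord0)) => [|i]; rewrite size_del ?hs// ?size_codom ?card_ord// => hi.
  rewrite nth_del ?hs// -[bump j i]/(val (lift j (Ordinal hi))) hn.
  rewrite /codom /image_mem (nth_map (Ordinal hi)) ?size_enum_ord//.
  by rewrite (nth_ord_enum (Ordinal hi) (Ordinal hi)).
rewrite hn hd -(IH (a \o lift j) l hl) mulr_sumr; apply: eq_bigr => w _.
rewrite big_ord_recl lift_perm_id /= -!mulrA; congr (_ * _).
have tl (i : nat) (H : 'I_n.+1 -> R) :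
    \prod_(j0 < n.+1 | (i.+1 < j0)%N) H j0 = \prod_(j0 < n | (i < j0)%N) H (lift ord0 j0).
  by rewrite big_mkcond big_ord_recl /= mul1r -big_mkcond.
have hd0 (H : 'I_n.+1 -> R) : \prod_(j0 < n.+1 | (0 < j0)%N) H j0 = \prod_(j0 < n) H (lift ord0 j0).
  by rewrite big_mkcond big_ord_recl /= mul1r.
rewrite big_ord_recl /= hd0 mulrCA lift_perm_id; congr (_ * _).
  rewrite big_map big_enum /= [RHS](reindex_inj (@perm_inj _ w)) /=.
  by apply: eq_bigr => i _; rewrite lift_perm_lift.
congr (_ * _); apply: eq_bigr => i _; first by rewrite lift_perm_lift.
by rewrite tl; apply: eq_bigr => i' _; rewrite !lift_perm_lift.
Qed.

Lemma vfact_neq0 m : HallLittlewood.v_ t m != 0.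
Proof.
have /andP[t0 t1] := t01; rewrite /HallLittlewood.v_ prodf_seq_neq0; apply/allP => i; rewrite mem_index_iota => /andP[i0 _] /=.
rewrite mulf_neq0 ?invr_neq0// gt_eqF// subr_gt0//; case: i i0 => // i _.
by rewrite exprn_ilt1// ltW.
Qed.

Lemma vfactS m : HallLittlewood.v_ t m.+1 = (1 - t ^+ m.+1) / (1 - t) * HallLittlewood.v_ t m.
Proof. by rewrite /HallLittlewood.v_ big_nat_recr//= mulrC. Qed.

Lemma sum_sel_rem (T : eqType) (G : T -> seq T -> R) (s : seq T) : uniq s ->
  \sum_(p <- sel s) G p.1 p.2 = \sum_(x <- s) G x (rem x s).
Proof.
elim: s G => [|x s IH] G; first by rewrite !big_nil.
move=> /= /andP[xs us]; rewrite (sum_sel_cons G) big_cons eqxx (IH (fun (y : T) r => G y (x :: r)))//.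
congr (_ + _); apply: eq_big_seq => y hy.
by case: eqP => // e; move: xs; rewrite e hy.
Qed.

Lemma size_prod_subX_diff (c : R) Y :
  (size (\prod_(y <- Y) ('X - (c * y)%:P) - \prod_(y <- Y) ('X - y%:P))%R <= size Y)%N.
Proof.
elim: Y => [|y Y IH]; first by rewrite !big_nil subrr size_poly0.
rewrite !big_cons; set P := \prod_(j <- Y) _ in IH *; set Q := \prod_(j <- Y) _ in IH *.
have -> : ('X - (c * y)%:P) * P - ('X - y%:P) * Q =
    ('X - (c * y)%:P) * (P - Q) + (y - c * y) *: Q.
  by rewrite -mul_polyC polyCB; ring.
rewrite (leq_trans (size_polyD _ _))// geq_max; apply/andP; split.
  by rewrite (leq_trans (size_polyMleq _ _))// size_XsubC /= add1n ltnS.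
by rewrite (leq_trans (size_scale_leq _ _))// size_prod_XsubC.
Qed.

(* value at z = 0 of the partial fraction expansion of prod (z - t y) / (z - y) *)
Lemma sum_sel_prod J : uniq J -> {in J, forall x, x != 0} ->
  \sum_(p <- sel J) \prod_(y <- p.2) ((p.1 - t * y) / (p.1 - y)) = (1 - t ^+ size J) / (1 - t).
Proof.
move=> uJ nz; have /andP[t0 t1] := t01; have h1t : 1 - t != 0 by rewrite gt_eqF// subr_gt0.
have selu p : p \in sel J -> uniq (p.1 :: p.2) by move/sel_perm/perm_uniq ->.
pose c (p : R * seq R) := (1 - t) * p.1 * \prod_(y <- p.2) ((p.1 - t * y) / (p.1 - y)).
pose P := \prod_(y <- J) ('X - (t * y)%:P) - \prod_(y <- J) ('X - y%:P)
  - \sum_(p <- sel J) c p *: \prod_(y <- p.2) ('X - y%:P).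
have P0 : P = 0.
  apply/eqP/negPn/negP => hP.
  have hsz : (size P <= size J)%N.
    rewrite /P (leq_trans (size_polyD _ _))// geq_max size_prod_subX_diff size_polyN /=.
    rewrite big_seq; apply: (big_ind (fun p : {poly R} => size p <= size J)%N) => [|p q hp hq|p hp].
    - by rewrite size_poly0.
    - by rewrite (leq_trans (size_polyD _ _))// geq_max hp.
    - rewrite (leq_trans (size_scale_leq _ _))// size_prod_XsubC.
      by rewrite -(perm_size (sel_perm hp)).
  have hr : all (root P) J.
    apply/allP => x hx; rewrite rootE /P !hornerD !hornerN horner_sum !horner_prod.
    have -> : \prod_(y <- J) ('X - y%:P).[x] = 0.
      apply/eqP; rewrite prodf_seq_eq0; apply/hasP; exists x => //=.
      by rewrite hornerXsubC subrr.
    rewrite subr0 (sum_sel_rem (fun y r => (c (y, r) *: \prod_(y0 <- r) ('X - y0%:P)).[x]))//.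
    rewrite [X in _ - X](bigD1_seq x)//= [X in _ - (_ + X)]big1_seq ?addr0 => [|y /andP[yx hy]]; last first.
      rewrite hornerZ horner_prod (bigD1_seq x) ?rem_uniq//=; last first.
        by rewrite mem_rem_uniq// !inE eq_sym yx.
      by rewrite hornerXsubC subrr mul0r mulr0.
    rewrite hornerZ horner_prod (perm_big _ (perm_to_rem hx)) big_cons /= /c /= subr_eq0.
    rewrite hornerXsubC; apply/eqP.
    rewrite [(1 - t) * x]mulrBl mul1r -mulrA; congr (_ * _); rewrite -big_split /=.
    apply: eq_big_seq => y; rewrite mem_rem_uniq// !inE => /andP[yx hy].
    by rewrite !hornerXsubC mulfVK// subr_eq0 eq_sym.
  by have := leq_trans (max_poly_roots hP hr uJ) hsz; rewrite ltnn.
have := congr1 (horner^~ 0) P0; rewrite /P horner0 !hornerD !hornerN horner_sum !horner_prod.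
have -> : \prod_(y <- J) ('X - (t * y)%:P).[0] = t ^+ size J * \prod_(y <- J) - y.
  rewrite -[size J]count_predT -iter_mulr_1 -big_const_seq -big_split /=.
  by apply: eq_bigr => y _; rewrite hornerXsubC sub0r mulrN.
have -> : \prod_(y <- J) ('X - y%:P).[0] = \prod_(y <- J) - y.
  by apply: eq_bigr => y _; rewrite hornerXsubC sub0r.
set PJ := \prod_(y <- J) - y.
have hPJ : PJ != 0 by rewrite prodf_seq_neq0; apply/allP => y /nz; rewrite oppr_eq0.
have -> : \sum_(i <- sel J) (c i *: \prod_(y <- i.2) ('X - y%:P)).[0] =
  - PJ * (1 - t) * \sum_(p <- sel J) \prod_(y <- p.2) ((p.1 - t * y) / (p.1 - y)).
  rewrite mulr_sumr; apply: eq_big_seq => p hp.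
  rewrite hornerZ horner_prod /c /PJ -(perm_big _ (sel_perm hp)) big_cons /=.
  have -> : \prod_(y <- p.2) ('X - y%:P).[0] = \prod_(y <- p.2) - y.
    by apply: eq_bigr => y _; rewrite hornerXsubC sub0r.
  move: (\prod_(y <- p.2) - y) (\prod_(y <- p.2) ((p.1 - t * y) / (p.1 - y))) => g1 g2; ring.
move: (\sum_(p <- sel J) _) (t ^+ size J) => S e h.
apply/eqP; rewrite eq_sym -(inj_eq (mulfI h1t)) -(inj_eq (mulfI hPJ)) -subr_eq0; apply/eqP.
by rewrite [(1 - t) * (_ / _)]mulrC divfK// -[RHS]oppr0 -h; ring.
Qed.

Lemma acr_perml K K' I : perm_eq K K' -> acr t K I = acr t K' I.
Proof. by move=> h; apply: perm_big. Qed.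

(** Symmetrizing the constant 1 gives the t-factorial by which P_lambda is divided for each
    multiplicity. *)
Lemma Ssum_zeros J : uniq J -> {in J, forall x, x != 0} ->
  Ssum (nseq (size J) 0%N) J = HallLittlewood.v_ t (size J).
Proof.
move e : (size J) => m; elim: m J e => [|m IH] J hs uJ nz.
  by rewrite /= /HallLittlewood.v_ big_nil.
rewrite /= (eq_big_seq (fun p => \prod_(y <- p.2) ((p.1 - t * y) / (p.1 - y)) * HallLittlewood.v_ t m)).
  by rewrite -mulr_suml sum_sel_prod// hs vfactS.
move=> p hp; have hq := sel_perm hp; rewrite expr0 mul1r IH//.
- by move: (perm_size hq); rewrite hs => -[].
- by have := perm_uniq hq; rewrite uJ => /= /andP[].
- by move=> x hx; apply: nz; rewrite -(perm_mem hq) inE hx orbT.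
Qed.

(** [p.1] is the set of variables receiving the [m] zero exponents: symmetrizing inside it gives
    [v_ t m], and its cross factors with the other variables give [acr]. *)
Lemma Ssum_strip l m J : (size l + m)%N = size J -> uniq J -> {in J, forall x, x != 0} ->
  Ssum (l ++ nseq m 0%N) J =
  \sum_(p <- splits J) if size p.1 == m then HallLittlewood.v_ t m * Ssum l p.2 * acr t p.2 p.1 else 0.
Proof.
elim: l J => [|e l IH] J hs uJ nz.
  rewrite add0n in hs; rewrite hs Ssum_zeros//= -hs.
  have key Y : \sum_(p <- splits Y) (if size p.1 == size Y then acr t p.2 p.1 else 0) = 1.
    elim: Y => [|y Y IHY]; first by rewrite big_seq1 /= /acr big_nil.
    rewrite (sum_splits_cons (fun I K => if size I == size (y :: Y) then acr t K I else 0)).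
    rewrite -[RHS]IHY; apply: eq_big_seq => -[I K] /= hp; rewrite eqSS.
    have hsz := size_splits hp; rewrite /= in hsz.
    rewrite [X in _ + X](_ : _ = 0) ?addr0; last by case: eqP => // h; move: hsz; rewrite h; lia.
    case: eqP => // h; have -> : K = [::] by apply/size0nil/eqP; rewrite -(eqn_add2l (size I)) addn0 hsz h.
    by rewrite /acr !big_nil.
  transitivity (HallLittlewood.v_ t m * \sum_(p <- splits J) (if size p.1 == size J then acr t p.2 p.1 else 0)).
    by rewrite key mulr1.
  by rewrite mulr_sumr -hs; apply: eq_bigr => p _; case: ifP; rewrite ?mulr0 ?mulr1.
rewrite [LHS]/=.
transitivity (\sum_(p <- sel J) \sum_(q <- splits p.2) (if size q.1 == m then
   p.1 ^+ e * (\prod_(y <- q.1) ((p.1 - t * y) / (p.1 - y))) * (\prod_(y <- q.2) ((p.1 - t * y) / (p.1 - y)))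
    * (HallLittlewood.v_ t m * Ssum l q.2 * acr t q.2 q.1) else 0)).
  apply: eq_big_seq => p hp; have hq := sel_perm hp.
  rewrite IH; last 3 first.
  - by move: (perm_size hq) hs => /=; lia.
  - by have := perm_uniq hq; rewrite uJ => /= /andP[].
  - by move=> x hx; apply: nz; rewrite -(perm_mem hq) inE hx orbT.
  rewrite mulr_sumr; apply: eq_big_seq => q hqs; case: ifP => _; last by rewrite mulr0.
  by rewrite (prod_splits _ hqs) !mulrA.
rewrite (sum_sel_splits (fun x I K => if size I == m then
   x ^+ e * (\prod_(y <- I) ((x - t * y) / (x - y))) * (\prod_(y <- K) ((x - t * y) / (x - y)))
    * (HallLittlewood.v_ t m * Ssum l K * acr t K I) else 0)).
apply: eq_big_seq => -[I K] _ /=; case: ifP => _; last by rewrite big1.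
rewrite mulr_sumr mulr_suml; apply: eq_big_seq => p hp.
rewrite -(acr_perml I (sel_perm hp)) acr_consl; ring.
Qed.

Lemma Ssum_map_succ l J : size l = size J -> Ssum (map S l) J = (\prod_(x <- J) x) * Ssum l J.
Proof.
elim: l J => [|e l IH] J /=; first by move=> /esym/size0nil ->; rewrite big_nil mulr1.
move=> hs; rewrite mulr_sumr; apply: eq_big_seq => p hp.
have hsp := perm_size (sel_perm hp); rewrite /= -hs in hsp; case: hsp => hsp.
have -> : \prod_(x <- J) x = p.1 * \prod_(x <- p.2) x.
  by rewrite -(perm_big _ (sel_perm hp)) big_cons.
by rewrite IH// exprS; ring.
Qed.

End SymmetrizedSums.

(** * Partitions padded with zeros, enumerated column by column *)

Section PaddedPartitions.
Implicit Types (l : seq nat) (m n N : nat).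

(** All weakly decreasing lists of length [n] with entries at most [N], generated by their first
    column: [m] zeros, and the other entries lowered by one. The enumeration has the shape of the
    column recursion. *)
Fixpoint plists N n : seq (seq nat) :=
  if N is N'.+1 then [seq map S l ++ nseq m 0%N | m <- iota 0 n.+1, l <- plists N' (n - m)]
  else [:: nseq n 0%N].

Lemma plistsS N n : plists N.+1 n =
  [seq map S l ++ nseq m 0%N | m <- iota 0 n.+1, l <- plists N (n - m)].
Proof. by []. Qed.

Lemma geq_trans : transitive geq.
Proof. by move=> y x z h1 h2; exact: leq_trans h2 h1. Qed.

Lemma sorted_zeros_last l : pairwise geq l ->
  l = [seq x <- l | x != 0%N] ++ nseq (count_mem 0%N l) 0%N.
Proof.
elim: l => [//|x l IH] /= /andP[hx /IH hl].
case: (eqVneq x 0%N) hx => [->|x0] hx /=; last by rewrite add0n -hl.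
have : all (pred1 0%N) l by apply: sub_all hx => y; rewrite /= leqn0.
move/all_pred1P; move: (size l) => m ->; have -> : [seq y <- nseq m 0%N | y != 0%N] = [::] by elim: m.
by rewrite count_nseq /= mul1n.
Qed.

Lemma plistsP N n l :
  reflect [/\ size l = n, pairwise geq l & all (fun x => (x <= N)%N) l] (l \in plists N n).
Proof.
apply: (iffP idP).
- elim: N n l => [|N IH] n l.
    rewrite inE => /eqP ->; split; rewrite ?size_nseq//; last by rewrite all_nseq orbT.
    by elim: n => //= n ->; rewrite all_nseq orbT.
  rewrite plistsS => /allpairsPdep [m [l' [hm /IH [hs hp ha] ->]]].
  rewrite mem_iota add0n ltnS /= in hm; split.
  - by rewrite size_cat size_map size_nseq hs subnK.
  - rewrite pairwise_cat pairwise_map; apply/and3P; split.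
    + by apply/allrelP => x y _; rewrite mem_nseq => /andP[_ /eqP ->].
    + by apply: sub_pairwise hp => x y; rewrite /= ltnS.
    + by elim: (m) => //= k ->; rewrite all_nseq orbT.
  - rewrite all_cat all_map all_nseq orbT andbT.
    by apply: sub_all ha => x; rewrite /= ltnS.
- elim: N n l => [|N IH] n l [hs hp ha].
    rewrite inE -hs; apply/eqP/all_pred1P; apply: sub_all ha => x; by rewrite /= leqn0.
  rewrite plistsS; apply/allpairsPdep; exists (count_mem 0%N l), (map predn [seq x <- l | x != 0%N]); split.
  + by rewrite mem_iota add0n ltnS -hs count_size.
  + apply: IH; split.
    * rewrite size_map -hs {2}(sorted_zeros_last hp) size_cat size_nseq addnK //.
    * rewrite pairwise_map; have := pairwise_filter (fun x => x != 0%N) hp.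
      apply: sub_pairwise => x y /= h; by case: x y h => [|x] [|y].
    * rewrite all_map; apply/allP => x; rewrite mem_filter => /andP[x0 hx] /=.
      by have := allP ha x hx; case: (x).
  + rewrite -map_comp [LHS](sorted_zeros_last hp); congr (_ ++ _).
    rewrite -[LHS]map_id; apply/eq_in_map => x; rewrite mem_filter => /andP[x0 _] /=.
    by rewrite prednK// lt0n.
Qed.

Lemma count0_strip l m : count_mem 0%N (map S l ++ nseq m 0%N) = m.
Proof.
rewrite count_cat count_map count_nseq /= mul1n (eq_count (a2 := pred0))//.
by rewrite count_pred0.
Qed.

Lemma countS_strip l m i : count_mem i.+1 (map S l ++ nseq m 0%N) = count_mem i l.
Proof.
rewrite count_cat count_map count_nseq /= mul0n addn0; apply: eq_count => x /=.
by rewrite eqSS.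
Qed.

Lemma uniq_plists N n : uniq (plists N n).
Proof.
elim: N n => [//|N IH] n; rewrite plistsS; apply: allpairs_uniq_dep; first exact: iota_uniq.
  by move=> m _; exact: IH.
move=> [m l] [m' l'] /= _ _ e.
have em : m = m' by rewrite -(count0_strip l m) e count0_strip.
have hs : size (map S l) = size (map S l').
  by have := congr1 size e; rewrite -em !size_cat => /addIn.
move: e; rewrite -em => /eqP; rewrite eqseq_cat// => /andP[/eqP h _].
by rewrite (inj_map succn_inj h).
Qed.

Lemma size_sum_count N l : all (fun x => (x <= N)%N) l ->
  size l = (\sum_(0 <= i < N.+1) count_mem i l)%N.
Proof.
elim: l => [|x l IH] /=; first by rewrite big1.
move=> /andP[hx /IH ->]; rewrite big_split /= -add1n; congr (_ + _)%N.
rewrite big_mkord (bigD1 (Ordinal (hx : x < N.+1)%N))//= eqxx big1 ?addn0// => i hi.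
by rewrite -val_eqE /= eq_sym in hi; rewrite (negbTE hi).
Qed.

End PaddedPartitions.

(** * Sums over partitions with bounded largest part *)

Section TruncatedSums.
Variables (R : realFieldType) (t : R).
Hypothesis t01 : 0 < t < 1.
Implicit Types (u x y z : R) (J I K Y : seq R) (l : seq nat).

Definition wfac u m : R := hpoch t m u / HallLittlewood.v_ t m.

(** The coefficient of the symmetrized sum: the number of zeros is weighted at [u], the multiplicity
    of each positive part at [t], which reproduces the factors of [b_el] divided by those of [v],
    and odd multiplicities of positive parts are excluded. *)
Definition wt N u l : R := wfac u (count_mem 0%N l) *
  \prod_(1 <= i < N.+1) (if odd (count_mem i l) then 0 else wfac t (count_mem i l)).

Fixpoint ZR N u J : R :=
  if N is N'.+1 then \sum_(p <- splits J) (if odd (size p.2) then 0 else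
     hpoch t (size p.1) u * acr t p.2 p.1 * (\prod_(k <- p.2) k) * ZR N' t p.2)
  else hpoch t (size J) u.

(** The zeros of [l] become parts equal to 1, whose multiplicity must be even. Unless the weight
    vanishes anyway, the positive entries of [l] have even multiplicities, so the parity of that
    number is the parity of the length of [l]. *)
Lemma wt_strip N u l m : all (fun e => (e <= N)%N) l ->
  wt N.+1 u (map S l ++ nseq m 0%N) = if odd (size l) then 0 else wfac u m * wt N t l.
Proof.
move=> ha; rewrite /wt count0_strip big_nat_recl//=.
set f := fun i => if odd (count_mem i l) then 0 else wfac t (count_mem i l).
have -> : \prod_(1 <= i < N.+1) (if odd (count_mem i.+1 (map S l ++ nseq m 0%N)) then 0
    else wfac t (count_mem i.+1 (map S l ++ nseq m 0%N))) = \prod_(1 <= i < N.+1) f i.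
  by apply: eq_bigr => i _; rewrite !countS_strip.
rewrite countS_strip; have [h0|h0] := eqVneq (\prod_(1 <= i < N.+1) f i) 0.
  by rewrite h0 !mulr0 if_same.
have -> : odd (size l) = odd (count_mem 0%N l).
  rewrite (size_sum_count ha) big_ltn// oddD.
  suff -> : odd (\sum_(1 <= i < N.+1) count_mem i l) = false by rewrite addbF.
  move: h0; rewrite prodf_seq_neq0 => /allP h.
  rewrite big_seq; apply: (big_ind (fun k => odd k = false)) => // [a b ha' hb|i hi].
    by rewrite oddD ha' hb.
  by have /= := h i hi; rewrite /f; case: odd; rewrite ?eqxx.
by case: ifP => _; rewrite ?mul0r ?mulr0// mulrA.
Qed.

Lemma sum_plists_ZR N u J : uniq J -> {in J, forall x, x != 0} ->
  \sum_(l <- plists N (size J)) wt N u l * Ssum t l J = ZR N u J.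
Proof.
elim: N u J => [|N IH] u J uJ nz.
  rewrite big_seq1 /= Ssum_zeros// /wt count_nseq /= mul1n big_geq// mulr1.
  by rewrite divfK// vfact_neq0.
rewrite plistsS [RHS]/= big_allpairs_dep -[iota _ _]/(index_iota 0 (size J).+1).
transitivity (\sum_(0 <= m < (size J).+1) \sum_(p <- splits J) (if size p.1 == m then
    (if odd (size p.2) then 0 else
     hpoch t (size p.1) u * acr t p.2 p.1 * (\prod_(k <- p.2) k) * ZR N t p.2) else 0)).
  apply: eq_big_nat => m; rewrite leq0n ltnS /= => hm.
  transitivity (\sum_(l <- plists N (size J - m)) \sum_(p <- splits J) (if size p.1 == m then
    (if odd (size l) then 0 else wfac u m * wt N t l) * HallLittlewood.v_ t m * acr t p.2 p.1 *
    (\prod_(k <- p.2) k) * Ssum t l p.2 else 0)).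
    apply: eq_big_seq => l /plistsP [hs hp ha].
    rewrite Ssum_strip ?size_map ?hs ?subnK// wt_strip// mulr_sumr.
    apply: eq_big_seq => p hps; case: eqP => [h|]; last by rewrite mulr0.
    rewrite Ssum_map_succ; last by rewrite hs -(size_splits hps) h addKn.
    by rewrite hs; move: (if _ then _ else _) => c; ring.
  rewrite exchange_big; apply: eq_big_seq => p hps /=.
  case: eqP => h; last by rewrite big1.
  have hK : (size J - m = size p.2)%N by rewrite -(size_splits hps) h addKn.
  rewrite hK; case: ifP => ho.
    by rewrite big1_seq// => l /= /plistsP [-> _ _]; rewrite ho !mul0r.
  rewrite -IH; last 2 first.
  - by have := perm_uniq (splits_perm hps); rewrite uJ cat_uniq => /and3P[].
  - by move=> x hx; apply: nz; have [_ h2] := mem_splits hps; exact: h2.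
  rewrite mulr_sumr; apply: eq_big_seq => l /plistsP [hl _ _]; rewrite hl ho h.
  rewrite /wfac; have := vfact_neq0 t01 m; set v := HallLittlewood.v_ t m => v0.
  by field.
rewrite exchange_big; apply: eq_big_seq => p hps /=.
have hsz : (size p.1 < (size J).+1)%N by rewrite ltnS -(size_splits hps) leq_addr.
move: (if odd (size p.2) then _ else _) => c.
rewrite big_mkord (bigD1 (Ordinal hsz))//= eqxx big1 ?addr0// => i hi.
by rewrite -val_eqE /= eq_sym in hi; rewrite (negbTE hi).
Qed.

Lemma splits_last (T : Type) (s : seq T) : exists r, splits s = rcons r ([::], s) /\
  all (fun p => (size p.2 < size s)%N) r.
Proof.
elim: s => [|x s [r [e ha]]]; first by exists [::].
exists ([seq (x :: p.1, p.2) | p <- splits s] ++ [seq (p.1, x :: p.2) | p <- r]).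
rewrite /= {2}e map_rcons -rcons_cat; split=> //.
rewrite all_cat !all_map e all_rcons /= ltnSn /=; apply/andP; split; apply: sub_all ha => p //= h.
exact: ltnW.
Qed.

(** [V] satisfies the recursion that defines [ZR], so the error satisfies it as well. The splitting
    with empty first part multiplies the error by the product of [J], which is below 1; the other
    terms involve fewer variables and decay by induction. *)
Lemma ZR_geometric J : uniq J -> {in J, forall x, 0 < x < 1} ->
  exists rho, 0 <= rho < 1 /\ forall u, exists C, forall N, `|ZR N u J - V t u J| <= C * rho ^+ N.
Proof.
have [n] := ubnP (size J); elim: n J => // n IH J; rewrite ltnS => hn uJ hJ.
have VS u := V_strips t01 u uJ hJ.
have step u N : ZR N.+1 u J - V t u J = \sum_(p <- splits J) (if odd (size p.2) then 0 else
     hpoch t (size p.1) u * acr t p.2 p.1 * (\prod_(k <- p.2) k) * (ZR N t p.2 - V t t p.2)).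
  rewrite VS /strips -sumrB; apply: eq_bigr => p _; rewrite /stripterm.
  by case: ifP; rewrite ?subrr// mulrBr.
(* For empty [J] the product is 1 and there is no contraction, but then the error is 0. *)
have [J0|Jn0] := eqVneq J [::].
  exists 0; split=> [|u]; first by rewrite lexx ltr01.
  exists 0 => N; rewrite mul0r normr_le0 subr_eq0 J0 in VS step *; apply/eqP.
  have V1 v : V t v [::] = 1 by rewrite /V /= /pfB /pfl /= pfn0 mul1r.
  elim: N u => [|N IHN] u; first by rewrite V1.
  apply/eqP; rewrite -subr_eq0 step big_seq1 /= IHN subrr mulr0//.
have [r [er hr]] := splits_last J.
have [rho1 [/andP[rho1_ge0 rho1_lt1] hrho1]] : exists rho1, 0 <= rho1 < 1 /\
    forall c : seq R * seq R -> R, exists C, forall N,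
    `|\sum_(p <- r) c p * (ZR N t p.2 - V t t p.2)| <= C * rho1 ^+ N.
  have hrs p : p \in r -> p \in splits J by move=> hp; rewrite er mem_rcons inE hp orbT.
  have hall p : p \in r -> exists rho, 0 <= rho < 1 /\
      exists C, forall N, `|ZR N t p.2 - V t t p.2| <= C * rho ^+ N.
    move=> hp; have hps := hrs p hp.
    have [||| rho [h1 h2]] := IH p.2; last by exists rho; split => //; exact: h2.
    - by apply: leq_trans hn; exact: (allP hr).
    - by have := perm_uniq (splits_perm hps); rewrite uJ cat_uniq => /and3P[].
    - by move=> x hx; apply: hJ; have [_ h2] := mem_splits hps; exact: h2.
  elim: (r) hall => [|p r' IHr] hall.
    exists 0; split; first by rewrite lexx ltr01.
    by move=> c; exists 0 => N; rewrite big_nil normr0 mul0r.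
  have [rhoA [/andP[A0 A1] hA]] := IHr (fun q hq => hall q (mem_behead (s := p :: r') hq)).
  have [rhoB [/andP[B0 B1] [CB hB]]] := hall p (mem_head _ _).
  exists (Num.max rhoA rhoB); split; first by rewrite le_max A0 gt_max A1 B1.
  move=> c; have [CA hCA] := hA c; exists (CA + `|c p| * CB) => N.
  have CA0 : 0 <= CA by have := hCA 0%N; rewrite expr0 mulr1; exact: le_trans (normr_ge0 _).
  have CB0 : 0 <= CB by have := hB 0%N; rewrite expr0 mulr1; exact: le_trans (normr_ge0 _).
  rewrite big_cons addrC (le_trans (ler_normD _ _))// mulrDl lerD//.
    apply: le_trans (hCA N) _; apply: ler_wpM2l => //.
    by rewrite lerXn2r ?nnegrE ?le_max ?A0 ?lexx.
  rewrite normrM -mulrA ler_wpM2l//; apply: le_trans (hB N) _; apply: ler_wpM2l => //.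
  by rewrite lerXn2r ?nnegrE ?le_max ?A0 ?B0 ?lexx ?orbT.
pose rho0 := \prod_(k <- J) k.
have [rho0_ge0 rho0_lt1] : 0 <= rho0 /\ rho0 < 1.
  rewrite /rho0; case: (J) Jn0 hJ => // x Y _ hY.
  have /andP[x0 x1] := hY x (mem_head _ _).
  have [P0 P1] : 0 <= \prod_(k <- Y) k /\ \prod_(k <- Y) k <= 1.
    have hYY k : k \in Y -> 0 < k < 1 by move=> hk; rewrite hY ?inE ?hk ?orbT.
    rewrite big_seq; split; first by apply: prodr_ge0 => k /hYY /andP[/ltW].
    by apply: prodr_ile1 => k /hYY /andP[/ltW -> /ltW].
  rewrite big_cons; split; first by rewrite mulr_ge0 // ltW.
  exact: le_lt_trans (ler_piMr (ltW x0) P1) x1.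
(* [rho] lies strictly above [rho0], so that the inhomogeneous term of the recursion is absorbed by
   the constant [C1 / (rho - rho0)]. *)
pose M := Num.max rho0 rho1; pose rho := (1 + M) / 2.
have M1 : M < 1 by rewrite gt_max rho0_lt1.
have [h0M h1M] : rho0 <= M /\ rho1 <= M by rewrite !le_max !lexx orbT.
have hrho : [/\ 0 < rho, rho < 1, rho0 < rho & rho1 <= rho].
  have M0 : 0 <= M by exact: le_trans h0M.
  by rewrite /rho; split; lra.
case: hrho => [rp r1 r0r r1r].
have stepb u : exists C1, 0 <= C1 /\ forall N, `|ZR N.+1 u J - V t u J| <= rho0 * `|ZR N t J - V t t J| + C1 * rho ^+ N.
  have [C1 hC1] := hrho1 (fun p => if odd (size p.2) then 0 else hpoch t (size p.1) u * acr t p.2 p.1 * (\prod_(k <- p.2) k)).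
  have C10 : 0 <= C1 by have := hC1 0%N; rewrite expr0 mulr1; exact: le_trans (normr_ge0 _).
  exists C1; split => // N; rewrite step er -cats1 big_cat big_seq1 /= addrC.
  rewrite (le_trans (ler_normD _ _))// lerD//.
    case: ifP => _; first by rewrite normr0 mulr_ge0.
    rewrite /acr (eq_bigr (fun=> 1)) => [|k _]; last by rewrite big_nil.
    by rewrite big1_eq !mul1r normrM (ger0_norm rho0_ge0).
  rewrite (eq_bigr (fun p : seq R * seq R => (if odd (size p.2) then 0 else hpoch t (size p.1) u * acr t p.2 p.1 * (\prod_(k <- p.2) k)) * (ZR N t p.2 - V t t p.2))).
    by apply: le_trans (hC1 N) _; rewrite ler_wpM2l// lerXn2r ?nnegrE// ltW.
  by move=> p _; case: ifP; rewrite ?mul0r.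
have [C1 [C10 hC1]] := stepb t.
have d0 : 0 < rho - rho0 by rewrite subr_gt0.
pose C := `|ZR 0 t J - V t t J| + C1 / (rho - rho0).
have C0 : 0 <= C by rewrite addr_ge0// divr_ge0// ltW.
have hC : C1 <= (rho - rho0) * C.
  by rewrite /C mulrDr [_ * (C1 / _)]mulrC divfK ?gt_eqF// ler_wpDl// mulr_ge0// ltW.
have he N : `|ZR N t J - V t t J| <= C * rho ^+ N.
  elim: N => [|N IHN]; first by rewrite expr0 mulr1 /C ler_wpDr// divr_ge0// ltW.
  apply: le_trans (hC1 N) _; apply: le_trans (_ : rho0 * (C * rho ^+ N) + C1 * rho ^+ N <= _).
    by rewrite lerD2r ler_wpM2l.
  rewrite mulrA -mulrDl exprS mulrA ler_wpM2r ?exprn_ge0 ?(ltW rp)//.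
  by move: hC; rewrite mulrBl lerBrDr addrC [C * rho]mulrC.
exists rho; split; first by rewrite (ltW rp) r1.
move=> u; have [Cu [Cu0 hCu]] := stepb u.
exists (`|ZR 0 u J - V t u J| + (rho0 * C + Cu) / rho) => -[|N].
  by rewrite expr0 mulr1 ler_wpDr// divr_ge0 ?(ltW rp)// addr_ge0// mulr_ge0.
apply: le_trans (hCu N) _; have rn0 : rho != 0 by rewrite gt_eqF.
rewrite [leRHS](_ : _ = `|ZR 0 u J - V t u J| * rho ^+ N.+1 + (rho0 * C + Cu) * rho ^+ N); last first.
  by rewrite exprS; field.
rewrite -[leLHS]add0r lerD//; first by rewrite mulr_ge0// exprn_ge0// ltW.
by rewrite mulrDl lerD2r -mulrA ler_wpM2l.
Qed.

End TruncatedSums.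

(** * Absolutely convergent sums *)

Local Open Scope classical_set_scope.
Local Open Scope ring_scope.

Section RealSums.
Variables (R : realType) (I : choiceType).
Implicit Types (f g h : I -> R) (s : seq I).

Lemma esum_le_bound h (M : R) : (forall s, uniq s -> \sum_(i <- s) h i <= M) ->
  (\esum_(i in [set: I]) (h i)%:E <= M%:E)%E.
Proof.
move=> hM; apply: ub_ereal_sup => _ [X [finX _] <-].
rewrite fsbig_finite// sumEFin lee_fin; apply: hM; exact: finmap.fset_uniq.
Qed.

Lemma seq_le_esum h s : (forall i, 0 <= h i) -> uniq s ->
  ((\sum_(i <- s) h i)%:E <= \esum_(i in [set: I]) (h i)%:E)%E.
Proof.
move=> h0 us; apply: esum_ge; exists [set` s].
  by split=> //; exact: finite_seq.
by rewrite -fsbig_seq// sumEFin.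
Qed.

Lemma rsummable_bound f (M : R) : (forall s, uniq s -> \sum_(i <- s) `|f i| <= M) -> rsummable f.
Proof. by move=> hM; apply: le_lt_trans (esum_le_bound hM) (ltry _). Qed.

Lemma rsummable_seq_bound f : rsummable f ->
  exists M, forall s, uniq s -> \sum_(i <- s) `|f i| <= M.
Proof.
move=> hf; exists (fine (\esum_(i in [set: I]) `|f i|%:E)%E) => s us.
rewrite -lee_fin fineK; first exact: seq_le_esum.
by rewrite ge0_fin_numE ?esum_ge0.
Qed.

Lemma rsummable_le f g : (forall i, `|f i| <= `|g i|) -> rsummable g -> rsummable f.
Proof.
move=> hfg /rsummable_seq_bound [M hM]; apply: (rsummable_bound (M := M)) => s us.
apply: le_trans (hM s us); exact: ler_sum.
Qed.

Let fine_esum_approx g e : (forall i, 0 <= g i) -> rsummable g -> 0 < e ->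
  exists A : seq I, forall h B, (forall i, 0 <= h i <= g i) -> uniq B -> {subset A <= B} ->
    \sum_(i <- B) h i <= fine (\esum_(i in [set: I]) (h i)%:E)%E <= \sum_(i <- B) h i + e.
Proof.
move=> g0 hg e0; set G := (\esum_(i in [set: I]) (g i)%:E)%E.
have Gfin : G \is a fin_num.
  rewrite ge0_fin_numE ?esum_ge0// => [|i _]; last by rewrite lee_fin.
  by move: hg; rewrite /rsummable /summable; under eq_esum => i _ do rewrite /= ger0_norm//.
have [_ [X [finX _] <-]] := ub_ereal_sup_adherent e0 Gfin.
rewrite fsbig_finite// sumEFin -/(esum _ _) -/G -(fineK Gfin) -EFinB lte_fin => hA.
have := finmap.fset_uniq (fset_set X); move: (finmap.enum_fset _) hA => A hA uA.
exists A => h B hh uB sAB.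
have h0 i : 0 <= h i by case/andP: (hh i).
have up : forall s, uniq s -> \sum_(i <- s) h i <= \sum_(i <- B) h i + e.
  move=> s us; rewrite (bigID (mem B))/=; apply: lerD.
    rewrite -big_filter; have hf : uniq [seq i <- s | i \in B] by exact: filter_uniq.
    rewrite [leRHS](bigID (mem s))/= -[X in X <= _]addr0 lerD ?sumr_ge0//.
    rewrite -[leRHS]big_filter le_eqVlt; apply/orP; left; apply/eqP/perm_big.
    by apply: uniq_perm; rewrite ?filter_uniq// => i; rewrite !mem_filter andbC.
  apply: le_trans (_ : \sum_(i <- s | i \notin B) g i <= _).
    by apply: ler_sum => i _; case/andP: (hh i).
  have : \sum_(i <- B ++ [seq i <- s | i \notin B]) g i <= fine G.
    rewrite -lee_fin (fineK Gfin); apply: seq_le_esum => //.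
    rewrite cat_uniq uB filter_uniq// andbT; apply/hasPn => i; by rewrite mem_filter => /andP[].
  rewrite big_cat big_filter /=; have : \sum_(i <- A) g i <= \sum_(i <- B) g i.
    rewrite [leRHS](bigID (mem A))/= -[leLHS]addr0 lerD ?sumr_ge0//.
    rewrite -[leRHS]big_filter le_eqVlt; apply/orP; left; apply/eqP/perm_big.
    apply: uniq_perm; rewrite ?filter_uniq// => i; rewrite mem_filter.
    by case: (boolP (i \in A)) => // /sAB ->.
  by move: hA; lra.
have hfin : (\esum_(i in [set: I]) (h i)%:E)%E \is a fin_num.
  rewrite ge0_fin_numE; last by apply: esum_ge0 => i _; rewrite lee_fin.
  exact: le_lt_trans (esum_le_bound up) (ltry _).
apply/andP; split; first by rewrite -lee_fin (fineK hfin) seq_le_esum.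
by rewrite -lee_fin (fineK hfin) esum_le_bound.
Qed.

(** [A] is chosen for the majorant [g] alone, so that one finite set serves all families dominated
    by [g]; dominated convergence follows from this uniformity. *)
Lemma rsum_approx g e : rsummable g -> 0 < e ->
  exists A : seq I, forall f B, (forall i, `|f i| <= g i) -> uniq B -> {subset A <= B} ->
    `|rsum f - \sum_(i <- B) f i| <= e.
Proof.
move=> hg e0.
have hg' : rsummable (fun i => `|g i|) by apply: rsummable_le hg => i; rewrite normr_id.
have [A hA] := fine_esum_approx (fun i => normr_ge0 (g i)) hg' e0.
exists A => f B hfg uB sAB.
have hp := hA (fun i => Num.max (f i) 0) B _ uB sAB.
have hn := hA (fun i => Num.max (- f i) 0) B _ uB sAB.
rewrite /rsum.
have -> : (\esum_(i in [set: I]) ((EFin \o f)^\+ i) = \esum_(i in [set: I]) (Num.max (f i) 0)%:E)%E.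
  by apply: eq_esum => i _; rewrite funeposE /= EFin_max.
have -> : (\esum_(i in [set: I]) ((EFin \o f)^\- i) = \esum_(i in [set: I]) (Num.max (- f i) 0)%:E)%E.
  by apply: eq_esum => i _; rewrite funenegE /= EFin_max.
have -> : \sum_(i <- B) f i = \sum_(i <- B) Num.max (f i) 0 - \sum_(i <- B) Num.max (- f i) 0.
  rewrite -sumrB; apply: eq_bigr => i _.
  by case: (ltrP (f i) 0); case: (ltrP (- f i) 0); lra.
have hb i : 0 <= Num.max (f i) 0 <= `|g i|.
  rewrite le_max lexx orbT ge_max normr_ge0 andbT.
  exact: le_trans (ler_norm _) (le_trans (hfg i) (ler_norm _)).
have hb' i : 0 <= Num.max (- f i) 0 <= `|g i|.
  rewrite le_max lexx orbT ge_max normr_ge0 andbT.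
  by apply: le_trans (ler_norm _) (le_trans _ (ler_norm _)); rewrite normrN.
move: (hp hb) (hn hb'); set P := fine _; set N := fine _; set SP := \sum_(i <- B) _; set SN := \sum_(i <- B) _.
move=> /andP[p1 p2] /andP[n1 n2]; rewrite ler_norml; apply/andP; split; lra.
Qed.

(** The sets [B N] need only reach the indices with nonzero term: partitions with more than [n]
    parts carry no mass and are never enumerated. *)
Lemma rsum_cvg f (B : nat -> seq I) : rsummable f -> (forall N, uniq (B N)) ->
  (forall i, f i != 0 -> \forall N \near \oo, i \in B N) ->
  (\sum_(i <- B N) f i) @[N --> \oo] --> rsum f.
Proof.
move=> hf uB hB; apply/cvgrPdist_le => e e0.
have [A hA] := rsum_approx hf e0.
have hf' : rsummable (fun i => `|f i|) by apply: rsummable_le hf => i; rewrite normr_id.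
have [A' {}hA] := rsum_approx hf' e0.
have hnear : \forall N \near \oo, {subset [seq i <- A' | f i != 0] <= B N}.
  elim: (A') => [|i s IH] /=; first by near=> N.
  case: ifPn => hi //; have := hB i hi => h1.
  near=> N => j; rewrite inE => /orP[/eqP ->|]; first by near: N.
  by move: j; near: N.
near=> N.
(* The indices of [A'] added to [B N] have zero terms, hence change no sum. *)
pose C := B N ++ [seq i <- undup A' | (f i == 0) && (i \notin B N)].
have uC : uniq C.
  rewrite cat_uniq uB filter_uniq ?undup_uniq// andbT; apply/hasPn => i.
  by rewrite mem_filter => /andP[/andP[]].
have eC : \sum_(i <- C) f i = \sum_(i <- B N) f i.
  rewrite /C big_cat /= [X in _ + X]big1_seq ?addr0//.
  by move=> i /=; rewrite mem_filter => /andP[/andP[/eqP ->]].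
rewrite -eC; apply: hA => // i hi; rewrite /C; rewrite mem_cat mem_filter mem_undup hi andbT.
case: (boolP (i \in B N)) => //= hn; rewrite andbT; apply/negPn/negP => f0.
case/negP: hn; have : {subset [seq i <- A' | f i != 0] <= B N} by near: N.
by apply; rewrite mem_filter f0.
Unshelve. all: by end_near. Qed.

Lemma cvg_sum_seq (T : Type) (s : seq T) (f_ : nat -> T -> R) (f : T -> R) :
  (forall i, f_ m i @[m --> \oo] --> f i) ->
  (\sum_(i <- s) f_ m i) @[m --> \oo] --> \sum_(i <- s) f i.
Proof.
move=> h; elim: s => [|i s IH].
  by rewrite big_nil; under eq_fun do rewrite big_nil; exact: cvg_cst.
by rewrite big_cons; under eq_fun do rewrite big_cons; exact: cvgD.
Qed.

Lemma rsum_dominated (f_ : nat -> I -> R) f g : rsummable g ->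
  (forall i, `|f i| <= g i) -> (forall i, f_ m i @[m --> \oo] --> f i) ->
  (forall m i, `|f_ m i| <= g i) ->
  rsum (f_ m) @[m --> \oo] --> rsum f.
Proof.
move=> hg hf hcv hfm; apply/cvgrPdist_le => e e0.
have e3 : 0 < e / 3 by rewrite divr_gt0.
have [A hA] := rsum_approx hg e3.
have sub : {subset A <= undup A} by move=> i; rewrite mem_undup.
have h1 := hA f (undup A) hf (undup_uniq A) sub.
have hc : (\sum_(i <- undup A) f_ m i) @[m --> \oo] --> \sum_(i <- undup A) f i.
  exact: cvg_sum_seq.
near=> m; have h2 := hA (f_ m) (undup A) (hfm m) (undup_uniq A) sub.
have h3 : `|\sum_(i <- undup A) f i - \sum_(i <- undup A) f_ m i| <= e / 3.
  by near: m; move/cvgrPdist_le: hc; exact.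
move: h1 h2 h3; rewrite !ler_norml => /andP[a1 a2] /andP[b1 b2] /andP[c1 c2].
by apply/andP; split; lra.
Unshelve. all: by end_near. Qed.

End RealSums.

(** * The half-space Hall-Littlewood expectation *)

Section SchurPfaffian.
Variables (R : realFieldType) (t : R).
Implicit Types (x y z : R) (s : seq R).

Fixpoint sprod s : R :=
  if s is x :: s' then (\prod_(y <- s') ((x - y) / (1 - x * y))) * sprod s' else 1.

Fixpoint pairprod (G : R -> R -> R) s : R :=
  if s is x :: s' then (\prod_(y <- s') G x y) * pairprod G s' else 1.

Lemma pairprod_codom G n (a : 'I_n -> R) :
  pairprod G (codom a) = \prod_(i < n) \prod_(j < n | (i < j)%N) G (a i) (a j).
Proof.
elim: n a => [|n IH] a.
  by rewrite big_ord0 (size0nil (_ : size (codom a) = 0%N)) ?size_codom ?card_ord.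
have -> : codom a = a ord0 :: codom (a \o lift ord0).
  by rewrite /codom /image_mem enum_ordSl /= -map_comp.
rewrite /= IH big_ord_recl; congr (_ * _).
  rewrite big_map big_enum /= [RHS]big_mkcond [RHS]big_ord_recl /= mul1r.
  exact: eq_bigr.
apply: eq_bigr => i _; rewrite [RHS]big_mkcond [RHS]big_ord_recl /= mul1r -big_mkcond.
by apply: eq_bigl.
Qed.

(** Eliminating the pair [x], [y] leaves the same kernel on the remaining points, with rows and
    columns scaled by [c]; the scalings collect the factors involving [x] and [y]. *)
Lemma schur_pfaffian s : ~~ odd (size s) -> uniq s -> {in s, forall x, 0 < x < 1} ->
  pfl None (Bk t 0) (map Some s) = sprod s.
Proof.
have [n] := ubnP (size s); elim: n s => // n IH [|x [|y s]] //.
  by move=> _ _ _ _; rewrite /pfl /= pfn0.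
rewrite ltnS /= negbK => hn ho us h01.
have hx := h01 x (mem_head _ _); have hy := h01 y (mem_behead (s := [:: x, y & s]) (mem_head _ _)).
have hs z : z \in s -> 0 < z < 1 by move=> hz; apply: h01; rewrite !inE hz !orbT.
have us' : uniq s by case/and3P: us.
have xy : x - y != 0 by rewrite subr_eq0; move: us; rewrite inE negb_or => /andP[/andP[]].
have n1 z w : 0 < z < 1 -> 0 < w < 1 -> 1 - z * w != 0.
  move=> /andP[z0 z1] /andP[w0 w1]; rewrite gt_eqF// subr_gt0 mulr_ilt1 ?ltW//.
have hB z w : Bk t 0 (Some z) (Some w) = (z - w) / (1 - z * w) by rewrite /= mul0r subr0.
rewrite /pfl [size _]/= size_map /= pfn_reduce; last 2 first.
- by move=> i j; rewrite Bk_anti.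
- by rewrite hB mulf_neq0// invr_neq0// n1.
pose c z := (x - z) * (y - z) / ((1 - x * z) * (1 - y * z)).
rewrite !big_cons [nth _ _ 0]/= [nth _ _ 1]/= hB -[RHS]mulrA; congr (_ * _).
rewrite [pfn _ _](@eq_pfn _ _ _ (fun i j => c (nth 0 s i) *
    Bk t 0 (nth None (map Some s) i) (nth None (map Some s) j) * c (nth 0 s j))); last first.
  move=> i j; rewrite (_ : (size s)./2.*2 = size s); last first.
    by rewrite -[RHS]odd_double_half (negbTE ho).
  move=> hi hj; rewrite [nth _ (_ :: _) i.+2]/= [nth _ (_ :: _) j.+2]/=.
  rewrite !(nth_map 0)// !hB.
  have hi' := hs _ (mem_nth 0 hi); have hj' := hs _ (mem_nth 0 hj).
  by rewrite /c; field; rewrite xy !n1.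
rewrite pfn_scale -/(pfl None (Bk t 0) (map Some s)).
rewrite (_ : pfn _ _ = pfl None (Bk t 0) (map Some s)); last by rewrite /pfl size_map.
rewrite IH// ?(leq_trans _ hn)// mulrA; congr (_ * _).
have -> : (size s)./2.*2 = size s by rewrite -[RHS]odd_double_half (negbTE ho).
rewrite -(big_mkord xpredT (fun i => c (nth 0 s i))) -(big_nth 0 xpredT c) -big_split /=.
by apply: eq_bigr => z _; rewrite /c invfM; ring.
Qed.

Lemma V0_pairprod s : ~~ odd (size s) -> uniq s -> {in s, forall x, 0 < x < 1} ->
  V t 0 s = pairprod (fun x y => (1 - t * x * y) / (1 - x * y)) s.
Proof.
move=> ho us h01; rewrite /V /pad (negbTE ho) cats0 /pfB schur_pfaffian//.
elim: s us h01 {ho} => [|x s IH] us h01; first by rewrite /= mulr1.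
have hs z : z \in s -> 0 < z < 1 by move=> hz; apply: h01; rewrite !inE hz !orbT.
case/andP: us => xs us; rewrite /= -IH// mulrACA -big_split /=; congr (_ * _).
apply: eq_big_seq => y hy.
have xy : x - y != 0 by rewrite subr_eq0; apply: contraNneq xs => ->.
by rewrite mulf_div [_ * (x - y)]mulrC -mulf_div divff// mul1r.
Qed.

End SchurPfaffian.

Lemma geometric_sum_le (R : realFieldType) (q : R) N : 0 <= q < 1 ->
  \sum_(0 <= i < N) q ^+ i <= (1 - q)^-1.
Proof.
move=> /andP[q0 q1]; have h : \sum_(0 <= i < N) q ^+ i * (1 - q) = 1 - q ^+ N.
  elim: N => [|N IH]; first by rewrite big_nil expr0 subrr.
  by rewrite big_nat_recr//= IH exprS; ring.
by rewrite -[leRHS]div1r ler_pdivlMr ?subr_gt0// mulr_suml h gerBl exprn_ge0.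
Qed.

(** * Infinite q-Pochhammer symbols at nonpositive arguments *)

Section QPochhammer.
Variable R : realType.
Implicit Types (b q : R).

Let partial b q N : R := \prod_(0 <= i < N) (1 - b * q ^+ i).

Let factor_ge1 b q i : b <= 0 -> 0 < q < 1 -> 1 <= 1 - b * q ^+ i.
Proof.
move=> b0 /andP[q0 q1]; by rewrite lerBrDr gerDl mulr_le0_ge0 ?exprn_ge0 ?(ltW q0).
Qed.

Let partial_ge1 b q N : b <= 0 -> 0 < q < 1 -> 1 <= partial b q N.
Proof.
move=> b0 hq; apply: (big_ind (fun z => 1 <= z)) => // [x y hx hy|i _]; first exact: mulr_ege1.
exact: factor_ge1.
Qed.

Let partial_le b q N : b <= 0 -> 0 < q < 1 -> partial b q N <= expR (- b / (1 - q)).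
Proof.
move=> b0 hq; have /andP[q0 q1] := hq.
have : partial b q N <= expR (\sum_(0 <= i < N) (- b * q ^+ i)).
  rewrite expR_sum /partial; apply: ler_prod => i _.
  by rewrite (le_trans ler01 (factor_ge1 i b0 hq)) /= (le_trans _ (expR_ge1Dx _))// mulNr.
move=> /le_trans; apply; rewrite ler_expR -mulr_sumr ler_wpM2l ?oppr_ge0//.
by rewrite geometric_sum_le// (ltW q0).
Qed.

Lemma qpoch_cvg b q : b <= 0 -> 0 < q < 1 -> cvgn (partial b q).
Proof.
move=> b0 hq; apply: nondecreasing_is_cvgn.
  apply/nondecreasing_seqP => N; rewrite /partial big_nat_recr//=.
  by rewrite ler_peMr ?factor_ge1// (le_trans ler01)// partial_ge1.
by exists (expR (- b / (1 - q))) => _ [N _ <-]; exact: partial_le.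
Qed.

Lemma qpoch_inf_ge1 b q : b <= 0 -> 0 < q < 1 -> 1 <= qpoch_inf b q.
Proof.
move=> b0 hq; apply: limr_ge; first exact: qpoch_cvg.
by near=> N; exact: partial_ge1.
Unshelve. all: by end_near. Qed.

Lemma qpoch_inf_le b q : b <= 0 -> 0 < q < 1 -> qpoch_inf b q <= expR (- b / (1 - q)).
Proof.
move=> b0 hq; apply: limr_le; first exact: qpoch_cvg.
by near=> N; exact: partial_le.
Unshelve. all: by end_near. Qed.

Lemma qpoch_inf_step b q : b <= 0 -> 0 < q < 1 -> qpoch_inf b q = (1 - b) * qpoch_inf (b * q) q.
Proof.
move=> b0 hq; have bq0 : b * q <= 0 by case/andP: hq => q0 _; rewrite mulr_le0_ge0// ltW.
apply/cvg_lim => //; rewrite -cvg_shiftS /=.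
have -> : (fun N => partial b q N.+1) = (fun N => (1 - b) * partial (b * q) q N).
  apply/funext => N; rewrite /partial big_nat_recl//= expr0 mulr1; congr (_ * _).
  by apply: eq_bigr => i _; rewrite exprS mulrA.
apply: cvgMr; exact: qpoch_cvg.
Unshelve. all: by end_near. Qed.

End QPochhammer.

(** * Sums of product weights over tuples *)

Section FiniteFunctionSums.
Variables (R : realFieldType) (h : nat -> R) (M : R).
Hypotheses (h0 : forall j, 0 <= h j) (hM : forall N, \sum_(0 <= j < N) h j <= M).

Lemma ler_sum_uniq_seq (T : finType) (F : T -> R) (s : seq T) : uniq s -> (forall x, 0 <= F x) ->
  \sum_(x <- s) F x <= \sum_x F x.
Proof.
move=> us F0; rewrite big_uniq//= [leRHS](bigID (mem s))/= lerDl.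
by apply: sumr_ge0.
Qed.

(** A finite list of tuples involves finitely many values, so that its sum is part of the expansion
    of a [k]-th power. *)
Lemma sum_ffun_prod_le k (s : seq {ffun 'I_k -> nat}) : uniq s ->
  \sum_(x <- s) \prod_(i < k) h (x i) <= M ^+ k.
Proof.
move=> us; have M0 : 0 <= M by have := hM 0; rewrite big_nil.
pose N := (\max_(x <- s) \max_(i < k) x i)%N.
have hN x i : x \in s -> (x i < N.+1)%N.
  move=> hx; rewrite ltnS; apply: (@leq_trans (\max_(i < k) x i)%N).
    exact: (leq_bigmax (F := fun i => x i)).
  by apply: (@leq_bigmax_seq _ s xpredT (fun y : {ffun 'I_k -> nat} => \max_(i < k) y i)%N).
pose phi (x : {ffun 'I_k -> nat}) : {ffun 'I_k -> 'I_N.+1} := [ffun i => inord (x i)].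
have -> : \sum_(x <- s) \prod_(i < k) h (x i) = \sum_(y <- map phi s) \prod_(i < k) h (y i).
  rewrite big_map; apply: eq_big_seq => x hx; apply: eq_bigr => i _.
  by rewrite ffunE inordK ?hN.
apply: le_trans (ler_sum_uniq_seq _ _) _.
- rewrite map_inj_in_uniq// => x y hx hy /ffunP e; apply/ffunP => i.
  by have := congr1 val (e i); rewrite !ffunE /= !inordK ?hN.
- by move=> y; apply: prodr_ge0.
rewrite -(bigA_distr_bigA (fun (i : 'I_k) (j : 'I_N.+1) => h j)) prodr_const card_ord.
rewrite lerXn2r ?nnegrE ?sumr_ge0//.
by rewrite -(big_mkord xpredT h).
Qed.

End FiniteFunctionSums.

(** * The expectation for distinct parameters and its continuity *)

Section HalfSpaceExpectation.
Variables (R : realType) (t x : R) (n : nat).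
Hypotheses (t01 : 0 < t < 1) (even_n : ~~ odd n).
Implicit Types (lam : intpartition) (a : 'I_n -> R) (y : R).

Definition gq y : R := qpoch_inf (- t `^ y) (t ^+ 2).

Let t0 : 0 < t. Proof. by case/andP: t01. Qed.
Let t1 : t < 1. Proof. by case/andP: t01. Qed.
Let npow_le0 y : - t `^ y <= 0. Proof. by rewrite oppr_le0 powR_ge0. Qed.

Let tt01 : 0 < t ^+ 2 < 1.
Proof. by rewrite exprn_gt0// exprn_ilt1// ltW. Qed.

Lemma gq_ge1 y : 1 <= gq y.
Proof. exact: qpoch_inf_ge1. Qed.

Lemma gq_neq0 y : gq y != 0.
Proof. by rewrite gt_eqF// (lt_le_trans ltr01)// gq_ge1. Qed.

Lemma powR_add_nat y k : t `^ (y + k%:R) = t `^ y * t ^+ k.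
Proof. by rewrite powRD ?(gt_eqF t0) ?implybT// powR_mulrn// ltW. Qed.

Lemma gq_step y : gq y = (1 + t `^ y) * gq (y + 2).
Proof.
by rewrite /gq (qpoch_inf_step (npow_le0 y) tt01) opprK mulNr -(powR_add_nat y 2).
Qed.

Lemma hpoch_double k u : hpoch t k.*2 u = \prod_(0 <= i < k) (1 - u * t ^+ i.*2).
Proof.
elim: k u => [|k IH] u; first by rewrite big_nil.
rewrite doubleS /= odd_double /= mul1r IH big_nat_recl//= expr0 mulr1; congr (_ * _).
by apply: eq_bigr => i _; rewrite doubleS !exprS !mulrA.
Qed.

Lemma gq_hpoch y k : hpoch t k.*2 (- t `^ y) * gq (y + k.*2%:R) = gq y.
Proof.
elim: k y => [|k IH] y; first by rewrite /= mul1r addr0.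
rewrite [RHS]gq_step -(IH (y + 2)) !hpoch_double [RHS]mulrA; congr (_ * _).
  rewrite big_nat_recl//= expr0 mulr1 opprK; congr (_ * _); apply: eq_bigr => i _.
  by rewrite (powR_add_nat y 2) !mulNr -mulrA -exprD.
by rewrite -addrA -natrD doubleS.
Qed.

Definition HLF lam : R := (qpoch_inf (- t `^ (x + n%:R - (plength lam)%:R)) (t ^+ 2))^-1.

(** Both [n] and the length are even, so g(x + n - l) arises from g(x) by removing finitely many
    factors. The observable thus becomes, up to g(x), the weight at [u = - t^x] of the number of
    zero parts. *)
Lemma HLF_hpoch lam : (size lam <= n)%N -> ~~ odd (size lam) ->
  HLF lam = hpoch t (n - size lam) (- t `^ x) / gq x.
Proof.
move=> hl ho; have e : (n - size lam = (n - size lam)./2.*2)%N.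
  by rewrite -[LHS]odd_double_half oddB// (negbTE even_n) (negbTE ho).
rewrite /HLF -/(gq _) /plength -addrA -natrB//.
have := gq_hpoch x (n - size lam)./2; rewrite -e => <-; rewrite invfM mulrA divff ?mul1r//.
rewrite e hpoch_double prodf_seq_neq0; apply/allP => i _ /=; rewrite mulNr opprK gt_eqF//.
by rewrite ltr_pwDl// mulr_ge0 ?powR_ge0// exprn_ge0// ltW.
Qed.

Definition padp lam : seq nat := lam ++ nseq (n - size lam) 0%N.

Lemma partP lam : sorted geq lam /\ 0%N \notin (lam : seq nat).
Proof. by case: lam => s /= /andP[]. Qed.

Lemma part_le_head lam i : i \in (lam : seq nat) -> (i <= head 0%N lam)%N.
Proof.
have [hs _] := partP lam; case: (parts lam) hs => // e l /= hp; rewrite inE => /orP[/eqP ->//|hi].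
have := order_path_min geq_trans hp => /allP /(_ i hi); exact.
Qed.

Lemma padp_plists lam N : (size lam <= n)%N -> (head 0%N lam <= N)%N -> padp lam \in plists N n.
Proof.
move=> hl hN; apply/plistsP; split.
- by rewrite size_cat size_nseq subnKC.
- rewrite pairwise_cat -sorted_pairwise; last exact: geq_trans.
  have [-> _] := partP lam; apply/and3P; split => //.
    by apply/allrelP => i j _; rewrite mem_nseq => /andP[_ /eqP ->].
  by elim: (n - _)%N => //= k ->; rewrite all_nseq orbT.
- rewrite all_cat all_nseq orbT andbT; apply/allP => i hi.
  exact: leq_trans (part_le_head hi) hN.
Qed.

Lemma count0_padp lam : count_mem 0%N (padp lam) = (n - size lam)%N.
Proof.
have [_ h] := partP lam; rewrite count_cat count_nseq /= mul1n.
by rewrite (count_memPn h).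
Qed.

Lemma countS_padp lam i : (0 < i)%N -> count_mem i (padp lam) = mult lam i.
Proof.
by move=> hi; rewrite count_cat count_nseq /= eq_sym (gtn_eqF hi) mul0n addn0.
Qed.

Lemma count_leq_succ (l : seq nat) i : count (leq i) l = (count_mem i l + count (leq i.+1) l)%N.
Proof. by elim: l => //= e l ->; case: (ltngtP i e) => _ /=; lia. Qed.

(** Column lengths are tail sums of the multiplicities: differences of consecutive columns give one
    direction, summation downwards from the last column the other. *)
Lemma ptranspose_evenE lam : ptranspose_even lam =
  all (fun i => ~~ odd (mult lam i)) (iota 1 (head 0%N lam)).
Proof.
rewrite /ptranspose_even /ptranspose all_map; set m := head 0%N lam.
have hend : count (leq m.+1) lam = 0%N.
  apply/eqP; rewrite -leqn0 leqNgt -has_count; apply/hasPn => e he /=.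
  by rewrite -leqNgt part_le_head.
apply/allP/allP => h i hi.
  rewrite mem_iota add1n ltnS in hi; case/andP: hi => i1 im.
  have h1 : ~~ odd (count (leq i) lam) by apply: (h i); rewrite mem_iota add1n ltnS i1.
  have h2 : ~~ odd (count (leq i.+1) lam).
    have [e|im'] := eqVneq i m; first by rewrite e hend.
    by apply: (h i.+1); rewrite mem_iota add1n ltnS /= ltn_neqAle im'.
  by move: h1; rewrite count_leq_succ oddD (negbTE h2) addbF.
rewrite mem_iota add1n ltnS in hi; case/andP: hi => i1 im /=.
have key : forall d j, (0 < j)%N -> (j + d = m.+1)%N -> ~~ odd (count (leq j) lam).
  elim=> [|d IH] j j0 hj; first by rewrite addn0 in hj; rewrite hj hend.
  rewrite count_leq_succ oddD negb_add (negbTE (IH j.+1 _ _)) ?addSnnS//.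
  by rewrite eqbF_neg; apply: h; rewrite mem_iota add1n ltnS j0; lia.
by apply: (key (m.+1 - i)%N) => //; rewrite subnKC// ltnW.
Qed.

Lemma even_size lam : ptranspose_even lam -> ~~ odd (size lam).
Proof.
rewrite /ptranspose_even /ptranspose; have [_ h0] := partP lam.
case e : (head 0%N lam) => [|m].
  by case: (parts lam) h0 e => //= i l; rewrite inE negb_or => /andP[/eqP h _] e; case: h.
rewrite /= => /andP[h _]; move: h; congr (~~ odd _).
by apply/eqP; rewrite -all_count; apply/allP => i hi; rewrite lt0n; apply: contraNneq h0 => <-.
Qed.

Lemma b_el_wfac lam : ptranspose_even lam ->
  b_el t lam / (\prod_(1 <= i < (head 0%N lam).+1) HallLittlewood.v_ t (mult lam i)) =
  \prod_(1 <= i < (head 0%N lam).+1) wfac t t (mult lam i).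
Proof.
rewrite ptranspose_evenE => /allP h; rewrite /b_el -prodf_div.
rewrite !big_seq; apply: eq_bigr => i; rewrite mem_index_iota => hi; rewrite /wfac; congr (_ / _).
have ho : ~~ odd (mult lam i) by apply: h; rewrite mem_iota add1n.
have e : mult lam i = (mult lam i)./2.*2 by rewrite -[LHS]odd_double_half (negbTE ho).
rewrite [in RHS]e hpoch_double big_add1 /=; apply: eq_bigr => k _.
by rewrite exprS.
Qed.

Lemma wt_padp lam N u : (head 0%N lam <= N)%N ->
  wt t N u (padp lam) = wfac t u (n - size lam) *
    (if ptranspose_even lam then \prod_(1 <= i < (head 0%N lam).+1) wfac t t (mult lam i) else 0).
Proof.
move=> hN; rewrite /wt count0_padp; congr (_ * _).
rewrite (big_cat_nat (n := (head 0%N lam).+1))//= [X in _ * X]big1_seq ?mulr1; last first.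
  move=> i /=; rewrite mem_index_iota => /andP[hi _]; rewrite countS_padp ?(leq_trans _ hi)//.
  have -> : mult lam i = 0%N.
    by apply/count_memPn; apply: contraTN hi => /part_le_head; rewrite -leqNgt.
  by rewrite /= /wfac /= /HallLittlewood.v_ big_nil divr1.
rewrite ptranspose_evenE; case: ifPn => [/allP h|/allPn [i hi ho]].
  rewrite !big_seq; apply: eq_bigr => i; rewrite mem_index_iota => hi; case/andP: (hi) => i1 _.
  rewrite countS_padp// ifF//; apply/negbTE; apply: h; by rewrite mem_iota add1n.
rewrite (bigD1_seq i) ?iota_uniq//=; last by rewrite mem_index_iota; rewrite mem_iota add1n in hi.
have i1 : (0 < i)%N by move: hi; rewrite mem_iota => /andP[].
by rewrite countS_padp// (negbNE ho) mul0r.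
Qed.

Lemma HL_P_eval_Ssum lam a : injective a -> (size lam <= n)%N ->
  HallLittlewood.HL_P_eval t lam a = (HallLittlewood.v n t lam)^-1 * Ssum t (padp lam) (codom a).
Proof.
move=> ainj hl; rewrite /HallLittlewood.HL_P_eval /HallLittlewood.HL_P hl.
rewrite mpoly.mevalZ HLPolynomial.HL_R_eval//; congr (_ * _).
rewrite -(@perm_sum_Ssum _ _ _ a (padp lam)) ?size_cat ?size_nseq ?subnKC//.
apply: eq_bigr => w _; congr (_ * _); apply: eq_bigr => i _; congr (_ ^+ _).
rewrite /part /padp nth_cat; case: ltnP => // h; rewrite nth_nseq if_same nth_default//.
Qed.

(** Probability times observable, rewritten as the term summed by [ZR]. The bound [N] is arbitrary
    because the parts that do not occur have weight 1. *)
Lemma HL_term_distinct lam a N : injective a -> (head 0%N lam <= N)%N ->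
  HL_prob t a lam * HLF lam = (HL_Phi t a)^-1 / gq x *
   (if (size lam <= n)%N then wt t N (- t `^ x) (padp lam) * Ssum t (padp lam) (codom a) else 0).
Proof.
move=> ainj hN; rewrite /HL_prob; case: ifP => hl; last first.
  rewrite /HallLittlewood.HL_P_eval /HallLittlewood.HL_P hl mpoly.meval0; ring.
rewrite HL_P_eval_Ssum// wt_padp//; case: ifP => he; last by rewrite !(mulr0, mul0r).
rewrite HLF_hpoch ?even_size// -b_el_wfac// /HallLittlewood.v /wfac /plength invfM.
rewrite -[true%:R]/(1 : R) mulr1; move: (\prod_(_ <= i < _) _)^-1 (Ssum _ _ _) (b_el _ _) (hpoch _ _ _) => A B C D.
by set G := (\prod_(_ <= i < _) _)^-1; ring.
Qed.

Definition topart (l : seq nat) : intpartition :=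
  insubd (@IntPartition [::] isT) [seq i <- l | i != 0%N].

Lemma topart_val N l : l \in plists N n -> topart l = [seq i <- l | i != 0%N] :> seq nat.
Proof.
move=> /plistsP[_ hp _]; rewrite /topart val_insubd /is_partition mem_filter eqxx /= andbT.
by rewrite sorted_pairwise ?pairwise_filter//; exact: geq_trans.
Qed.

Lemma topart_size N l : l \in plists N n -> (size (topart l) <= n)%N.
Proof.
move=> hl; rewrite (topart_val hl) size_filter; case/plistsP: hl => <- _ _; exact: count_size.
Qed.

Lemma topart_head N l : l \in plists N n -> (head 0%N (topart l) <= N)%N.
Proof.
move=> hl; rewrite (topart_val hl); case/plistsP: hl => _ _ /allP h.
case e : [seq i <- l | i != 0%N] => [//|i s] /=; apply: h.
have : i \in [seq i <- l | i != 0%N] by rewrite e mem_head.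
by rewrite mem_filter => /andP[].
Qed.

Lemma padp_topart N l : l \in plists N n -> padp (topart l) = l.
Proof.
move=> hl; rewrite /padp (topart_val hl); case/plistsP: hl => sl hp _.
rewrite [RHS](sorted_zeros_last hp); congr (_ ++ nseq _ _).
by rewrite size_filter -sl -(count_predC (fun i => i != 0%N) l) addKn; apply: eq_count => i /=; rewrite negbK.
Qed.

Lemma padpK lam : topart (padp lam) = lam.
Proof.
have [hs h0] := partP lam.
have e : [seq i <- padp lam | i != 0%N] = lam.
  rewrite /padp filter_cat [X in _ ++ X](_ : _ = [::]) ?cats0; last by elim: (n - _)%N.
  by apply/all_filterP/allP => i hi; apply: contraNneq h0 => <-.
by apply: val_inj; rewrite /topart val_insubd e /is_partition hs h0.
Qed.

(** Summability allows the expectation to be computed along the partitions with at most [n] parts,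
    all of size at most [N]. These partial sums are [ZR] up to a constant, and [ZR] converges to
    [V]. *)
Lemma HL_expectation_distinct a : injective a -> (forall i, 0 < a i < 1) ->
  HL_integrable t a HLF ->
  HL_expectation t a HLF = V t (- t `^ x) (codom a) / V t 0 (codom a) / gq x.
Proof.
move=> ainj a01 hint; set J := codom a; set u := - t `^ x.
have uJ : uniq J by apply/injectiveP.
have J01 : {in J, forall y, 0 < y < 1} by move=> _ /codomP[i ->].
have sJ : size J = n by rewrite size_codom card_ord.
have nzJ : {in J, forall y, y != 0} by move=> y /J01 /andP[y0 _]; rewrite gt_eqF.
have PhiE : HL_Phi t a = V t 0 J.
  by rewrite V0_pairprod ?sJ// pairprod_codom.
have hB : (\sum_(lam <- map topart (plists N n)) HL_prob t a lam * HLF lam) @[N --> \oo]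
    --> HL_expectation t a HLF.
  apply: rsum_cvg => //.
    move=> N; rewrite map_inj_in_uniq ?uniq_plists// => l l' hl hl' e.
    by rewrite -(padp_topart hl) e (padp_topart hl').
  move=> lam h; near=> N.
  have hlam : (size lam <= n)%N.
    by rewrite leqNgt; apply: contra h => hn; rewrite (HL_term_distinct ainj (leqnn _)) leqNgt hn mulr0.
  rewrite -(padpK lam) map_f// padp_plists//.
  by near: N; exact: nbhs_infty_ge.
rewrite -(cvg_lim (@norm_hausdorff _ R) hB); apply/cvg_lim => //.
have E N : \sum_(lam <- map topart (plists N n)) HL_prob t a lam * HLF lam =
    (V t 0 J)^-1 / gq x * ZR t N u J.
  rewrite big_map -(sum_plists_ZR t01)// sJ mulr_sumr !big_seq; apply: eq_bigr => l hl.
  by rewrite (HL_term_distinct ainj (topart_head hl)) (topart_size hl) PhiE (padp_topart hl).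
under eq_fun do rewrite E.
have -> : V t u J / V t 0 J / gq x = (V t 0 J)^-1 / gq x * V t u J by ring.
apply: cvgMr.
have [rho [/andP[rho0 rho1] H]] := ZR_geometric t01 uJ J01; have [C hC] := H u.
apply/subr_cvg0; apply: (@squeeze_cvgr _ _ _ _ (fun N => - (C * rho ^+ N)) (fun N => C * rho ^+ N)).
- by near=> N; rewrite -ler_norml.
- rewrite -oppr0; apply: cvgN; rewrite -[0](mulr0 C); apply: cvgMr; apply: cvg_expr.
  by rewrite ger0_norm.
- rewrite -[0](mulr0 C); apply: cvgMr; apply: cvg_expr; by rewrite ger0_norm.
Unshelve. all: by end_near. Qed.

Lemma sumn_part lam : (size lam <= n)%N -> sumn lam = (\sum_(i < n) part lam i)%N.
Proof.
move=> hl; rewrite sumnE (big_nth 0%N) big_mkord (big_ord_widen n (fun i => nth 0%N lam i) hl).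
by rewrite big_mkcond; apply: eq_bigr => i _; case: ltnP => // h; rewrite /part nth_default.
Qed.

Definition partf lam : {ffun 'I_n -> nat} := [ffun i : 'I_n => part lam i].

Lemma partf_inj : {in [pred lam : intpartition | (size lam <= n)%N] &, injective partf}.
Proof.
move=> l l' hl hl' /ffunP e; rewrite -(padpK l) -(padpK l'); congr topart.
have P l0 : (size (parts l0) <= n)%N -> padp l0 = mkseq (part l0) n.
  move=> h; apply: (@eq_from_nth _ 0%N); first by rewrite size_cat size_nseq subnKC// size_mkseq.
  rewrite size_cat size_nseq subnKC// => i hi; rewrite nth_mkseq// /padp /part nth_cat.
  by case: ltnP => // h'; rewrite nth_nseq if_same nth_default.
rewrite !P//; apply: (@eq_from_nth _ 0%N); rewrite !size_mkseq// => i hi; rewrite !nth_mkseq//.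
by have := e (Ordinal hi); rewrite !ffunE.
Qed.

Lemma rsummable_sumn (C rho : R) : 0 < rho < 1 ->
  rsummable (fun lam => C * rho ^+ sumn lam * (size lam <= n)%:R).
Proof.
move=> /andP[r0 r1].
have rr : 0 <= rho < 1 by rewrite ltW.
pose M := (1 - rho)^-1.
apply: (rsummable_bound (M := `|C| * M ^+ n)) => s us.
rewrite [leLHS](_ : _ = `|C| * \sum_(f <- map partf [seq lam <- s | (size (parts lam) <= n)%N]) \prod_(i < n) rho ^+ (f i)).
  rewrite ler_wpM2l// (@sum_ffun_prod_le _ (fun j => rho ^+ j))//.
  - by move=> j; rewrite exprn_ge0// ltW.
  - by move=> N; exact: geometric_sum_le.
  rewrite map_inj_in_uniq ?filter_uniq// => l l'; rewrite !mem_filter => /andP[h _] /andP[h' _].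
  exact: partf_inj.
rewrite big_map big_filter mulr_sumr [RHS]big_mkcond; apply: eq_bigr => l _.
case: ifP => h; last by rewrite mulr0 normr0.
rewrite mulr1 normrM [in X in _ * X]ger0_norm ?exprn_ge0 ?(ltW r0)// (sumn_part h); congr (_ * _).
by rewrite expr_sum; apply: eq_bigr => i _; rewrite ffunE.
Qed.

Lemma HLF01 lam : 0 < HLF lam <= 1.
Proof.
have h := gq_ge1 (x + n%:R - (plength lam)%:R).
by rewrite /HLF invr_gt0 (lt_le_trans ltr01 h) invf_le1// (lt_le_trans ltr01 h).
Qed.

Lemma b_el01 lam : 0 <= b_el t lam <= 1.
Proof.
have h k : 0 <= 1 - t ^+ k <= 1.
  by rewrite subr_ge0 exprn_ile1 ?(ltW t0) ?(ltW t1)//= lerBlDr lerDl exprn_ge0// ltW.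
rewrite /b_el prodr_ge0 ?prodr_ile1//.
  by move=> i _; rewrite prodr_ge0 ?prodr_ile1// => k _; case/andP: (h (k.*2).-1).
by move=> i _; rewrite prodr_ge0// => k _; case/andP: (h (k.*2).-1).
Qed.

Lemma HL_Phi_ge1 a : (forall i, 0 < a i < 1) -> 1 <= HL_Phi t a.
Proof.
move=> a01; rewrite /HL_Phi; elim/big_rec: _ => // i y _ hy; apply: mulr_ege1 => //.
elim/big_rec: _ => // j z _ hz; apply: mulr_ege1 => //.
have [/andP[i0 i1] /andP[j0 j1]] := (a01 i, a01 j).
have h : a i * a j < 1 by rewrite mulr_ilt1// ltW.
rewrite ler_pdivlMr ?subr_gt0// mul1r lerD2l lerN2 -mulrA ler_piMl ?mulr_ge0// ltW//.
Qed.

Lemma cvg_prod_seq (T : Type) (s : seq T) (P : pred T) (f_ : nat -> T -> R) (f : T -> R) :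
  (forall i, f_ m i @[m --> \oo] --> f i) ->
  (\prod_(i <- s | P i) f_ m i) @[m --> \oo] --> \prod_(i <- s | P i) f i.
Proof.
move=> h; elim: s => [|i s IH].
  by rewrite big_nil; under eq_fun do rewrite big_nil; exact: cvg_cst.
rewrite big_cons; under eq_fun do rewrite big_cons.
by case: (P i) => //; apply: cvgM.
Qed.

Definition shift a (e : R) (i : 'I_n) : R := a i - e * (i.+1)%:R.

Lemma shift0 a : shift a 0 = a.
Proof. by apply/funext => i; rewrite /shift mul0r subr0. Qed.

Lemma cvg_shift a (e_ : nat -> R) i : e_ m @[m --> \oo] --> 0 ->
  shift a (e_ m) i @[m --> \oo] --> a i.
Proof.
move=> he; rewrite -[X in _ --> X](subr0 (a i)); apply: cvgB; first exact: cvg_cst.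
by rewrite -[X in _ --> X](mul0r (i.+1%:R : R)); apply: cvgMl.
Qed.

(** One summable majorant governs [a] and all perturbed parameters, which gives integrability and
    convergence of the expectations. The perturbed parameters are distinct and lie below the [a i],
    so that admissible contours remain admissible. *)
Lemma HL_limit a : (forall i, 0 < a i < 1) ->
  HL_integrable t a HLF /\ exists b_ : nat -> 'I_n -> R,
  [/\ forall i, b_ m i @[m --> \oo] --> a i,
      forall m, injective (b_ m), forall m i, 0 < b_ m i < a i,
      forall m, HL_integrable t (b_ m) HLF &
      HL_expectation t (b_ m) HLF @[m --> \oo] --> HL_expectation t a HLF].
Proof.
move=> a01.
have [eta [C [rho [eta0 C0 rho01 hb]]]] := HLPolynomial.HL_P_bound t01 a01.
(* Small [e] keeps the parameters positive, and [|a i - a j| != |i - j| * e] keeps them distinct. *)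
have hs : HLPolynomial.small (fun e => (forall i, 0 < shift a e i) /\ 
   forall i j : 'I_n, i != j -> `|a i - a j| - `|i.+1%:R - j.+1%:R| * e != 0).
  apply: HLPolynomial.small_and.
    apply: HLPolynomial.small_forall => i; case/andP: (a01 i) => i0 _.
    have h1 : 1 - a i < 1 by rewrite ltrBlDr ltrDl.
    have [d d0 hd] := HLPolynomial.small_le1 h1 (ltr0Sn R i).
    by exists d => // e /hd; rewrite /shift; move: (a i) (i.+1%:R : R) => p q; nra.
  apply: HLPolynomial.small_forall => i; apply: HLPolynomial.small_forall => j.
  have [->|ij] := eqVneq i j; first by exists 1.
  have [|d d0 hd] := @HLPolynomial.small_affine _ (a i - a j) (i.+1%:R - j.+1%:R).
    by rewrite subr_eq0 eqr_nat eqSS.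
  by exists d => // e /hd.
have [d d0 hd] := hs.
pose e_ (m : nat) := Num.min d eta * (m.+1%:R)^-1.
have dm0 : 0 < Num.min d eta by rewrite lt_min d0.
have e0 m : 0 < e_ m by rewrite mulr_gt0// invr_gt0.
have eM m : e_ m <= Num.min d eta by rewrite ler_piMr ?(ltW dm0)// invf_le1// ler1n.
have ecv : e_ m @[m --> \oo] --> 0.
  by rewrite -(mulr0 (Num.min d eta)); apply: cvgMr; exact: cvg_harmonic.
have ed m : 0 < e_ m <= d by rewrite e0 (le_trans (eM m))// ge_min lexx.
have eeta m : `|e_ m| <= eta by rewrite gtr0_norm// (le_trans (eM m))// ge_min lexx orbT.
pose g lam := C * rho ^+ sumn lam * (size lam <= n)%:R.
have sg : rsummable g by exact: rsummable_sumn.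
have bound (b : 'I_n -> R) lam : (forall i, 0 < b i < 1) ->
    `|HallLittlewood.HL_P_eval t lam b| <= C * rho ^+ sumn lam ->
    `|HL_prob t b lam * HLF lam| <= g lam.
  move=> b01 hP; have hP' : `|HallLittlewood.HL_P_eval t lam b| <= g lam.
    rewrite /g; have [hl|hl] := leqP (size lam) n; first by rewrite mulr1.
    by rewrite /HallLittlewood.HL_P_eval /HallLittlewood.HL_P leqNgt hl mpoly.meval0 normr0 mulr0.
  have g0 : 0 <= g lam by exact: le_trans hP'.
  have [/andP[F0 F1] /andP[E0 E1]] := (HLF01 lam, b_el01 lam).
  have Ph := HL_Phi_ge1 b01.
  have Pi : `|(HL_Phi t b)^-1| <= 1.
    by rewrite ger0_norm ?invr_ge0 ?invf_le1 ?(lt_le_trans ltr01 Ph)// (le_trans ler01 Ph).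
  rewrite /HL_prob !normrM (ger0_norm E0) (gtr0_norm F0) (_ : `|(ptranspose_even lam)%:R| = (ptranspose_even lam)%:R); last by rewrite normr_nat.
  have D1 : (ptranspose_even lam)%:R <= 1 :> R by rewrite lern1 leq_b1.
  apply: le_trans (ler_piMr _ F1) _; first by rewrite !mulr_ge0.
  apply: le_trans (ler_piMr _ D1) _; first by rewrite !mulr_ge0.
  by rewrite -[leRHS]mul1r ler_pM ?mulr_ge0// mulr_ile1.
have int0 lam : `|HL_prob t a lam * HLF lam| <= g lam.
  apply: bound => //; rewrite -{1}(shift0 a); apply: hb; by rewrite normr0 ltW.
have s01 m i : 0 < shift a (e_ m) i < a i.
  have [-> _] := hd _ (ed m); by rewrite /shift ltrBlDr ltrDl mulr_gt0.
have s01' m i : 0 < shift a (e_ m) i < 1.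
  have /andP[-> h] := s01 m i; by rewrite (lt_trans h)//; case/andP: (a01 i).
have intm m lam : `|HL_prob t (shift a (e_ m)) lam * HLF lam| <= g lam.
  by apply: bound => //; apply: hb.
have gE lam : `|g lam| = g lam by rewrite ger0_norm// (le_trans _ (int0 lam)).
split; first by apply: rsummable_le sg => lam; rewrite gE.
exists (fun m => shift a (e_ m)); split => //.
- by move=> i; exact: cvg_shift.
- move=> m i j hij; apply/eqP; apply/negPn/negP => ij.
  have [_ /(_ i j ij)] := hd _ (ed m); case/negP; rewrite subr_eq0; apply/eqP.
  rewrite -[e_ m]gtr0_norm// -normrM; congr (`|_|); move: hij; rewrite /shift.
  by move: (a i) (a j) (e_ m) (i.+1%:R : R) (j.+1%:R : R) => p q e y z h; lra.
- by move=> m; apply: rsummable_le sg => lam; rewrite gE.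
apply: (rsum_dominated sg) => // lam; apply: cvgMl; apply: cvgMl.
apply: cvgM.
  apply: cvgMl; apply: cvgV; first by rewrite gt_eqF// (lt_le_trans ltr01)// HL_Phi_ge1.
  apply: cvg_prod_seq => i; apply: cvg_prod_seq => j; apply: cvgM.
    apply: cvgB; first exact: cvg_cst.
    apply: cvgM; last exact: cvg_shift.
    by apply: cvgM; [exact: cvg_cst|exact: cvg_shift].
  apply: cvgV.
    rewrite subr_eq0 eq_sym lt_eqF//; have [/andP[i0 i1] /andP[j0 j1]] := (a01 i, a01 j).
    by rewrite mulr_ilt1// ltW.
  by apply: cvgB; [exact: cvg_cst|apply: cvgM; exact: cvg_shift].
have [p hp] := HLPolynomial.HL_P_poly t a lam.
have -> : HallLittlewood.HL_P_eval t lam a = p.[0] by rewrite -hp -/(shift a 0) shift0.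
under eq_fun do rewrite /shift hp.
apply: (@cvg_comp _ _ _ e_ (fun e => p.[e]) _ _ _ ecv); exact: continuous_horner.
Qed.

End HalfSpaceExpectation.

Local Open Scope complex_scope.
Local Notation Re := complex.Re.
Local Notation Im := complex.Im.

(** * Contour integrals over circles *)

Section ComplexSequences.
Variable R : realType.
Notation C := R[i].
Implicit Types (z w l : C).

(** The modulus as a real number, since the norm of [R[i]] takes complex values. *)
Definition nrm z : R := Num.sqrt (Re z ^+ 2 + Im z ^+ 2).

Lemma nrmE z : `|z| = (nrm z)%:C. Proof. exact: normc_def. Qed.

Lemma nrm_ge0 z : 0 <= nrm z. Proof. exact: sqrtr_ge0. Qed.

Lemma nrm_le z (M : R) : (nrm z <= M) = (`|z| <= M%:C).
Proof. by rewrite nrmE lecR. Qed.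

Lemma nrmM z w : nrm (z * w) = nrm z * nrm w.
Proof. by apply: complexI; rewrite rmorphM /= -!nrmE normrM. Qed.

Lemma nrmV z : nrm z^-1 = (nrm z)^-1.
Proof. by apply: complexI; rewrite fmorphV /= -!nrmE normfV. Qed.

Lemma nrmN z : nrm (- z) = nrm z.
Proof. by apply: complexI; rewrite -!nrmE normrN. Qed.

Lemma nrmX z k : nrm (z ^+ k) = nrm z ^+ k.
Proof. by apply: complexI; rewrite rmorphXn /= -!nrmE normrX. Qed.

Lemma nrmD z w : nrm (z + w) <= nrm z + nrm w.
Proof. by rewrite nrm_le rmorphD /= -!nrmE ler_normD. Qed.

Lemma nrmB z w : nrm (z - w) <= nrm z + nrm w.
Proof. by rewrite -[nrm w]nrmN nrmD. Qed.

Lemma nrm_sub_ge z w : nrm z - nrm w <= nrm (z - w).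
Proof. by rewrite lerBlDr (le_trans _ (nrmD _ _))// subrK. Qed.

Lemma nrm_real (x : R) : nrm x%:C = `|x|.
Proof. by rewrite /nrm /= expr0n addr0 sqrtr_sqr. Qed.

Lemma nrm1 : nrm 1 = 1.
Proof. by rewrite -[1 in LHS]/(1%:C) nrm_real normr1. Qed.

Lemma nrm0 : nrm 0 = 0.
Proof. by rewrite -[0 in LHS]/(0%:C) nrm_real normr0. Qed.

Lemma nrm_prod (I : Type) (s : seq I) (P : pred I) (F : I -> C) :
  nrm (\prod_(i <- s | P i) F i) = \prod_(i <- s | P i) nrm (F i).
Proof. by apply: (big_morph nrm nrmM); rewrite -[1]/(1%:C) nrm_real normr1. Qed.

Lemma nrm_sum (I : Type) (s : seq I) (P : pred I) (F : I -> C) :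
  nrm (\sum_(i <- s | P i) F i) <= \sum_(i <- s | P i) nrm (F i).
Proof.
elim/big_ind2: _ => [||//]; first by rewrite -[0]/(0%:C) nrm_real normr0.
by move=> x y z w hx hz; apply: le_trans (nrmD _ _) _; exact: lerD.
Qed.

Lemma nrm_gt0 z : (0 < nrm z) = (z != 0).
Proof. by rewrite -normr_gt0 nrmE -ltcR. Qed.

Lemma Re_le_nrm z : `|Re z| <= nrm z.
Proof. by rewrite -sqrtr_sqr ler_wsqrtr// lerDl sqr_ge0. Qed.

Lemma Im_le_nrm z : `|Im z| <= nrm z.
Proof. by rewrite -sqrtr_sqr ler_wsqrtr// lerDr sqr_ge0. Qed.

Lemma nrm_le_ReIm z : nrm z <= `|Re z| + `|Im z|.
Proof.
rewrite -[leRHS]ger0_norm ?addr_ge0// -sqrtr_sqr ler_wsqrtr// sqrrD !real_normK ?num_real//.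
by rewrite lerD2r lerDl mulrn_wge0// mulr_ge0.
Qed.

Lemma ReM z w : Re (z * w) = Re z * Re w - Im z * Im w.
Proof. by case: z w => [? ?] []. Qed.

Lemma ImM z w : Im (z * w) = Re z * Im w + Im z * Re w.
Proof. by case: z w => [? ?] []. Qed.

Lemma ReD z w : Re (z + w) = Re z + Re w. Proof. by case: z w => [? ?] []. Qed.
Lemma ImD z w : Im (z + w) = Im z + Im w. Proof. by case: z w => [? ?] []. Qed.
Lemma ReN z : Re (- z) = - Re z. Proof. by case: z. Qed.
Lemma ImN z : Im (- z) = - Im z. Proof. by case: z. Qed.

Definition ccvg (z_ : nat -> C) l : Prop :=
  Re (z_ m) @[m --> \oo] --> Re l /\ Im (z_ m) @[m --> \oo] --> Im l.

Lemma ccvg_cst z : ccvg (fun=> z) z. Proof. by split; exact: cvg_cst. Qed.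

Lemma ccvgD (z_ w_ : nat -> C) z w : ccvg z_ z -> ccvg w_ w -> ccvg (fun m => z_ m + w_ m) (z + w).
Proof.
move=> [a b] [c d]; split; [rewrite ReD; under eq_fun do rewrite ReD|rewrite ImD; under eq_fun do rewrite ImD];
exact: cvgD.
Qed.

Lemma ccvgN (z_ : nat -> C) z : ccvg z_ z -> ccvg (fun m => - z_ m) (- z).
Proof.
move=> [a b]; split; [rewrite ReN; under eq_fun do rewrite ReN|rewrite ImN; under eq_fun do rewrite ImN];
exact: cvgN.
Qed.

Lemma ccvgB (z_ w_ : nat -> C) z w : ccvg z_ z -> ccvg w_ w -> ccvg (fun m => z_ m - w_ m) (z - w).
Proof. by move=> hz hw; apply: ccvgD => //; exact: ccvgN. Qed.

Lemma ccvgM (z_ w_ : nat -> C) z w : ccvg z_ z -> ccvg w_ w -> ccvg (fun m => z_ m * w_ m) (z * w).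
Proof.
move=> [a b] [c d]; split.
  rewrite ReM; under eq_fun do rewrite ReM; apply: cvgB; exact: cvgM.
rewrite ImM; under eq_fun do rewrite ImM; apply: cvgD; exact: cvgM.
Qed.

Lemma ReV z : Re z^-1 = Re z / (Re z ^+ 2 + Im z ^+ 2). Proof. by case: z. Qed.
Lemma ImV z : Im z^-1 = - (Im z / (Re z ^+ 2 + Im z ^+ 2)). Proof. by case: z. Qed.

Lemma ccvgV (z_ : nat -> C) z : z != 0 -> ccvg z_ z -> ccvg (fun m => (z_ m)^-1) z^-1.
Proof.
move=> z0 [a b]; have h : (fun m => (Re (z_ m) ^+ 2 + Im (z_ m) ^+ 2)^-1) @ \oo --> (Re z ^+ 2 + Im z ^+ 2)^-1.
  apply: cvgV; first by apply: contraTneq z0 => e; rewrite -nrm_gt0 /nrm e sqrtr0 ltxx.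
  by rewrite !expr2; under eq_fun do rewrite !expr2; apply: cvgD; apply: cvgM.
split; first by rewrite ReV; under eq_fun do rewrite ReV; exact: cvgM.
by rewrite ImV; under eq_fun do rewrite ImV; apply: cvgN; exact: cvgM.
Qed.

Lemma ccvg_sum (I : Type) (s : seq I) (P : pred I) (f_ : nat -> I -> C) (f : I -> C) :
  (forall i, ccvg (f_ ^~ i) (f i)) ->
  ccvg (fun m => \sum_(i <- s | P i) f_ m i) (\sum_(i <- s | P i) f i).
Proof.
move=> h; elim: s => [|i s IH].
  by rewrite big_nil; under eq_fun do rewrite big_nil; exact: ccvg_cst.
by rewrite big_cons; under eq_fun do rewrite big_cons; case: (P i) => //; exact: ccvgD.
Qed.

Lemma ccvg_prod (I : Type) (s : seq I) (P : pred I) (f_ : nat -> I -> C) (f : I -> C) :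
  (forall i, ccvg (f_ ^~ i) (f i)) ->
  ccvg (fun m => \prod_(i <- s | P i) f_ m i) (\prod_(i <- s | P i) f i).
Proof.
move=> h; elim: s => [|i s IH].
  by rewrite big_nil; under eq_fun do rewrite big_nil; exact: ccvg_cst.
by rewrite big_cons; under eq_fun do rewrite big_cons; case: (P i) => //; exact: ccvgM.
Qed.

Lemma ccvg_real (x_ : nat -> R) (x : R) : x_ @ \oo --> x -> ccvg (fun m => (x_ m)%:C) x%:C.
Proof. by move=> h; split => //=; exact: cvg_cst. Qed.

Lemma ccvg_unique (z_ : nat -> C) z w : ccvg z_ z -> ccvg z_ w -> z = w.
Proof.
move=> [a b] [c d]; apply/eqP; rewrite eq_complex; apply/andP; split; apply/eqP.
  exact: (cvg_unique (@norm_hausdorff _ R) a c).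
exact: (cvg_unique (@norm_hausdorff _ R) b d).
Qed.

Lemma ccvg_squeeze (z_ : nat -> C) z (e_ : nat -> R) : (forall m, nrm (z_ m - z) <= e_ m) ->
  e_ @ \oo --> 0 -> ccvg z_ z.
Proof.
move=> h e0; have en0 : (fun m => - e_ m) @ \oo --> 0 by rewrite -oppr0; exact: cvgN.
split; apply/subr_cvg0; apply: (squeeze_cvgr _ en0 e0); near=> m; rewrite -ler_norml.
  by rewrite -ReN -ReD (le_trans (Re_le_nrm _)).
by rewrite -ImN -ImD (le_trans (Im_le_nrm _)).
Unshelve. all: by end_near. Qed.

Lemma ccvg_bound (z_ : nat -> C) z (M : R) : (forall m, nrm (z_ m) <= M) -> ccvg z_ z -> nrm z <= M.
Proof.
move=> h [a b]; have M0 : 0 <= M by exact: le_trans (nrm_ge0 _) (h 0%N).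
have E y : (nrm y <= M) = (Re y * Re y + Im y * Im y <= M ^+ 2).
  by rewrite -(ler_pXn2r (ltn0Sn 1)) ?nnegrE ?nrm_ge0// sqr_sqrtr ?addr_ge0 ?sqr_ge0.
rewrite E; have hc : (fun m => Re (z_ m) * Re (z_ m) + Im (z_ m) * Im (z_ m)) @ \oo -->
   Re z * Re z + Im z * Im z by apply: cvgD; exact: cvgM.
rewrite -(cvg_lim (@norm_hausdorff _ R) hc); apply: limr_le; first by apply/cvg_ex; exists (Re z * Re z + Im z * Im z).
by near=> m; rewrite -E.
Unshelve. all: by end_near. Qed.

Lemma ccvg_shift (z_ : nat -> C) z k : ccvg z_ z -> ccvg (fun m => z_ (m + k)%N) z.
Proof. by move=> [a b]; split; [rewrite (cvg_shiftn k (fun m => Re (z_ m)))|rewrite (cvg_shiftn k (fun m => Im (z_ m)))]. Qed.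

Lemma ccvg_eventually (z_ w_ : nat -> C) z k : (forall m, (k <= m)%N -> z_ m = w_ m) -> ccvg z_ z -> ccvg w_ z.
Proof.
move=> h /(@ccvg_shift _ _ k); rewrite (_ : (fun m => z_ (m + k)%N) = (fun m => w_ (m + k)%N)); last first.
  by apply/funext => m; rewrite h// leq_addl.
by case=> a b; split; [rewrite -(cvg_shiftn k (fun m => Re (w_ m)))|rewrite -(cvg_shiftn k (fun m => Im (w_ m)))].
Qed.

End ComplexSequences.

(** * Mean values over circles *)

Section CircleMean.
Variable R : realType.
Notation C := R[i].
Notation mu := (@lebesgue_measure R).
Implicit Types (z w : C) (H G q : C -> C) (r M th : R).

Definition period : set R := `[0, 2 * pi]%classic.

Let pi2_gt0 : 0 < 2 * pi :> R. Proof. by rewrite mulr_gt0// pi_gt0. Qed.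

Let mperiod : measurable period. Proof. exact: measurable_itv. Qed.

Let mu_period : mu period = (2 * pi)%:E.
Proof. by rewrite /period lebesgue_measure_itv/= lte_fin pi2_gt0 oppr0 addr0. Qed.

(** Measurable and bounded along the circle. The class is stable under sums, products and bounded
    pointwise limits, which makes integrability of all integrands below automatic. *)
Definition nice r H : Prop :=
  [/\ measurable_fun period (fun th => Re (H (circle_pt r th))),
      measurable_fun period (fun th => Im (H (circle_pt r th))) &
      exists M, forall z, nrm z = r -> nrm (H z) <= M].

Definition mean r H : C := ((2 * pi)^-1)%:C *
  ((\int[mu]_(th in period) Re (H (circle_pt r th))) +i*
   (\int[mu]_(th in period) Im (H (circle_pt r th)))).

Lemma nrm_circle_pt r th : 0 < r -> nrm (circle_pt r th) = r.
Proof.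
by move=> r0; rewrite /nrm /= !exprMn -mulrDr cos2Dsin2 mulr1 sqrtr_sqr gtr0_norm.
Qed.

Lemma Rintegral_period (c : R) : \int[mu]_(th in period) c = c * (2 * pi).
Proof. by rewrite Rintegral_cst//; congr (_ * _); exact: (congr1 fine mu_period). Qed.

Section Rules.
Variable r : R.
Hypothesis r0 : 0 < r.

Definition on_circle (P : C -> Prop) := forall z, nrm z = r -> P z.

Lemma on_circle_pt (P : C -> Prop) th : on_circle P -> P (circle_pt r th).
Proof. by apply; exact: nrm_circle_pt. Qed.

Lemma nice_ext H G : on_circle (fun z => H z = G z) -> nice r H -> nice r G.
Proof.
move=> e [a b [M hM]].
have ecomp (T : Type) (p : C -> T) : (fun th => p (G (circle_pt r th))) = (fun th => p (H (circle_pt r th))).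
  by apply/funext => th; rewrite (on_circle_pt th e).
split; [by rewrite (ecomp _ (@complex.Re R))|by rewrite (ecomp _ (@complex.Im R))|].
by exists M => z hz; rewrite -e// hM.
Qed.

Lemma mean_ext H G : on_circle (fun z => H z = G z) -> mean r H = mean r G.
Proof.
move=> e; rewrite /mean; congr (_ * (_ +i* _)); apply: eq_Rintegral => th _;
by rewrite (on_circle_pt th e).
Qed.

Lemma bounded_integrable (h : R -> R) M : measurable_fun period h ->
  (forall th, `|h th| <= M) -> mu.-integrable period (EFin \o h).
Proof.
move=> mh hM; apply: measurable_bounded_integrable => //.
  by rewrite -[ltLHS]/(mu period) mu_period ltry.
by exists M; split; [exact: num_real|move=> y hy th _ /=; rewrite (le_trans (hM th))// ltW].
Qed.

Lemma nice_integrable H : nice r H ->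
  mu.-integrable period (EFin \o (fun th => Re (H (circle_pt r th)))) /\
  mu.-integrable period (EFin \o (fun th => Im (H (circle_pt r th)))).
Proof.
move=> [a b [M hM]]; split; apply: (bounded_integrable (M := M)) => // th.
  exact: le_trans (Re_le_nrm _) (on_circle_pt th hM).
exact: le_trans (Im_le_nrm _) (on_circle_pt th hM).
Qed.

Lemma nice_cst c : nice r (fun=> c).
Proof. by split; [exact: measurable_cst|exact: measurable_cst|exists (nrm c)]. Qed.

Lemma nice_id : nice r (fun z => z).
Proof.
split; last by exists r => z ->.
  apply: measurable_funM; first exact: measurable_cst.
  by apply: measurable_funTS; apply: continuous_measurable_fun; exact: continuous_cos.
apply: measurable_funM; first exact: measurable_cst.
by apply: measurable_funTS; apply: continuous_measurable_fun; exact: continuous_sin.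
Qed.

Lemma niceD H G : nice r H -> nice r G -> nice r (fun z => H z + G z).
Proof.
move=> [a b [M hM]] [c d [N hN]]; split.
- by under eq_fun do rewrite ReD; exact: measurable_funD.
- by under eq_fun do rewrite ImD; exact: measurable_funD.
- by exists (M + N) => z hz; rewrite (le_trans (nrmD _ _))// lerD ?hM ?hN.
Qed.

Lemma niceM H G : nice r H -> nice r G -> nice r (fun z => H z * G z).
Proof.
move=> [a b [M hM]] [c d [N hN]]; split.
- by under eq_fun do rewrite ReM; apply: measurable_funB; exact: measurable_funM.
- by under eq_fun do rewrite ImM; apply: measurable_funD; exact: measurable_funM.
- by exists (M * N) => z hz; rewrite nrmM ler_pM ?nrm_ge0 ?hM ?hN.
Qed.

Lemma niceN H : nice r H -> nice r (fun z => - H z).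
Proof.
move=> nH; apply: nice_ext (niceM (nice_cst (- 1)) nH) => z _; exact: mulN1r.
Qed.

Lemma niceB H G : nice r H -> nice r G -> nice r (fun z => H z - G z).
Proof. by move=> nH nG; apply: niceD => //; exact: niceN. Qed.

Lemma niceX H k : nice r H -> nice r (fun z => H z ^+ k).
Proof.
move=> nH; elim: k => [|k IH]; first exact: nice_cst.
by under eq_fun do rewrite exprS; exact: niceM.
Qed.

Lemma nice_sum (I : Type) (s : seq I) (P : pred I) (F : I -> C -> C) :
  (forall i, nice r (F i)) -> nice r (fun z => \sum_(i <- s | P i) F i z).
Proof.
move=> h; elim: s => [|i s IH]; first by under eq_fun do rewrite big_nil; exact: nice_cst.
by under eq_fun do rewrite big_cons; case: (P i) => //; exact: niceD.
Qed.

Lemma nice_prod (I : Type) (s : seq I) (P : pred I) (F : I -> C -> C) :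
  (forall i, nice r (F i)) -> nice r (fun z => \prod_(i <- s | P i) F i z).
Proof.
move=> h; elim: s => [|i s IH]; first by under eq_fun do rewrite big_nil; exact: nice_cst.
by under eq_fun do rewrite big_cons; case: (P i) => //; exact: niceM.
Qed.

Lemma invc_circle z : nrm z = r -> z^-1 = ((r ^+ 2)^-1)%:C * (Re z +i* (- Im z)).
Proof.
move=> e; have e2 : Re z ^+ 2 + Im z ^+ 2 = r ^+ 2.
  by rewrite -e sqr_sqrtr// addr_ge0 ?sqr_ge0.
apply/eqP; rewrite eq_complex ReV ImV e2 ReM ImM /=; apply/andP; split; apply/eqP; ring.
Qed.

Lemma nice_inv : nice r (fun z => z^-1).
Proof.
apply: (@nice_ext (fun z => ((r ^+ 2)^-1)%:C * (Re z +i* (- Im z)))).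
  by move=> z /invc_circle.
apply: niceM; first exact: nice_cst.
have [a b _] := nice_id; split => //=; first exact: measurableT_comp.
by exists r => z <-; rewrite /nrm /= sqrrN.
Qed.

Lemma meanD H G : nice r H -> nice r G -> mean r (fun z => H z + G z) = mean r H + mean r G.
Proof.
move=> /nice_integrable[a b] /nice_integrable[c d]; rewrite /mean -mulrDr; congr (_ * _).
under eq_Rintegral do rewrite ReD; under [X in _ +i* X]eq_Rintegral do rewrite ImD.
by rewrite !RintegralD.
Qed.

Lemma meanZ c H : nice r H -> mean r (fun z => c * H z) = c * mean r H.
Proof.
move=> /nice_integrable[a b]; rewrite /mean mulrCA; congr (_ * _).
under eq_Rintegral do rewrite ReM; under [X in _ +i* X]eq_Rintegral do rewrite ImM.
have iZ (k : R) h : mu.-integrable period (EFin \o h) -> mu.-integrable period (EFin \o (fun th => k * h th)).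
  by move=> ih; rewrite (_ : EFin \o _ = (fun th => k%:E * (h th)%:E)%E)//; exact: integrableZl.
rewrite RintegralB ?RintegralD ?RintegralZl//; try exact: iZ.
by case: c => p s.
Qed.

Lemma meanN H : nice r H -> mean r (fun z => - H z) = - mean r H.
Proof.
move=> nH; rewrite -[RHS]mulN1r -meanZ//; apply: mean_ext => z _; by rewrite mulN1r.
Qed.

Lemma meanB H G : nice r H -> nice r G -> mean r (fun z => H z - G z) = mean r H - mean r G.
Proof. by move=> nH nG; rewrite meanD ?meanN//; exact: niceN. Qed.

Lemma mean0 : mean r (fun=> 0) = 0.
Proof.
rewrite -[RHS](mul0r (mean r (fun=> 0))) -meanZ; last exact: nice_cst.
by apply: mean_ext => z _; rewrite mul0r.
Qed.

Lemma mean_sum (I : Type) (s : seq I) (P : pred I) (F : I -> C -> C) :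
  (forall i, nice r (F i)) ->
  mean r (fun z => \sum_(i <- s | P i) F i z) = \sum_(i <- s | P i) mean r (F i).
Proof.
move=> h; elim: s => [|i s IH].
  by rewrite big_nil -[RHS]mean0; apply: mean_ext => z _; rewrite big_nil.
rewrite big_cons -IH; case e : (P i).
  rewrite -meanD//; last exact: nice_sum.
  by apply: mean_ext => z _; rewrite big_cons e.
by apply: mean_ext => z _; rewrite big_cons e.
Qed.

Lemma mean1 : mean r (fun=> 1) = 1.
Proof.
rewrite /mean !Rintegral_period mul0r mul1r -[_ +i* 0]/((2 * pi)%:C) -rmorphM /= mulVf//.
by rewrite gt_eqF.
Qed.

Lemma mean_cvg (H_ : nat -> C -> C) H M : (forall m, nice r (H_ m)) ->
  on_circle (fun z => forall m, nrm (H_ m z) <= M) ->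
  on_circle (fun z => ccvg (H_ ^~ z) (H z)) ->
  nice r H /\ ccvg (fun m => mean r (H_ m)) (mean r H).
Proof.
move=> nH hM hc.
have hMt th m : nrm (H_ m (circle_pt r th)) <= M := on_circle_pt th hM m.
have hct th := on_circle_pt th hc.
have nH' : nice r H.
  split.
  - apply: (measurable_fun_cvg (h := fun m th => Re (H_ m (circle_pt r th)))).
      by move=> m; case: (nH m).
    by move=> th _; case: (hct th).
  - apply: (measurable_fun_cvg (h := fun m th => Im (H_ m (circle_pt r th)))).
      by move=> m; case: (nH m).
    by move=> th _; case: (hct th).
  - by exists M => z hz; apply: ccvg_bound (hM z hz) (hc z hz).
split=> //.
have dct (h_ : nat -> R -> R) (h : R -> R) : (forall m, measurable_fun period (h_ m)) -> measurable_fun period h ->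
    (forall th, h_ m th @[m --> \oo] --> h th) -> (forall m th, `|h_ m th| <= M) ->
    mu.-integrable period (EFin \o h) ->
    (\int[mu]_(th in period) h_ m th) @[m --> \oo] --> \int[mu]_(th in period) h th.
  move=> mh_ mh hcv hb ih.
  have := @dominated_convergence _ _ _ mu period mperiod (fun m th => (h_ m th)%:E)
    (fun th => (h th)%:E) (fun=> M%:E).
  case.
  - by move=> m; apply/measurable_EFinP; exact: mh_.
  - exact/measurable_EFinP.
  - apply: aeW => th _; apply/fine_cvgP; split; [exact: nearW|exact: hcv].
  - apply: (@bounded_integrable (fun=> M) `|M|) => //.
  - by apply: aeW => th m _; rewrite lee_fin.
  move=> _ _ h1; apply: fine_cvg; rewrite fineK//.
  exact: integrable_fin_num.
rewrite /mean; apply: ccvgM; first exact: ccvg_cst.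
have [iR iI] := nice_integrable nH'; have [mR mI _] := nH'.
split=> /=; apply: dct => //.
- by move=> m; case: (nH m).
- by move=> th; case: (hct th).
- by move=> m th; apply: le_trans (Re_le_nrm _) (hMt th m).
- by move=> m; case: (nH m).
- by move=> th; case: (hct th).
- by move=> m th; apply: le_trans (Im_le_nrm _) (hMt th m).
Unshelve. all: by end_near. Qed.

Lemma mean_ccvg (H_ : nat -> C -> C) H M : (forall m, nice r (H_ m)) ->
  on_circle (fun z => forall m, nrm (H_ m z) <= M) ->
  on_circle (fun z => ccvg (H_ ^~ z) (H z)) -> ccvg (fun m => mean r (H_ m)) (mean r H).
Proof. by move=> nH hM hc; case: (mean_cvg nH hM hc). Qed.

(** The factor 2 comes from estimating the real and imaginary parts separately. *)
Lemma mean_bound H M : nice r H -> on_circle (fun z => nrm (H z) <= M) -> nrm (mean r H) <= 2 * M.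
Proof.
move=> nH hM; have [iR iI] := nice_integrable nH.
have hMt th := on_circle_pt th hM.
have bd (h : R -> R) : (forall th, `|h th| <= M) -> mu.-integrable period (EFin \o h) ->
    `|\int[mu]_(th in period) h th| <= M * (2 * pi).
  move=> hb ih; have := @le_normr_Rintegral _ _ _ mu period h mperiod ih; move=> /le_trans; apply.
  rewrite -[M * _](_ : \int[mu]_(th in period) M = _); last exact: Rintegral_period.
  apply: le_Rintegral => //; last by apply: (@bounded_integrable (fun=> M) `|M|).
  rewrite (_ : EFin \o _ = abse \o (EFin \o h))//; exact: integrable_abse.
rewrite /mean nrmM nrm_real gtr0_norm ?invr_gt0// mulrC ler_pdivrMr//.
apply: le_trans (nrm_le_ReIm _) _ => /=.
have h1 := bd _ (fun th => le_trans (Re_le_nrm _) (hMt th)) iR.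
have h2 := bd _ (fun th => le_trans (Im_le_nrm _) (hMt th)) iI.
apply: le_trans (lerD h1 h2) _; rewrite le_eqVlt; apply/orP; left; apply/eqP; ring.
Qed.

(** Termwise integration of a geometric series. It takes the place of the residue theorem: every
    pole met below is expanded in this way. *)
Lemma mean_geometric H q th : 0 <= th < 1 -> nice r H -> nice r q ->
  on_circle (fun z => nrm (q z) <= th) ->
  nice r (fun z => H z / (1 - q z)) /\
  ccvg (fun N => \sum_(0 <= i < N) mean r (fun z => H z * q z ^+ i))
       (mean r (fun z => H z / (1 - q z))).
Proof.
move=> /andP[th0 th1] nH nq hq.
have [_ _ [M hM]] := nH.
have nHq i : nice r (fun z => H z * q z ^+ i) by apply: niceM => //; exact: niceX.
have q1 z : nrm z = r -> 1 - q z != 0.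
  move=> e; rewrite -nrm_gt0; apply: lt_le_trans (nrm_sub_ge _ _).
  by rewrite -[1]/(1%:C) nrm_real normr1 subr_gt0 (le_lt_trans (hq z e)).
have gE z N : nrm z = r -> \sum_(0 <= i < N) H z * q z ^+ i = H z / (1 - q z) * (1 - q z ^+ N).
  move=> e; elim: N => [|N IH]; first by rewrite big_nil expr0 subrr mulr0.
  rewrite big_nat_recr//= IH exprS; have := q1 z e; move: (q z ^+ N) => Q h; field; exact: h.
have M0 : 0 <= M.
  exact: le_trans (nrm_ge0 _) (on_circle_pt 0 hM).
have := @mean_cvg (fun N z => \sum_(0 <= i < N) H z * q z ^+ i) (fun z => H z / (1 - q z))
  (M * (1 - th)^-1).
case.
- by move=> N; apply: nice_sum.
- move=> z e N; apply: le_trans (nrm_sum _ _ _) _.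
  apply: (@le_trans _ _ (\sum_(0 <= i < N) M * th ^+ i)).
    apply: ler_sum => i _; rewrite nrmM nrmX ler_pM ?nrm_ge0 ?exprn_ge0 ?nrm_ge0 ?hM//.
    by rewrite lerXn2r ?nnegrE ?nrm_ge0 ?hq.
  by rewrite -mulr_sumr ler_wpM2l// geometric_sum_le// th0.
- move=> z e; under eq_fun do rewrite gE//.
  rewrite -[X in ccvg _ X]mulr1; apply: ccvgM; first exact: ccvg_cst.
  apply: (@ccvg_squeeze _ _ _ (fun N => th ^+ N)).
    move=> N; rewrite addrC addKr nrmN nrmX lerXn2r ?nnegrE ?nrm_ge0 ?hq//.
  by apply: cvg_expr; rewrite ger0_norm.
move=> nL cL; split=> //; under eq_fun do rewrite -(mean_sum _ _ nHq); exact: cL.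
Qed.

End Rules.
End CircleMean.

(** * Means of powers and of simple fractions *)

Section Fourier.
Variable R : realType.
Notation C := R[i].
Notation mu := (@lebesgue_measure R).

Let pi2_gt0 : 0 < 2 * pi :> R. Proof. by rewrite mulr_gt0// pi_gt0. Qed.

Lemma Rintegral_derive_periodic (F f : R -> R) : (forall y : R, is_derive y 1 F (f y)) ->
  continuous f -> F (2 * pi) = F 0 -> \int[mu]_(th in @period R) f th = 0.
Proof.
move=> dF cf e; rewrite /Rintegral (@continuous_FTC2 _ f F)//.
- by rewrite e -EFinB subrr.
- exact: continuous_subspaceT.
- have cF y : F x @[x --> y] --> F y.
    apply: differentiable_continuous; apply/derivable1_diffP.
    by have := dF y => /(@ex_derive _ _ _ _ _ _ _).
  split; [by move=> y _; have := dF y => /(@ex_derive _ _ _ _ _ _ _)| |].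
    exact: cvg_at_right_filter.
  exact: cvg_at_left_filter.
- by move=> y _; rewrite derive1E; have := dF y => /(@derive_val _ _ _ _ _ _ _).
Qed.

Lemma circle_ptX (r th : R) k : circle_pt r th ^+ k = circle_pt (r ^+ k) (k%:R * th).
Proof.
elim: k => [|k IH].
  by apply/eqP; rewrite eq_complex /= !expr0 mul0r cos0 sin0 mulr1 mulr0 !eqxx.
rewrite exprS IH -natr1 mulrDl mul1r; apply/eqP; rewrite eq_complex ReM ImM /= cosD sinD.
by rewrite exprS; apply/andP; split; apply/eqP; ring.
Qed.

Lemma circle_pt_period k : circle_pt 1 (k%:R * (2 * pi)) = 1 :> C.
Proof.
have e : circle_pt 1 (2 * pi) = 1 :> C.
  by rewrite /circle_pt mulr_natl cos2pi sin2pi mulr1 mulr0.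
by rewrite -{1}(expr1n R k) -circle_ptX e expr1n.
Qed.

Lemma Rintegral_cos k : (0 < k)%N -> \int[mu]_(th in @period R) cos (k%:R * th) = 0.
Proof.
move=> k0; have kn : k%:R != 0 :> R by rewrite pnatr_eq0 -lt0n.
apply: (@Rintegral_derive_periodic (fun y => k%:R^-1 * sin (k%:R * y))).
- move=> y; rewrite (_ : (fun x => _) = (fun x => k%:R^-1 * x) \o (sin \o (fun x => k%:R * x)))//.
  by apply: is_derive_eq; rewrite /GRing.scale /= !mulr1; field.
- move=> y; apply: (@cvg_comp _ _ _ (fun y => k%:R * y) cos); last exact: continuous_cos.
  by apply: cvgMr; exact: cvg_id.
- by rewrite mulr0 sin0; have := circle_pt_period k => /(congr1 (@complex.Im R)) /=; rewrite mul1r => ->.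
Qed.

Lemma Rintegral_sin k : (0 < k)%N -> \int[mu]_(th in @period R) sin (k%:R * th) = 0.
Proof.
move=> k0; have kn : k%:R != 0 :> R by rewrite pnatr_eq0 -lt0n.
apply: (@Rintegral_derive_periodic (fun y => (- k%:R^-1) * cos (k%:R * y))).
- move=> y; rewrite (_ : (fun x => _) = (fun x => (- k%:R^-1) * x) \o (cos \o (fun x => k%:R * x)))//.
  by apply: is_derive_eq; rewrite /GRing.scale /= !mulr1; field.
- move=> y; apply: (@cvg_comp _ _ _ (fun y => k%:R * y) sin); last exact: continuous_sin.
  by apply: cvgMr; exact: cvg_id.
- by rewrite mulr0 cos0; have := circle_pt_period k => /(congr1 (@complex.Re R)) /=; rewrite mul1r => ->.
Qed.

Variable r : R.
Hypothesis r0 : 0 < r.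

Let integrable_cos (k : nat) : mu.-integrable (@period R) (EFin \o (fun th => cos (k%:R * th))).
Proof.
apply: (@bounded_integrable _ _ 1); last by move=> th; rewrite cos_max.
apply: measurable_funTS; apply: continuous_measurable_fun => y.
apply: (@cvg_comp _ _ _ (fun y => k%:R * y) cos); last exact: continuous_cos.
by apply: cvgMr; exact: cvg_id.
Qed.

Let integrable_sin (k : nat) : mu.-integrable (@period R) (EFin \o (fun th => sin (k%:R * th))).
Proof.
apply: (@bounded_integrable _ _ 1); last by move=> th; rewrite sin_max.
apply: measurable_funTS; apply: continuous_measurable_fun => y.
apply: (@cvg_comp _ _ _ (fun y => k%:R * y) sin); last exact: continuous_sin.
by apply: cvgMr; exact: cvg_id.
Qed.

Let Rintegral_Zcos (c : R) k : (0 < k)%N -> \int[mu]_(th in @period R) (c * cos (k%:R * th)) = 0.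
Proof.
move=> k0; transitivity (c * \int[mu]_(th in @period R) cos (k%:R * th)).
  by apply: RintegralZl => //; exact: measurable_itv.
by rewrite Rintegral_cos// mulr0.
Qed.

Let Rintegral_Zsin (c : R) k : (0 < k)%N -> \int[mu]_(th in @period R) (c * sin (k%:R * th)) = 0.
Proof.
move=> k0; transitivity (c * \int[mu]_(th in @period R) sin (k%:R * th)).
  by apply: RintegralZl => //; exact: measurable_itv.
by rewrite Rintegral_sin// mulr0.
Qed.

Lemma meanX k : mean r (fun z => z ^+ k) = (k == 0%N)%:R.
Proof.
case: k => [|k].
  by rewrite eqxx -[RHS](mean1 r); apply: mean_ext => // z _; rewrite expr0.
rewrite /mean /=; under eq_Rintegral do rewrite circle_ptX /=.
under [X in _ +i* X]eq_Rintegral do rewrite circle_ptX /=.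
by rewrite Rintegral_Zcos// Rintegral_Zsin// mulr0.
Qed.

(** On the circle [z^-1] is the conjugate of [z] divided by [r ^+ 2]. *)
Lemma meanXV k : mean r (fun z => z^-1 ^+ k) = (k == 0%N)%:R.
Proof.
have H z : nrm z = r -> z^-1 ^+ k = ((r ^+ 2)^-1 ^+ k)%:C * (Re (z ^+ k) +i* (- Im (z ^+ k))).
  move=> e; rewrite (invc_circle e) exprMn rmorphXn /=; congr (_ * _).
  have conjE w : Re w +i* (- Im w) = conjc w by case: w.
  by rewrite !conjE rmorphXn.
rewrite (mean_ext r0 H) meanZ//; last first.
  have [a b [M hM]] := niceX k (nice_id r).
  split => //=; first exact: measurableT_comp.
  by exists M => z hz; rewrite /nrm /= sqrrN; exact: hM.
rewrite /mean /=.
case: k {H} => [|k].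
  rewrite expr0 mul1r; under eq_Rintegral do rewrite expr0 /=.
  under [X in _ +i* X]eq_Rintegral do rewrite expr0 /= oppr0.
  by have := mean1 r; rewrite /mean.
under eq_Rintegral do rewrite circle_ptX /=.
under [X in _ +i* X]eq_Rintegral do rewrite circle_ptX /= -mulNr.
by rewrite Rintegral_Zcos// Rintegral_Zsin// !mulr0.
Qed.

Lemma nice_geom (b : R) : 0 <= b -> b * r < 1 -> nice r (fun z => (1 - b%:C * z)^-1).
Proof.
move=> b0 br; have := @mean_geometric _ r r0 (fun=> 1) (fun z => b%:C * z) (b * r).
case.
- by rewrite mulr_ge0// ltW.
- exact: nice_cst.
- by apply: niceM => //; [exact: nice_cst|exact: nice_id].
- by move=> z <-; rewrite nrmM nrm_real ger0_norm.
by move=> h _; apply: nice_ext h => // z _; rewrite mul1r.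
Qed.

(** In the geometric expansion of the fraction, only the term of degree [k] has a nonzero mean. *)
Lemma mean_geom_neg (b : R) k : 0 <= b -> b * r < 1 ->
  mean r (fun z => z^-1 ^+ k / (1 - b%:C * z)) = (b ^+ k)%:C.
Proof.
move=> b0 br; have := @mean_geometric _ r r0 (fun z => z^-1 ^+ k) (fun z => b%:C * z) (b * r).
case.
- by rewrite mulr_ge0// ltW.
- by apply: niceX => //; exact: nice_inv.
- by apply: niceM => //; [exact: nice_cst|exact: nice_id].
- by move=> z <-; rewrite nrmM nrm_real ger0_norm.
move=> _ h; apply: ccvg_unique h _.
(* The partial sums are constant as soon as they contain the term of index [k]. *)
apply: (ccvg_eventually (k := k.+1) (z_ := fun=> (b ^+ k)%:C)); last exact: ccvg_cst.
move=> N hN; have E i : mean r (fun z => z^-1 ^+ k * (b%:C * z) ^+ i) = (i == k)%:R * (b ^+ i)%:C.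
  have zn0 z : nrm z = r -> z != 0 by move=> e; rewrite -nrm_gt0 e.
  have [ik|ki] := leqP i k.
    rewrite (@mean_ext _ _ r0 _ (fun z => (b ^+ i)%:C * z^-1 ^+ (k - i))).
      rewrite meanZ//; last by apply: niceX => //; exact: nice_inv.
      by rewrite meanXV mulrC; congr ((nat_of_bool _)%:R * _); rewrite subn_eq0 eqn_leq ik.
    move=> z e; rewrite exprMn rmorphXn mulrCA; congr (_ * _).
    by rewrite -{1}(subnK ik) exprD -mulrA -exprMn mulVf ?zn0// expr1n mulr1.
  rewrite (@mean_ext _ _ r0 _ (fun z => (b ^+ i)%:C * z ^+ (i - k))).
    rewrite meanZ//; last by apply: niceX => //; exact: nice_id.
    by rewrite meanX mulrC subn_eq0 leqNgt ki (gtn_eqF ki).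
  move=> z e; rewrite exprMn rmorphXn mulrCA; congr (_ * _).
  by rewrite -{1}(subnK (ltnW ki)) exprD mulrCA -exprMn mulVf ?zn0// expr1n mulr1.
rewrite (eq_bigr _ (fun i _ => E i)) (bigD1_seq k) ?iota_uniq ?mem_index_iota//=.
rewrite eqxx mul1r big1 ?addr0// => i /negbTE ->; by rewrite mul0r.
Qed.

Lemma mean_geom_pos (b : R) k : 0 <= b -> b * r < 1 -> 
  mean r (fun z => z ^+ k.+1 / (1 - b%:C * z)) = 0.
Proof.
move=> b0 br; have := @mean_geometric _ r r0 (fun z => z ^+ k.+1) (fun z => b%:C * z) (b * r).
case.
- by rewrite mulr_ge0// ltW.
- by apply: niceX => //; exact: nice_id.
- by apply: niceM => //; [exact: nice_cst|exact: nice_id].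
- by move=> z <-; rewrite nrmM nrm_real ger0_norm.
move=> _ h; apply: ccvg_unique h _; rewrite [X in ccvg X](_ : _ = fun=> 0); first exact: ccvg_cst.
apply/funext => N; apply: big1 => i _.
rewrite (@mean_ext _ _ r0 _ (fun z => (b ^+ i)%:C * z ^+ (k.+1 + i))).
  rewrite meanZ//; last by apply: niceX => //; exact: nice_id.
  by rewrite meanX addSn mulr0.
by move=> z e; rewrite exprMn rmorphXn mulrCA exprD.
Qed.

End Fourier.

(** * Double means with one mixed pole *)

Section DoubleMean.
Variables (R : realType) (r1 r2 : R).
Notation C := R[i].
Variables (q1 q2 : C -> C) (th1 th2 : R).
Hypotheses (r10 : 0 < r1) (r20 : 0 < r2) (th10 : 0 <= th1) (th20 : 0 <= th2) (th1th2 : th1 * th2 < 1).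
Hypotheses (nq1 : nice r1 q1) (nq2 : nice r2 q2).
Hypotheses (hq1 : on_circle r1 (fun z => nrm (q1 z) <= th1)).
Hypotheses (hq2 : on_circle r2 (fun z => nrm (q2 z) <= th2)).
Implicit Types F G : C -> C.

(** The mixed factor [1 / (z * w - 1)] has this shape up to elementary factors, with [q1], [q2] the
    inversion on contours of radius above 1 and the identity on contours of radius below 1. *)
Definition dkernel F G z w := F z * G w / (1 - q1 z * q2 w).

Let th01 : 0 <= th1 * th2 < 1. Proof. by rewrite mulr_ge0. Qed.
Let d0 : 0 < 1 - th1 * th2. Proof. by rewrite subr_gt0. Qed.

Let hq z w : nrm z = r1 -> nrm w = r2 -> nrm (q1 z * q2 w) <= th1 * th2.
Proof. by move=> hz hw; rewrite nrmM ler_pM ?nrm_ge0 ?hq1 ?hq2. Qed.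

Let inner_geom F G z : nice r2 G -> nrm z = r1 ->
  nice r2 (dkernel F G z) /\
  ccvg (fun N => \sum_(0 <= i < N) F z * q1 z ^+ i * mean r2 (fun w => G w * q2 w ^+ i))
       (mean r2 (dkernel F G z)).
Proof.
move=> nG hz; have := @mean_geometric _ r2 r20 (fun w => F z * G w) (fun w => q1 z * q2 w) _ th01.
case.
- by apply: niceM => //; exact: nice_cst.
- by apply: niceM => //; exact: nice_cst.
- by move=> w hw; exact: hq.
move=> nk ck; split=> //; move: ck; congr ccvg; apply/funext => N; apply: eq_bigr => i _.
rewrite -meanZ//; last by apply: niceM => //; exact: niceX.
by apply: mean_ext => // w _; rewrite exprMn; ring.
Qed.

Let dkernel_bound F G z w (MF MG : R) : nrm z = r1 -> nrm w = r2 ->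
  on_circle r1 (fun z => nrm (F z) <= MF) -> on_circle r2 (fun z => nrm (G z) <= MG) ->
  nrm (dkernel F G z w) <= MF * MG / (1 - th1 * th2).
Proof.
move=> hz hw hF hG; rewrite /dkernel !nrmM nrmV ler_pM ?mulr_ge0 ?nrm_ge0 ?invr_ge0 ?nrm_ge0//.
  by rewrite ler_pM ?nrm_ge0 ?hF ?hG.
have h : 1 - th1 * th2 <= nrm (1 - q1 z * q2 w).
  apply: le_trans (nrm_sub_ge _ _).
  by rewrite -[1 in leRHS]/(1%:C) nrm_real normr1 lerD2l lerN2 hq.
by rewrite lef_pV2// posrE// (lt_le_trans d0).
Qed.

(** Expanding the mixed factor separates the variables, so that a double integral becomes a series
    of products of one-variable moments. The same series shows that the inner mean is measurable in
    [z]. *)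
Lemma dmean_series F G : nice r1 F -> nice r2 G ->
  [/\ on_circle r1 (fun z => nice r2 (dkernel F G z)),
      nice r1 (fun z => mean r2 (dkernel F G z)) &
      ccvg (fun N => \sum_(0 <= i < N) mean r1 (fun z => F z * q1 z ^+ i) *
                                        mean r2 (fun w => G w * q2 w ^+ i))
           (mean r1 (fun z => mean r2 (dkernel F G z)))].
Proof.
move=> nF nG; have [_ _ [MF hF]] := nF; have [_ _ [MG hG]] := nG.
have MF0 : 0 <= MF by apply: le_trans (nrm_ge0 _) (on_circle_pt r10 0 hF).
have MG0 : 0 <= MG by apply: le_trans (nrm_ge0 _) (on_circle_pt r20 0 hG).
have nFq i : nice r1 (fun z => F z * q1 z ^+ i) by apply: niceM => //; exact: niceX.
have nGq i : nice r2 (fun w => G w * q2 w ^+ i) by apply: niceM => //; exact: niceX.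
have gb i : nrm (mean r2 (fun w => G w * q2 w ^+ i)) <= 2 * (MG * th2 ^+ i).
  apply: mean_bound => // w hw; rewrite nrmM nrmX ler_pM ?nrm_ge0 ?exprn_ge0 ?nrm_ge0 ?hG//.
  by rewrite lerXn2r ?nnegrE ?nrm_ge0 ?hq2.
have fb i z : nrm z = r1 -> nrm (F z * q1 z ^+ i) <= MF * th1 ^+ i.
  move=> hz; rewrite nrmM nrmX ler_pM ?nrm_ge0 ?exprn_ge0 ?nrm_ge0 ?hF//.
  by rewrite lerXn2r ?nnegrE ?nrm_ge0 ?hq1.
have := @mean_cvg _ r1 r10
  (fun N z => \sum_(0 <= i < N) F z * q1 z ^+ i * mean r2 (fun w => G w * q2 w ^+ i))
  (fun z => mean r2 (dkernel F G z)) (2 * MF * MG * (1 - th1 * th2)^-1).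
case.
- by move=> N; apply: nice_sum => // i; apply: niceM => //; exact: nice_cst.
- move=> z hz N; apply: le_trans (nrm_sum _ _ _) _.
  apply: (@le_trans _ _ (\sum_(0 <= i < N) 2 * MF * MG * (th1 * th2) ^+ i)); last first.
    by rewrite -mulr_sumr ler_wpM2l ?geometric_sum_le// !mulr_ge0.
  apply: ler_sum => i _; rewrite nrmM exprMn.
  rewrite (_ : 2 * MF * MG * (th1 ^+ i * th2 ^+ i) = MF * th1 ^+ i * (2 * (MG * th2 ^+ i))); last by ring.
  by apply: ler_pM; rewrite ?nrm_ge0// fb.
- by move=> z hz; case: (inner_geom F nG hz).
move=> n c.
split=> //; first by move=> z hz; case: (inner_geom F nG hz).
move: c; congr ccvg; apply/funext => N; rewrite mean_sum//; last first.
  by move=> i; apply: niceM => //; exact: nice_cst.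
apply: eq_bigr => i _.
by rewrite [RHS]mulrC -meanZ//; apply: mean_ext => // z _; rewrite mulrC.
Qed.

Lemma dmean_bound F G (MF MG : R) : nice r1 F -> nice r2 G ->
  on_circle r1 (fun z => nrm (F z) <= MF) -> on_circle r2 (fun z => nrm (G z) <= MG) ->
  nrm (mean r1 (fun z => mean r2 (dkernel F G z))) <= 4 * (MF * MG / (1 - th1 * th2)).
Proof.
move=> nF nG hF hG; have [n1 n2 _] := dmean_series nF nG.
rewrite (_ : 4 * _ = 2 * (2 * (MF * MG / (1 - th1 * th2)))); last by ring.
apply: mean_bound => // z hz; apply: mean_bound => //; first exact: n1.
by move=> w hw; exact: dkernel_bound.
Qed.

Lemma dmean_cvg (F_ G_ : nat -> C -> C) F G (MF MG : R) :
  (forall m, nice r1 (F_ m)) -> (forall m, nice r2 (G_ m)) ->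
  (forall m, on_circle r1 (fun z => nrm (F_ m z) <= MF)) ->
  (forall m, on_circle r2 (fun z => nrm (G_ m z) <= MG)) ->
  on_circle r1 (fun z => ccvg (F_ ^~ z) (F z)) -> on_circle r2 (fun z => ccvg (G_ ^~ z) (G z)) ->
  ccvg (fun m => mean r1 (fun z => mean r2 (dkernel (F_ m) (G_ m) z)))
       (mean r1 (fun z => mean r2 (dkernel F G z))).
Proof.
move=> nF nG hF hG cF cG.
apply: (@mean_ccvg _ r1 r10 _ _ (2 * (MF * MG / (1 - th1 * th2)))).
- by move=> m; case: (dmean_series (nF m) (nG m)).
- move=> z hz m; apply: mean_bound => //; first by case: (dmean_series (nF m) (nG m)) => h _ _; exact: h.
  by move=> w hw; exact: dkernel_bound.
move=> z hz; apply: (@mean_ccvg _ r2 r20 _ _ (MF * MG / (1 - th1 * th2))).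
- by move=> m; case: (dmean_series (nF m) (nG m)) => h _ _; exact: h.
- by move=> w hw m; exact: dkernel_bound.
move=> w hw; apply: ccvgM; first by apply: ccvgM; [exact: cF|exact: cG].
exact: ccvg_cst.
Qed.

End DoubleMean.

(** * The kernel at distinct parameters *)

Section PartialFractions.
Variables (F : numFieldType) (I : finType) (P : pred I) (a : I -> F) (N : {poly F}).
Hypotheses (a_inj : injective a) (a_neq0 : forall i, a i != 0) (a2_neq1 : forall i, a i ^+ 2 != 1).
Hypotheses (size_N : (size N <= #|P|.+2)%N) (N1 : N.[1] = 0) (Nm1 : N.[-1] = 0).

Definition pf_coef j := N.[(a j)^-1] /
  (((a j)^-1 ^+ 2 - 1) * \prod_(i | P i && (i != j)) (1 - a i / a j)).

(** Both sides have degree at most [|P| + 1] and agree at the [|P| + 2] points [1], [-1] and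
    [1 / a j]. *)
Lemma partial_fractions z : N.[z] =
  (z ^+ 2 - 1) * \sum_(j | P j) pf_coef j * \prod_(i | P i && (i != j)) (1 - a i * z).
Proof.
pose lin i : {poly F} := 1 - a i *: 'X.
pose S := \sum_(j | P j) pf_coef j *: \prod_(i | P i && (i != j)) lin i.
pose D := N - ('X^2 - 1) * S.
have linE i y : (lin i).[y] = 1 - a i * y by rewrite hornerD hornerN hornerZ hornerX hornerC.
have SE y : S.[y] = \sum_(j | P j) pf_coef j * \prod_(i | P i && (i != j)) (1 - a i * y).
  rewrite horner_sum; apply: eq_bigr => j _; rewrite hornerZ horner_prod; congr (_ * _).
  by apply: eq_bigr.
have DE y : D.[y] = N.[y] - (y ^+ 2 - 1) * S.[y].
  by rewrite hornerD hornerN hornerM hornerD hornerN hornerXn hornerC.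
suff D0 : D = 0 by apply/eqP; rewrite -subr_eq0 -SE -DE D0 horner0.
pose rts := [:: 1, -1 & [seq (a j)^-1 | j <- enum P]].
have size_lin i : (size (lin i) <= 2)%N.
  apply: leq_trans (size_polyD _ _) _; rewrite size_polyN geq_max size_poly1 /=.
  by apply: leq_trans (size_scale_leq _ _) _; rewrite size_polyX.
have size_S : (size S <= #|P|)%N.
  apply: leq_trans (size_sum _ _ _) _; apply/bigmax_leqP => j Pj.
  apply: leq_trans (size_scale_leq _ _) _; apply: leq_trans (size_prod_leq _ _) _.
  have cP : #|[pred i | P i && (i != j)]| = #|P|.-1.
    by rewrite (cardD1 j P) -topredE /= Pj add1n /=; apply: eq_card => i; rewrite /in_mem /= andbC.
  rewrite leq_subLR cP; have : (\sum_(i | P i && (i != j)) size (lin i) <= #|P|.-1 * 2)%N.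
    rewrite -cP -sum_nat_const; apply: leq_sum => i _; exact: size_lin.
  have : (0 < #|P|)%N by apply/card_gt0P; exists j.
  by move: (\sum_(_ | _) _)%N => m; lia.
have size_D : (size D <= #|P|.+2)%N.
  apply: leq_trans (size_polyD _ _) _; rewrite geq_max size_N size_polyN /=.
  apply: leq_trans (size_polyMleq _ _) _.
  have : (size ('X^2 - 1 : {poly F})%R <= 3)%N.
    by apply: leq_trans (size_polyD _ _) _; rewrite size_polyN size_polyXn size_poly1.
  by move: (size _) (size S) size_S => m k; lia.
have rts_root : all (root D) rts.
  rewrite /= /root !DE N1 Nm1 !expr2 mulrNN mulr1 subrr !mul0r !subr0 !eqxx /=.
  rewrite all_map; apply/allP => j; rewrite mem_enum => Pj /=; have {}Pj : P j := Pj; rewrite DE SE.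
  rewrite (bigD1 j)//= [X in _ * (_ + X)]big1 ?addr0; last first.
    move=> i /andP[Pi ij]; rewrite (bigD1 j)/=; last by rewrite Pj eq_sym.
    by rewrite divff// subrr mul0r mulr0.
  rewrite mulrCA -[_ * \prod_(_ | _) _]mulrC mulrA mulrC /pf_coef; apply/eqP.
  set Q := \prod_(_ | _) _; have Q0 : Q != 0.
    apply/prodf_neq0 => i /andP[_ ij]; apply: contra ij; rewrite subr_eq0 => /eqP e.
    by apply/eqP/a_inj; rewrite -[a i](divfK (a_neq0 j)) -e mul1r.
  have h0 : (a j)^-1 ^+ 2 - 1 != 0.
    by rewrite subr_eq0 exprVn invr_eq1.
  move: h0; set c := _ - 1 => h0; move: N.[_] => y.
  by field; rewrite h0 Q0.
have rts_uniq : uniq rts.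
  rewrite /= inE negb_or map_inj_uniq ?enum_uniq ?andbT; last first.
    by move=> i j /invr_inj /a_inj.
  have two : 1 != -1 :> F by rewrite -subr_eq0 opprK -(natrD _ 1 1) pnatr_eq0.
  rewrite two /=; apply/andP; split; apply/negP => /mapP[j _] /esym/eqP.
    by rewrite invr_eq1 => /eqP e; have := a2_neq1 j; rewrite e expr1n eqxx.
  rewrite -[-1]invrK invrN invr1 (inj_eq invr_inj) => /eqP e.
  by have := a2_neq1 j; rewrite e sqrrN expr1n eqxx.
apply: (roots_geq_poly_eq0 rts_root rts_uniq).
by rewrite /= size_map -cardE.
Qed.

End PartialFractions.

(** * The inverse of the matrix (a_i - a_j) / (1 - a_i a_j) *)

Section CauchyInverse.
Variables (F : numFieldType) (n : nat) (a : 'I_n -> F).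
Hypotheses (even_n : ~~ odd n) (a_inj : injective a) (a_neq0 : forall i, a i != 0).
Hypotheses (aa_neq1 : forall i j, a i * a j != 1).

Let a2_neq1 i : a i ^+ 2 != 1. Proof. exact: aa_neq1. Qed.
Let aa1 i j : 1 - a i * a j != 0. Proof. by rewrite subr_eq0 eq_sym. Qed.
Let aij i j : i != j -> a i - a j != 0.
Proof. by move=> ij; rewrite subr_eq0; apply: contra ij => /eqP /a_inj ->. Qed.

(** Up to an elementary factor, the residue at [1 / a i] of the product f of the (z - a_j) / (1 -
    a_j z). *)
Definition cpsi i := \prod_(j | j != i) ((1 - a i * a j) / (a i - a j)).
Definition cB i j := (a i - a j) / (1 - a i * a j).
(** The inverse of [cB] is [cB] itself with rows and columns scaled by [cpsi], which keeps it
    explicit and antisymmetric. *)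
Definition cM i j := cpsi i * cB i j * cpsi j.

Lemma cpsi_neq0 i : cpsi i != 0.
Proof. by apply/prodf_neq0 => j ji; rewrite mulf_neq0// invr_eq0 aij// eq_sym. Qed.

Let prod_opp (P : pred 'I_n) (G : 'I_n -> F) :
  \prod_(j | P j) - G j = (-1) ^+ #|P| * \prod_(j | P j) G j.
Proof. by rewrite prodrN. Qed.

Let size_prod_lin (P : pred 'I_n) (G : 'I_n -> {poly F}) : (forall i, (size (G i) <= 2)%N) ->
  (size (\prod_(i | P i) G i)%R <= #|P|.+1)%N.
Proof.
move=> h; apply: leq_trans (size_prod_leq _ _) _; rewrite leq_subLR.
have : (\sum_(i | P i) size (G i) <= #|P| * 2)%N.
  by rewrite -sum_nat_const; apply: leq_sum => i _.
by move: (\sum_(i | P i) size (G i))%N #|P| => m p; lia.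
Qed.

Let sXa i : (size ('X - (a i)%:P : {poly F})%R <= 2)%N. Proof. by rewrite size_XsubC. Qed.
Let s1a i : (size (1 - a i *: 'X : {poly F})%R <= 2)%N.
Proof.
apply: leq_trans (size_polyD _ _) _; rewrite size_polyN geq_max size_poly1 /=.
by apply: leq_trans (size_scale_leq _ _) _; rewrite size_polyX.
Qed.

(** The left side vanishes at [1] and, [n] being even, at [-1]; its partial fraction coefficients
    are then read off at the [1 / a j]. *)
Lemma blaschke_identity z : z * \prod_i (z - a i) - z * \prod_i (1 - a i * z) =
  (z ^+ 2 - 1) * \sum_j cpsi j * \prod_(i | i != j) (1 - a i * z).
Proof.
pose N : {poly F} := 'X * \prod_i ('X - (a i)%:P) - 'X * \prod_i (1 - a i *: 'X).
have NE y : N.[y] = y * \prod_i (y - a i) - y * \prod_i (1 - a i * y).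
  rewrite hornerD hornerN !hornerM hornerX !horner_prod; congr (_ * _ - _ * _).
    by apply: eq_bigr => i _; rewrite hornerXsubC.
  by apply: eq_bigr => i _; rewrite hornerD hornerN hornerZ hornerX hornerC.
rewrite -NE (@partial_fractions F _ predT a N a_inj a_neq0 a2_neq1).
- congr (_ * _); apply: eq_bigr => j _; congr (_ * _).
  rewrite /pf_coef NE (bigD1 j)//= [X in _ - _ * X](bigD1 j)//= mulfV// subrr mul0r mulr0 subr0.
  have -> : \prod_(i < n | i != j) ((a j)^-1 - a i) =
      (\prod_(i < n | i != j) (1 - a i / a j)) * \prod_(i < n | i != j) ((1 - a j * a i) / (a j - a i)).
    rewrite -big_split; apply: eq_bigr => i ij /=.
    by field; rewrite a_neq0 /= ?andbT aij// eq_sym.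
  rewrite -/(cpsi j); set Q := \prod_(i < n | i != j) _; have Q0 : Q != 0.
    apply/prodf_neq0 => i ij; rewrite subr_eq0 eq_sym; apply: contra (aij ij) => /eqP e.
    by rewrite subr_eq0 -[a i](divfK (a_neq0 j)) e mul1r.
  by field; rewrite a_neq0 Q0 /= mulN1r; exact: aa1.
- have hs (p : {poly F}) : (size p <= n.+1)%N -> (size ('X * p)%R <= n.+2)%N.
    by move=> hp; apply: leq_trans (size_polyMleq _ _) _; rewrite size_polyX.
  have cn : #|('I_n : predArgType)| = n by rewrite card_ord.
  rewrite (_ : #|_| = n)//; apply: leq_trans (size_polyD _ _) _; rewrite size_polyN geq_max.
  by rewrite !hs// -[in X in (_ <= X)%N]cn; exact: size_prod_lin.
- by rewrite NE !mul1r (eq_bigr (fun i => 1 - a i * 1)) ?subrr// => i _; rewrite mulr1.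
- rewrite NE; set p := \prod_i _; set q := \prod_i _; suff -> : p = q by rewrite subrr.
  rewrite /p (eq_bigr (fun i => - (1 + a i))); last by move=> i _; rewrite opprD.
  rewrite prod_opp (_ : #|_| = n) ?card_ord// -signr_odd (negbTE even_n) expr0 mul1r.
  by apply: eq_bigr => i _; rewrite mulrN1 opprK.
Qed.

Lemma sum_cpsi : \sum_i cpsi i = 0.
Proof.
have := blaschke_identity 0; rewrite !mul0r subrr expr0n /= sub0r mulN1r => /esym/eqP.
rewrite oppr_eq0 => /eqP e; rewrite -[RHS]e; apply: eq_bigr => j _.
by rewrite big1 ?mulr1// => i _; rewrite mulr0 subr0.
Qed.

Lemma blaschke_expansion z : z != 0 -> (forall i, 1 - a i * z != 0) ->
  \prod_i ((z - a i) / (1 - a i * z)) = 1 + (z - z^-1) * \sum_j cpsi j / (1 - a j * z).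
Proof.
move=> z0 hz; rewrite prodf_div; set p := \prod_i _; set q := \prod_i _.
have q0 : q != 0 by apply/prodf_neq0 => i _; exact: hz.
have e := blaschke_identity z; rewrite -/p -/q in e.
have sE : \sum_j cpsi j * \prod_(i | i != j) (1 - a i * z) = q * \sum_j cpsi j / (1 - a j * z).
  rewrite mulr_sumr; apply: eq_bigr => j _; rewrite /q [X in _ = X * _](bigD1 j)//=.
  by move: (\prod_(_ | _) _) => Q; field; exact: hz.
rewrite sE in e; apply: (mulfI z0); apply: (mulfI q0).
rewrite [LHS](_ : _ = z * p); last by field.
rewrite (_ : z * p = z * q + (z ^+ 2 - 1) * (q * \sum_j cpsi j / (1 - a j * z))); last by rewrite -e; ring.
by field.
Qed.

(** The expansion of f evaluated at its zero [a i]. *)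
Lemma sum_cpsi_geom i : \sum_j cpsi j / (1 - a j * a i) = a i / (1 - a i ^+ 2).
Proof.
have h2 : 1 - a i ^+ 2 != 0 by rewrite subr_eq0 eq_sym a2_neq1.
have := @blaschke_expansion (a i) (a_neq0 i) (fun j => aa1 j i).
rewrite (bigD1 i)//= subrr !mul0r; move: (\sum_j _) => S e.
apply: (mulfI h2); rewrite [RHS]mulrC divfK//.
rewrite (_ : (1 - a i ^+ 2) * S = a i - a i * (1 + (a i - (a i)^-1) * S)); last by field.
by rewrite -e mulr0 subr0.
Qed.

Let cB_split i j : cB j i = - (a i)^-1 + ((a i)^-1 - a i) / (1 - a j * a i).
Proof. by rewrite /cB; field; rewrite a_neq0 aa1. Qed.

Let inv_sub i : (a i)^-1 - a i = (1 - a i ^+ 2) / a i.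
Proof. by field. Qed.

Let h2 i : 1 - a i ^+ 2 != 0. Proof. by rewrite subr_eq0 eq_sym a2_neq1. Qed.

Lemma sum_cpsi_cB i : \sum_j cpsi j * cB j i = 1.
Proof.
transitivity (- (a i)^-1 * \sum_j cpsi j + ((a i)^-1 - a i) * \sum_j cpsi j / (1 - a j * a i)).
  by rewrite !mulr_sumr -big_split; apply: eq_bigr => j _; rewrite cB_split /=; ring.
by rewrite sum_cpsi sum_cpsi_geom inv_sub; field; rewrite a_neq0 h2.
Qed.

Lemma sum_cpsi_cB_a i : \sum_j a j * cpsi j * cB j i = (1 - \sum_j a j * cpsi j) / a i.
Proof.
transitivity (- (a i)^-1 * (\sum_j a j * cpsi j) +
    ((1 - a i ^+ 2) / a i ^+ 2) * (\sum_j cpsi j / (1 - a j * a i) - \sum_j cpsi j)).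
  rewrite -sumrB !mulr_sumr -big_split; apply: eq_bigr => j _ /=; rewrite /cB.
  by field; rewrite a_neq0 aa1.
by rewrite sum_cpsi sum_cpsi_geom; move: (\sum_j _) => s; field; rewrite a_neq0 h2.
Qed.

Lemma sum_cpsi_cB_inv i : \sum_j cpsi j * cB j i / a j = a i * (1 - \sum_j cpsi j / a j).
Proof.
transitivity (- a i * (\sum_j cpsi j / a j) + (1 - a i ^+ 2) * (\sum_j cpsi j / (1 - a j * a i))).
  rewrite !mulr_sumr -big_split; apply: eq_bigr => j _ /=; rewrite /cB.
  by field; rewrite a_neq0 aa1.
by rewrite sum_cpsi_geom; move: (\sum_j _) => s; field; rewrite h2.
Qed.

Lemma cB_anti i j : cB i j = - cB j i.
Proof. by rewrite /cB -[a i - a j]opprB mulNr [a j * a i]mulrC. Qed.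

(** Two evaluations of the double sum of [a j * cpsi j * cB j i * cpsi i]: summing over [j] first
    uses [sum_cpsi_cB_a], summing over [i] first uses [sum_cpsi_cB]. *)
Lemma moment_constants :
  (1 - \sum_j a j * cpsi j) * (1 - \sum_j cpsi j / a j) = 1.
Proof.
have e1 : \sum_i (\sum_j a j * cpsi j * cB j i) * cpsi i =
    (1 - \sum_j a j * cpsi j) * \sum_j cpsi j / a j.
  by rewrite mulr_sumr; apply: eq_bigr => i _; rewrite sum_cpsi_cB_a; ring.
have e2 : \sum_i (\sum_j a j * cpsi j * cB j i) * cpsi i = - \sum_j a j * cpsi j.
  transitivity (\sum_j a j * cpsi j * - (\sum_i cpsi i * cB i j)).
    under eq_bigr do rewrite mulr_suml; rewrite exchange_big /=; apply: eq_bigr => j _.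
    rewrite -sumrN mulr_sumr; apply: eq_bigr => i _; rewrite cB_anti; ring.
  by rewrite -sumrN; apply: eq_bigr => j _; rewrite sum_cpsi_cB mulrN1.
rewrite mulrBr mulr1 -e1 e2; ring.
Qed.

(** This is the diagonal of [cM] times [cB], up to sign. Partial fractions are taken for the
    parameters other than [a i] and evaluated at [a i]. Their number is odd, so only one of the two
    products carries a factor ['X]: this makes the numerator vanish at [-1]. *)
Lemma sum_cB2 i : cpsi i * \sum_j cpsi j * cB j i ^+ 2 = -1.
Proof.
pose P j := j != i.
pose N : {poly F} := \prod_(j | P j) ('X - (a j)%:P) - 'X * \prod_(j | P j) (1 - a j *: 'X).
have NE y : N.[y] = \prod_(j | P j) (y - a j) - y * \prod_(j | P j) (1 - a j * y).
  rewrite hornerD hornerN !hornerM hornerX !horner_prod; congr (_ - _ * _).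
    by apply: eq_bigr => j _; rewrite hornerXsubC.
  by apply: eq_bigr => j _; rewrite hornerD hornerN hornerZ hornerX hornerC.
have cP : #|P|.+1 = n.
  rewrite (_ : #|P| = #|predC1 i|)// cardC1 card_ord prednK//.
  exact: leq_ltn_trans (leq0n i) (ltn_ord i).
have oP : odd #|P|.
  move: even_n; have : odd #|P|.+1 = odd n by rewrite cP.
  by move=> <- /=; rewrite negbK.
have coef j : P j -> pf_coef P a N j = a j * cpsi j * cB j i.
  move=> Pj; rewrite /pf_coef NE (bigD1 j Pj)/= [X in _ - _ * X](bigD1 j Pj)/= mulfV// subrr mul0r mulr0 subr0.
  have -> : \prod_(k | P k && (k != j)) ((a j)^-1 - a k) =
      (\prod_(k | P k && (k != j)) (1 - a k / a j)) * \prod_(k | P k && (k != j)) ((1 - a j * a k) / (a j - a k)).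
    rewrite -big_split; apply: eq_bigr => k /andP[_ kj] /=.
    by field; rewrite a_neq0 /= ?andbT aij// eq_sym.
  have -> : cpsi j = (1 - a j * a i) / (a j - a i) * \prod_(k | P k && (k != j)) ((1 - a j * a k) / (a j - a k)).
    by rewrite /cpsi (bigD1 i) 1?eq_sym//=; congr (_ * _); apply: eq_bigl => k; rewrite andbC.
  set Q := \prod_(k | P k && (k != j)) (1 - _); have Q0 : Q != 0.
    apply/prodf_neq0 => k /andP[_ kj]; rewrite subr_eq0 eq_sym; apply: contra (aij kj) => /eqP e.
    by rewrite subr_eq0 -[a k](divfK (a_neq0 j)) e mul1r.
  move: (\prod_(k | _) _) => T; rewrite /cB.
  by field; rewrite a_neq0 Q0 aa1 aij//= mulN1r; exact: aa1.
have sN : (size N <= #|P|.+2)%N.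
  rewrite /N; apply: leq_trans (size_polyD _ _) _; rewrite size_polyN geq_max.
  rewrite (leq_trans (size_prod_lin _ sXa))//=.
  apply: leq_trans (size_polyMleq _ _) _; rewrite size_polyX /=; exact: size_prod_lin.
have N1 : N.[1] = 0.
  by rewrite NE !mul1r (eq_bigr (fun j => 1 - a j * 1)) ?subrr// => j _; rewrite mulr1.
have Nm1 : N.[-1] = 0.
  rewrite NE (eq_bigr (fun j => - (1 + a j))); last by move=> j _; rewrite opprD.
  rewrite prod_opp -signr_odd oP expr1 !mulN1r opprK; apply/eqP; rewrite addrC subr_eq0; apply/eqP.
  by apply: eq_bigr => j _; rewrite mulrN1 opprK.
have := partial_fractions a_inj a_neq0 a2_neq1 sN N1 Nm1 (a i); rewrite NE.
set p := \prod_(j | P j) _; set q := \prod_(j | P j) _ => e.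
have q0 : q != 0 by apply/prodf_neq0 => j _; exact: aa1.
have pq : p = q / cpsi i.
  rewrite /cpsi -[RHS]mulrC -prodfV -big_split; apply: eq_bigr => j ji /=.
  by rewrite mulrC; field; rewrite aa1 /= ?andbT aij// eq_sym.
have {}e : (cpsi i)^-1 - a i = (a i ^+ 2 - 1) * \sum_(j | P j) a j * cpsi j * cB j i / (1 - a j * a i).
  apply: (mulfI q0); rewrite mulrBr -pq [q * a i]mulrC e mulrCA; congr (_ * _); rewrite mulr_sumr.
  apply: eq_bigr => j Pj; rewrite coef// /q [in RHS](bigD1 j)//=.
  by move: (\prod_(_ | _) _) => Q; field; exact: aa1.
pose S := \sum_j cpsi j * cB j i / (1 - a j * a i).
have e1 : \sum_(j | P j) a j * cpsi j * cB j i / (1 - a j * a i) = (a i)^-1 * (S - 1).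
  transitivity ((a i)^-1 * (S - \sum_j cpsi j * cB j i)); last by rewrite sum_cpsi_cB.
  rewrite -sumrB mulr_sumr [RHS](bigD1 i)//= /cB !(subrr, mul0r, mulr0) add0r.
  by apply: eq_bigr => j _; field; rewrite a_neq0 aa1.
have e2 : \sum_j cpsi j * cB j i ^+ 2 = - (a i)^-1 + ((a i)^-1 - a i) * S.
  transitivity (- (a i)^-1 * (\sum_j cpsi j * cB j i) + ((a i)^-1 - a i) * S); last by rewrite sum_cpsi_cB mulr1.
  rewrite !mulr_sumr -big_split; apply: eq_bigr => j _ /=.
  by rewrite [in LHS]expr2 {1}cB_split; ring.
apply: (mulfI (invr_neq0 (cpsi_neq0 i))); rewrite mulKf ?cpsi_neq0// mulrN1 e2.
apply/eqP; rewrite -addr_eq0 -[(cpsi i)^-1](subrK (a i)) e e1; apply/eqP.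
by field.
Qed.

(** Off the diagonal, [cB i j * cB j k] decomposes into simple fractions in [a j], with coefficients
    [c1] and [c2]; [sum_cpsi] and [sum_cpsi_geom] evaluate the sums. The diagonal is [sum_cB2]. *)
Lemma cM_inverse i k : \sum_j cM i j * cB j k = (i == k)%:R.
Proof.
have [->|ik] := eqVneq i k.
  rewrite -[RHS]opprK -(sum_cB2 k) mulr_sumr -sumrN; apply: eq_bigr => j _.
  by rewrite /cM (cB_anti k j); ring.
pose c1 := (a i ^+ 2 - 1) * (1 - a i * a k) / (a i * (a i - a k)).
pose c2 := (a i * a k - 1) * (1 - a k ^+ 2) / (a k * (a k - a i)).
have dik := aij ik; have dki : a k - a i != 0 by rewrite aij// eq_sym.
transitivity (cpsi i * (- (a i * a k)^-1 * (\sum_j cpsi j) + c1 * (\sum_j cpsi j / (1 - a j * a i)) +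
  c2 * (\sum_j cpsi j / (1 - a j * a k)))).
  rewrite !mulr_sumr -!big_split mulr_sumr; apply: eq_bigr => j _ /=; rewrite /cM /cB /c1 /c2.
  have h : 1 - a i * a j != 0 by []; rewrite (mulrC (a j) (a i)).
  by field; rewrite !a_neq0 h aa1 dik dki.
rewrite sum_cpsi !sum_cpsi_geom /c1 /c2 mulr0 add0r -[RHS]/(0 : F).
by field; rewrite !a_neq0 !h2 dik dki.
Qed.

End CauchyInverse.

(** * Moments of f on circles *)

Section BlaschkeMoments.
Variables (R : realType) (n : nat) (a : 'I_n -> R).
Notation C := R[i].
Hypotheses (a0 : forall j, 0 < a j).

Lemma den_ge (b : R) (z : C) : 0 <= b -> 1 - b * nrm z <= nrm (1 - b%:C * z).
Proof.
move=> b0; apply: le_trans (nrm_sub_ge _ _).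
by rewrite -[1 in leRHS]/(1%:C) nrm_real normr1 nrmM nrm_real ger0_norm.
Qed.

Section Radius.
Variable r : R.
Hypotheses (r0 : 0 < r) (ar : forall j, a j * r < 1).

Lemma den_neq0 j : on_circle r (fun z => 1 - (a j)%:C * z != 0).
Proof.
move=> z e; rewrite -nrm_gt0; apply: lt_le_trans (den_ge _ (ltW (a0 j))).
by rewrite e subr_gt0.
Qed.

Lemma circle_neq0 : on_circle r (fun z => z != 0).
Proof. by move=> z e; rewrite -nrm_gt0 e. Qed.

Lemma nice_f : nice r (f_prod a).
Proof.
apply: nice_prod => // j; apply: niceM => //; first by apply: niceB => //; [exact: nice_id|exact: nice_cst].
by apply: nice_geom => //; exact: ltW.
Qed.

(** The bound is in terms of the [a j] only, which makes the kernel estimates uniform over the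
    approximating parameters below them. *)
Lemma f_bound (b : 'I_n -> R) : (forall j, 0 < b j <= a j) -> (forall j, a j < 1) ->
  on_circle r (fun z => nrm (f_prod b z) <= \prod_(j < n) ((r + 1) / (1 - a j * r))).
Proof.
move=> hb a1 z e; rewrite /f_prod nrm_prod; apply: ler_prod => j _; rewrite nrm_ge0 /=.
have /andP[b0 ba] := hb j.
rewrite nrmM nrmV ler_pM ?nrm_ge0 ?invr_ge0 ?nrm_ge0//.
  by apply: le_trans (nrmB _ _) _; rewrite e nrm_real gtr0_norm// lerD2l (le_trans ba)// ltW.
have h : 1 - a j * r <= nrm (1 - (b j)%:C * z).
  apply: le_trans (den_ge _ (ltW b0)); rewrite e lerD2l lerN2 ler_wpM2r// ltW//.
have h0 : 0 < 1 - a j * r by rewrite subr_gt0.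
by rewrite lef_pV2// posrE// (lt_le_trans h0).
Qed.

Lemma f_cvg (b_ : nat -> 'I_n -> R) : (forall j, b_ m j @[m --> \oo] --> a j) ->
  on_circle r (fun z => ccvg (fun m => f_prod (b_ m) z) (f_prod a z)).
Proof.
move=> hb z e; apply: ccvg_prod => j; apply: ccvgM.
  by apply: ccvgB; [exact: ccvg_cst|exact: ccvg_real].
apply: ccvgV; first exact: den_neq0.
by apply: ccvgB; [exact: ccvg_cst|apply: ccvgM; [exact: ccvg_real|exact: ccvg_cst]].
Qed.

Hypotheses (even_n : ~~ odd n) (a_inj : injective a) (a1 : forall j, a j < 1).

Local Notation psi := (cpsi a).

Lemma cpsi_real j : cpsi (fun i => (a i)%:C) j = (psi j)%:C.
Proof.
rewrite /cpsi rmorph_prod; apply: eq_bigr => i _.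
by rewrite fmorph_div /= !rmorphB /= rmorphM rmorph1.
Qed.

Let aa1 i j : a i * a j != 1.
Proof. by rewrite lt_eqF// mulr_ilt1// ?ltW. Qed.

Lemma f_expand : on_circle r (fun z =>
  f_prod a z = 1 + \sum_j (psi j)%:C * (z / (1 - (a j)%:C * z) - z^-1 / (1 - (a j)%:C * z))).
Proof.
move=> z e; rewrite /f_prod (@blaschke_expansion _ n (fun i => (a i)%:C)) //.
- by congr (_ + _); rewrite mulr_sumr; apply: eq_bigr => j _; rewrite cpsi_real; ring.
- by move=> i j [] /a_inj.
- by move=> i; rewrite -[0]/(0%:C) (inj_eq (@complexI R)) gt_eqF.
- by move=> i j; rewrite -rmorphM -[1]/(1%:C) (inj_eq (@complexI R)).
- exact: circle_neq0.
- by move=> j; exact: den_neq0.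
Qed.

(** [b ^+ s.+1 - b ^+ s.-1], without the second term for [s = 0]. It is minus the mean of (z - 1/z)
    z^(-s) / (1 - b z); the second term is absent because at [s = 0] the integrand part z / (1 - b
    z) has mean 0. *)
Definition qmom (b : R) (s : nat) : R := b ^+ s.+1 - (if s is s'.+1 then b ^+ s' else 0).
Definition momC (k : nat) : R := (k == 0%N)%:R - \sum_j psi j * qmom (a j) k.
Definition momA (k : nat) : R := \sum_j psi j * a j ^+ k.

Let ngeo j : nice r (fun z => (1 - (a j)%:C * z)^-1).
Proof. by apply: nice_geom => //; exact: ltW. Qed.

Let nX k : nice r (fun z : C => z ^+ k). Proof. by apply: niceX; exact: nice_id. Qed.
Let nV k : nice r (fun z : C => z^-1 ^+ k). Proof. by apply: niceX => //; exact: nice_inv. Qed.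
Let nXg k j : nice r (fun z : C => z ^+ k / (1 - (a j)%:C * z)). Proof. by apply: niceM. Qed.
Let nVg k j : nice r (fun z : C => z^-1 ^+ k / (1 - (a j)%:C * z)). Proof. by apply: niceM. Qed.

(** The value does not depend on the radius, as long as the poles [1 / a j] stay outside; moments
    may therefore be transported between the small and the large contours. *)
Lemma moment_C k : mean r (fun z => f_prod a z * z^-1 ^+ k) = (momC k)%:C.
Proof.
pose g j (z : C) := (if k is k'.+1 then z^-1 ^+ k' / (1 - (a j)%:C * z) else z ^+ 1 / (1 - (a j)%:C * z)).
have ng j : nice r (g j) by rewrite /g {g}; case: k.
rewrite (@mean_ext _ r r0 _ (fun z => z^-1 ^+ k + \sum_j (psi j)%:C * (g j z - z^-1 ^+ k.+1 / (1 - (a j)%:C * z)))).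
  have nt j : nice r (fun z => (psi j)%:C * (g j z - z^-1 ^+ k.+1 / (1 - (a j)%:C * z))).
    by apply: niceM => //; [exact: nice_cst|exact: niceB].
  rewrite meanD//; last exact: nice_sum.
  rewrite meanXV// mean_sum// /momC rmorphB rmorph_sum /= rmorph_nat -sumrN; congr (_ + _).
  apply: eq_bigr => j _; rewrite meanZ//; last exact: niceB.
  rewrite meanB// mean_geom_neg//; last exact: ltW.
  have -> : mean r (g j) = (if k is k'.+1 then a j ^+ k' else 0)%:C.
    rewrite /g; case: k {g ng nt} => [|k]; first by rewrite mean_geom_pos//; exact: ltW.
    by rewrite mean_geom_neg//; exact: ltW.
  by rewrite /qmom -rmorphB -rmorphM -rmorphN /= -mulrN opprB.
move=> z e; rewrite (f_expand e) mulrDl mul1r mulr_suml; congr (_ + _); apply: eq_bigr => j _.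
rewrite -mulrA; congr (_ * _); rewrite mulrBl /g; congr (_ - _); last by rewrite exprS; ring.
case: k {g ng} => [|k]; first by rewrite expr0 mulr1 expr1.
have z0 := circle_neq0 e.
by rewrite exprS; move: (_ ^+ k) => Z; field; rewrite z0 den_neq0.
Qed.

(** The expansion of f has terms with a pole at 0; their contributions, present for [k = 0] only,
    cancel by [sum_cpsi]. *)
Lemma moment_C_pos k : mean r (fun z => f_prod a z * z ^+ k.+1) = 0.
Proof.
rewrite (@mean_ext _ r r0 _ (fun z => z ^+ k.+1 + \sum_j (psi j)%:C * (z ^+ k.+2 / (1 - (a j)%:C * z) - z ^+ k / (1 - (a j)%:C * z)))).
  have nt j : nice r (fun z => (psi j)%:C * (z ^+ k.+2 / (1 - (a j)%:C * z) - z ^+ k / (1 - (a j)%:C * z))).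
    by apply: niceM => //; [exact: nice_cst|exact: niceB].
  rewrite meanD//; last exact: nice_sum.
  rewrite meanX// mean_sum// add0r.
  transitivity (\sum_j (psi j)%:C * (- (k == 0%N)%:R : C)).
    apply: eq_bigr => j _; rewrite meanZ//; last exact: niceB.
    rewrite meanB// mean_geom_pos//; last exact: ltW.
    rewrite add0r; congr (_ * - _); case: k {nt} => [|k]; last by rewrite mean_geom_pos//; exact: ltW.
    by have := @mean_geom_neg _ r r0 (a j) 0 (ltW (a0 j)) (ar j); rewrite expr0.
  rewrite -mulr_suml -rmorph_sum /= sum_cpsi// ?mul0r// => i; exact: lt0r_neq0.
move=> z e; rewrite (f_expand e) mulrDl mul1r mulr_suml; congr (_ + _); apply: eq_bigr => j _.
have z0 := circle_neq0 e.
by rewrite !exprS; move: (_ ^+ k) => Z; field; rewrite z0 den_neq0.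
Qed.

Hypothesis r1 : 1 < r.

Let q_le (z : C) : nrm z = r -> nrm (z^-1 ^+ 2) <= r^-1 ^+ 2.
Proof. by move=> e; rewrite nrmX nrmV e. Qed.

Let th01 : 0 <= r^-1 ^+ 2 < 1.
Proof. by rewrite exprn_ge0 ?invr_ge0 ?ltW//= exprn_ilt1// ?invr_ge0 ?invf_lt1// ltW. Qed.

Lemma sq_neq1 : on_circle r (fun z => z ^+ 2 - 1 != 0).
Proof.
move=> z e; rewrite -nrm_gt0; apply: lt_le_trans (nrm_sub_ge _ _).
by rewrite nrmX e nrm1 subr_gt0 exprn_egt1.
Qed.

Let sqE : on_circle r (fun z => (z ^+ 2 - 1)^-1 = z^-1 ^+ 2 / (1 - z^-1 ^+ 2)).
Proof.
move=> z e; have z0 := circle_neq0 e; have h := sq_neq1 e.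
by rewrite exprVn; field; rewrite h z0.
Qed.

Lemma nice_sqV : nice r (fun z => (z ^+ 2 - 1)^-1).
Proof.
have [h _] := mean_geometric r0 th01 (nV 2) (nV 2) q_le.
by apply: nice_ext h => // z e; rewrite sqE.
Qed.

Let mean_sqV k : mean r (fun z => z * z^-1 ^+ k / (z ^+ 2 - 1)) = 0.
Proof.
have [_ h] := mean_geometric r0 th01 (nV k.+1) (nV 2) q_le.
rewrite (@mean_ext _ r r0 _ (fun z => z^-1 ^+ k.+1 / (1 - z^-1 ^+ 2))).
  apply: ccvg_unique h _; rewrite [X in ccvg X](_ : _ = fun=> 0); first exact: ccvg_cst.
  apply/funext => N; apply: big1 => i _.
  rewrite (@mean_ext _ r r0 _ (fun z => z^-1 ^+ (k.+1 + 2 * i))); first by rewrite meanXV.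
  by move=> z _; rewrite exprD exprM.
move=> z e; have z0 := circle_neq0 e; rewrite sqE// mulrA; congr (_ / _).
by rewrite [RHS]exprS; move: (z^-1 ^+ k) => Z; field.
Qed.

(** The denominator [z ^+ 2 - 1] cancels the factor [z - 1/z] in the expansion of f. The constant
    term of the expansion leaves z / (z^2 - 1), which outside the unit circle is a series in
    negative powers and has mean 0 against every z^(-k). *)
Lemma moment_A k : mean r (fun z => z * f_prod a z / (z ^+ 2 - 1) * z^-1 ^+ k) = (momA k)%:C.
Proof.
rewrite (@mean_ext _ r r0 _ (fun z => z * z^-1 ^+ k / (z ^+ 2 - 1) + \sum_j (psi j)%:C * (z^-1 ^+ k / (1 - (a j)%:C * z)))).
  have nt j : nice r (fun z => (psi j)%:C * (z^-1 ^+ k / (1 - (a j)%:C * z))).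
    by apply: niceM => //; exact: nice_cst.
  rewrite meanD//.
  - rewrite mean_sqV add0r mean_sum// /momA rmorph_sum; apply: eq_bigr => j _.
    by rewrite meanZ// mean_geom_neg// ?rmorphM//; exact: ltW.
  - apply: niceM => //; last exact: nice_sqV.
    by apply: niceM => //; exact: nice_id.
  - exact: nice_sum.
move=> z e; rewrite (f_expand e) mulrDr mulr1 !mulrDl; congr (_ + _).
  by rewrite mulrAC.
rewrite -!mulrA mulr_suml mulr_sumr; apply: eq_bigr => j _.
have z0 := circle_neq0 e; have h := sq_neq1 e; move: (z^-1 ^+ k) => Z.
by field; rewrite z0 h den_neq0.
Qed.

End Radius.
End BlaschkeMoments.

(** * Closed forms of the kernel entries from series of moments *)

Section MomentSeries.
Variables (R : realType) (n : nat) (a : 'I_n -> R).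
Hypotheses (even_n : ~~ odd n) (a0 : forall j, 0 < a j) (a1 : forall j, a j < 1) (a_inj : injective a).

Local Notation psi := (cpsi a).
Local Notation q := (qmom).

Let an0 j : a j != 0. Proof. exact: lt0r_neq0. Qed.
Let aa1 i j : a i * a j != 1. Proof. by rewrite lt_eqF// mulr_ilt1// ?ltW. Qed.
Let aa1' i j : 1 - a i * a j != 0. Proof. by rewrite subr_eq0 eq_sym. Qed.

(** With [kr12] and [kr22], the entries of D + W^T B_0^-1 W, where [cM] is the inverse of B_0. *)
Definition kr11 (u v : nat) : R := \sum_i \sum_j cM a i j * (a i ^+ u * a j ^+ v).
Definition kr12 (u v : nat) : R := (u == v)%:R - \sum_i \sum_j cM a i j * (a i ^+ u * qmom (a j) v).
Definition kr22 (u v : nat) : R :=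
  (u == v.+1)%:R - (v == u.+1)%:R + \sum_i \sum_j cM a i j * (qmom (a i) u * qmom (a j) v).

(** Each pair [(i, j)] contributes a geometric series in [a i * a j], and its sum supplies the
    denominator of [cB]. *)
Lemma bilinear_series (c d : 'I_n -> R) u v :
  let X k := \sum_i c i * a i ^+ k in let Y k := \sum_j d j * a j ^+ k in
  (\sum_(0 <= m < N) (X (u.+1 + m)%N * Y (v + m)%N - X (u + m)%N * Y (v.+1 + m)%N)) @[N --> \oo] -->
  \sum_i \sum_j c i * cB a i j * d j * (a i ^+ u * a j ^+ v).
Proof.
move=> X Y.
have E N : \sum_(0 <= m < N) (X (u.+1 + m)%N * Y (v + m)%N - X (u + m)%N * Y (v.+1 + m)%N) =
   \sum_i \sum_j c i * cB a i j * d j * (a i ^+ u * a j ^+ v) * (1 - (a i * a j) ^+ N).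
  transitivity (\sum_(0 <= m < N) \sum_i \sum_j c i * d j * (a i ^+ u * a j ^+ v) * (a i - a j) * (a i * a j) ^+ m).
    apply: eq_bigr => m _; rewrite /X /Y !big_distrlr -sumrB; apply: eq_bigr => i _ /=.
    by rewrite -sumrB; apply: eq_bigr => j _; rewrite !addSn !exprS !exprD exprMn; ring.
  rewrite exchange_big; apply: eq_bigr => i _ /=; rewrite exchange_big; apply: eq_bigr => j _ /=.
  rewrite -mulr_sumr.
  have -> : \sum_(0 <= m < N) (a i * a j) ^+ m = (1 - (a i * a j) ^+ N) / (1 - a i * a j).
    have h := aa1' i j; elim: N => [|N IH]; first by rewrite big_nil expr0 subrr mul0r.
    by rewrite big_nat_recr//= IH exprS; move: (_ ^+ N) => Z; field.
  by rewrite /cB; field.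
under eq_fun do rewrite E.
apply: cvg_sum_seq => i; apply: cvg_sum_seq => j.
rewrite -[X in _ --> X]mulr1; apply: cvgMr; rewrite -[X in _ --> X]subr0.
apply: cvgB; first exact: cvg_cst.
apply: cvg_expr; rewrite ger0_norm ?mulr_ge0 ?ltW//; apply: mulr_ilt1; rewrite ?ltW//; exact: a1.
Qed.

Lemma kr11_series u v :
  (\sum_(0 <= m < N) (momA a (u.+1 + m)%N * momA a (v + m)%N - momA a (u + m)%N * momA a (v.+1 + m)%N))
    @[N --> \oo] --> kr11 u v.
Proof. exact: bilinear_series. Qed.

Let Q j : R := a j ^+ 2 - 1.
Let sg : R := \sum_j psi j / a j.
Let dc j : R := - (psi j * Q j / a j).

Let qE j k : qmom (a j) k = (Q j * a j ^+ k + (k == 0%N)%:R) / a j.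
Proof.
rewrite /qmom /Q; case: k => [|k] /=; first by rewrite expr0 expr1 subr0; field.
by rewrite !exprS expr0 addr0; move: (a j ^+ k) => Z; field.
Qed.

Let momCE k : momC a k = (k == 0%N)%:R * (1 - sg) + \sum_j dc j * a j ^+ k.
Proof.
rewrite /momC mulrBr mulr1 -addrA; congr (_ + _); rewrite /sg mulr_sumr -!sumrN -big_split.
by apply: eq_bigr => j _ /=; rewrite qE /dc; field.
Qed.

Let momCS k : momC a k.+1 = \sum_j dc j * a j ^+ k.+1.
Proof. by rewrite momCE mul0r add0r. Qed.

(** The moments [momC] fit the bilinear form except for a constant at index 0. This constant meets
    the series once, for [v = m = 0], and [sum_cpsi_cB_inv] matches the result with the closed
    form. *)
Lemma kr12_series u v :
  ((u == v)%:R + \sum_(0 <= m < N) (momA a (u.+1 + m)%N * momC a (v + m)%N -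
     momA a (u + m)%N * momC a (v.+1 + m)%N)) @[N --> \oo] --> kr12 u v.
Proof.
have h := @bilinear_series psi dc u v; rewrite /= in h.
have E : kr12 u v = (u == v)%:R + (\sum_i \sum_j psi i * cB a i j * dc j * (a i ^+ u * a j ^+ v) +
    (v == 0%N)%:R * (momA a u.+1 * (1 - sg))).
  rewrite /kr12; congr (_ + _); rewrite /momA mulr_suml mulr_sumr -big_split -sumrN.
  apply: eq_bigr => i _ /=.
  have -> : psi i * a i ^+ u.+1 * (1 - sg) = psi i * a i ^+ u * \sum_j psi j * cB a j i / a j.
    by rewrite sum_cpsi_cB_inv// exprS -/sg; ring.
  rewrite !mulr_sumr -sumrN -big_split; apply: eq_bigr => j _ /=.
  by rewrite qE /dc /cM (cB_anti a i j); field.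
rewrite E; apply: cvgD; first exact: cvg_cst.
(* Passing to [N.+1] isolates the term [m = 0], the only one in which [momC] can occur at index
   0. *)
rewrite -cvg_shiftS.
have -> : (fun N => \sum_(0 <= m < N.+1) (momA a (u.+1 + m)%N * momC a (v + m)%N - momA a (u + m)%N * momC a (v.+1 + m)%N)) =
  (fun N => \sum_(0 <= m < N.+1) (momA a (u.+1 + m)%N * (\sum_j dc j * a j ^+ (v + m)) -
      momA a (u + m)%N * (\sum_j dc j * a j ^+ (v.+1 + m))) + (v == 0%N)%:R * (momA a u.+1 * (1 - sg))).
  apply/funext => N; rewrite [in LHS]big_nat_recl// [in RHS]big_nat_recl//= !addn0 !momCE.
  rewrite [X in _ + X = _](_ : _ = \sum_(0 <= m < N) (momA a (u.+1 + m.+1)%N * (\sum_j dc j * a j ^+ (v + m.+1)) -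
      momA a (u + m.+1)%N * (\sum_j dc j * a j ^+ (v.+1 + m.+1)))).
    rewrite -[(v.+1 == 0%N)%:R]/(0 : R) mul0r add0r.
    by move: (\sum_(0 <= m < N) _) (\sum_j dc j * a j ^+ v) (\sum_j dc j * a j ^+ v.+1) => S1 S2 S3; ring.
  by apply: eq_bigr => m _; rewrite !addnS !momCS.
by apply: cvgD; [move: h; rewrite -cvg_shiftS|exact: cvg_cst].
Qed.

(** The mean of f z^(i - u), which vanishes for [i > u] because f has no pole inside the circle. *)
Definition momCt (u i : nat) : R := if (i <= u)%N then momC a (u - i) else 0.

Let Tsum N u v : R := \sum_(0 <= i < N) (momCt u i.+1 * momCt v i - momCt u i * momCt v i.+1).

Let Tsum_anti N u v : Tsum N u v = - Tsum N v u.
Proof. by rewrite /Tsum -sumrN; apply: eq_bigr => i _; ring. Qed.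

Let kr22_anti u v : kr22 u v = - kr22 v u.
Proof.
rewrite /kr22 opprD opprB; congr (_ + _); rewrite -sumrN exchange_big; apply: eq_bigr => i _ /=.
rewrite -sumrN; apply: eq_bigr => j _.
by rewrite /cM (cB_anti a j i); ring.
Qed.

Let sum_a_cM j : \sum_i cM a i j * a i = psi j * (1 - \sum_k a k * psi k) / a j.
Proof.
rewrite -mulrA -(sum_cpsi_cB_a even_n a_inj an0 aa1) mulr_sumr; apply: eq_bigr => i _; rewrite /cM; ring.
Qed.

Let mom0 : momC a 0 = 1 - \sum_k a k * psi k.
Proof. by rewrite /momC; congr (_ - _); apply: eq_bigr => j _; rewrite /qmom expr1 subr0 mulrC. Qed.

Let kr22_base N v : Tsum N.+1 0 v = kr22 0 v.
Proof.
case: v => [|v].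
  apply/eqP; have /eqP := Tsum_anti N.+1 0 0; have /eqP := kr22_anti 0 0.
  by rewrite -!addr_eq0 -!mulr2n !mulrn_eq0 /= => /eqP -> /eqP ->.
rewrite /Tsum big_nat_recl//= big1 => [|i _]; last by rewrite /momCt !ltn0 !mul0r subrr.
rewrite addr0 /momCt /= !subn0 subn1 /= mul0r sub0r.
rewrite /kr22 -[(0%N == v.+2)%:R]/(0 : R) sub0r eqSS.
have -> : \sum_i \sum_j cM a i j * (qmom (a i) 0 * qmom (a j) v.+1) =
   (1 - \sum_k a k * psi k) * \sum_j psi j * Q j * a j ^+ v / a j.
  rewrite exchange_big mulr_sumr; apply: eq_bigr => j _ /=.
  transitivity ((\sum_i cM a i j * a i) * (Q j * a j ^+ v)).
    rewrite mulr_suml; apply: eq_bigr => i _; rewrite [qmom (a j) _]qE exprS addr0 /qmom expr1 subr0.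
    by field.
  by rewrite sum_a_cM; field.
rewrite mom0 momCE; set s := \sum_k _.
have -> : \sum_j psi j * Q j * a j ^+ v / a j = - \sum_j dc j * a j ^+ v.
  by rewrite -sumrN; apply: eq_bigr => j _; rewrite /dc; ring.
have := moment_constants even_n a_inj an0 aa1; rewrite -/s -/sg => h.
transitivity (- ((v == 0%N)%:R * ((1 - s) * (1 - sg))) - (1 - s) * \sum_j dc j * a j ^+ v); first by ring.
by rewrite h; ring.
Qed.

(** Raising both indices multiplies the main term by [a i * a j], and the difference cancels the
    denominator of [cB]; products of single sums remain, together with corrections at index 0. *)
Let kr22_step u v : kr22 u.+1 v.+1 - kr22 u v = momC a u * momC a v.+1 - momC a u.+1 * momC a v.
Proof.
pose al i := psi i * Q i * a i ^+ u; pose be j := psi j * Q j * a j ^+ v.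
pose eu : R := (u == 0%N)%:R; pose ev : R := (v == 0%N)%:R.
have inv j : \sum_i psi i * cB a i j / a i = a j * (1 - sg) by rewrite sum_cpsi_cB_inv.
have mu' : \sum_j dc j * a j ^+ u = - \sum_i al i / a i.
  by rewrite -sumrN; apply: eq_bigr => i _; rewrite /dc /al; ring.
have mv' : \sum_j dc j * a j ^+ v = - \sum_i be i / a i.
  by rewrite -sumrN; apply: eq_bigr => i _; rewrite /dc /be; ring.
have mu1 : \sum_j dc j * a j ^+ u.+1 = - \sum_i al i.
  by rewrite -sumrN; apply: eq_bigr => i _; rewrite /dc /al exprS; field.
have mv1 : \sum_j dc j * a j ^+ v.+1 = - \sum_i be i.
  by rewrite -sumrN; apply: eq_bigr => i _; rewrite /dc /be exprS; field.
rewrite !momCE mu' mv' mu1 mv1 -/eu -/ev !mul0r !add0r.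
have -> : kr22 u.+1 v.+1 - kr22 u v = \sum_i \sum_j (al i / a i * be j - al i * (be j / a j)
    - eu * (psi i * cB a i j / a i) * (be j / a j) + ev * (al i / a i) * (psi j * cB a j i / a j)
    - eu * ev * (psi i * cB a i j / a i) * (psi j / a j)).
  rewrite /kr22 !eqSS opprD addrACA subrr add0r -sumrB; apply: eq_bigr => i _.
  rewrite -sumrB; apply: eq_bigr => j _; rewrite !qE -/eu -/ev /al /be !exprS /cM (cB_anti a j i) /cB.
  move: (a i ^+ u) (a j ^+ v) => U W; rewrite !addr0.
  by field; rewrite !an0 aa1'.
have e1 : \sum_i \sum_j (al i / a i * be j) = (\sum_i al i / a i) * \sum_j be j by rewrite big_distrlr.
have e2 : \sum_i \sum_j (al i * (be j / a j)) = (\sum_i al i) * \sum_j be j / a j by rewrite big_distrlr.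
have e3 : \sum_i \sum_j (eu * (psi i * cB a i j / a i) * (be j / a j)) = eu * (1 - sg) * \sum_j be j.
  rewrite exchange_big mulr_sumr; apply: eq_bigr => j _ /=.
  transitivity (eu * (be j / a j) * \sum_i psi i * cB a i j / a i).
    by rewrite mulr_sumr; apply: eq_bigr => i _; ring.
  by rewrite inv; field.
have e4 : \sum_i \sum_j (ev * (al i / a i) * (psi j * cB a j i / a j)) = ev * (1 - sg) * \sum_i al i.
  rewrite mulr_sumr; apply: eq_bigr => i _ /=; rewrite -mulr_sumr inv.
  by field.
have e5 : \sum_i \sum_j (eu * ev * (psi i * cB a i j / a i) * (psi j / a j)) = 0.
  rewrite exchange_big /=; transitivity (eu * ev * (1 - sg) * \sum_j psi j).
    rewrite mulr_sumr; apply: eq_bigr => j _ /=.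
    transitivity (eu * ev * (psi j / a j) * \sum_i psi i * cB a i j / a i).
      by rewrite mulr_sumr; apply: eq_bigr => i _; ring.
    by rewrite inv; field.
  by rewrite sum_cpsi// mulr0.
transitivity (\sum_i \sum_j (al i / a i * be j) - \sum_i \sum_j (al i * (be j / a j)) -
  \sum_i \sum_j (eu * (psi i * cB a i j / a i) * (be j / a j)) +
  \sum_i \sum_j (ev * (al i / a i) * (psi j * cB a j i / a j)) -
  \sum_i \sum_j (eu * ev * (psi i * cB a i j / a i) * (psi j / a j))).
  rewrite -!(sumrB, big_split) /=; apply: eq_bigr => i _.
  by rewrite -!(sumrB, big_split).
rewrite e1 e2 e3 e4 e5; ring.
Qed.

(** Both sides are antisymmetric and obey the same recursion along diagonals, so that row 0 decides.
    In row 0, [moment_constants] accounts for the entry next to the diagonal. *)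
Lemma kr22_finite N u v : (u + v < N)%N ->
  \sum_(0 <= i < N) (momCt u i.+1 * momCt v i - momCt u i * momCt v i.+1) = kr22 u v.
Proof.
rewrite -/(Tsum N u v); elim: u v N => [|u IH] v [//|N] h; first exact: kr22_base.
case: v h => [|v] h; first by rewrite Tsum_anti kr22_base [RHS]kr22_anti.
rewrite -[RHS](subrK (kr22 u v)) kr22_step -(IH v N); last by lia.
by rewrite /Tsum big_nat_recl//= /momCt /= !subn0 !subSS !subn0 [in RHS]addrC addrC; congr (_ + _).
Qed.

End MomentSeries.

(** * Contour integrals as double means *)

Section ContourKernel.
Variable R : realType.
Notation C := R[i].

Lemma circle_integralE (r : R) (H : C -> C) : 0 < r -> nice r H ->
  circle_integral r H = (0 +i* (2 * pi)) * mean r (fun z => H z * z).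
Proof.
move=> r0 nH; have pi0 : 2 * pi != 0 :> R by rewrite gt_eqF// mulr_gt0// pi_gt0.
have -> : circle_integral r H = (2 * pi)%:C * mean r (fun z => H z * ((0 +i* 1) * z)).
  by rewrite /mean mulrA -rmorphM /= divff// mul1r.
have -> : (0 +i* (2 * pi)) = (2 * pi)%:C * (0 +i* 1) :> C.
  by apply/eqP; rewrite eq_complex ReM ImM /= !(mulr0, mul0r, mulr1, subrr, addr0) !eqxx.
rewrite -mulrA -[in RHS]meanZ//; last by apply: niceM => //; exact: nice_id.
by congr (_ * _); apply: mean_ext => // z _; rewrite mulrCA.
Qed.

Lemma circle_integral_ext (r : R) (H G : C -> C) : 0 < r -> on_circle r (fun z => H z = G z) ->
  circle_integral r H = circle_integral r G.
Proof.
move=> r0 e; rewrite /circle_integral; congr (_ +i* _); apply: eq_Rintegral => th _;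
by rewrite (on_circle_pt r0 th e).
Qed.

Variables (r1 r2 : R) (q1 q2 : C -> C) (th1 th2 : R).
Hypotheses (r10 : 0 < r1) (r20 : 0 < r2) (th10 : 0 <= th1) (th20 : 0 <= th2) (th1th2 : th1 * th2 < 1).
Hypotheses (nq1 : nice r1 q1) (nq2 : nice r2 q2).
Hypotheses (hq1 : on_circle r1 (fun z => nrm (q1 z) <= th1)).
Hypotheses (hq2 : on_circle r2 (fun z => nrm (q2 z) <= th2)).

Definition dmean (F G : C -> C) : C := mean r1 (fun z => mean r2 (dkernel q1 q2 F G z)).

(** The numerator [w - z] splits the integrand into two kernels with separated variables, hence the
    difference; the factor [w * z] in the hypothesis comes from dz = i z dtheta and its analogue for
    [w]. *)
Lemma circle_integral2_dkernel (g : C -> C -> C) (F G F' G' : C -> C) :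
  nice r1 F -> nice r2 G -> nice r1 F' -> nice r2 G' ->
  (forall z w, nrm z = r1 -> nrm w = r2 ->
     g z w * w * z = dkernel q1 q2 F G z w - dkernel q1 q2 F' G' z w) ->
  circle_integral2 r1 r2 g = dmean F G - dmean F' G'.
Proof.
move=> nF nG nF' nG' hg.
have [k1 k2 _] := dmean_series r10 r20 th10 th20 th1th2 nq1 nq2 hq1 hq2 nF nG.
have [k1' k2' _] := dmean_series r10 r20 th10 th20 th1th2 nq1 nq2 hq1 hq2 nF' nG'.
pose dk z w := dkernel q1 q2 F G z w - dkernel q1 q2 F' G' z w.
have ndk z : nrm z = r1 -> nice r2 (dk z) by move=> hz; apply: niceB => //; [exact: k1|exact: k1'].
have z0 z : nrm z = r1 -> z != 0 by move=> e; rewrite -nrm_gt0 e.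
have w0 w : nrm w = r2 -> w != 0 by move=> e; rewrite -nrm_gt0 e.
have gE z w : nrm z = r1 -> nrm w = r2 -> g z w = dk z w * w^-1 * z^-1.
  by move=> hz hw; rewrite /dk -hg//; field; rewrite z0 ?w0.
have ng z : nrm z = r1 -> nice r2 (g z).
  move=> hz; apply: (@nice_ext _ r2 r20 (fun w => dk z w * w^-1 * z^-1)).
    by move=> w hw; rewrite gE.
  apply: niceM => //; last exact: nice_cst.
  by apply: niceM => //; [exact: ndk|exact: nice_inv].
pose m z := mean r2 (dkernel q1 q2 F G z) - mean r2 (dkernel q1 q2 F' G' z).
have nm : nice r1 m by apply: niceB.
have pi0 : (0 +i* (2 * pi)) != 0 :> C.
  by rewrite eq_complex /= negb_and orbC gt_eqF// mulr_gt0// pi_gt0.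
have inE z : nrm z = r1 -> circle_integral r2 (fun w => g z w) = (0 +i* (2 * pi)) * (m z * z^-1).
  move=> hz; rewrite circle_integralE//; last exact: ng.
  congr (_ * _); transitivity (mean r2 (fun w => z^-1 * dk z w)).
    apply: mean_ext => // w hw; rewrite gE//; have := w0 w hw; have := z0 z hz.
    by move: (dk z w) => d ? ?; field; apply/andP.
  rewrite meanZ//; last exact: ndk.
  by rewrite mulrC /m -meanB//; [exact: k1|exact: k1'].
rewrite /circle_integral2 (circle_integral_ext r10 inE) circle_integralE//; last first.
  apply: niceM => //; first exact: nice_cst.
  by apply: niceM => //; exact: nice_inv.
rewrite (@mean_ext _ _ r10 _ (fun z => (0 +i* (2 * pi)) * m z)); last first.
  by move=> z hz; have := z0 z hz => ?; field.
rewrite meanZ// /m meanB//.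
rewrite /dmean; move: (0 +i* (2 * pi)) pi0 (mean r1 _) (mean r1 _) => p p0 A B.
by field.
Qed.

End ContourKernel.

(** * The kernel entries: evaluation, limits and bounds *)

Section KernelEntries.
Variables (R : realType) (n : nat) (r1 r2 s1 s2 : R).
Notation C := R[i].
Hypotheses (hr1 : 1 < r1) (hr2 : 1 < r2) (hs1 : 0 < s1 < 1) (hs2 : 0 < s2 < 1).
Implicit Types (a b : 'I_n -> R) (u v : nat).

Let r10 : 0 < r1. Proof. exact: lt_trans hr1. Qed.
Let r20 : 0 < r2. Proof. exact: lt_trans hr2. Qed.
Let s10 : 0 < s1. Proof. by case/andP: hs1. Qed.
Let s20 : 0 < s2. Proof. by case/andP: hs2. Qed.

(** [FA] is the factor of a variable with denominator [z ^+ 2 - 1], [FC] that of a variable without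
    it. On the large contours the two terms of [w - z] differ by which of the exponents [u], [v] is
    raised by one. *)
Definition FA a u (z : C) : C := z * f_prod a z / (z ^+ 2 - 1) * z^-1 ^+ u.
Definition FC a u (z : C) : C := f_prod a z * z^-1 ^+ u.

Let inv (z : C) := z^-1.
Let idc (z : C) := z.

Let hinv (r : R) : 0 < r -> on_circle r (fun z => nrm (inv z) <= r^-1).
Proof. by move=> r0 z e; rewrite nrmV e. Qed.
Let hid (r : R) : on_circle r (fun z => nrm (idc z) <= r). Proof. by move=> z ->. Qed.

Let th12 : r1^-1 * r2^-1 < 1.
Proof. by rewrite mulr_ilt1// ?invr_ge0 ?ltW// invf_lt1. Qed.
Let st12 : s1 * s2 < 1.
Proof. by case/andP: hs1 => ? ?; case/andP: hs2 => ? ?; rewrite mulr_ilt1// ltW. Qed.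

Let ri0 : 0 <= r1^-1. Proof. by rewrite invr_ge0 ltW. Qed.
Let ri0' : 0 <= r2^-1. Proof. by rewrite invr_ge0 ltW. Qed.

(** The second condition places every pole [1 / a j] outside the circle of radius [r]. *)
Definition good (r : R) a := (forall j, 0 < a j < 1) /\ (forall j, a j * r < 1).

Let good_s (s : R) a : 0 < s < 1 -> (forall j, 0 < a j < 1) -> good s a.
Proof.
move=> /andP[? ?] h; split=> // j; have /andP[? ?] := h j.
by rewrite mulr_ilt1// ltW.
Qed.

Let good0 r a : good r a -> forall j, 0 < a j. Proof. by case=> h _ j; case/andP: (h j). Qed.
Let good1 r a : good r a -> forall j, a j < 1. Proof. by case=> h _ j; case/andP: (h j). Qed.

Let nice_FC r a u : 0 < r -> good r a -> nice r (FC a u).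
Proof.
move=> r0 g; apply: niceM => //; first by apply: nice_f => //; [exact: good0 g|case: g].
by apply: niceX => //; exact: nice_inv.
Qed.

Let nice_FA r a u : 1 < r -> good r a -> nice r (FA a u).
Proof.
move=> rg g; have r0 : 0 < r by exact: lt_trans rg.
apply: niceM => //; last by apply: niceX => //; exact: nice_inv.
apply: niceM => //; last exact: nice_sqV.
by apply: niceM => //; [exact: nice_id|apply: nice_f => //; [exact: good0 g|case: g]].
Qed.

Definition fsup r a : R := \prod_(j < n) ((r + 1) / (1 - a j * r)).

Let fsup_ge0 r a : 0 < r -> good r a -> 0 <= fsup r a.
Proof.
move=> r0 [_ g]; apply: prodr_ge0 => j _; rewrite divr_ge0//; first by rewrite addr_ge0// ltW.
by rewrite subr_ge0 ltW.
Qed.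

Let FC_bound' r a b u : 0 < r -> good r a -> (forall j, 0 < b j <= a j) ->
  on_circle r (fun z => nrm (FC b u z) <= fsup r a * r^-1 ^+ u).
Proof.
move=> r0 g hb z e.
rewrite nrmM nrmX nrmV e ler_wpM2r ?exprn_ge0 ?invr_ge0 ?(ltW r0)//.
by have [_ ar] := g; exact: (f_bound r0 ar hb (good1 g) e).
Qed.

Let FC_bound r a b u : 1 < r -> good r a -> (forall j, 0 < b j <= a j) ->
  on_circle r (fun z => nrm (FC b u z) <= fsup r a * r^-1 ^+ u).
Proof. by move=> rg; apply: FC_bound'; exact: lt_trans rg. Qed.

Let FC_bound1 r a b u : 1 < r -> good r a -> (forall j, 0 < b j <= a j) ->
  on_circle r (fun z => nrm (FC b u z) <= fsup r a).
Proof.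
move=> rg g hb z e; have r0 : 0 < r by exact: lt_trans rg.
apply: le_trans (FC_bound u rg g hb e) _; rewrite ler_piMr ?fsup_ge0//.
by rewrite exprn_ile1 ?invr_ge0 ?(ltW r0)// invf_le1// ltW.
Qed.

Definition asup r a : R := r * fsup r a / (r ^+ 2 - 1).

Let FA_bound r a b u : 1 < r -> good r a -> (forall j, 0 < b j <= a j) ->
  on_circle r (fun z => nrm (FA b u z) <= asup r a).
Proof.
move=> rg g hb z e; have r0 : 0 < r by exact: lt_trans rg.
have d0 : 0 < r ^+ 2 - 1 by rewrite subr_gt0 exprn_egt1.
have -> : FA b u z = z / (z ^+ 2 - 1) * FC b u z by rewrite /FA /FC; ring.
rewrite nrmM [X in X * _]nrmM nrmV e /asup mulrAC; apply: ler_pM; rewrite ?nrm_ge0//.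
- by rewrite mulr_ge0 ?invr_ge0 ?nrm_ge0 ?(ltW r0).
- by rewrite invr_ge0 nrm_ge0.
- by rewrite ler_wpM2l ?(ltW r0)//; exact: FC_bound1.
- have h : r ^+ 2 - 1 <= nrm (z ^+ 2 - 1) by rewrite -{1}e -nrmX -nrm1 nrm_sub_ge.
  by rewrite lef_pV2// posrE (lt_le_trans d0).
Qed.

Let FC_cvg r a (b_ : nat -> 'I_n -> R) u : 0 < r -> good r a -> (forall j, b_ m j @[m --> \oo] --> a j) ->
  on_circle r (fun z => ccvg (fun m => FC (b_ m) u z) (FC a u z)).
Proof.
move=> r0 g hb z e; apply: ccvgM; last exact: ccvg_cst.
by have [_ ar] := g; exact: (f_cvg (good0 g) ar hb e).
Qed.

Let FA_cvg r a (b_ : nat -> 'I_n -> R) u : 0 < r -> good r a -> (forall j, b_ m j @[m --> \oo] --> a j) ->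
  on_circle r (fun z => ccvg (fun m => FA (b_ m) u z) (FA a u z)).
Proof.
move=> r0 g hb z e; apply: ccvgM; last exact: ccvg_cst.
apply: ccvgM; last exact: ccvg_cst; apply: ccvgM; first exact: ccvg_cst.
by have [_ ar] := g; exact: (f_cvg (good0 g) ar hb e).
Qed.

Let dm := dmean r1 r2 inv inv.
Let dms := dmean s1 s2 idc idc.

Let ninv r : 0 < r -> nice r inv. Proof. by move=> r0; exact: nice_inv. Qed.

Let zw_neq1 (z w : C) : nrm z = r1 -> nrm w = r2 -> z * w - 1 != 0.
Proof.
move=> hz hw; rewrite -nrm_gt0; apply: lt_le_trans (nrm_sub_ge _ _).
by rewrite nrm1 nrmM hz hw subr_gt0 mulr_egt1.
Qed.

Let zw_neq1s (z w : C) : nrm z = s1 -> nrm w = s2 -> z * w - 1 != 0.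
Proof.
move=> hz hw; rewrite -[_ - _]opprB oppr_eq0 -nrm_gt0; apply: lt_le_trans (nrm_sub_ge _ _).
by rewrite nrm1 nrmM hz hw subr_gt0.
Qed.

Let c_neq0 (r : R) (z : C) : 0 < r -> nrm z = r -> z != 0.
Proof. by move=> r0 e; rewrite -nrm_gt0 e. Qed.

Lemma Kc11E a u v : good r1 a -> good r2 a ->
  Kc11 a r1 r2 u v = dm (FA a u.+1) (FA a v) - dm (FA a u) (FA a v.+1).
Proof.
move=> g1 g2; apply: (circle_integral2_dkernel r10 r20 ri0 ri0' th12 (ninv r10) (ninv r20) (hinv r10) (hinv r20)
  (nice_FA u.+1 hr1 g1) (nice_FA v hr2 g2) (nice_FA u hr1 g1) (nice_FA v.+1 hr2 g2)).
move=> z w hz hw; rewrite /dkernel /FA /inv !exprS !exprVn.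
have z0 := c_neq0 r10 hz; have w0 := c_neq0 r20 hw; have h := zw_neq1 hz hw.
have hz2 := sq_neq1 hr1 hz; have hw2 := sq_neq1 hr2 hw.
have zu : z ^+ u != 0 by rewrite expf_neq0.
have wv : w ^+ v != 0 by rewrite expf_neq0.
move: (z ^+ u) (w ^+ v) (f_prod a z) (f_prod a w) zu wv => Z W fz fw Z0 W0.
by field; rewrite h hz2 hw2 z0 w0 Z0 W0.
Qed.

Lemma Kc12E a u v : good r1 a -> good r2 a ->
  Kc12 a r1 r2 u v = (u == v)%:R + (dm (FA a u.+1) (FC a v) - dm (FA a u) (FC a v.+1)).
Proof.
move=> g1 g2; rewrite /Kc12; congr (_ + _).
apply: (circle_integral2_dkernel r10 r20 ri0 ri0' th12 (ninv r10) (ninv r20) (hinv r10) (hinv r20)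
  (nice_FA u.+1 hr1 g1) (nice_FC v r20 g2) (nice_FA u hr1 g1) (nice_FC v.+1 r20 g2)).
move=> z w hz hw; rewrite /dkernel /FA /FC /inv !exprS !exprVn.
have z0 := c_neq0 r10 hz; have w0 := c_neq0 r20 hw; have h := zw_neq1 hz hw.
have hz2 := sq_neq1 hr1 hz.
have zu : z ^+ u != 0 by rewrite expf_neq0.
have wv : w ^+ v != 0 by rewrite expf_neq0.
move: (z ^+ u) (w ^+ v) (f_prod a z) (f_prod a w) zu wv => Z W fz fw Z0 W0.
by field; rewrite h hz2 z0 w0 Z0 W0.
Qed.

Let nice_zFC r a u : 0 < r -> good r a -> nice r (fun z => z * FC a u z).
Proof. by move=> r0 g; apply: niceM => //; [exact: nice_id|exact: nice_FC]. Qed.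

Lemma Kc22E a u v : (forall j, 0 < a j < 1) ->
  Kc22 a s1 s2 u v = dms (fun z => z * FC a u z) (FC a v) - dms (FC a u) (fun w => w * FC a v w).
Proof.
move=> g; have g1 := good_s hs1 g; have g2 := good_s hs2 g.
apply: (circle_integral2_dkernel s10 s20 (ltW s10) (ltW s20) st12 (nice_id _) (nice_id _) (@hid s1) (@hid s2)
  (nice_zFC u s10 g1) (nice_FC v s20 g2) (nice_FC u s10 g1) (nice_zFC v s20 g2)).
move=> z w hz hw; rewrite /dkernel /FC /idc !exprVn.
have z0 := c_neq0 s10 hz; have w0 := c_neq0 s20 hw; have h := zw_neq1s hz hw.
have h' : 1 - z * w != 0 by rewrite -opprB oppr_eq0.
have zu : z ^+ u != 0 by rewrite expf_neq0.
have wv : w ^+ v != 0 by rewrite expf_neq0.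
move: (z ^+ u) (w ^+ v) (f_prod a z) (f_prod a w) zu wv => Z W fz fw Z0 W0.
by field; rewrite h h' z0 w0 Z0 W0.
Qed.

Section Distinct.
Variable a : 'I_n -> R.
Hypotheses (even_n : ~~ odd n) (a_inj : injective a) (g1 : good r1 a) (g2 : good r2 a).

Let a0 := good0 g1.
Let a1 := good1 g1.
Let ar1 : forall j, a j * r1 < 1. Proof. by case: g1. Qed.
Let ar2 : forall j, a j * r2 < 1. Proof. by case: g2. Qed.

Let mA1 u : mean r1 (FA a u) = (momA a u)%:C. Proof. exact: moment_A. Qed.
Let mA2 u : mean r2 (FA a u) = (momA a u)%:C. Proof. exact: moment_A. Qed.
Let mC2 u : mean r2 (FC a u) = (momC a u)%:C. Proof. exact: moment_C. Qed.

Let FAq u i : (fun z => FA a u z * inv z ^+ i) = FA a (u + i).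
Proof. by apply/funext => z; rewrite /FA /inv exprD mulrA. Qed.
Let FCq u i : (fun z => FC a u z * inv z ^+ i) = FC a (u + i).
Proof. by apply/funext => z; rewrite /FC /inv exprD mulrA. Qed.

Let dm_series F G : nice r1 F -> nice r2 G ->
  ccvg (fun N => \sum_(0 <= i < N) mean r1 (fun z => F z * inv z ^+ i) * mean r2 (fun w => G w * inv w ^+ i)) (dm F G).
Proof.
by move=> nF nG; case: (dmean_series r10 r20 ri0 ri0' th12 (ninv r10) (ninv r20) (hinv r10) (hinv r20) nF nG).
Qed.

Lemma Kc11_distinct u v : Kc11 a r1 r2 u v = (kr11 a u v)%:C.
Proof.
rewrite Kc11E//; have := ccvg_real (@kr11_series _ _ _ a0 a1 u v).
apply: ccvg_unique.
have h1 := dm_series (nice_FA u.+1 hr1 g1) (nice_FA v hr2 g2).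
have h2 := dm_series (nice_FA u hr1 g1) (nice_FA v.+1 hr2 g2).
move: (ccvgB h1 h2); congr ccvg; apply/funext => N.
rewrite -sumrB rmorph_sum; apply: eq_bigr => i _.
by rewrite !FAq !mA1 !mA2 rmorphB !rmorphM.
Qed.

Lemma Kc12_distinct u v : Kc12 a r1 r2 u v = (kr12 a u v)%:C.
Proof.
rewrite Kc12E//; have := ccvg_real (@kr12_series _ _ _ even_n a0 a1 a_inj u v).
apply: ccvg_unique.
have h1 := dm_series (nice_FA u.+1 hr1 g1) (nice_FC v r20 g2).
have h2 := dm_series (nice_FA u hr1 g1) (nice_FC v.+1 r20 g2).
move: (ccvgD (ccvg_cst (u == v)%:R) (ccvgB h1 h2)); congr ccvg; apply/funext => N.
rewrite rmorphD rmorph_nat -sumrB rmorph_sum; congr (_ + _); apply: eq_bigr => i _.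
by rewrite !FAq !FCq !mA1 !mC2 -!rmorphM -rmorphB.
Qed.

Let mCt (s : R) u i : 0 < s -> good s a -> mean s (fun z => FC a u z * idc z ^+ i) = (momCt a u i)%:C.
Proof.
move=> s0 g; have [_ as1] := g; rewrite /momCt; case: leqP => h.
  rewrite -(moment_C a0 s0 as1 even_n a_inj a1); apply: mean_ext => // z e; rewrite /FC /idc -mulrA; congr (_ * _).
  by rewrite -{1}(subnK h) exprD -mulrA -exprMn mulVf ?expr1n ?mulr1// (c_neq0 s0 e).
rewrite -[RHS](@moment_C_pos _ _ a a0 s s0 as1 even_n a_inj a1 (i - u.+1)); apply: mean_ext => // z e.
rewrite /FC /idc -mulrA; congr (_ * _); rewrite -{1}(subnK (ltnW h)) exprD mulrCA -exprMn.
by rewrite mulVf ?expr1n ?mulr1 ?(c_neq0 s0 e)// -subSn// subSS.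
Qed.

Let mzCt (s : R) u i : 0 < s -> good s a -> mean s (fun z => z * FC a u z * idc z ^+ i) = (momCt a u i.+1)%:C.
Proof.
by move=> s0 g; rewrite -(mCt _ _ s0 g); apply: mean_ext => // z e; rewrite /idc exprS; ring.
Qed.

(** On the small contours the mixed factor expands in positive powers, which lower the index of the
    moments; the moments vanish once the index is negative, so the series is finite. *)
Lemma Kc22_distinct u v : Kc22 a s1 s2 u v = (kr22 a u v)%:C.
Proof.
have a01 : forall j, 0 < a j < 1 by case: g1.
rewrite Kc22E//; have gs1 := good_s hs1 a01; have gs2 := good_s hs2 a01.
have dmss F G : nice s1 F -> nice s2 G ->
  ccvg (fun N => \sum_(0 <= i < N) mean s1 (fun z => F z * idc z ^+ i) * mean s2 (fun w => G w * idc w ^+ i)) (dms F G).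
  by move=> nF nG; case: (dmean_series s10 s20 (ltW s10) (ltW s20) st12 (nice_id _) (nice_id _) (@hid s1) (@hid s2) nF nG).
have h1 := dmss _ _ (nice_zFC u s10 gs1) (nice_FC v s20 gs2).
have h2 := dmss _ _ (nice_FC u s10 gs1) (nice_zFC v s20 gs2).
apply: ccvg_unique (ccvgB h1 h2) _.
apply: (ccvg_eventually (k := (u + v).+1) (z_ := fun=> (kr22 a u v)%:C)); last exact: ccvg_cst.
move=> N hN; rewrite -(kr22_finite even_n a0 a1 a_inj hN) -sumrB rmorph_sum; apply: eq_bigr => i _.
by rewrite !mzCt// !mCt// rmorphB !rmorphM.
Qed.

End Distinct.

(** * Convergence and uniform bounds along approximating parameters *)

Section Family.
Variables (a : 'I_n -> R) (b_ : nat -> 'I_n -> R).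
Hypotheses (even_n : ~~ odd n) (g1 : good r1 a) (g2 : good r2 a).
Hypotheses (b_cvg : forall j, b_ m j @[m --> \oo] --> a j) (b_inj : forall m, injective (b_ m))
  (b_lt : forall m j, 0 < b_ m j < a j).

Let b_le m j : 0 < b_ m j <= a j. Proof. by case/andP: (b_lt m j) => -> /ltW. Qed.
Let a01 : forall j, 0 < a j < 1. Proof. by case: g1. Qed.
Let b01 m j : 0 < b_ m j < 1.
Proof. by case/andP: (b_lt m j) => -> /lt_trans -> //; case/andP: (a01 j). Qed.

Let good_b r m : 0 < r -> good r a -> good r (b_ m).
Proof.
move=> r0 [_ h]; split=> // j; apply: le_lt_trans (h j); rewrite ler_wpM2r ?ltW//.
by case/andP: (b_lt m j).
Qed.

Let gb1 m := good_b m r10 g1.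
Let gb2 m := good_b m r20 g2.
Let gs1 := good_s hs1 a01.
Let gs2 := good_s hs2 a01.
Let gbs1 m := good_b m s10 gs1.
Let gbs2 m := good_b m s20 gs2.

Let dm_cvg := dmean_cvg r10 r20 ri0 ri0' th12 (ninv r10) (ninv r20) (hinv r10) (hinv r20).
Let dms_cvg := dmean_cvg s10 s20 (ltW s10) (ltW s20) st12 (nice_id s1) (nice_id s2) (@hid s1) (@hid s2).

Lemma Kc11_cvg u v : ccvg (fun m => Kc11 (b_ m) r1 r2 u v) (Kc11 a r1 r2 u v).
Proof.
rewrite Kc11E//; under eq_fun do rewrite (Kc11E _ _ (gb1 _) (gb2 _)).
apply: ccvgB.
  exact: (dm_cvg (fun m => nice_FA u.+1 hr1 (gb1 m)) (fun m => nice_FA v hr2 (gb2 m))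
    (fun m => FA_bound u.+1 hr1 g1 (b_le m)) (fun m => FA_bound v hr2 g2 (b_le m))
    (FA_cvg u.+1 r10 g1 b_cvg) (FA_cvg v r20 g2 b_cvg)).
exact: (dm_cvg (fun m => nice_FA u hr1 (gb1 m)) (fun m => nice_FA v.+1 hr2 (gb2 m))
    (fun m => FA_bound u hr1 g1 (b_le m)) (fun m => FA_bound v.+1 hr2 g2 (b_le m))
    (FA_cvg u r10 g1 b_cvg) (FA_cvg v.+1 r20 g2 b_cvg)).
Qed.

Lemma Kc12_cvg u v : ccvg (fun m => Kc12 (b_ m) r1 r2 u v) (Kc12 a r1 r2 u v).
Proof.
rewrite Kc12E//; under eq_fun do rewrite (Kc12E _ _ (gb1 _) (gb2 _)).
apply: ccvgD; first exact: ccvg_cst.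
apply: ccvgB.
  exact: (dm_cvg (fun m => nice_FA u.+1 hr1 (gb1 m)) (fun m => nice_FC v r20 (gb2 m))
    (fun m => FA_bound u.+1 hr1 g1 (b_le m)) (fun m => FC_bound1 v hr2 g2 (b_le m))
    (FA_cvg u.+1 r10 g1 b_cvg) (FC_cvg v r20 g2 b_cvg)).
exact: (dm_cvg (fun m => nice_FA u hr1 (gb1 m)) (fun m => nice_FC v.+1 r20 (gb2 m))
    (fun m => FA_bound u hr1 g1 (b_le m)) (fun m => FC_bound1 v.+1 hr2 g2 (b_le m))
    (FA_cvg u r10 g1 b_cvg) (FC_cvg v.+1 r20 g2 b_cvg)).
Qed.

Let zFC_bound r b u : 0 < r -> good r a -> (forall j, 0 < b j <= a j) ->
  on_circle r (fun z => nrm (z * FC b u z) <= r * (fsup r a * r^-1 ^+ u)).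
Proof. by move=> r0 g hb z e; rewrite nrmM e ler_wpM2l ?(ltW r0)//; exact: FC_bound'. Qed.

Let zFC_cvg r u : 0 < r -> good r a -> on_circle r (fun z => ccvg (fun m => z * FC (b_ m) u z) (z * FC a u z)).
Proof. by move=> r0 g z e; apply: ccvgM; [exact: ccvg_cst|apply: FC_cvg e]. Qed.

Lemma Kc22_cvg u v : ccvg (fun m => Kc22 (b_ m) s1 s2 u v) (Kc22 a s1 s2 u v).
Proof.
rewrite Kc22E//; under eq_fun do rewrite (Kc22E _ _ (b01 _)).
apply: ccvgB.
  exact: (dms_cvg (fun m => nice_zFC u s10 (gbs1 m)) (fun m => nice_FC v s20 (gbs2 m))
    (fun m => zFC_bound u s10 gs1 (b_le m)) (fun m => FC_bound' v s20 gs2 (b_le m)) (zFC_cvg u s10 gs1) (FC_cvg v s20 gs2 b_cvg)).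
exact: (dms_cvg (fun m => nice_FC u s10 (gbs1 m)) (fun m => nice_zFC v s20 (gbs2 m))
    (fun m => FC_bound' u s10 gs1 (b_le m)) (fun m => zFC_bound v s20 gs2 (b_le m)) (FC_cvg u s10 gs1 b_cvg) (zFC_cvg v s20 gs2)).
Qed.

Let dm_bound := dmean_bound r10 r20 ri0 ri0' th12 (ninv r10) (ninv r20) (hinv r10) (hinv r20).

Lemma Kc11_bounded : exists c, forall m u v, nrm (Kc11 (b_ m) r1 r2 u v) <= c.
Proof.
exists (4 * (asup r1 a * asup r2 a / (1 - r1^-1 * r2^-1)) + 4 * (asup r1 a * asup r2 a / (1 - r1^-1 * r2^-1))) => m u v.
rewrite Kc11E//; apply: le_trans (nrmB _ _) _.
apply: lerD.
  exact: (dm_bound (nice_FA u.+1 hr1 (gb1 m)) (nice_FA v hr2 (gb2 m)) (FA_bound u.+1 hr1 g1 (b_le m)) (FA_bound v hr2 g2 (b_le m))).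
exact: (dm_bound (nice_FA u hr1 (gb1 m)) (nice_FA v.+1 hr2 (gb2 m)) (FA_bound u hr1 g1 (b_le m)) (FA_bound v.+1 hr2 g2 (b_le m))).
Qed.

Lemma Kc12_bounded : exists c, forall m u v, nrm (Kc12 (b_ m) r1 r2 u v) <= c.
Proof.
exists (1 + (4 * (asup r1 a * fsup r2 a / (1 - r1^-1 * r2^-1)) + 4 * (asup r1 a * fsup r2 a / (1 - r1^-1 * r2^-1)))) => m u v.
rewrite Kc12E//; apply: le_trans (nrmD _ _) _; apply: lerD.
  by case: (_ == _); rewrite ?nrm1// -[false%:R]/(0%:C) nrm_real normr0.
apply: le_trans (nrmB _ _) _.
apply: lerD.
  exact: (dm_bound (nice_FA u.+1 hr1 (gb1 m)) (nice_FC v r20 (gb2 m)) (FA_bound u.+1 hr1 g1 (b_le m)) (FC_bound1 v hr2 g2 (b_le m))).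
exact: (dm_bound (nice_FA u hr1 (gb1 m)) (nice_FC v.+1 r20 (gb2 m)) (FA_bound u hr1 g1 (b_le m)) (FC_bound1 v.+1 hr2 g2 (b_le m))).
Qed.

(* the moments of f do not depend on the radius, hence decay although |z| < 1 on the contours of K22 *)
Lemma Kc22_bounded : exists c, forall m u v, nrm (Kc22 (b_ m) s1 s2 u v) <= c.
Proof.
pose L := 2 * fsup r1 a; pose th := r1^-1.
have th01 : 0 <= th < 1 by rewrite ri0 invf_lt1.
have L0 : 0 <= L by rewrite mulr_ge0// fsup_ge0.
have momb m k : `|momC (b_ m) k| <= L * th ^+ k.
  have [b0 br] := gb1 m.
  rewrite -nrm_real -(@moment_C _ _ (b_ m) (good0 (gb1 m)) r1 r10 br even_n (@b_inj m) (good1 (gb1 m)) k) /L -mulrA.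
  by apply: mean_bound => //; [exact: nice_FC|exact: FC_bound].
(* In the finite sum for [kr22] one moment is bounded by [L] and the other is summed, the moments
   being dominated by a geometric sequence in [u - i]. *)
have sumb m u N : \sum_(0 <= i < N) `|momCt (b_ m) u i| <= L / (1 - th).
  apply: (@le_trans _ _ (\sum_(0 <= i < u.+1) L * th ^+ i)); last first.
    by rewrite -mulr_sumr ler_wpM2l// geometric_sum_le.
  rewrite [leRHS]big_nat_rev /= add0n.
  apply: (@le_trans _ _ (\sum_(0 <= i < N + u.+1) `|momCt (b_ m) u i|)).
    by rewrite [leRHS](big_cat_nat (n := N))//= ?leq_addr// lerDl sumr_ge0.
  rewrite (big_cat_nat (n := u.+1))//= ?leq_addl// [X in _ + X]big1_seq ?addr0; last first.
    by move=> i; rewrite mem_index_iota => /andP[_ /andP[h _]]; rewrite /momCt leqNgt h normr0.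
  rewrite !big_nat; apply: ler_sum => i /andP[_ hi]; rewrite /momCt -ltnS hi subSS.
  exact: momb.
have b1 m v i : `|momCt (b_ m) v i| <= L.
  rewrite /momCt; case: ifP => _; last by rewrite normr0.
  apply: le_trans (momb _ _) _; rewrite ler_piMr// exprn_ile1//; by case/andP: th01 => ? /ltW.
exists (L * (L / (1 - th)) + L * (L / (1 - th))) => m u v.
rewrite Kc22_distinct// nrm_real -(kr22_finite even_n (good0 (gb1 m)) (good1 (gb1 m)) (@b_inj m) (ltnSn (u + v))).
rewrite sumrB; apply: le_trans (ler_normB _ _) _; apply: lerD; apply: le_trans (ler_norm_sum _ _ _) _.
  apply: (@le_trans _ _ (\sum_(0 <= i < (u + v).+1) L * `|momCt (b_ m) v i|)).
    by apply: ler_sum => i _; rewrite normrM ler_wpM2r.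
  by rewrite -mulr_sumr ler_wpM2l.
apply: (@le_trans _ _ (\sum_(0 <= i < (u + v).+1) L * `|momCt (b_ m) u i|)).
  by apply: ler_sum => i _; rewrite normrM mulrC ler_wpM2r.
by rewrite -mulr_sumr ler_wpM2l.
Qed.

End Family.
End KernelEntries.

(** * Fredholm Pfaffians *)

Section InjectiveWeights.

(** Among [k] distinct natural numbers one is at least [k - 1]; it is removed, and the others are
    treated by induction. *)
Lemma sumn_uniq_ge (s : seq nat) : uniq s -> ('C(size s, 2) <= sumn s)%N.
Proof.
have [k] := ubnP (size s); elim: k s => // k IH [|y s] //; rewrite ltnS => hk us.
have [x xs hx] : exists2 x, x \in y :: s & (size s <= x)%N.
  have [/hasP[x xs hx]|/hasPn h] := boolP (has (fun x => size s <= x)%N (y :: s)); first by exists x.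
  have /(uniq_leq_size us) : {subset y :: s <= iota 0 (size s)}.
    by move=> x xs; rewrite mem_iota /= ltnNge h.
  by rewrite size_iota ltnn.
rewrite (perm_sumn (perm_to_rem xs)) /= binS bin1 addnC leq_add//.
have <- : size (rem x (y :: s)) = size s by rewrite size_rem.
by apply: IH; [rewrite size_rem|exact: rem_uniq].
Qed.

Variable R : realType.

Lemma prod_injective_le (w : R) k (x : {ffun 'I_k -> nat}) : 0 <= w <= 1 -> injective x ->
  \prod_(i < k) w ^+ x i <= w ^+ 'C(k, 2).
Proof.
move=> /andP[w0 w1] xi; rewrite -expr_sum; apply: ler_wiXn2l => //.
have := @sumn_uniq_ge (codom x); rewrite size_codom card_ord sumnE big_map.
rewrite -[X in (_ <= X)%N]/(\sum_(i <- enum 'I_k) x i)%N big_enum; apply.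
exact/injectiveP.
Qed.

(** The ratio of consecutive terms of [h] tends to 0, so that [h] is bounded by the sum of its
    initial terms; the factor [2 ^+ k] built into [h] leaves [(1 / 2) ^+ k]. *)
Lemma superexponential_bound (A w : R) : 0 <= A -> 0 <= w < 1 ->
  exists C, forall k, A ^+ k * w ^+ 'C(k, 2) <= C * (1 / 2) ^+ k.
Proof.
move=> A0 /andP[w0 w1]; pose h k := (2 * A) ^+ k * w ^+ 'C(k, 2).
have h0 k : 0 <= h k by rewrite mulr_ge0 ?exprn_ge0 ?mulr_ge0.
have hS k : h k.+1 = h k * (2 * A * w ^+ k).
  by rewrite /h binS bin1 exprD exprS; ring.
have [k0 hk0] : exists k0, forall k, (k0 <= k)%N -> 2 * A * w ^+ k <= 1.
  have : (fun k => 2 * A * w ^+ k) @ \oo --> 0.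
    by rewrite -[0](mulr0 (2 * A)); apply: cvgMr; apply: cvg_expr; rewrite ger0_norm.
  move=> /cvgrPdist_le /(_ 1 ltr01) [k0 _ hk]; exists k0 => k hk'.
  by have := hk k hk'; rewrite /= sub0r normrN => /(le_trans (ler_norm _)).
exists (\sum_(0 <= k < k0.+1) h k) => k.
have hb : h k <= \sum_(0 <= k < k0.+1) h k.
  have small j : (j <= k0)%N -> h j <= \sum_(0 <= k < k0.+1) h k.
    move=> hj; rewrite (bigD1_seq j) ?iota_uniq ?mem_index_iota//= lerDl; exact: sumr_ge0.
  have [/small //|/ltnW hk] := leqP k k0.
  rewrite -(subnK hk); elim: (k - k0)%N => [|d IH]; first by rewrite add0n small.
  by rewrite addSn hS; apply: le_trans IH; rewrite ler_piMr// hk0// leq_addl.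
have e : (1 / 2) ^+ k * 2 ^+ k = 1 :> R by rewrite -exprMn divfK// expr1n.
rewrite -(@ler_pM2r _ (2 ^+ k)) ?exprn_gt0// -[leRHS]mulrA e mulr1.
by apply: le_trans hb; rewrite /h exprMn le_eqVlt; apply/orP; left; apply/eqP; ring.
Qed.

End InjectiveWeights.

Lemma ler_sum_subseq (R : realType) (I : eqType) (h : I -> R) (s B : seq I) : (forall i, 0 <= h i) ->
  uniq s -> uniq B -> {subset s <= B} -> \sum_(i <- s) h i <= \sum_(i <- B) h i.
Proof.
move=> h0 us uB sB; rewrite [leRHS](perm_big (s ++ [seq i <- B | i \notin s])).
  by rewrite big_cat lerDl sumr_ge0.
apply: uniq_perm => //.
  rewrite cat_uniq us filter_uniq// andbT /=; apply/hasPn => i.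
  by rewrite mem_filter => /andP[].
by move=> i; rewrite mem_cat mem_filter; case: (boolP (i \in s)) => [/sB ->|].
Qed.

(** * Complex families: domination and finite support *)

Section ComplexSums.
Variables (R : realType) (I : choiceType).
Notation C := R[i].

Lemma Re_sum (T : Type) (s : seq T) (F : T -> C) : Re (\sum_(i <- s) F i) = \sum_(i <- s) Re (F i).
Proof. by apply: (big_morph (@complex.Re R)) => // ? ?; exact: ReD. Qed.

Lemma Im_sum (T : Type) (s : seq T) (F : T -> C) : Im (\sum_(i <- s) F i) = \sum_(i <- s) Im (F i).
Proof. by apply: (big_morph (@complex.Im R)) => // ? ?; exact: ImD. Qed.

Lemma csummable_le (F : I -> C) (g : I -> R) : rsummable g -> (forall i, nrm (F i) <= g i) -> csummable F.
Proof.
move=> sg h; split; apply: rsummable_le sg => i; apply: le_trans (ler_norm _).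
  exact: le_trans (Re_le_nrm _) (h i).
exact: le_trans (Im_le_nrm _) (h i).
Qed.

Lemma csum_dominated (F_ : nat -> I -> C) (F : I -> C) (g : I -> R) : rsummable g ->
  (forall m i, nrm (F_ m i) <= g i) -> (forall i, ccvg (F_ ^~ i) (F i)) ->
  (forall i, nrm (F i) <= g i) /\ ccvg (fun m => csum (F_ m)) (csum F).
Proof.
move=> sg h hc; have hF i : nrm (F i) <= g i by exact: ccvg_bound (h ^~ i) (hc i).
split=> //; split=> /=; apply: (rsum_dominated sg).
- by move=> i; apply: le_trans (Re_le_nrm _) (hF i).
- by move=> i; case: (hc i).
- by move=> m i; apply: le_trans (Re_le_nrm _) (h m i).
- by move=> i; apply: le_trans (Im_le_nrm _) (hF i).
- by move=> i; case: (hc i).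
- by move=> m i; apply: le_trans (Im_le_nrm _) (h m i).
Qed.

Lemma rsum_finite (f : I -> R) (s : seq I) : uniq s -> (forall i, i \notin s -> f i = 0) ->
  rsum f = \sum_(i <- s) f i.
Proof.
move=> us hs; have sf : rsummable f.
  apply: (rsummable_bound (M := \sum_(i <- s) `|f i|)) => s' us'.
  rewrite (bigID (mem s))/= [X in _ + X]big1 ?addr0; last by move=> i hi; rewrite hs ?normr0.
  rewrite -big_filter; apply: ler_sum_subseq => //; first by rewrite filter_uniq.
  by move=> i; rewrite mem_filter => /andP[].
have h2 : (fun _ : nat => \sum_(i <- s) f i) @ \oo --> rsum f.
  apply: rsum_cvg => // i hi; apply: nearW => _; apply: contraNT hi => /hs ->; exact: eqxx.
exact: (cvg_unique (@norm_hausdorff _ R) h2 (cvg_cst _)).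
Qed.

Lemma csum_finite (F : I -> C) (s : seq I) : uniq s -> (forall i, i \notin s -> F i = 0) ->
  csum F = \sum_(i <- s) F i.
Proof.
move=> us hs; apply/eqP; rewrite eq_complex Re_sum Im_sum /csum /=.
by apply/andP; split; apply/eqP; apply: rsum_finite => // i /hs ->.
Qed.

End ComplexSums.

(** * Limits of Fredholm Pfaffians *)

Section FredholmLimit.
Variables (R : realType) (t L c : R).
Notation C := R[i].
Hypotheses (t01 : 0 < t < 1) (L0 : 0 <= L) (c0 : 0 <= c).

(** The weight [t^x] is used as [w^x * w^x]: one factor makes the sum over the points converge, the
    other yields [w ^+ 'C(k, 2)] on distinct points. *)
Let w : R := Num.sqrt t.
Let w01 : 0 <= w < 1.
Proof. by rewrite sqrtr_ge0 /= -[X in _ < X]sqrtr1 ltr_sqrt//; case/andP: t01. Qed.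
Let w2 : w * w = t. Proof. by rewrite -expr2 sqr_sqrtr// ltW//; case/andP: t01. Qed.

(** The consequence of antisymmetry on which the domination rests: only tuples of distinct points
    contribute. *)
Definition vanishes_noninjective (K : nat -> nat -> 'M[C]_2) : Prop :=
  forall k (x : {ffun 'I_k -> nat}), ~ injective x -> pfaffian (kernel_mx K x) = 0.

(** Counting terms: [(2k)!] permutations divided by [2^k k!], together with (2k)! <= (2^k k!)^2. *)
Lemma pfaffian_bound k (A : 'M[C]_(k.*2)) : (forall i j, nrm (A i j) <= c) ->
  nrm (pfaffian A) <= k`!%:R * (2 * c) ^+ k.
Proof.
move=> hA; rewrite /pfaffian nrmM nrmV.
have -> : nrm (2 ^ k * k`!)%N%:R = (2 ^ k * k`!)%N%:R :> R.
  by rewrite -(rmorph_nat (real_complex R)) nrm_real normr_nat.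
have f0 : 0 < (2 ^ k * k`!)%N%:R :> R by rewrite ltr0n muln_gt0 expn_gt0 fact_gt0.
rewrite mulrC ler_pdivrMr//; apply: le_trans (nrm_sum _ _ _) _.
apply: (@le_trans _ _ (\sum_(s : 'S_(k.*2)) c ^+ k)).
  apply: ler_sum => s _; rewrite nrmM nrmX nrmN nrm1 expr1n mul1r nrm_prod.
  rewrite -[X in c ^+ X](card_ord k) -prodr_const; apply: ler_prod => i _; rewrite nrm_ge0; exact: hA.
rewrite sumr_const card_Sn -[leLHS]mulr_natl exprMn.
have -> : k`!%:R * (2 ^+ k * c ^+ k) * (2 ^ k * k`!)%N%:R = (k`! * (2 ^ k * (2 ^ k * k`!)))%N%:R * c ^+ k :> R.
  by rewrite !natrM !natrX; ring.
rewrite ler_wpM2r ?exprn_ge0// ler_nat.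
elim: k {A hA f0} => // k IH; rewrite doubleS !factS !expnS.
have -> : (k.+1 * k`! * (2 * 2 ^ k * (2 * 2 ^ k * (k.+1 * k`!))) =
  (2 * k.+1) * ((2 * k.+1) * (k`! * (2 ^ k * (2 ^ k * k`!)))))%N by ring.
by apply: leq_mul; [rewrite mul2n|apply: leq_mul => //; rewrite mul2n doubleS].
Qed.

Variables (f_ : nat -> nat -> C) (f : nat -> C) (K_ : nat -> nat -> nat -> 'M[C]_2) (K : nat -> nat -> 'M[C]_2).
Hypotheses (f_bound : forall m j, nrm (f_ m j) <= L * t ^+ j) (K_bound : forall m u v p q, nrm (K_ m u v p q) <= c).
Hypotheses (f_cvg : forall j, ccvg (f_ ^~ j) (f j)) (K_cvg : forall u v p q, ccvg (fun m => K_ m u v p q) (K u v p q)).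
Hypothesis K_vanish : forall m, vanishes_noninjective (K_ m).

Let g k (x : {ffun 'I_k -> nat}) : R :=
  k`!%:R * (2 * c * L) ^+ k * w ^+ 'C(k, 2) * \prod_(i < k) w ^+ x i.

Let g_summand m k (x : {ffun 'I_k -> nat}) : nrm (fredholm_summand (f_ m) (K_ m) x) <= g x.
Proof.
rewrite /fredholm_summand nrmM; have [w0 /ltW w1] := andP w01.
have gx : 0 <= g x.
  by rewrite /g !mulr_ge0 ?exprn_ge0 ?mulr_ge0 ?prodr_ge0// => i _; rewrite exprn_ge0.
have [/injectiveP xi|xi] := boolP (injectiveb x); last first.
  rewrite K_vanish; last by move/injectiveP; exact/negP.
  by rewrite nrm0 mulr0.
apply: (@le_trans _ _ ((\prod_(i < k) (L * t ^+ x i)) * (k`!%:R * (2 * c) ^+ k))).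
  rewrite ler_pM ?nrm_ge0//; last by apply: pfaffian_bound => i j; rewrite mxE.
  by rewrite nrm_prod; apply: ler_prod => i _; rewrite nrm_ge0 /=.
rewrite big_split /= prodr_const card_ord.
have -> : \prod_(i < k) t ^+ x i = (\prod_(i < k) w ^+ x i) * \prod_(i < k) w ^+ x i.
  by rewrite -big_split; apply: eq_bigr => i _ /=; rewrite -exprMn w2.
have h := prod_injective_le (andb_true_intro (conj w0 w1)) xi.
have p0 : 0 <= \prod_(i < k) w ^+ x i by rewrite prodr_ge0// => i _; rewrite exprn_ge0.
rewrite /g; move: (\prod_(i < k) _) p0 h => P p0 h.
rewrite (_ : _ * (_ * _) = (k`!%:R * (2 * c * L) ^+ k) * (P * P)); last by rewrite !exprMn; ring.
rewrite -[leRHS]mulrA ler_wpM2l ?mulr_ge0 ?exprn_ge0 ?mulr_ge0//.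
by rewrite ler_wpM2r.
Qed.

Let gM k : R := k`!%:R * (2 * c * L) ^+ k * w ^+ 'C(k, 2) * (1 - w)^-1 ^+ k.

Let g_sum k (s : seq {ffun 'I_k -> nat}) : uniq s -> \sum_(x <- s) g x <= gM k.
Proof.
move=> us; have [w0 /ltW w1] := andP w01; rewrite -mulr_sumr ler_wpM2l//.
  by rewrite !mulr_ge0 ?exprn_ge0 ?mulr_ge0.
apply: (@sum_ffun_prod_le _ (fun j => w ^+ j)) => //; first by move=> j; rewrite exprn_ge0.
by move=> N; exact: geometric_sum_le.
Qed.

Let g_ge0 k (x : {ffun 'I_k -> nat}) : 0 <= g x. Proof. exact: le_trans (nrm_ge0 _) (g_summand 0 x). Qed.

Let sg k : rsummable (@g k).
Proof.
apply: (rsummable_bound (M := gM k)) => s us; apply: le_trans (g_sum us).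
by apply: ler_sum => x _; rewrite ger0_norm.
Qed.

Let pf_cvg k (x : {ffun 'I_k -> nat}) :
  ccvg (fun m => fredholm_summand (f_ m) (K_ m) x) (fredholm_summand f K x).
Proof.
apply: ccvgM; first by apply: ccvg_prod => i; exact: f_cvg.
rewrite /pfaffian; apply: ccvgM; first exact: ccvg_cst.
apply: ccvg_sum => s; apply: ccvgM; first exact: ccvg_cst.
apply: ccvg_prod => i; rewrite mxE; under eq_fun do rewrite mxE; exact: K_cvg.
Qed.

Let csum_bound k (F : {ffun 'I_k -> nat} -> C) : (forall x, nrm (F x) <= g x) -> nrm (csum F) <= 2 * gM k.
Proof.
move=> hF; have rb (h : {ffun 'I_k -> nat} -> R) : (forall x, `|h x| <= g x) -> `|rsum h| <= gM k.
  move=> hh; apply/ler_addgt0Pr => e e0; have [A hA] := rsum_approx (@sg k) e0.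
  have subA : {subset A <= undup A} by move=> i; rewrite mem_undup.
  have := hA h (undup A) hh (undup_uniq _) subA.
  rewrite -[rsum h](subrK (\sum_(i <- undup A) h i)) => hd.
  apply: le_trans (ler_normD _ _) _; rewrite addrK in hd *; rewrite addrC lerD//.
  apply: le_trans (ler_norm_sum _ _ _) _; apply: le_trans (g_sum (undup_uniq A)).
  exact: ler_sum.
apply: le_trans (nrm_le_ReIm _) _; rewrite mulr_natl mulr2n; apply: lerD => /=; apply: rb => x.
  exact: le_trans (Re_le_nrm _) (hF x).
exact: le_trans (Im_le_nrm _) (hF x).
Qed.

Let G k : R := 2 * ((2 * c * L / (1 - w)) ^+ k * w ^+ 'C(k, 2)).

Let term_bound k (F : {ffun 'I_k -> nat} -> C) : (forall x, nrm (F x) <= g x) ->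
  nrm (k`!%:R^-1 * csum F) <= G k.
Proof.
move=> hF; rewrite nrmM nrmV -(rmorph_nat (real_complex R)) nrm_real normr_nat.
have f0 : 0 < k`!%:R :> R by rewrite ltr0n fact_gt0.
rewrite mulrC ler_pdivrMr//; apply: le_trans (csum_bound hF) _.
by rewrite /gM /G !exprMn le_eqVlt; apply/orP; left; apply/eqP; ring.
Qed.

Let sG : rsummable (fun k => G k.+1).
Proof.
have [w0 w1] := andP w01; have A0 : 0 <= 2 * c * L / (1 - w) by rewrite divr_ge0 ?mulr_ge0// subr_ge0 ltW.
have [D hD] := superexponential_bound A0 w01.
have D0 : 0 <= D by have := hD 0%N; rewrite (_ : 'C(0, 2) = 0%N)// !expr0 !mulr1 => /(le_trans ler01).
apply: (rsummable_bound (M := 2 * (D * 2))) => s us.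
apply: (@le_trans _ _ (\sum_(k <- s) 2 * (D * (1 / 2) ^+ k))).
  apply: ler_sum => k _; rewrite ger0_norm; last by rewrite !mulr_ge0 ?exprn_ge0.
  rewrite ler_wpM2l//; apply: le_trans (hD k.+1) _; rewrite ler_wpM2l// exprS ler_piMl ?exprn_ge0//; lra.
rewrite -mulr_sumr -mulr_sumr ler_wpM2l// ler_wpM2l//.
pose N := (\max_(k <- s) k).+1.
apply: (@le_trans _ _ (\sum_(0 <= k < N) (1 / 2 : R) ^+ k)).
  apply: ler_sum_subseq => //; first exact: iota_uniq.
  by move=> k ks; rewrite mem_index_iota /= ltnS (leq_bigmax_seq (F := id)).
have h2 : 1 - 1 / 2 = 2^-1 :> R by lra.
apply: le_trans (@geometric_sum_le _ (1 / 2) N _) _; last by rewrite h2 invrK.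
by apply/andP; split; lra.
Qed.

(** Dominated convergence over the tuples for fixed [k], then over [k]. It is used with truncated
    weights and a fixed kernel, and with fixed weights and varying parameters of the kernel. *)
Lemma fredholm_limit : [/\ fredholm_summable f K, forall m, fredholm_summable (f_ m) (K_ m) &
  ccvg (fun m => fredholm_pfaffian (f_ m) (K_ m)) (fredholm_pfaffian f K)].
Proof.
have dom k := csum_dominated (@sg k) (fun m => @g_summand m k) (@pf_cvg k).
have tb m k : nrm (fredholm_term (f_ m) (K_ m) k) <= G k by apply: term_bound; exact: g_summand.
have tc k : ccvg (fun m => fredholm_term (f_ m) (K_ m) k) (fredholm_term f K k).
  by apply: ccvgM; [exact: ccvg_cst|exact: (dom k).2].
have [tb' tcv] := csum_dominated sG (fun m k => tb m k.+1) (fun k => tc k.+1).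
split.
- split; first by move=> k; apply: csummable_le (@sg k) _; exact: (dom k).1.
  exact: csummable_le sG tb'.
- move=> m; split; first by move=> k; apply: csummable_le (@sg k) _; exact: g_summand.
  by apply: csummable_le sG _ => k; exact: tb.
- by apply: ccvgD; [exact: ccvg_cst|exact: tcv].
Qed.

End FredholmLimit.

(** * The near-diagonal part of the kernel and its Schur complement *)

Section SchurComplement.
Variable F : numFieldType.
Implicit Types (A M : nat -> nat -> F) (x : nat -> nat).

Lemma sum_even_odd k (G : nat -> F) :
  \sum_(c < k.*2) G c = \sum_(s < k) (G s.*2 + G s.*2.+1).
Proof.
elim: k => [|k IH]; first by rewrite !big_ord0.
by rewrite doubleS !big_ord_recr /= IH -addrA.
Qed.

Definition adj (u v : nat) : F := (u == v.+1)%:R - (v == u.+1)%:R.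

Lemma adj_anti u v : adj u v = - adj v u. Proof. by rewrite /adj opprB. Qed.

(** The part D of the kernel at the points [x s]; the indices [2s] and [2s + 1] are the first and
    second component at the point number [s]. *)
Definition jmat x (p q : nat) : F :=
  if odd p then (if odd q then adj (x p./2) (x q./2) else - (x p./2 == x q./2)%:R)
  else (if odd q then (x p./2 == x q./2)%:R else 0).

(** For distinct points, [jmat] has the block form [[0, 1], [-1, A]] once its indices are sorted by
    parity, and the inverse is [[A, -1], [1, 0]]. *)
Definition jinv x (p q : nat) : F :=
  if odd p then (if odd q then 0 else (x p./2 == x q./2)%:R)
  else (if odd q then - (x p./2 == x q./2)%:R else adj (x p./2) (x q./2)).

Lemma antisym_jmat x : antisym (jmat x).
Proof. by move=> p q; rewrite /jmat eq_sym; case: (odd p); case: (odd q); rewrite ?opprK ?oppr0// adj_anti. Qed.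

Lemma antisym_jinv x : antisym (jinv x).
Proof. by move=> p q; rewrite /jinv eq_sym; case: (odd p); case: (odd q); rewrite ?opprK ?oppr0// adj_anti. Qed.

Definition inj_below k x := forall i j, (i < k)%N -> (j < k)%N -> x i = x j -> i = j.

Lemma sum_eqx k x (a : nat) (G : nat -> F) : inj_below k x -> (a < k)%N ->
  \sum_(s < k) (x a == x s)%:R * G s = G a.
Proof.
move=> xi ak; rewrite -(sum_delta G ak); apply: eq_bigr => s _; congr ((nat_of_bool _)%:R * _).
by apply/eqP/eqP => [/xi ->|->].
Qed.

Lemma jmat_inverse k x p q : inj_below k x -> (p < k.*2)%N -> (q < k.*2)%N ->
  \sum_(c < k.*2) jinv x p c * jmat x c q = deltaf F p q.
Proof.
move=> xi hp hq; have hp2 : (p./2 < k)%N by rewrite ltn_half_double.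
have hq2 : (q./2 < k)%N by rewrite ltn_half_double.
have dE : odd p = odd q -> deltaf F p q = (x p./2 == x q./2)%:R.
  move=> e; rewrite /deltaf; congr (nat_of_bool _)%:R; apply/eqP/eqP => [->//|/xi h].
  by rewrite -[p]odd_double_half -[q]odd_double_half e h.
have dE' : odd p != odd q -> deltaf F p q = 0.
  by move=> e; rewrite /deltaf; case: eqP => // h; rewrite h eqxx in e.
rewrite (@sum_even_odd k (fun c => jinv x p c * jmat x c q)).
under eq_bigr => s _ do rewrite /jinv /jmat /= odd_double /= doubleK uphalf_double.
case op : (odd p); case oq : (odd q).
- rewrite dE ?op ?oq// -[RHS](sum_eqx (fun s => (x s == x q./2)%:R) xi hp2).
  by apply: eq_bigr => s _; rewrite mul0r addr0.
- rewrite dE' ?op ?oq// big1// => s _; by rewrite mulr0 mul0r addr0.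
- rewrite dE' ?op ?oq// big_split /=.
  rewrite (_ : \sum_(s < k) _ = adj (x p./2) (x q./2)); last first.
    rewrite -(sum_eqx (fun s => adj (x p./2) (x s)) xi hq2).
    by apply: eq_bigr => s _; rewrite mulrC eq_sym.
  rewrite (_ : \sum_(s < k) _ = - adj (x p./2) (x q./2)) ?subrr//.
  rewrite -(sum_eqx (fun s => adj (x s) (x q./2)) xi hp2) -sumrN.
  by apply: eq_bigr => s _; rewrite mulNr.
- rewrite dE ?op ?oq// -[RHS](sum_eqx (fun s => (x s == x q./2)%:R) xi hp2).
  by apply: eq_bigr => s _; rewrite mulr0 add0r mulrNN.
Qed.

Lemma pfn_jmat k x : inj_below k x -> pfn k (jmat x) = 1.
Proof.
elim: k x => [|k IH] x xi; first by rewrite pfn0.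
have j01 : jmat x 0 1 = 1 by rewrite /jmat /= eqxx.
rewrite (pfn_reduce k (@antisym_jmat x)) j01 ?oner_eq0// mul1r -[RHS](IH (x \o S)); last first.
  by move=> i j hi hj /= /xi; rewrite !ltnS => h; apply/eqP; rewrite -eqSS; apply/eqP; exact: h.
apply: eq_pfn => i j hi hj.
have z l : (l < k.*2)%N -> jmat x 0 l.+2 = 0.
  move=> hl; rewrite /jmat /= negbK; case: ifP => // _; case: eqP => // /xi h.
  by have := h isT; rewrite ltnS ltn_half_double => /(_ hl).
by rewrite !z// !mul0r subrr mul0r subr0 /jmat /= !negbK.
Qed.

(** A Pfaffian of order [2k], where [k] is the number of points, is traded for one of fixed order
    [2h] whose entries are sums over the points. This makes sums over sets of points accessible. *)
Lemma pfn_schur_jmat h k A M (p q : nat -> nat -> F) x :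
  antisym A -> antisym M -> inj_below k x ->
  (forall i j, (i < h.*2)%N -> (j < h.*2)%N -> \sum_(c < h.*2) M i c * A c j = deltaf F i j) ->
  let W a P := if odd P then - q a P./2 else p a P./2 in
  pfn h A * pfn k (fun P Q => jmat x P Q + \sum_(a < h.*2) \sum_(b < h.*2) W a P * M a b * W b Q) =
  pfn h (fun i j => A i j + (\sum_(s < k) \sum_(s' < k) p i s * adj (x s) (x s') * p j s' +
    \sum_(s < k) (p i s * q j s - q i s * p j s))).
Proof.
move=> hA hM xi hMA W; rewrite -(pfn_schur_l k W hA (@antisym_jmat x) hM hMA).
rewrite (pfn_schur_r h W hA (@antisym_jmat x) (@antisym_jinv x)); last first.
  by move=> i j; exact: jmat_inverse.
rewrite pfn_jmat// mul1r; apply: eq_pfn => i j _ _; congr (_ + _).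
rewrite (@sum_even_odd k (fun a => \sum_(b < k.*2) W i a * jinv x a b * W j b)) -big_split /=.
apply: eq_bigr => s _; rewrite (@sum_even_odd k (fun b => W i s.*2 * jinv x s.*2 b * W j b)).
rewrite (@sum_even_odd k (fun b => W i s.*2.+1 * jinv x s.*2.+1 b * W j b)).
rewrite /W /jinv /= odd_double /= doubleK uphalf_double.
under eq_bigr => b _ do rewrite /= odd_double /= doubleK uphalf_double.
under [X in _ + X]eq_bigr => b _ do rewrite /= odd_double /= doubleK uphalf_double.
rewrite !big_split /= -addrA; congr (_ + _).
rewrite (_ : \sum_(b < k) p i s * - (x s == x b)%:R * - q j b = p i s * q j s); last first.
  rewrite -(sum_eqx (fun b => q j b) xi (ltn_ord s)) mulr_sumr; apply: eq_bigr => b _; ring.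
rewrite (_ : \sum_(b < k) - q i s * (x s == x b)%:R * p j b = - (q i s * p j s)); last first.
  rewrite -(sum_eqx (fun b => p j b) xi (ltn_ord s)) mulr_sumr -sumrN; apply: eq_bigr => b _; ring.
by rewrite [X in _ + (_ + X)]big1 ?addr0// => b _; rewrite mulr0 mul0r.
Qed.

End SchurComplement.

(** * The entries of the traded Pfaffian *)

Section ThetaForm.
Variable F : numFieldType.
Implicit Types (X Y : F) (e phi : nat -> F).

(** The series of the [z ^+ u * phi u * phi u.+1] for [phi] equal to 1 from [N] on, with its tail
    summed in closed form. *)
Definition theta N phi (z : F) : F := \sum_(0 <= u < N) z ^+ u * (phi u * phi u.+1) + z ^+ N / (1 - z).

Definition qpow X (s : nat) : F := X ^+ s.+1 - (if s is s'.+1 then X ^+ s' else 0).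

Lemma geometric_tail N (z : F) : z != 1 -> (1 - z)^-1 = \sum_(0 <= u < N) z ^+ u + z ^+ N / (1 - z).
Proof.
move=> z1; have h : 1 - z != 0 by rewrite subr_eq0 eq_sym.
elim: N => [|N IH]; first by rewrite big_nil expr0 add0r mul1r.
by rewrite {1}IH big_nat_recr//= exprS; move: (z ^+ N) (\sum_(_ <= _ < _) _) => Z S; field.
Qed.

(** Expansion of (1 - e_u)(1 - e_(u+1)): the constant 1 gives the Cauchy entry, the linear terms the
    couplings through [qpow], and the quadratic terms the part with [adj]. *)
Lemma theta_indicator N e X Y : X * Y != 1 -> (forall u, (N <= u)%N -> e u = 0) ->
  (X - Y) / (1 - X * Y) +
  (\sum_(u < N) \sum_(v < N) e u * e v * (X ^+ u * adj F u v * Y ^+ v) +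
   \sum_(u < N) e u * (X ^+ u * qpow Y u - qpow X u * Y ^+ u)) =
  (X - Y) * theta N (fun u => 1 - e u) (X * Y).
Proof.
move=> z1 e0; pose z := X * Y.
have sh u : \sum_(v < N) (v == u.+1 :> nat)%:R * (e v * Y ^+ v) = e u.+1 * Y ^+ u.+1.
  have [hu|hu] := ltnP u.+1 N.
    by rewrite -(sum_delta (fun v => e v * Y ^+ v) hu); apply: eq_bigr => w _; rewrite /deltaf eq_sym.
  rewrite e0// mul0r big1// => w _; case: eqP => [h|_]; last by rewrite mul0r.
  by have := ltn_ord w; rewrite h ltnNge hu.
have sh' u : \sum_(v < N) (v == u.+1 :> nat)%:R * (e v * X ^+ v) = e u.+1 * X ^+ u.+1.
  have [hu|hu] := ltnP u.+1 N.
    by rewrite -(sum_delta (fun v => e v * X ^+ v) hu); apply: eq_bigr => w _; rewrite /deltaf eq_sym.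
  rewrite e0// mul0r big1// => w _; case: eqP => [h|_]; last by rewrite mul0r.
  by have := ltn_ord w; rewrite h ltnNge hu.
have -> : \sum_(u < N) \sum_(v < N) e u * e v * (X ^+ u * adj F u v * Y ^+ v) =
    \sum_(u < N) (X - Y) * (z ^+ u * (e u * e u.+1)).
  transitivity (\sum_(u < N) (e u * Y ^+ u * \sum_(v < N) (v == u.+1 :> nat)%:R * (e v * X ^+ v)) -
     \sum_(u < N) (e u * X ^+ u * \sum_(v < N) (v == u.+1 :> nat)%:R * (e v * Y ^+ v))).
    under [X in _ = X - _]eq_bigr => u _ do rewrite mulr_sumr.
    under [X in _ = _ - X]eq_bigr => u _ do rewrite mulr_sumr.
    rewrite [X in _ = X - _]exchange_big -sumrB; apply: eq_bigr => u _; rewrite -sumrB.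
    by apply: eq_bigr => v _; rewrite /adj; ring.
  rewrite -sumrB; apply: eq_bigr => u _; rewrite sh' sh /z exprMn !exprS; ring.
have -> : \sum_(u < N) e u * (X ^+ u * qpow Y u - qpow X u * Y ^+ u) =
    \sum_(u < N) (X - Y) * (z ^+ u * - (e u + e u.+1)).
  have E : \sum_(u < N) (if u : nat is u'.+1 then e u * z ^+ u' else 0) = \sum_(u < N) e u.+1 * z ^+ u.
    case: N e0 {sh sh'} => [|N] e0; first by rewrite !big_ord0.
    rewrite big_ord_recl /= add0r [RHS]big_ord_recr /= e0// mul0r addr0.
    by apply: eq_bigr.
  under [RHS]eq_bigr => u _ do rewrite mulrN mulrDr opprD mulrDr.
  rewrite big_split /= -!mulr_sumr [X in _ = _ + _ * X](_ : _ = - \sum_(u < N) e u.+1 * z ^+ u); last first.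
    by rewrite -sumrN; apply: eq_bigr => u _; rewrite mulrC.
  rewrite -E -sumrN !mulr_sumr -big_split; apply: eq_bigr => -[u hu] _ /=; rewrite /qpow /z.
  by case: u {hu} => [|u]; rewrite ?exprMn ?exprS ?expr0; ring.
rewrite (geometric_tail N z1) -/z /theta -/z big_mkord.
rewrite -!mulr_sumr -mulrDr -mulrDr; congr (_ * _); rewrite big_mkord addrAC; congr (_ + _).
rewrite -!big_split; apply: eq_bigr => u _ /=; ring.
Qed.

End ThetaForm.

(** * Sums over subsets of multi-affine functions *)

Section MultiAffineSum.
Variables (F : numFieldType) (I : finType).

(** A set of size [k] is the image of [k!] injective tuples, which cancels the factor [1 / k!] of
    the Fredholm expansion. *)
Lemma sum_injective_sets (g : {set I} -> F) :
  \sum_(k < #|I|.+1) (k`!%:R)^-1 * (\sum_(x : {ffun 'I_k -> I} | injectiveb x) g (x @: finset.setT)) =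
  \sum_(T : {set I}) g T.
Proof.
have hT (T : {set I}) : (#|T| < #|I|.+1)%N by rewrite ltnS max_card.
rewrite [RHS](partition_big (fun T : {set I} => Ordinal (hT T)) xpredT)//=.
apply: eq_bigr => k _.
rewrite (partition_big (fun x : {ffun 'I_k -> I} => x @: finset.setT) (fun T => #|T| == k)) /=; last first.
  by move=> x /injectiveP xi; rewrite card_imset// cardsT card_ord.
rewrite mulr_sumr; apply: eq_big => [T|T /eqP hk]; first by rewrite -val_eqE.
have fk : k`!%:R != 0 :> F by rewrite pnatr_eq0 -lt0n fact_gt0.
transitivity ((k`!%:R)^-1 * \sum_(x | x \in [set x : {ffun 'I_k -> I} in ffun_on T | injectiveb x]%SET) g T).
  congr (_ * _); apply: eq_big => [x|x /andP[_ /eqP ->//]].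
  rewrite inE andbC; case xi : (injectiveb x); rewrite ?andbF// !andbT.
  apply/eqP/ffun_onP => [<- i|h]; first exact: imset_f.
  apply/eqP; rewrite eqEcard card_imset ?cardsT ?card_ord ?hk ?leqnn ?andbT; last exact/injectiveP.
  by apply/fintype.subsetP => s /imsetP[i _ ->].
by rewrite sumr_const card_inj_ffuns_on card_ord hk ffactnn -[g T *+ _]mulr_natl mulrA mulVf// mul1r.
Qed.

Variables (G : (I -> F) -> F) (f : I -> F).
Hypothesis G_affine : forall i phi, exists c0 c1, forall v,
  G (fun s => if s == i then v else phi s) = c0 + v * c1.
Hypothesis f_neq : forall i, 1 + f i != 0.

(* G affine in one variable satisfies G(1) + f G(0) = (1 + f) G(1 / (1 + f)) *)
Lemma sum_sets_affine :
  \sum_(T : {set I}) (\prod_(i in T) f i) * G (fun s => 1 - (s \in T)%:R) =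
  (\prod_i (1 + f i)) * G (fun s => (1 + f s)^-1).
Proof.
have key r phi : uniq r ->
  \sum_(T : {set I} | T \subset r) (\prod_(i in T) f i) * G (fun s => if s \in r then 1 - (s \in T)%:R else phi s) =
  (\prod_(i <- r) (1 + f i)) * G (fun s => if s \in r then (1 + f s)^-1 else phi s).
  elim: r phi => [|m r IH] phi.
    move=> _; rewrite (big_pred1 finset.set0) ?big_set0 ?big_nil ?mul1r//.
    by move=> T; rewrite /= -finset.subset0; apply/fintype.subsetP/fintype.subsetP => h s /h; rewrite ?inE.
  move=> /andP[mr ur]; rewrite big_cons (bigID (fun T : {set I} => m \in T)) /=.
  have [c0 [c1 hc]] := G_affine m (fun s => if s \in r then (1 + f s)^-1 else phi s).
  pose phi1 v := fun s => if s == m then v else phi s.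
  have e1 (T : {set I}) v : T \subset r -> 
      (fun s => if s \in r then 1 - (s \in T)%:R else phi1 v s) =
      (fun s => if s \in m :: r then (if s == m then v else 1 - (s \in T)%:R) else phi s) :> (I -> F).
    move=> _; apply/funext => s; rewrite inE /phi1; case: eqP => [->|_] //=; by rewrite (negbTE mr).
  rewrite (reindex_onto (fun T => m |: T) (fun T => T :\ m)) /=; last first.
    by move=> T /andP[_ mT]; rewrite finset.setD1K.
  rewrite (eq_bigl (fun T : {set I} => T \subset r)); last first.
    move=> T; rewrite finset.setU11 andbT.
    apply/andP/idP => [[hs /eqP hT]|hs].
      have mT : m \notin T by rewrite -hT !inE eqxx.
      apply/fintype.subsetP => s sT; move/fintype.subsetP: hs => /(_ s).
      rewrite in_setU1 sT orbT => /(_ isT); rewrite inE => /orP[/eqP e|//].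
      by rewrite -e sT in mT.
    have mT : m \notin T by apply: contra mr => /(fintype.subsetP hs).
    rewrite finset.setU1K// eqxx; split=> //; apply/fintype.subsetP => s; rewrite in_setU1 inE => /orP[->//|/(fintype.subsetP hs) ->].
    by rewrite orbT.
  rewrite [X in _ + X](eq_bigl (fun T : {set I} => T \subset r)); last first.
    move=> T; apply/andP/idP => [[hs mT]|hs].
      apply/fintype.subsetP => s sT; move/fintype.subsetP: hs => /(_ s sT); rewrite inE => /orP[/eqP e|//].
      by rewrite -e sT in mT.
    split; last by apply: contra mr => /(fintype.subsetP hs).
    by apply/fintype.subsetP => s /(fintype.subsetP hs) sr; rewrite inE sr orbT.
  transitivity (f m * (\sum_(T : {set I} | T \subset r) (\prod_(i in T) f i) *
     G (fun s => if s \in r then 1 - (s \in T)%:R else phi1 0 s)) +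
     \sum_(T : {set I} | T \subset r) (\prod_(i in T) f i) *
     G (fun s => if s \in r then 1 - (s \in T)%:R else phi1 1 s)).
    congr (_ + _).
      rewrite mulr_sumr; apply: eq_bigr => T hT.
      have mT : m \notin T by apply: contra mr => /(fintype.subsetP hT).
      rewrite big_setU1//= -mulrA (e1 T 0)//; congr (_ * (_ * G _)); apply/funext => s.
      by case: ifP => // _; rewrite in_setU1; case: eqP => //= _; rewrite subrr.
    apply: eq_bigr => T hT; have mT : m \notin T by apply: contra mr => /(fintype.subsetP hT).
    rewrite (e1 T 1)//; congr (_ * G _); apply/funext => s.
    by case: ifP => // _; case: eqP => // ->; rewrite (negbTE mT) subr0.
  have e2 v : (fun s => if s \in r then (1 + f s)^-1 else phi1 v s) =
     (fun s => if s == m then v else if s \in r then (1 + f s)^-1 else phi s) :> (I -> F).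
    apply/funext => s; rewrite /phi1; case: eqP => [->|//]; by rewrite (negbTE mr).
  have e3 : (fun s => if s \in m :: r then (1 + f s)^-1 else phi s) =
     (fun s => if s == m then (1 + f m)^-1 else if s \in r then (1 + f s)^-1 else phi s).
    by apply/funext => s; rewrite inE; case: eqP => // ->.
  rewrite !IH// !e2 e3 !hc; move: (\prod_(_ <- _) _) => P; have := f_neq m; move: (f m) => z hz; by field.
have := key (index_enum I) (fun _ => 1) (index_enum_uniq I).
have hT (T : {set I}) : T \subset index_enum I by apply/fintype.subsetP => s _; rewrite mem_index_enum.
have mE s : s \in index_enum I := mem_index_enum s.
have -> : (fun s => if s \in index_enum I then (1 + f s)^-1 else 1) = (fun s => (1 + f s)^-1).
  by apply/funext => s; rewrite mE.
move=> <-; apply: eq_big => [T|T _]; first by rewrite hT.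
by congr (_ * G _); apply/funext => s; rewrite mE.
Qed.

End MultiAffineSum.

(** * Multi-affine dependence of the traded Pfaffian *)

Section ThetaAffine.
Variables (F : numFieldType) (N h : nat) (X : nat -> F).

(** Values of index at least [N] are frozen at 1, which is the value at a point outside the chosen
    set. *)
Definition below (phi : 'I_N -> F) (u : nat) : F := if insub u is Some i then phi i else 1.

Definition theta_pf (phi : 'I_N -> F) : F :=
  pfn h (fun i j => (X i - X j) * theta N (below phi) (X i * X j)).

(** The variable phi_i multiplies (X - Y)((XY)^i phi_(i+1) + (XY)^(i-1) phi_(i-1)), and this is the
    antisymmetrization of X^i with [q]. Changing phi_i is therefore a perturbation of rank two. *)
Lemma theta_pf_affine (i : 'I_N) phi : exists c0 c1, forall v,
  theta_pf (fun s => if s == i then v else phi s) = c0 + v * c1.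
Proof.
pose ph v := below (fun s => if s == i then v else phi s).
pose lo := if nat_of_ord i is u'.+1 then ph 0 u' else 0; pose hi := ph 0 i.+1.
pose B j k := (X j - X k) * theta N (ph 0) (X j * X k).
pose q j := (if nat_of_ord i is u'.+1 then lo * X j ^+ u' else 0) - hi * X j ^+ i.+1.
have hB : antisym B by move=> j k; rewrite /B -[X j - X k]opprB mulNr [X k * X j]mulrC.
have [c0 [c1 hc]] := pfn_rank2_affine h (fun j => X j ^+ i) q hB.
exists c0, c1 => v; rewrite -hc; apply: eq_pfn => j k _ _; rewrite /B /theta -/(ph v).
have phE w u : ph w u = if u == i then w else ph 0 u.
  rewrite /ph /below; case: insubP => [u' _ e|hu]; first by rewrite -val_eqE /= e; case: (u == i).
  by case: eqP => // e; move: hu; rewrite e ltn_ord.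
have phi_i w : ph w i = w by rewrite phE eqxx.
suff -> : \sum_(0 <= u < N) (X j * X k) ^+ u * (ph v u * ph v u.+1) =
   \sum_(0 <= u < N) (X j * X k) ^+ u * (ph 0 u * ph 0 u.+1) +
   v * ((X j * X k) ^+ i * hi + (if nat_of_ord i is u'.+1 then (X j * X k) ^+ u' * lo else 0)).
  rewrite /q; case: (nat_of_ord i) => [|u']; rewrite ?exprMn ?exprS ?expr0; ring.
have hN := ltn_ord i.
transitivity (\sum_(0 <= u < N) ((X j * X k) ^+ u * (ph 0 u * ph 0 u.+1) +
   (v * ((u == i)%:R * ((X j * X k) ^+ u * hi)) + v * ((u.+1 == i)%:R * ((X j * X k) ^+ u * ph 0 u))))).
  apply: eq_bigr => u _; rewrite (phE v u) (phE v u.+1).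
  have [->|ui] := eqVneq u i.
    by rewrite (gtn_eqF (ltnSn i)) phi_i /hi /=; ring.
  by case: eqP => [e|_]; rewrite ?e ?phi_i /=; ring.
rewrite big_split /=; congr (_ + _); rewrite big_split /= -!mulr_sumr -mulrDr; congr (v * (_ + _)).
  rewrite (bigD1_seq (nat_of_ord i))/= ?mem_index_iota ?iota_uniq// eqxx mul1r big1 ?addr0// => u /negbTE ->.
  by rewrite mul0r.
rewrite /lo; case: (nat_of_ord i) hN => [|u'] hN; first by rewrite big1// => u _; rewrite mul0r.
rewrite (bigD1_seq u')/= ?mem_index_iota ?iota_uniq// ?(ltnW hN)// eqxx mul1r big1 ?addr0// => u /negbTE.
by rewrite eqSS => ->; rewrite mul0r.
Qed.

End ThetaAffine.

(** * Minors of the kernel at distinct parameters *)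

Section KernelPfaffian.
Variables (R : realType) (h : nat) (a : 'I_(h.*2) -> R).
Hypotheses (a0 : forall j, 0 < a j) (a1 : forall j, a j < 1) (a_inj : injective a).

Definition kr (u v : nat) : 'M[R]_2 :=
  \matrix_(p < 2, q < 2)
    if p == 0 then (if q == 0 then kr11 a u v else kr12 a u v)
    else (if q == 0 then - kr12 a v u else kr22 a u v).

(** This and the following definitions are copies indexed by [nat] of the parameters, [cpsi], [cB]
    and [cM], as required by [pfn]. *)
Let aN i := nth 0 (codom a) i.
Let aNE (i : 'I_(h.*2)) : aN i = a i.
Proof. by rewrite /aN (nth_map i) ?size_enum_ord// nth_ord_enum. Qed.

Definition cauchyB (i j : nat) : R := (aN i - aN j) / (1 - aN i * aN j).
Let psiN (i : nat) : R := \prod_(j < h.*2 | j != i :> nat) ((1 - aN i * aN j) / (aN i - aN j)).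
Let MN i j := psiN i * cauchyB i j * psiN j.

Let BN_anti : antisym cauchyB.
Proof. by move=> i j; rewrite /cauchyB -[aN i - aN j]opprB mulNr [aN j * aN i]mulrC. Qed.
Let MN_anti : antisym MN.
Proof. by move=> i j; rewrite /MN BN_anti; ring. Qed.

Let an0 j : a j != 0. Proof. exact: lt0r_neq0. Qed.
Let aa1 i j : a i * a j != 1. Proof. by rewrite lt_eqF// mulr_ilt1// ?ltW. Qed.

Let MNE (i j : 'I_(h.*2)) : MN i j = cM a i j.
Proof.
have pE (l : 'I_(h.*2)) : psiN l = cpsi a l.
  by apply: eq_big => [m|m _]; rewrite ?aNE// val_eqE.
by rewrite /MN !pE /cauchyB !aNE.
Qed.

Let MN_inverse i j : (i < h.*2)%N -> (j < h.*2)%N ->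
  \sum_(c < h.*2) MN i c * cauchyB c j = deltaf R i j.
Proof.
move=> hi hj; have := cM_inverse (negbT (odd_double h)) a_inj an0 aa1 (Ordinal hi) (Ordinal hj).
rewrite /deltaf -val_eqE /= => <-; apply: eq_bigr => c _.
by rewrite -(MNE (Ordinal hi)) /cauchyB /cB -(aNE c) -(aNE (Ordinal hj)).
Qed.

Let x k N (y : {ffun 'I_k -> 'I_N}) (s : nat) : nat := if insub s is Some i then val (y i) else 0%N.
Let xE k N (y : {ffun 'I_k -> 'I_N}) (s : 'I_k) : x y s = y s.
Proof. by rewrite /x insubT//= => ?; congr (val (y _)); apply: val_inj. Qed.

Lemma kr_jmat (z : nat -> nat) P Q :
  let W (i P : nat) := if odd P then - qpow (aN i) (z P./2) else aN i ^+ z P./2 in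
  kr (z P./2) (z Q./2) (inord (odd P)) (inord (odd Q)) =
  jmat R z P Q + \sum_(i < h.*2) \sum_(j < h.*2) W i P * MN i j * W j Q.
Proof.
have cMa i j : cM a i j = - cM a j i by rewrite /cM cB_anti; ring.
have qE X s : qpow X s = qmom X s by [].
move=> W; rewrite mxE -!val_eqE /= !inordK ?ltnS ?leq_b1//.
under eq_bigr => i _ do under eq_bigr => j _ do rewrite MNE /W !aNE.
rewrite /jmat /W; case: (odd P); case: (odd Q) => /=.
- rewrite /kr22 /adj; congr (_ + _); apply: eq_bigr => i _; apply: eq_bigr => j _; rewrite !qE; ring.
- rewrite /kr12 opprB addrC [in LHS]eq_sym; congr (_ + _); rewrite exchange_big; apply: eq_bigr => i _.
  by apply: eq_bigr => j _; rewrite cMa !qE; ring.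
- rewrite /kr12 -sumrN; congr (_ + _); apply: eq_bigr => i _; rewrite -sumrN; apply: eq_bigr => j _.
  rewrite !qE; ring.
- by rewrite add0r; apply: eq_bigr => i _; apply: eq_bigr => j _; ring.
Qed.

Lemma pfaffian_kr k (z : {ffun 'I_k -> nat}) (z' : nat -> nat) : (forall i : 'I_k, z' i = z i) ->
  pfaffian (kernel_mx kr z) =
  pfn k (fun P Q => kr (z' P./2) (z' Q./2) (inord (odd P)) (inord (odd Q))).
Proof.
move=> e; congr pfaffian; apply/matrixP => P Q; rewrite [LHS]mxE [RHS]mxE.
by rewrite -(e (ord_half P)) -(e (ord_half Q)).
Qed.

(* the Schur complement of either diagonal block in a matrix with blocks
   cauchyB and jmat computes the same Pfaffian *)
Lemma pfaffian_kr_injective k N (y : {ffun 'I_k -> 'I_N}) : injective y ->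
  pfn h cauchyB * pfaffian (kernel_mx kr [ffun i => val (y i)]) =
  theta_pf h (nth 0 (codom a)) (fun s : 'I_N => 1 - (s \in y @: finset.setT)%:R).
Proof.
move=> yi; set T := y @: finset.setT.
rewrite (@pfaffian_kr _ _ (x y)); last by move=> i; rewrite xE ffunE.
rewrite [X in _ * X](eq_pfn (fun P Q _ _ => kr_jmat (x y) P Q)).
have xi : inj_below k (x y).
  move=> i j hi hj; rewrite (xE y (Ordinal hi)) (xE y (Ordinal hj)) => /val_inj /yi.
  by move/(congr1 val).
rewrite (@pfn_schur_jmat _ h k cauchyB MN (fun i s => aN i ^+ x y s) (fun i s => qpow (aN i) (x y s)) (x y) BN_anti MN_anti xi MN_inverse).
apply: eq_pfn => i j hi hj.
(* [e] is the indicator of the chosen points, extended by 0; it turns sums over the tuple into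
   weighted sums over [u < N], as in [theta_indicator]. *)
pose e (u : nat) : R := if insub u is Some i then (i \in T)%:R else 0.
have eE (u : 'I_N) : e u = (u \in T)%:R by rewrite /e; case: insubP => [i' _ /val_inj ->|]//; rewrite ltn_ord.
have sumT (G : nat -> R) : \sum_(s < k) G (x y s) = \sum_(u < N) e u * G u.
  transitivity (\sum_(u in T) G (val u)).
    rewrite big_imset /=; last by move=> ? ? _ _; exact: yi.
    by apply: eq_big => [s|s _]; rewrite ?inE// xE.
  rewrite big_mkcond; apply: eq_bigr => u _; rewrite eE.
  by case: (u \in T); rewrite ?mul1r ?mul0r.
have hN l (hl : (l < h.*2)%N) : aN l = a (Ordinal hl) by rewrite -aNE.
rewrite (_ : theta N _ _ = theta N (fun u => 1 - e u) (aN i * aN j)); last first.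
  rewrite /theta; congr (_ + _); apply: eq_bigr => u _.
  have bE w : below (fun s : 'I_N => 1 - (s \in T)%:R) w = 1 - e w.
    by rewrite /below /e; case: insubP => // _; rewrite subr0.
  by rewrite !bE.
rewrite -theta_indicator; last 2 first.
- by rewrite -/(aN i) -/(aN j) (hN i hi) (hN j hj) aa1.
- by move=> u hu; rewrite /e insubF// ltnNge hu.
congr (_ + (_ + _)).
  rewrite (sumT (fun u => \sum_(s' < k) aN i ^+ u * adj R u (x y s') * aN j ^+ x y s')).
  apply: eq_bigr => u _; rewrite (sumT (fun v => aN i ^+ u * adj R u v * aN j ^+ v)) mulr_sumr.
  by apply: eq_bigr => v _; rewrite mulrA.
by rewrite (sumT (fun u => aN i ^+ u * qpow (aN j) u - qpow (aN i) u * aN j ^+ u)).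
Qed.

(** Exchanging the first components of two equal points is an odd permutation that preserves the
    matrix. *)
Lemma pfaffian_kr_noninjective k (z : {ffun 'I_k -> nat}) : ~ injective z -> pfaffian (kernel_mx kr z) = 0.
Proof.
move=> zi; pose z' s := if insub s is Some i then z i else 0%N.
have zE (i : 'I_k) : z' i = z i by rewrite /z' insubT//= => ?; congr (z _); apply: val_inj.
rewrite (pfaffian_kr zE).
have [i [j [zij ij]]] : exists i j, z i = z j /\ i != j.
  have /injectivePn[i [j ij zij]] : ~~ injectiveb z by apply/negP => /injectiveP.
  by exists i, j.
set A := fun P Q => _.
pose sg l := if l == i.*2 then j.*2 else if l == j.*2 then i.*2 else l.
have sgE (l : 'I_(k.*2)) : sg l = tperm (ord_even i) (ord_even j) l.
  by rewrite permE /= /sg -!val_eqE /=; case: eqP => // _; case: eqP.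
have sA P : z' (sg P)./2 = z' P./2 /\ odd (sg P) = odd P.
  rewrite /sg; case: eqP => [->|_]; first by rewrite !doubleK !odd_double !zE zij.
  by case: eqP => [->|//]; rewrite !doubleK !odd_double !zE zij.
have := pfn_perm A sgE; rewrite odd_tperm (inj_eq (@ord_even_inj k)) ij expr1 mulN1r.
rewrite (eq_pfn (B := A)); last by move=> P Q _ _; rewrite /A; have [-> ->] := sA P; have [-> ->] := sA Q.
by move/eqP; rewrite -addr_eq0 -mulr2n mulrn_eq0 /= => /eqP.
Qed.

End KernelPfaffian.

(** * The Fredholm Pfaffian at distinct parameters *)

Section FredholmDistinct.
Variables (R : realType) (t x : R) (h : nat) (a : 'I_(h.*2) -> R) (c : R).
Hypotheses (t01 : 0 < t < 1) (a01 : forall j, 0 < a j < 1) (a_inj : injective a).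
Notation C := R[i].
Local Notation rc := (real_complex R).
Implicit Types (y : R).

Let t0 : 0 < t. Proof. by case/andP: t01. Qed.
Let tt01 : 0 < t ^+ 2 < 1.
Proof. by case/andP: t01 => p q; rewrite exprn_gt0//= exprn_ilt1// ltW. Qed.
Let npow_le0 y : - t `^ y <= 0. Proof. by rewrite oppr_le0 powR_ge0. Qed.

Lemma gq_succ_le y : gq t (y + 1) <= gq t y.
Proof.
rewrite /gq; apply: ler_lim; [exact: qpoch_cvg|exact: qpoch_cvg|apply: nearW => N].
have q0 i : 0 <= (t ^+ 2) ^+ i by rewrite !exprn_ge0// ltW.
apply: ler_prod => i _; rewrite !mulNr !opprK addr_ge0 ?mulr_ge0 ?powR_ge0//=.
rewrite lerD2l ler_wpM2r// (powR_add_nat t01 y 1) expr1.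
by rewrite ler_piMr ?powR_ge0// ltW//; case/andP: t01.
Qed.

Lemma f_xE (j : nat) : 1 + f_x t x j = gq t (x + j.+1%:R) / gq t (x + j%:R).
Proof. by rewrite /f_x addrC subrK -addrA natr1. Qed.

Let gq_gt0 y : 0 < gq t y. Proof. exact: lt_le_trans ltr01 (gq_ge1 t01 y). Qed.

(** The chain g(y) >= g(y + 1) >= g(y + 2) and the relation g(y) = (1 + t^y) g(y + 2) give g(y + 1)
    / g(y) >= 1 / (1 + t^y) >= 1 - t^y. *)
Lemma f_x_bound j : `|f_x t x j| <= t `^ x * t ^+ j.
Proof.
rewrite -(powR_add_nat t01); set y := x + _.
have -> : f_x t x j = gq t (y + 1) / gq t y - 1 by [].
have h1 := gq_succ_le y; have h2 := gq_succ_le (y + 1).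
rewrite -addrA -[1 + 1]/(2 : R) in h2; have := gq_step t01 y; have p0 := powR_ge0 t y.
have := gq_gt0 y; have := gq_gt0 (y + 2); move: (gq t y) (gq t (y + 1)) (gq t (y + 2)) (t `^ y) h1 h2 p0.
move=> g g1 g2 p h1 h2 p0 g20 g0 e; rewrite ler0_norm; last by rewrite subr_le0 ler_pdivrMr// mul1r.
rewrite opprB lerBlDl -lerBlDr ler_pdivlMr// e; apply: le_trans h2.
have -> : (1 - p) * ((1 + p) * g2) = (1 - p ^+ 2) * g2 by ring.
by rewrite ler_piMl ?(ltW g20)// lerBlDr lerDl exprn_ge0.
Qed.

Lemma prod_f_x N : \prod_(s < N) (1 + f_x t x s) = gq t (x + N%:R) / gq t x.
Proof.
elim: N => [|N IH]; first by rewrite big_ord0 addr0 divff ?gq_neq0.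
rewrite big_ord_recr /= IH f_xE; have := gq_neq0 t01 (x + N%:R); have := gq_neq0 t01 x.
by move: (gq t (x + _)) (gq t x) (gq t (x + _)) => p q r hq hp; field; rewrite hp hq.
Qed.

Let a0 j : 0 < a j. Proof. by case/andP: (a01 j). Qed.
Let a1 j : a j < 1. Proof. by case/andP: (a01 j). Qed.
Let aN := nth 0 (codom a).

Definition cx_kr (u v : nat) : 'M[C]_2 := map_mx (real_complex R) (kr a u v).
Hypothesis cx_kr_bound : forall u v p q, nrm (cx_kr u v p q) <= c.

Lemma pfaffian_cx_kr k (z : {ffun 'I_k -> nat}) :
  pfaffian (kernel_mx cx_kr z) = (pfaffian (kernel_mx (kr a) z))%:C.
Proof.
rewrite /pfaffian (rmorphM rc) (fmorphV rc) (rmorph_nat rc) (rmorph_sum rc); congr (_ * _).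
apply: eq_bigr => s _; rewrite (rmorphM rc) (rmorph_sign rc) (rmorph_prod rc); congr (_ * _).
by apply: eq_bigr => i _; rewrite !mxE.
Qed.

Lemma cx_kr_vanish : vanishes_noninjective cx_kr.
Proof. by move=> k z zi; rewrite pfaffian_cx_kr (pfaffian_kr_noninjective _ zi). Qed.

(** Weights cut off at [N] make the expansion finite, so that the summation over subsets is exact
    before the limit in [N]. *)
Let fT N (j : nat) : C := if (j < N)%N then (f_x t x j)%:C else 0.

Let inj_sum N k : R := \sum_(y : {ffun 'I_k -> 'I_N} | injectiveb y)
  (\prod_(i < k) f_x t x (y i)) * pfaffian (kernel_mx (kr a) [ffun i => val (y i)]).

Let term_fT N k : fredholm_term (fT N) cx_kr k = ((k`!%:R)^-1 * inj_sum N k)%:C.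
Proof.
rewrite /fredholm_term (rmorphM rc) (fmorphV rc) (rmorph_nat rc); congr (_ * _).
pose em (y : {ffun 'I_k -> 'I_N}) : {ffun 'I_k -> nat} := [ffun i => val (y i)].
have em_inj : injective em.
  by move=> y y' /ffunP e; apply/ffunP => i; apply: val_inj; have := e i; rewrite !ffunE.
rewrite (@csum_finite _ _ _ (codom em)); last 2 first.
- by rewrite map_inj_uniq ?enum_uniq.
- move=> z hz; rewrite /fredholm_summand.
  suff [i hi] : exists i : 'I_k, (N <= z i)%N.
    by rewrite (bigD1 i)//= /fT ltnNge hi !mul0r.
  apply/existsP; apply: contraR hz => /existsPn hz.
  have lt i : (z i < N)%N by rewrite ltnNge hz.
  by apply/codomP; exists [ffun i => Ordinal (lt i)]; apply/ffunP => i; rewrite !ffunE.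
rewrite big_map big_enum /= (bigID (fun y : {ffun 'I_k -> 'I_N} => injectiveb y)) /= [X in _ + X]big1 ?addr0; last first.
  move=> y /injectiveP yi; rewrite /fredholm_summand cx_kr_vanish ?mulr0// => ei; apply: yi => i j e.
  by apply: ei; rewrite !ffunE e.
rewrite /inj_sum (rmorph_sum rc); apply: eq_bigr => y _; rewrite (rmorphM rc) (rmorph_prod rc) /fredholm_summand pfaffian_cx_kr.
by congr (_ * _); apply: eq_bigr => i _; rewrite ffunE /fT ltn_ord.
Qed.

Let frs N : R := \sum_(k < N.+1) (k`!%:R)^-1 * inj_sum N k.

Let fredholm_fT N : fredholm_pfaffian (fT N) cx_kr = (frs N)%:C.
Proof.
rewrite /fredholm_pfaffian (@csum_finite _ _ _ (iota 0 N)) ?iota_uniq//; last first.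
  move=> k; rewrite mem_iota add0n leq0n /= -leqNgt => hk.
  rewrite term_fT /inj_sum big1 ?mulr0// => y /injectiveP /leq_card.
  by rewrite !card_ord leqNgt ltnS hk.
rewrite /frs big_ord_recl (rmorphD rc) /=; congr (_ + _).
  rewrite fact0 invr1 mul1r /inj_sum (eq_bigr (fun=> 1)) => [|y _]; last first.
    rewrite big_ord0 mul1r; transitivity (pfn 0 (fun _ _ => 0 : R)); last exact: pfn0.
    by congr pfaffian; apply/matrixP => -[].
  rewrite (eq_bigl xpredT) => [|y]; last by apply/injectiveP => -[].
  by rewrite sumr_const card_ffun !card_ord expn0.
transitivity (\sum_(0 <= k < N) fredholm_term (fT N) cx_kr k.+1); first by rewrite /index_iota subn0.
by rewrite big_mkord (rmorph_sum rc); apply: eq_bigr => k _; rewrite term_fT.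
Qed.

(* 1 / (1 + f_x s); consecutive values multiply to 1 + t^(x + s) by gq_step *)
Let psi (s : nat) : R := gq t (x + s%:R) / gq t (x + s.+1%:R).

Let frsE N : pfn h (cauchyB a) * frs N =
  gq t (x + N%:R) / gq t x * theta_pf h aN (fun s : 'I_N => psi s).
Proof.
pose G := @theta_pf R N h aN; pose f (s : 'I_N) : R := f_x t x s.
have f1 i : 1 + f i != 0 by rewrite f_xE mulf_neq0 ?invr_eq0 ?gq_neq0.
have := sum_sets_affine (@theta_pf_affine R N h aN) f1.
rewrite (prod_f_x N) (_ : (fun s => (1 + f s)^-1) = (fun s : 'I_N => psi s)); last first.
  by apply/funext => s; rewrite f_xE invf_div.
move=> <-; rewrite -sum_injective_sets card_ord mulr_sumr; apply: eq_bigr => k _.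
rewrite mulrCA; congr (_ * _); rewrite mulr_sumr; apply: eq_bigr => y /injectiveP yi.
rewrite mulrCA (pfaffian_kr_injective a0 a1 a_inj yi); congr (_ * _).
by rewrite big_imset /= => [|? ? _ _]; [apply: eq_bigl => i; rewrite inE|exact: yi].
Qed.

Lemma cvg_pfn (A_ : nat -> nat -> nat -> R) (A : nat -> nat -> R) :
  (forall i j, (i < h.*2)%N -> (j < h.*2)%N -> A_ m i j @[m --> \oo] --> A i j) ->
  pfn h (A_ m) @[m --> \oo] --> pfn h A.
Proof.
move=> hA; rewrite pfnE; under eq_fun do rewrite pfnE.
apply: cvgMr; apply: cvg_sum_seq => s; apply: cvgMr; apply: cvg_prod_seq => i; exact: hA.
Qed.

Let theta_psi N z : z != 1 -> t * z != 1 -> theta N.+1 (below (fun s : 'I_N.+1 => psi s)) z =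
  (1 - z ^+ N) / (1 - z) + t `^ x * ((1 - (t * z) ^+ N) / (1 - t * z)) + z ^+ N * psi N + z ^+ N.+1 / (1 - z).
Proof.
move=> z1 tz1; have bE u : below (fun s : 'I_N.+1 => psi s) u = if (u < N.+1)%N then psi u else 1.
  by rewrite /below; case: insubP => [i -> ->//|/negbTE ->].
have geo (w : R) : w != 1 -> \sum_(0 <= u < N) w ^+ u = (1 - w ^+ N) / (1 - w).
  by move=> w1; rewrite mulrBl mul1r {1}(geometric_tail N w1) addrK.
rewrite /theta; congr (_ + _); rewrite big_nat_recr//= !bE ltnSn ltnn mulr1; congr (_ + _).
rewrite -(geo z)// -(geo (t * z))// mulr_sumr -big_split /= !big_nat; apply: eq_bigr => u /andP[_ hu].
rewrite !bE !ltnS hu (ltnW hu) /psi (gq_step t01 (x + u%:R)) exprMn (powR_add_nat t01).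
have -> : x + u%:R + 2 = x + u.+2%:R by rewrite -addrA -natrD addn2.
have := gq_neq0 t01 (x + u.+1%:R); have := gq_neq0 t01 (x + u.+2%:R).
by move: (gq t _) (gq t _) (t `^ x) (z ^+ u) (t ^+ u) => p q r s w hp hq; field; rewrite hp hq.
Qed.

Let psi_bound N : `|psi N| <= 1 + t `^ x.
Proof.
have p0 := powR_ge0 t x; rewrite /psi ger0_norm; last by rewrite divr_ge0// ltW.
rewrite ler_pdivrMr//.
rewrite (gq_step t01); have := gq_succ_le (x + N.+1%:R).
have -> : x + N.+1%:R + 1 = x + N%:R + 2 by rewrite -natr1; ring.
move=> hle; have h1 : 0 <= 1 + t `^ (x + N%:R) by rewrite addr_ge0 ?powR_ge0.
have h2 : 0 <= gq t (x + N%:R + 2) by exact: ltW.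
have h3 : 1 + t `^ (x + N%:R) <= 1 + t `^ x.
  rewrite lerD2l (powR_add_nat t01) ler_piMr// exprn_ile1// ltW//; by case/andP: t01.
exact: (ler_pM h1 h2 h3 hle).
Qed.

Let theta_psi_cvg z : 0 < z < 1 -> theta N.+1 (below (fun s : 'I_N.+1 => psi s)) z @[N --> \oo] -->
  (1 - z)^-1 + t `^ x * (1 - t * z)^-1.
Proof.
move=> /andP[z0 z1]; have tz : t * z < 1 by case/andP: t01 => _ ?; rewrite mulr_ilt1// ltW.
under eq_fun do rewrite theta_psi ?lt_eqF//.
have e0 w : 0 <= w < 1 -> w ^+ N @[N --> \oo] --> (0 : R).
  by move=> /andP[w0 w1]; apply: cvg_expr; rewrite ger0_norm.
have ez := e0 z; rewrite (ltW z0) z1 in ez; have {}ez := ez isT.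
have et := e0 (t * z); rewrite mulr_ge0 ?(ltW t0) ?(ltW z0)// tz in et; have {}et := et isT.
have -> : (1 - z)^-1 + t `^ x * (1 - t * z)^-1 =
  (1 - 0) / (1 - z) + t `^ x * ((1 - 0) / (1 - t * z)) + 0 + 0 / (1 - z) by rewrite !subr0 !mul1r mul0r !addr0.
apply: cvgD; [apply: cvgD; [apply: cvgD|]|].
- by apply: cvgMl; apply: cvgB => //; exact: cvg_cst.
- by apply: cvgMr; apply: cvgMl; apply: cvgB => //; exact: cvg_cst.
- apply/norm_cvg0P; apply: (@squeeze_cvgr _ _ _ _ (fun=> 0) (fun N => z ^+ N * (1 + t `^ x))).
  + apply: nearW => N; by rewrite normr_ge0 /= normrM (ger0_norm (exprn_ge0 N (ltW z0))) ler_wpM2l ?psi_bound ?exprn_ge0 ?(ltW z0).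
  + exact: cvg_cst.
  + by rewrite -[0](mul0r (1 + t `^ x)); apply: cvgMl.
- by apply: cvgMl; rewrite (cvg_shiftS (fun N => z ^+ N)).
Qed.

Let gq_cvg1 : gq t (x + N%:R) @[N --> \oo] --> (1 : R).
Proof.
apply: (@squeeze_cvgr _ _ _ _ (fun=> 1) (fun N => expR (t `^ x * t ^+ N / (1 - t ^+ 2)))).
- by apply: nearW => N; rewrite gq_ge1//= (le_trans (qpoch_inf_le _ _))// opprK (powR_add_nat t01).
- exact: cvg_cst.
- have e : (fun N => t `^ x * t ^+ N / (1 - t ^+ 2)) @ \oo --> (0 : R).
    rewrite -[X in _ --> X](_ : t `^ x * 0 / (1 - t ^+ 2) = 0); last by rewrite mulr0 mul0r.
    by apply: cvgMl; apply: cvgMr; apply: cvg_expr; rewrite ger0_norm ?(ltW t0)//; case/andP: t01.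
  apply: (@cvg_comp _ _ _ (fun N => t `^ x * t ^+ N / (1 - t ^+ 2)) expR _ _ _ e).
  by have := @continuous_expR R 0; rewrite /continuous_at expR0.
Qed.

(** Limit of the truncated weights: [fredholm_limit] handles the left side, while on the right g(x +
    N) tends to 1 and the entries of [theta_pf] tend to those of B_u at [u = - t^x]. *)
Lemma fredholm_distinct :
  fredholm_pfaffian (fun j => (f_x t x j)%:C) cx_kr =
  (V t (- t `^ x) (codom a) / V t 0 (codom a) / gq t x)%:C.
Proof.
have tx0 : 0 <= t `^ x := powR_ge0 t x.
have c0 : 0 <= c by apply: le_trans (cx_kr_bound 0 0 0 0); exact: nrm_ge0.
have fTb N j : nrm (fT N j) <= t `^ x * t ^+ j.
  rewrite /fT; case: ifP => _; first by rewrite nrm_real f_x_bound.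
  by rewrite nrm0 mulr_ge0// exprn_ge0// ltW.
have fTc j : ccvg (fT ^~ j) (f_x t x j)%:C.
  by apply: (@ccvg_eventually _ _ _ _ j.+1) (ccvg_cst _) => N hN; rewrite /fT hN.
have [_ _] := fredholm_limit t01 tx0 c0 fTb (fun=> cx_kr_bound) fTc
  (fun u v p q => ccvg_cst (cx_kr u v p q)) (fun=> cx_kr_vanish).
move=> /(@ccvg_shift _ _ _ 1) /ccvg_unique; apply.
under eq_fun do rewrite fredholm_fT addn1.
apply: ccvg_real.
set J := codom a.
have sJ : size J = h.*2 by rewrite size_codom card_ord.
have J01 : {in J, forall y, 0 < y < 1} by move=> _ /codomP[i ->].
have uJ : uniq J by apply/injectiveP.
have VE u : V t u J = cprod t J * pfn h (fun i j => Bk t u (Some (aN i)) (Some (aN j))).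
  rewrite /V /pad sJ odd_double cats0 /pfB /pfl size_map sJ doubleK; congr (_ * _).
  by apply: eq_pfn => i j hi hj; rewrite !(nth_map 0) ?sJ.
have V0 : V t 0 J != 0.
  have hV : HL_Phi t a = V t 0 J.
    by rewrite V0_pairprod ?sJ ?odd_double// pairprod_codom.
  by rewrite -hV gt_eqF// (lt_le_trans ltr01)// HL_Phi_ge1.
have BE : pfn h (fun i j => Bk t 0 (Some (aN i)) (Some (aN j))) = pfn h (cauchyB a).
  by apply: eq_pfn => i j _ _; rewrite /= mul0r subr0.
have P0 : pfn h (cauchyB a) != 0.
  by apply: contra_neq V0 => e; rewrite VE BE e mulr0.
have C0 : cprod t J != 0.
  by apply: contra_neq V0 => e; rewrite VE e mul0r.
rewrite (_ : (fun N => frs N.+1) = (fun N => gq t (x + N.+1%:R) / gq t x *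
    theta_pf h aN (fun s : 'I_N.+1 => psi s) / pfn h (cauchyB a))); last first.
  by apply/funext => N; rewrite -frsE mulrAC divff// mul1r.
have -> : V t (- t `^ x) J / V t 0 J / gq t x = 1 / gq t x *
   pfn h (fun i j => Bk t (- t `^ x) (Some (aN i)) (Some (aN j))) / pfn h (cauchyB a).
  rewrite !VE BE; have := gq_neq0 t01 x; move: (pfn _ _) (pfn _ _) (gq _ _) (cprod _ _) P0 C0 => p q g e hq he hg.
  by field; rewrite hq he hg.
apply: cvgMl; apply: cvgM.
  by apply: cvgMl; rewrite (cvg_shiftS (fun N => gq t (x + N%:R))); exact: gq_cvg1.
apply: cvg_pfn => i j hi hj; rewrite /= mulNr opprK -mulrA.
apply: cvgMr; apply: theta_psi_cvg.
have aj l : (l < h.*2)%N -> 0 < aN l < 1 by move=> hl; apply: J01; rewrite mem_nth ?sJ.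
have [/andP[i0 i1] /andP[j0 j1]] := (aj i hi, aj j hj).
by rewrite mulr_gt0//= mulr_ilt1// ltW.
Qed.

End FredholmDistinct.

(** Both sides are limits along one sequence of distinct parameters lying below the [a j], so that
    the same contours serve throughout. Along the sequence they agree, since
    [HL_expectation_distinct] and [fredholm_distinct] give the same closed form. *)
Theorem proposition3p3 (R : realType) (t x : R) (n : nat) (a : 'I_n -> R)
    (r1 r2 s1 s2 : R)
    (ht : 0 < t < 1) (hn : (0 < n)%N) (hne : ~~ odd n)
    (ha : forall j, 0 < a j < 1)
    (hr1 : 1 < r1) (hr1a : forall j, r1 < (a j)^-1)
    (hr2 : 1 < r2) (hr2a : forall j, r2 < (a j)^-1)
    (hs1 : 0 < s1 < 1) (hs2 : 0 < s2 < 1) :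
  let F := fun lam : intpartition =>
    (qpoch_inf (- t `^ (x + n%:R - (plength lam)%:R)) (t ^+ 2))^-1 in
  let f := fun j : nat => (f_x t x j)%:C in
  let K := Kc a r1 r2 s1 s2 in
  [/\ HL_integrable t a F,
      fredholm_summable f K &
      (HL_expectation t a F)%:C = fredholm_pfaffian f K].
Proof.
have [h e] : exists h, n = h.*2 by exists n./2; rewrite -[LHS]odd_double_half (negbTE hne).
subst n; move=> F f K.
have [Fint [b_ [b_cvg b_inj b_lt bint Ecvg]]] := HL_limit x ht ha.
have good_a r : (forall j, r < (a j)^-1) -> good r a.
  by move=> hr; split=> // j; have /andP[aj _] := ha j; rewrite mulrC -ltr_pdivlMr// div1r.
have [g1 g2] := (good_a r1 hr1a, good_a r2 hr2a).
have b01 m j : 0 < b_ m j < 1.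
  by have /andP[-> /lt_trans ->] := b_lt m j; last by case/andP: (ha j).
have good_b m r : 0 < r -> good r a -> good r (b_ m).
  move=> r0 [_ hr]; split=> // j; apply: lt_trans (hr j); rewrite ltr_pM2r//.
  by case/andP: (b_lt m j).
have gb1 m := good_b m r1 (lt_trans ltr01 hr1) g1.
have gb2 m := good_b m r2 (lt_trans ltr01 hr2) g2.
pose K_ m := Kc (b_ m) r1 r2 s1 s2.
have KE m u v : K_ m u v = cx_kr (b_ m) u v.
  apply/matrixP => p q; rewrite !mxE.
  case: (p == 0); case: (q == 0).
  - exact: Kc11_distinct.
  - exact: Kc12_distinct.
  - by rewrite (Kc12_distinct hr1 hr2 hne (b_inj m) (gb1 m) (gb2 m)) (rmorphN (real_complex R)).
  - exact: Kc22_distinct.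
have [c11 h11] := Kc11_bounded hr1 hr2 g1 g2 b_lt.
have [c12 h12] := Kc12_bounded hr1 hr2 g1 g2 b_lt.
have [c22 h22] := Kc22_bounded hr1 hs1 hs2 hne g1 b_inj b_lt.
pose c := c11 + c12 + c22.
have c110 : 0 <= c11 := le_trans (nrm_ge0 _) (h11 0 0 0).
have c120 : 0 <= c12 := le_trans (nrm_ge0 _) (h12 0 0 0).
have c220 : 0 <= c22 := le_trans (nrm_ge0 _) (h22 0 0 0).
have Kb m u v p q : nrm (K_ m u v p q) <= c.
  rewrite mxE; case: (p == 0); case: (q == 0); rewrite ?nrmN.
  - by apply: le_trans (h11 m u v) _; rewrite /c; lra.
  - by apply: le_trans (h12 m u v) _; rewrite /c; lra.
  - by apply: le_trans (h12 m v u) _; rewrite /c; lra.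
  - by apply: le_trans (h22 m u v) _; rewrite /c; lra.
have ccvg_ext (z_ w_ : nat -> R[i]) z w : z_ =1 w_ -> z = w -> ccvg w_ w -> ccvg z_ z.
  by move=> /funext -> ->.
have Kcvg u v p q : ccvg (fun m => K_ m u v p q) (K u v p q).
  have KcE b : Kc b r1 r2 s1 s2 u v p q = if p == 0 then (if q == 0 then Kc11 b r1 r2 u v else Kc12 b r1 r2 u v)
      else (if q == 0 then - Kc12 b r1 r2 v u else Kc22 b s1 s2 u v) by rewrite mxE.
  apply: (ccvg_ext _ _ _ _ (fun m => KcE _ (b_ m)) (KcE _ a)).
  case: (p == 0); case: (q == 0).
  - exact: Kc11_cvg.
  - exact: Kc12_cvg.
  - by apply: ccvgN; exact: Kc12_cvg.
  - exact: (Kc22_cvg hs1 hs2 g1).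
have cxb m u v p q : nrm (cx_kr (b_ m) u v p q) <= c by rewrite -KE.
have KE' m : K_ m = cx_kr (b_ m) by apply/funext => u; apply/funext => v; exact: KE.
have fb (m j : nat) : nrm (f j) <= t `^ x * t ^+ j by rewrite /f nrm_real f_x_bound.
have c0 : 0 <= c by rewrite /c !addr_ge0.
have Kv m : vanishes_noninjective (K_ m) by rewrite KE'; exact: cx_kr_vanish.
have [Ks _ Pcvg] := fredholm_limit ht (powR_ge0 t x) c0 fb Kb (fun j => ccvg_cst (f j)) Kcvg Kv.
split=> //; apply: ccvg_unique Pcvg.
under eq_fun do rewrite KE' (fredholm_distinct x ht (b01 _) (b_inj _) (cxb _)).
under eq_fun do rewrite -(HL_expectation_distinct ht hne (b_inj _) (b01 _) (bint _)).
exact: ccvg_real.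
Qed.
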